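(* Let $G$ be a locally compact group. Every nonempty collection $\mathcal T$ of coaction functors has a greatest lower bound $\sigma$ with respect to the partial ordering $\le$ of coaction functors, characterized by $$A^m_\sigma=\overline{\mathrm{span}}_{\tau\in\mathcal T}\,A^m_\tau$$ for every coaction $(A,\delta)$ of $G$.
   Context: **Conventions.** $G$ is a locally compact group; ideals of $C^*$-algebras are closed and two-sided; homomorphisms are $*$-homomorphisms; $\otimes$ is the minimal tensor product; $\mathcal K=\mathcal K(L^2(G))$. For $C^*$-algebras $A,C$ put $\widetilde M(A\otimes C)=\{m\in M(A\otimes C): m(1\otimes C)\cup(1\otimes C)m\subset A\otimes C\}$; a homomorphism $\phi:A\to B$ has a canonical extension $\overline{\phi\otimes\mathrm{id}}:\widetilde M(A\otimes C)\to\widetilde M(B\otimes C)$ with $\overline{\phi\otimes\mathrm{id}}(m)(1\otimes c)=(\phi\otimes\mathrm{id})(m(1\otimes c))$. Let $\delta_G:C^*(G)\to M(C^*(G)\otimes C^*(G))$ be the comultiplication, $\delta_G(s)=s\otimes s$ for $s\in G$. **Coactions.** A coaction $(A,\delta)$ of $G$ is a $C^*$-algebra $A$ with an injective nondegenerate homomorphism $\delta:A\to \widetilde M(A\otimes C^*(G))\subset M(A\otimes C^*(G))$ such that $(\delta\otimes\mathrm{id})\circ\delta=(\mathrm{id}\otimes\delta_G)\circ\delta$ and $\overline{\mathrm{span}}\,\delta(A)(1\otimes C^*(G))=A\otimes C^*(G)$. The category $\mathbf{Coact}$ has coactions of $G$ as objects; a morphism $\phi:(A,\delta)\to(B,\epsilon)$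 is a homomorphism $\phi:A\to B$ (not into multipliers) with $\epsilon\circ\phi=\overline{\phi\otimes\mathrm{id}}\circ\delta$. **Crossed products.** Let $w_G\in M(C_0(G)\otimes C^*(G))$ be the unitary function $w_G(s)=s$. $(A\rtimes_\delta G,j_A,j_G)$ is the crossed product, universal for pairs of nondegenerate homomorphisms $\pi:A\to M(C)$, $\mu:C_0(G)\to M(C)$ satisfying $(\pi\otimes\mathrm{id})\circ\delta(a)=\mathrm{Ad}\,(\mu\otimes\mathrm{id})(w_G)(\pi(a)\otimes1)$; it carries the dual action $\widehat\delta$ of $G$ (fixing $j_A(A)$ and acting by right translation on $j_G(C_0(G))$). It is functorial on $\mathbf{Coact}$, $\phi\mapsto\phi\rtimes G$. With $\lambda,\rho$ the left and right regular representations and $M$ the multiplication representation of $C_0(G)$ on $L^2(G)$, there is a canonical surjection $\Phi=\big((\mathrm{id}\otimes\lambda)\circ\delta\times(1\otimes M)\big)\times(1\otimes\rho):A\rtimes_\delta G\rtimes_{\widehat\delta}G\to A\otimes\mathcal K$. The coaction is maximal if $\Phi$ is an isomorphism, and normal if $\Phi$ factors through an isomorphism $A\rtimes_\delta G\rtimes_{\widehat\delta,r}G\cong A\otimes\mathcal K$. **Maximalization and normalization.** Every coaction $(A,\delta)$ has a maximalization: a maximal coaction $(A^m,\delta^m)$ and a surjective morphism $q^m_A:(A^m,\delta^m)\to(A,\delta)$ with $q^m_A\rtimes G$ an isomorphism; and a normalization: a normal coaction $(A^n,\delta^n)$ and a surjective morphism $\Lambda_A:(A,\delta)\to(A^n,\delta^n)$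 with $\Lambda_A\rtimes G$ an isomorphism. Both are unique up to isomorphism and, after choices, functors on $\mathbf{Coact}$ ($\phi\mapsto\phi^m$, $\phi\mapsto\phi^n$) with $q^m$, $\Lambda$ natural. One identifies $A^{mn}=A^n$, so $\Lambda_{A^m}=\Lambda_A\circ q^m_A:A^m\to A^n$. **Coaction functors.** A coaction functor is a functor $\tau:(A,\delta)\mapsto(A^\tau,\delta^\tau)$ on $\mathbf{Coact}$ together with a natural transformation $q^\tau$ from maximalization to $\tau$ such that for every $(A,\delta)$ the map $q^\tau_A:A^m\to A^\tau$ is surjective and $\ker q^\tau_A\subset\ker\Lambda_{A^m}$. Put $A^m_\tau:=\ker q^\tau_A$. Write $\sigma\le\tau$ (''$\sigma$ is smaller than $\tau$'') if $A^m_\tau\subset A^m_\sigma$ for every coaction $(A,\delta)$. The notation $\overline{\mathrm{span}}_{\tau\in\mathcal T}A^m_\tau$ means the closed linear span of $\bigcup_{\tau\in\mathcal T}A^m_\tau$ in $A^m$. *)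

(* Defs.v *)
(* Two devices are used throughout.
   - Objects that the theory only fixes up to canonical isomorphism (tensor
     products, C*(G), C_0(G), L^2(G), K(L^2(G)), crossed products) are records
     containing the defining property.
   - Maps and multipliers that the theory singles out as "the unique x such
     that P x" are introduced by the description operator [the].              *)
From HB Require Import structures.
From mathcomp Require Import all_boot all_order all_algebra.
From mathcomp Require Import complex.
From mathcomp Require Import all_classical all_reals all_analysis.

Set Implicit Arguments.
Unset Strict Implicit.
Unset Printing Implicit Defensive.

Import Order.TTheory GRing.Theory Num.Theory.
Import numFieldNormedType.Exports.

Local Open Scope classical_set_scope.
Local Open Scope ring_scope.

(* "the x such that P x"; it is d when there is no such x. *)
Definition the (T : Type) (d : T) (P : T -> Prop) : T :=
  if pselect (exists x, P x) is left e then projT1 (cid e) else d.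

HB.mixin Record isTopologicalGroup G of Group G & Topological G := {
  mulg_continuous : continuous (fun p : G * G => (fst p * snd p)%g);
  invg_continuous : continuous (fun x : G => (x^-1)%g)
}.

#[short(type="topGroupType")]
HB.structure Definition TopologicalGroup :=
  {G of isTopologicalGroup G & Group G & Topological G}.

Section CStarAlgebras.
Variable R : realType.

Record cstar := CStar {
  cstar_car :> completeNormedModType R[i];
  cmul : cstar_car -> cstar_car -> cstar_car;
  cadj : cstar_car -> cstar_car;
  cmulA : forall x y z, cmul x (cmul y z) = cmul (cmul x y) z;
  cmul_linl : forall c x y z,
    cmul (c *: x + y) z = c *: cmul x z + cmul y z;
  cmul_linr : forall c x y z,
    cmul x (c *: y + z) = c *: cmul x y + cmul x z;
  cadjK : forall x, cadj (cadj x) = x;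
  cadj_antilin : forall c x y, cadj (c *: x + y) = c^* *: cadj x + cadj y;
  cadjM : forall x y, cadj (cmul x y) = cmul (cadj y) (cadj x);
  cnormM : forall x y, `|cmul x y| <= `|x| * `|y|;
  cnorm_cstar : forall x, `|cmul (cadj x) x| = `|x| ^+ 2
}.

Definition is_linear (V W : lmodType R[i]) (f : V -> W) : Prop :=
  forall c x y, f (c *: x + y) = c *: f x + f y.

Definition cspan (V : completeNormedModType R[i]) (S : set V) : set V :=
  closure [set x | exists n (c : 'I_n -> R[i]) (v : 'I_n -> V),
    (forall k, S (v k)) /\ x = \sum_k c k *: v k].

Definition is_hom (A B : cstar) (f : A -> B) : Prop :=
  [/\ is_linear f,
      forall x y, f (cmul x y) = cmul (f x) (f y) &
      forall x, f (cadj x) = cadj (f x)].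

(* The elements of M(A) are the double centralizers (L, R) of A; linearity
   and boundedness of both maps are consequences of the defining identity. *)
Record multiplier (A : cstar) := Multiplier {
  lact : A -> A;
  ract : A -> A;
  lractP : forall x y, cmul x (lact y) = cmul (ract x) y
}.

Section MultiplierOps.
Variable A : cstar.
Implicit Types m n : multiplier A.

Lemma mult1_subproof (x y : A) : cmul x (id y) = cmul (id x) y.
Proof. by []. Qed.
Definition mult1 : multiplier A := Multiplier mult1_subproof.

Lemma multM_subproof m n (x y : A) :
  cmul x (lact m (lact n y)) = cmul (ract n (ract m x)) y.
Proof. by rewrite lractP lractP. Qed.
Definition multM m n : multiplier A := Multiplier (multM_subproof m n).

Lemma cmulDl (x y z : A) : cmul (x + y) z = cmul x z + cmul y z.
Proof. by have := cmul_linl 1 x y z; rewrite !scale1r. Qed.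

Lemma cmulDr (x y z : A) : cmul x (y + z) = cmul x y + cmul x z.
Proof. by have := cmul_linr 1 x y z; rewrite !scale1r. Qed.

Lemma cmul0l (z : A) : cmul 0 z = 0.
Proof. by apply: (addrI (cmul 0 z)); rewrite -cmulDl !addr0. Qed.

Lemma cmul0r (z : A) : cmul z 0 = 0.
Proof. by apply: (addrI (cmul z 0)); rewrite -cmulDr !addr0. Qed.

Lemma cmulZl c (x z : A) : cmul (c *: x) z = c *: cmul x z.
Proof. by have := cmul_linl c x 0 z; rewrite cmul0l !addr0. Qed.

Lemma cmulZr c (x z : A) : cmul x (c *: z) = c *: cmul x z.
Proof. by have := cmul_linr c x z 0; rewrite cmul0r !addr0. Qed.

Lemma multD_subproof m n (x y : A) :
  cmul x (lact m y + lact n y) = cmul (ract m x + ract n x) y.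
Proof. by rewrite cmulDl cmulDr !lractP. Qed.
Definition multD m n : multiplier A := Multiplier (multD_subproof m n).

Lemma multZ_subproof (c : R[i]) m (x y : A) :
  cmul x (c *: lact m y) = cmul (c *: ract m x) y.
Proof. by rewrite cmulZl cmulZr lractP. Qed.
Definition multZ (c : R[i]) m : multiplier A := Multiplier (multZ_subproof c m).

Lemma mult_adj_subproof m (x y : A) :
  cmul x (cadj (ract m (cadj y))) = cmul (cadj (lact m (cadj x))) y.
Proof. by rewrite -[x in LHS]cadjK -cadjM -lractP cadjM cadjK. Qed.
Definition mult_adj m : multiplier A := Multiplier (mult_adj_subproof m).

Lemma mult_embed_subproof (a x y : A) :
  cmul x (cmul a y) = cmul (cmul x a) y.
Proof. exact: cmulA. Qed.
Definition mult_embed (a : A) : multiplier A :=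
  Multiplier (mult_embed_subproof a).

Definition unitary_mult m : Prop :=
  multM (mult_adj m) m = mult1 /\ multM m (mult_adj m) = mult1.

End MultiplierOps.

Definition is_mhom (A B : cstar) (f : A -> multiplier B) : Prop :=
  [/\ forall c x y, f (c *: x + y) = multD (multZ c (f x)) (f y),
      forall x y, f (cmul x y) = multM (f x) (f y) &
      forall x, f (cadj x) = mult_adj (f x)].

Definition nondeg_hom (A B : cstar) (f : A -> multiplier B) : Prop :=
  cspan [set x : B | exists a b, x = lact (f a) b] = setT.

(* The canonical extension M(A) -> M(B) of a nondegenerate f : A -> M(B). *)
Definition mult_ext (A B : cstar) (f : A -> multiplier B) (m : multiplier A) :
    multiplier B :=
  the (mult1 B) (fun n => forall a, multM n (f a) = f (lact m a)).

Record hilbert := Hilbert {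
  hilbert_car :> completeNormedModType R[i];
  ip : hilbert_car -> hilbert_car -> R[i];
  ip_linl : forall c x y z, ip (c *: x + y) z = c * ip x z + ip y z;
  ip_sym : forall x y, ip y x = (ip x y)^*;
  ip_norm : forall x, `|x| ^+ 2 = ip x x
}.

Definition is_representation (A : cstar) (H : hilbert) (p : A -> H -> H) :
    Prop :=
  [/\ forall a, is_linear (p a),
      forall c a b x, p (c *: a + b) x = c *: p a x + p b x,
      forall a b x, p (cmul a b) x = p a (p b x) &
      forall a x y, ip (p a x) y = ip x (p (cadj a) y)].

(* The norm of \sum_k h_k (x) k_k in the Hilbert space H (x) K. *)
Definition hilbert_tensor_norm (H K : hilbert) (I : finType)
    (h : I -> H) (k : I -> K) : R :=
  Num.sqrt (complex.Re (\sum_s \sum_t ip (h s) (h t) * ip (k s) (k t))).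

(* The union, over all representations p of A and q of B, of the sets
   { ‖(\sum_k p a_k (x) q b_k) xi‖ : xi in the algebraic tensor product, ‖xi‖ <= 1 }
   whose suprema are the norms ‖\sum_k p a_k (x) q b_k‖.                      *)
Definition spatial_norms (A B : cstar) (n : nat) (a : 'I_n -> A)
    (b : 'I_n -> B) : set R :=
  [set r | exists (H K : hilbert) (p : A -> H -> H) (q : B -> K -> K),
    [/\ is_representation p, is_representation q &
      exists (m : nat) (h : 'I_m -> H) (k : 'I_m -> K),
        hilbert_tensor_norm h k <= 1 /\
        r = hilbert_tensor_norm
              (fun s : ('I_n * 'I_m)%type => p (a (fst s)) (h (snd s)))
              (fun s : ('I_n * 'I_m)%type => q (b (fst s)) (k (snd s)))]].

Record min_tensor (A B : cstar) := MinTensor {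
  tensor_car :> cstar;
  tensor_elt : A -> B -> tensor_car;
  tensor_linl : forall b, is_linear (fun a => tensor_elt a b);
  tensor_linr : forall a, is_linear (tensor_elt a);
  tensor_mul : forall a a' b b',
    cmul (tensor_elt a b) (tensor_elt a' b') =
    tensor_elt (cmul a a') (cmul b b');
  tensor_adj : forall a b,
    cadj (tensor_elt a b) = tensor_elt (cadj a) (cadj b);
  tensor_dense : cspan [set x | exists a b, x = tensor_elt a b] = setT;
  tensor_norm : forall (n : nat) (a : 'I_n -> A) (b : 'I_n -> B),
    complex.Re `|\sum_k tensor_elt (a k) (b k)| = sup (spatial_norms a b)
}.

End CStarAlgebras.

Arguments mult1 {R A}.
Arguments mult_embed {R} A a.

Notation "m ** n" := (multM m n) (at level 40, left associativity).

Section GroupAlgebras.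
Variables (R : realType) (G : topGroupType).

Definition strictly_continuous (B : cstar R) (u : G -> multiplier B) : Prop :=
  forall b : B, continuous (fun s => lact (u s) b) /\
                continuous (fun s => ract (u s) b).

Definition is_unitary_hom (B : cstar R) (u : G -> multiplier B) : Prop :=
  [/\ forall s, unitary_mult (u s),
      forall s t, u (s * t)%g = u s ** u t &
      strictly_continuous u].

(* C*(G), by its universal property for strictly continuous homomorphisms of G
   into unitary groups of multiplier algebras; [gelt s] is s in M(C*(G)). *)
Record group_algebra := GroupAlgebra {
  group_algebra_car :> cstar R;
  gelt : G -> multiplier group_algebra_car;
  gelt_unitary : is_unitary_hom gelt;
  group_algebra_univ : forall (B : cstar R) (u : G -> multiplier B),
    is_unitary_hom u ->
    exists! p : group_algebra_car -> multiplier B,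
      [/\ is_mhom p, nondeg_hom p & forall s, mult_ext p (gelt s) = u s]
}.

Definition vanishes_at_infinity (h : G -> R[i]) : Prop :=
  continuous (h : G -> R[i]^o) /\
  forall e : R[i], 0 < e -> compact [set s | e <= `|h s|].

(* C_0(G); [c0_eval] sends an element to the function it is. *)
Record c0_algebra := C0Algebra {
  c0_car :> cstar R;
  c0_eval : c0_car -> G -> R[i];
  c0_lin : forall c f g s,
    c0_eval (c *: f + g) s = c * c0_eval f s + c0_eval g s;
  c0_mul : forall f g s, c0_eval (cmul f g) s = c0_eval f s * c0_eval g s;
  c0_adj : forall f s, c0_eval (cadj f) s = (c0_eval f s)^*;
  c0_norm : forall f,
    complex.Re `|f| = sup [set complex.Re `|c0_eval f s| | s in [set: G]];
  c0_inj : injective c0_eval;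
  c0_range : forall h, (exists f, c0_eval f = h) <-> vanishes_at_infinity h
}.

(* C_c(G) *)
Definition compactly_supported (f : G -> R[i]) : Prop :=
  continuous (f : G -> R[i]^o) /\ compact (closure [set s | f s != 0]).

(* Left Haar measure, as a Radon measure, i.e. as a positive functional on
   C_c(G); the values of [haar] outside C_c(G) are irrelevant. *)
Record haar_integral := HaarIntegral {
  haar :> (G -> R[i]) -> R[i];
  haar_lin : forall c f g, compactly_supported f -> compactly_supported g ->
    haar (fun t => c * f t + g t) = c * haar f + haar g;
  haar_pos : forall f, compactly_supported f ->
    (forall t, 0 <= f t) -> 0 <= haar f;
  haar_left_inv : forall s f, compactly_supported f ->
    haar (fun t => f (s * t)%g) = haar f;
  haar_nonzero : exists f, compactly_supported f /\ haar f <> 0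
}.

Definition modular (mu : haar_integral) (s : G) : R[i] :=
  the 1 (fun d => forall f, compactly_supported f ->
    d * mu (fun t => f (t * s)%g) = mu f).

(* L^2(G) as the completion of C_c(G); [l2_class f] is the class of f. *)
Record l2_space (mu : haar_integral) := L2Space {
  l2_car :> hilbert R;
  l2_class : (G -> R[i]) -> l2_car;
  l2_ip : forall f g, compactly_supported f -> compactly_supported g ->
    ip (l2_class f) (l2_class g) = mu (fun t => f t * (g t)^*);
  l2_dense : closure (l2_class @` compactly_supported) = setT
}.

Definition is_compact_operator (H : hilbert R) (T : H -> H) : Prop :=
  is_linear T /\ compact (closure (T @` [set x | `|x| <= 1])).

Record compact_operators (H : hilbert R) := CompactOperators {
  compact_car :> cstar R;
  compact_op : compact_car -> H -> H;
  compact_op_repr : is_representation compact_op;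
  compact_op_inj : injective compact_op;
  compact_op_range : forall T : H -> H,
    (exists x, compact_op x = T) <-> is_compact_operator T
}.

(* B(H) -> M(K(H)) *)
Definition mult_of_op (H : hilbert R) (K : compact_operators H) (T : H -> H) :
    multiplier K :=
  the mult1 (fun m : multiplier K => forall x xi,
    compact_op (lact m x) xi = T (compact_op x xi)).

(* The bounded operator on L^2(G) given on C_c(G) by F. *)
Definition l2_op (mu : haar_integral) (L : l2_space mu)
    (F : (G -> R[i]) -> (G -> R[i])) : L -> L :=
  the id (fun T : L -> L => [/\ is_linear T, continuous T &
    forall f, compactly_supported f -> T (l2_class L f) = l2_class L (F f)]).

Definition left_regular_op (mu : haar_integral) (L : l2_space mu) (s : G) :
    L -> L :=
  l2_op (fun f t => f (s^-1 * t)%g).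

Definition right_regular_op (mu : haar_integral) (L : l2_space mu) (s : G) :
    L -> L :=
  l2_op (fun f t => sqrtC (modular mu s) * f (t * s)%g).

Definition mul_op (mu : haar_integral) (L : l2_space mu) (h : G -> R[i]) :
    L -> L :=
  l2_op (fun f t => h t * f t).

(* A choice of the objects that G determines up to isomorphism. *)
Record setting := Setting {
  tens : forall A B : cstar R, min_tensor A B;
  CsG : group_algebra;
  C0G : c0_algebra;
  haarG : haar_integral;
  L2G : l2_space haarG;
  KG : compact_operators L2G
}.

End GroupAlgebras.

Section Coactions.
Variables (R : realType) (G : topGroupType) (S : setting R G).

Local Notation calg := (cstar R).
Local Notation "A '⊠' B" := (tensor_car (tens S A B))
  (at level 35, right associativity).
Local Notation "a '⊗' b" := (tensor_elt (tens S _ _) a b)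
  (at level 35, right associativity).
Local Notation CG := (group_algebra_car (CsG S)).
Local Notation C0 := (c0_car (C0G S)).
Local Notation K := (compact_car (KG S)).
Local Notation iota := (mult_embed _).

Definition mult_tensor (A B : calg) (m : multiplier A) (n : multiplier B) :
    multiplier (A ⊠ B) :=
  the mult1 (fun p : multiplier (A ⊠ B) => forall a b,
    lact p (a ⊗ b) = lact m a ⊗ lact n b /\
    ract p (a ⊗ b) = ract m a ⊗ ract n b).

Local Notation "m ⊗m n" := (mult_tensor m n)
  (at level 35, right associativity).

(* f (x) g : A (x) B -> M(A' (x) B') *)
Definition hom_tensor (A B A' B' : calg)
    (f : A -> multiplier A') (g : B -> multiplier B') :
    A ⊠ B -> multiplier (A' ⊠ B') :=
  the (fun=> mult1) (fun F => is_mhom F /\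
    forall a b, F (a ⊗ b) = f a ⊗m g b).

(* The canonical isomorphism (A (x) B) (x) D -> A (x) (B (x) D). *)
Definition tensor_assoc (A B D : calg) :
    (A ⊠ B) ⊠ D -> multiplier (A ⊠ (B ⊠ D)) :=
  the (fun=> mult1) (fun F => is_mhom F /\
    forall a b d, F ((a ⊗ b) ⊗ d) = iota (a ⊗ (b ⊗ d))).

(* The subalgebra \tilde M(A (x) B) of M(A (x) B) *)
Definition mtilde (A B : calg) (m : multiplier (A ⊠ B)) : Prop :=
  forall b : B, (exists x, m ** (mult1 ⊗m iota b) = iota x) /\
                (exists x, (mult1 ⊗m iota b) ** m = iota x).

(* The extension \tilde M(A (x) B) -> \tilde M(A' (x) B) of phi (x) id, where
   the homomorphism phi : A -> A' may be degenerate. *)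
Definition mtilde_ext (A A' B : calg) (phi : A -> A')
    (m : multiplier (A ⊠ B)) : multiplier (A' ⊠ B) :=
  the mult1 (fun n : multiplier (A' ⊠ B) => mtilde n /\
    forall b x, m ** (mult1 ⊗m iota b) = iota x ->
      n ** (mult1 ⊗m iota b) =
      hom_tensor (fun a => iota (phi a)) (fun b' : B => iota b') x).

(* The integrated form C*(G) -> M(B) of u : G -> UM(B). *)
Definition integrated (B : calg) (u : G -> multiplier B) :
    CG -> multiplier B :=
  the (fun=> mult1) (fun p => [/\ is_mhom p, nondeg_hom p &
    forall s, mult_ext p (gelt (CsG S) s) = u s]).

Definition comult : CG -> multiplier (CG ⊠ CG) :=
  integrated (fun s => gelt (CsG S) s ⊗m gelt (CsG S) s).

Record coaction := Coaction {
  coact_alg :> calg;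
  coact : coact_alg -> multiplier (coact_alg ⊠ CG);
  coact_hom : is_mhom coact;
  coact_inj : injective coact;
  coact_nondeg : nondeg_hom coact;
  coact_mtilde : forall a, mtilde (coact a);
  coact_coassoc : forall a,
    mult_ext (@tensor_assoc coact_alg CG CG)
      (mult_ext (hom_tensor coact (fun c : CG => iota c)) (coact a)) =
    mult_ext (hom_tensor (fun a : coact_alg => iota a) comult) (coact a);
  coact_span :
    cspan [set x : coact_alg ⊠ CG |
      exists a c, iota x = coact a ** (mult1 ⊗m iota c)] = setT
}.

Record coact_mor (A B : coaction) := CoactMor {
  coact_mor_fun :> A -> B;
  coact_mor_hom : is_hom coact_mor_fun;
  coact_mor_equiv : forall a,
    coact (coact_mor_fun a) = mtilde_ext coact_mor_fun (coact a)
}.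

(* ev_s (x) id : C_0(G) (x) B -> B and id (x) ev_s : B (x) C_0(G) -> B *)
Definition eval_left (B : calg) (s : G) : C0 ⊠ B -> multiplier B :=
  the (fun=> mult1) (fun F => is_mhom F /\
    forall f b, F (f ⊗ b) = multZ (c0_eval f s) (iota b)).

Definition eval_right (B : calg) (s : G) : B ⊠ C0 -> multiplier B :=
  the (fun=> mult1) (fun F => is_mhom F /\
    forall b f, F (b ⊗ f) = multZ (c0_eval f s) (iota b)).

(* w_G in M(C_0(G) (x) C*(G)), the function s |-> s *)
Definition wG : multiplier (C0 ⊠ CG) :=
  the mult1 (fun w : multiplier (C0 ⊠ CG) =>
    forall s, mult_ext (@eval_left CG s) w = gelt (CsG S) s).

Definition covariant_pair (A : coaction) (B : calg)
    (p : A -> multiplier B) (m : C0 -> multiplier B) : Prop :=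
  [/\ is_mhom p /\ nondeg_hom p, is_mhom m /\ nondeg_hom m &
    forall a,
      let W := mult_ext (hom_tensor m (fun c : CG => iota c)) wG in
      mult_ext (hom_tensor p (fun c : CG => iota c)) (coact a) =
      W ** (p a ⊗m mult1) ** mult_adj W].

(* Th is the integrated form p x m of the covariant pair (p, m). *)
Definition coact_integrates (A : coaction) (X : calg)
    (jA : A -> multiplier X) (jG : C0 -> multiplier X)
    (B : calg) (p : A -> multiplier B) (m : C0 -> multiplier B)
    (Th : X -> multiplier B) : Prop :=
  [/\ is_mhom Th, nondeg_hom Th,
      forall a, mult_ext Th (jA a) = p a &
      forall f, mult_ext Th (jG f) = m f].

Record coact_crossed (A : coaction) := CoactCrossed {
  coact_crossed_car :> calg;
  jA : A -> multiplier coact_crossed_car;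
  jG : C0 -> multiplier coact_crossed_car;
  coact_crossed_cov : covariant_pair jA jG;
  coact_crossed_univ :
    forall (B : calg) (p : A -> multiplier B) (m : C0 -> multiplier B),
    covariant_pair p m ->
    exists! Th : coact_crossed_car -> multiplier B,
      coact_integrates jA jG p m Th
}.

(* F = phi x G.  A description on the generators j_A(a) j_G(f) is needed
   because j_B \o phi need not be nondegenerate. *)
Definition is_crossed_mor (A B : coaction) (phi : coact_mor A B)
    (X : coact_crossed A) (Y : coact_crossed B) (F : X -> Y) : Prop :=
  is_hom F /\
  forall a f x, iota x = jA X a ** jG X f ->
    iota (F x) = jA Y (phi a) ** jG Y f.

Definition crossed_mor_iso (A B : coaction) (phi : coact_mor A B) : Prop :=
  exists (X : coact_crossed A) (Y : coact_crossed B) (F : X -> Y),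
    is_crossed_mor phi F /\ bijective F.

Record action (X : calg) := Action {
  act :> G -> X -> X;
  act_hom : forall s, is_hom (act s);
  act1 : forall x, act 1%g x = x;
  actM : forall s t x, act (s * t)%g x = act s (act t x);
  act_continuous : forall x, continuous (fun s => act s x)
}.

Definition act_covariant (X : calg) (al : action X) (B : calg)
    (p : X -> multiplier B) (u : G -> multiplier B) : Prop :=
  [/\ is_mhom p, nondeg_hom p, is_unitary_hom u &
    forall s x, p (al s x) = u s ** p x ** mult_adj (u s)].

Definition act_integrates (X Y : calg) (iX : X -> multiplier Y)
    (iG : G -> multiplier Y) (B : calg)
    (p : X -> multiplier B) (u : G -> multiplier B) (Th : Y -> multiplier B) :
    Prop :=
  [/\ is_mhom Th, nondeg_hom Th,
      forall x, mult_ext Th (iX x) = p x &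
      forall s, mult_ext Th (iG s) = u s].

Record act_crossed (X : calg) (al : action X) := ActCrossed {
  act_crossed_car :> calg;
  iX : X -> multiplier act_crossed_car;
  iG : G -> multiplier act_crossed_car;
  act_crossed_cov : act_covariant al iX iG;
  act_crossed_univ :
    forall (B : calg) (p : X -> multiplier B) (u : G -> multiplier B),
    act_covariant al p u ->
    exists! Th : act_crossed_car -> multiplier B,
      act_integrates iX iG p u Th
}.

Definition act_integrated (X : calg) (al : action X) (Y : act_crossed al)
    (B : calg) (p : X -> multiplier B) (u : G -> multiplier B) :
    Y -> multiplier B :=
  the (fun=> mult1) (act_integrates (iX Y) (iG Y) p u).

Definition lambda_mult (s : G) : multiplier K :=
  mult_of_op (KG S) (@left_regular_op R G (haarG S) (L2G S) s).

Definition rho_mult (s : G) : multiplier K :=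
  mult_of_op (KG S) (@right_regular_op R G (haarG S) (L2G S) s).

Definition mul_mult (f : C0) : multiplier K :=
  mult_of_op (KG S) (@mul_op R G (haarG S) (L2G S) (c0_eval f)).

(* The regular representation of X x_al G on M(X (x) K): the element
   [orbit_mult al x] of M(X (x) C_0(G)) is the function s |-> al_{s^-1}(x). *)
Definition orbit_mult (X : calg) (al : action X) (x : X) :
    multiplier (X ⊠ C0) :=
  the mult1 (fun m : multiplier (X ⊠ C0) =>
    forall s, mult_ext (@eval_right X s) m = iota (al (s^-1)%g x)).

Definition regular_repr (X : calg) (al : action X) (Y : act_crossed al) :
    Y -> multiplier (X ⊠ K) :=
  act_integrated
    (fun x => mult_ext (hom_tensor (fun x : X => iota x) mul_mult)
                       (orbit_mult al x))
    (fun s => mult1 ⊗m lambda_mult s).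

(* The reduced crossed product is the quotient of the full one by the kernel
   of the regular representation. *)
Record red_crossed (X : calg) (al : action X) (Y : act_crossed al) :=
  RedCrossed {
  red_crossed_car :> calg;
  red_quot : Y -> red_crossed_car;
  red_quot_hom : is_hom red_quot;
  red_quot_surj : forall z, exists y, red_quot y = z;
  red_quot_ker : forall y, red_quot y = 0 <-> regular_repr y = mult_embed _ 0
}.

Definition is_dual_action (A : coaction) (X : coact_crossed A)
    (al : action X) : Prop :=
  (forall s a, mult_ext (fun x => iota (al s x)) (jA X a) = jA X a) /\
  (forall s (f f' : C0),
     (forall t, c0_eval f' t = c0_eval f (t * s)%g) ->
     mult_ext (fun x => iota (al s x)) (jG X f) = jG X f').

(* ((id (x) lambda) o delta) x (1 (x) M) : A x_delta G -> M(A (x) K) *)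
Definition canonical_inner (A : coaction) (X : coact_crossed A) :
    X -> multiplier (A ⊠ K) :=
  the (fun=> mult1) (coact_integrates (jA X) (jG X)
    (fun a => mult_ext (hom_tensor (fun a : A => iota a)
                                   (integrated lambda_mult)) (coact a))
    (fun f => mult1 ⊗m mul_mult f)).

(* Phi : A x_delta G x_{\hat delta} G -> M(A (x) K), with image A (x) K *)
Definition canonical_surj (A : coaction) (X : coact_crossed A)
    (al : action X) (Y : act_crossed al) : Y -> multiplier (A ⊠ K) :=
  act_integrated (@canonical_inner A X) (fun s => mult1 ⊗m rho_mult s).

Definition is_maximal (A : coaction) : Prop :=
  exists (X : coact_crossed A) (al : action X) (Y : act_crossed al)
         (F : Y -> A ⊠ K),
    [/\ is_dual_action al, is_hom F, bijective F &
        forall y, iota (F y) = canonical_surj y].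

Definition is_normal (A : coaction) : Prop :=
  exists (X : coact_crossed A) (al : action X) (Y : act_crossed al)
         (Z : red_crossed Y) (F : Z -> A ⊠ K),
    [/\ is_dual_action al, is_hom F, bijective F &
        forall y, iota (F (red_quot Z y)) = canonical_surj y].

(* The functor laws are stated for any morphism that is the identity map,
   resp. for any morphism that is the composite map. *)
Record coact_functor := CoactFunctor {
  fobj :> coaction -> coaction;
  fmap : forall A B, coact_mor A B -> coact_mor (fobj A) (fobj B);
  fmap_id : forall A (f : coact_mor A A),
    (forall a, f a = a) -> forall x, fmap f x = x;
  fmap_comp : forall A B D (f : coact_mor A B) (g : coact_mor B D)
    (h : coact_mor A D),
    (forall a, h a = g (f a)) -> forall x, fmap h x = fmap g (fmap f x)
}.

(* A choice of maximalizations, with the resulting functor. *)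
Record maximalization := Maximalization {
  max_functor :> coact_functor;
  qmax : forall A, coact_mor (max_functor A) A;
  max_maximal : forall A, is_maximal (max_functor A);
  qmax_surj : forall A b, exists a, qmax A a = b;
  qmax_iso : forall A, crossed_mor_iso (qmax A);
  qmax_nat : forall A B (f : coact_mor A B) a,
    f (qmax A a) = qmax B (fmap max_functor f a)
}.

Record normalization := Normalization {
  nor_functor :> coact_functor;
  qnor : forall A, coact_mor A (nor_functor A);
  nor_normal : forall A, is_normal (nor_functor A);
  qnor_surj : forall A b, exists a, qnor A a = b;
  qnor_iso : forall A, crossed_mor_iso (qnor A);
  qnor_nat : forall A B (f : coact_mor A B) a,
    fmap nor_functor f (qnor A a) = qnor B (f a)
}.

Variables (Mx : maximalization) (Nx : normalization).

Record coaction_functor := CoactionFunctor {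
  cf_functor :> coact_functor;
  cf_q : forall A, coact_mor (Mx A) (cf_functor A);
  cf_q_nat : forall A B (f : coact_mor A B) a,
    fmap cf_functor f (cf_q A a) = cf_q B (fmap Mx f a);
  cf_q_surj : forall A b, exists a, cf_q A a = b;
  cf_q_ker : forall A a, cf_q A a = 0 -> qnor Nx (Mx A) a = 0
}.

(* A^m_tau *)
Definition cf_ker (tau : coaction_functor) (A : coaction) : set (Mx A) :=
  [set a | cf_q tau A a = 0].
Arguments cf_ker tau A : clear implicits.

Definition cf_le (sigma tau : coaction_functor) : Prop :=
  forall A, cf_ker tau A `<=` cf_ker sigma A.

(* Collections of coaction functors are predicates on [coaction_functor], which
   is too large a type for [set].  *)
Definition cf_is_glb (T : coaction_functor -> Prop) (sigma : coaction_functor) : Prop :=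
  (forall tau, T tau -> cf_le sigma tau) /\
  (forall rho, (forall tau, T tau -> cf_le rho tau) -> cf_le rho sigma).

End Coactions.

Arguments cf_ker {R G S Mx Nx} tau A.

(* Main.v *)
(* For a coaction on A, the closed span I of the kernels A^m_tau is a closed
   ideal of A^m, and the greatest lower bound sends A to A^m / I.  The coaction
   of A^m descends along q : A^m -> A^m / I because q factors through every
   q_tau, and the coaction of A^tau vanishes at q_tau(a) = 0.  Injectivity is
   the one axiom that does not pass to quotients formally.  It is obtained from
   the counit e : C^*(G) -> C, the integrated form of the trivial homomorphism
   G -> {1}: coassociativity and the injectivity of delta give
   (id (x) e) o delta = id on A^m, and this identity does descend.
   The norm estimates behind tensor products of homomorphisms rest on one
   principle: if T : A -> H is linear and <T a, T b> = <T (b^* a), v>, then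
   |T a| <= |a| |v|, by writing 1 - h = (1 - k)^2 for self-adjoint |h| < 1.
   Minimal tensor norms are then computed in Hilbert space representations, of
   which there are enough by the Gelfand-Naimark theorem. *)
Require Import Defs.
From HB Require Import structures.
From mathcomp Require Import all_boot all_order all_algebra.
From mathcomp Require Import complex ring lra.
From mathcomp Require Import all_classical all_reals all_analysis.

Set Implicit Arguments.
Unset Strict Implicit.
Unset Printing Implicit Defensive.

Import Order.TTheory GRing.Theory Num.Theory.
Import numFieldNormedType.Exports.

Local Open Scope classical_set_scope.
Local Open Scope ring_scope.

Local Notation "x %:C" := (real_complex _ x) (at level 1, format "x %:C").

(** * Banach spaces and closed spans *)

(** Every object singled out by [the] is opaque until one solution of its description is exhibited,
    so the bulk of the work is existence: bounded extensions of maps given only on elementary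
    tensors or on vectors [f(x) y]. Multipliers, being bare double centralizers, carry no norm; they
    are replaced by the adjointable operators [Mcs], and identities are translated back along
    [mul_of]. Most bounds come from fixing the vector, letting the algebra element vary, and
    applying the contraction principle. This does not suffice for associativity of the minimal
    tensor product: the norm of A (x) (B (x) D) ranges over all representations of B (x) D, while
    rebracketing only makes sense for product representations. There the square of the operator,
    written as a matrix over B (x) D, carries the estimate from the latter to the former. Without
    functional calculus, positivity is the norm condition [|M - h| <= M], and the approximate units
    behind the quotient norm are Cesaro means of the iterates of [x |-> x (1 - s^2)]. *)

Section BanachFromSubspace.
Variable R : realType.

Definition cabs (c : R[i]) : R := complex.Re `|c|.

Lemma null_seq : exists2 d : nat -> R, (forall n, 0 < d n) &
  forall e : R, 0 < e -> exists k, forall m, (k <= m)%N -> d m < e.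
Proof.
exists (fun n => n.+1%:R^-1) => [n|e e0]; first by rewrite invr_gt0 ltr0n.
exists (Num.truncn e^-1) => m km; rewrite invf_plt ?posrE ?ltr0n //.
have := truncnS_gt e^-1 => /lt_le_trans; apply.
by rewrite ler_nat ltnS.
Qed.

Lemma cabsE (c : R[i]) : `|c| = (cabs c)%:C.
Proof. by rewrite /cabs RRe_real // normr_real. Qed.

Section Seminorm.
Variables (V : lmodType R[i]) (N : V -> R).

Definition cauchy_for (u : nat -> V) : Prop :=
  forall e : R, 0 < e -> exists k, forall m n, (k <= m)%N -> (k <= n)%N ->
    N (u m - u n) < e.

Definition cvg_for (u : nat -> V) (l : V) : Prop :=
  forall e : R, 0 < e -> exists k, forall n, (k <= n)%N -> N (u n - l) < e.

End Seminorm.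

(** One template for adjointable operators, completions of kernel spaces, matrices, quotients and
    scalars, each carved out of an ambient module. The norm is constrained only on [bd_set], because
    operator norms are infima of sets that may be empty elsewhere. *)
Record banach_data (V : lmodType R[i]) := BanachData {
  bd_set : set V;
  bd_norm : V -> R;
  bd_set0 : bd_set 0;
  bd_setL : forall c x y, bd_set x -> bd_set y -> bd_set (c *: x + y);
  bd_normD : forall x y, bd_set x -> bd_set y ->
    bd_norm (x + y) <= bd_norm x + bd_norm y;
  bd_normZ : forall c x, bd_set x -> bd_norm (c *: x) = cabs c * bd_norm x;
  bd_norm0 : forall x, bd_set x -> bd_norm x = 0 -> x = 0;
  bd_complete : forall u, (forall n, bd_set (u n)) -> cauchy_for bd_norm u ->
    exists l, bd_set l /\ cvg_for bd_norm u l
}.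

Section Construction.
Variables (V : lmodType R[i]) (d : banach_data V).

Definition bd_pred : {pred V} := fun x => `[< bd_set d x >].

Lemma bd_pred_submod : GRing.submod_closed bd_pred.
Proof.
split; first by apply/asboolP/bd_set0.
by move=> c x y /asboolP dx /asboolP dy; apply/asboolP/bd_setL.
Qed.

HB.instance Definition _ :=
  GRing.isSubmodClosed.Build R[i] V bd_pred bd_pred_submod.

Record banach_sub := BanachSub { bs_val : V; bs_valP : bs_val \in bd_pred }.

HB.instance Definition _ := [isSub for bs_val].
HB.instance Definition _ := [Choice of banach_sub by <:].
HB.instance Definition _ := [SubChoice_isSubLmodule of banach_sub by <:].

Definition bs_norm (x : banach_sub) : R[i] := (bd_norm d (bs_val x))%:C.

Lemma bs_normD x y : bs_norm (x + y) <= bs_norm x + bs_norm y.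
Proof. by rewrite -rmorphD lecR; apply: bd_normD; apply/asboolP/bs_valP. Qed.

Lemma bs_normZ c x : bs_norm (c *: x) = `|c| * bs_norm x.
Proof.
by rewrite cabsE -rmorphM /bs_norm /= bd_normZ //; apply/asboolP/bs_valP.
Qed.

Lemma bs_norm0 x : bs_norm x = 0 -> x = 0.
Proof.
move=> /complexI /bd_norm0 e; apply: val_inj => /=.
by apply: e; apply/asboolP/bs_valP.
Qed.

HB.instance Definition _ :=
  Lmodule_isNormed.Build R[i] banach_sub bs_normD bs_normZ bs_norm0.

End Construction.

Section SequentialCompleteness.
Variable V : normedModType R[i].

Definition nrm (x : V) : R := complex.Re `|x|.

Lemma nrmE x : `|x| = (nrm x)%:C.
Proof. by rewrite /nrm RRe_real // normr_real. Qed.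

Lemma nrm_ge0 x : 0 <= nrm x.
Proof. by rewrite -lecR -nrmE normr_ge0. Qed.

Lemma nrm0 : nrm 0 = 0.
Proof. by rewrite /nrm normr0. Qed.

Lemma nrm0_eq0 x : nrm x = 0 -> x = 0.
Proof. by move=> x0; apply/eqP; rewrite -normr_eq0 nrmE x0. Qed.

Lemma nrmN x : nrm (- x) = nrm x.
Proof. by rewrite /nrm normrN. Qed.

Lemma nrm_distC x y : nrm (x - y) = nrm (y - x).
Proof. by rewrite -nrmN opprB. Qed.

Lemma nrmD x y : nrm (x + y) <= nrm x + nrm y.
Proof. by rewrite -lecR rmorphD /= -!nrmE ler_normD. Qed.

Lemma nrmB x y : nrm (x - y) <= nrm x + nrm y.
Proof. by rewrite -(nrmN y) nrmD. Qed.

Lemma nrm_tri y x z : nrm (x - z) <= nrm (x - y) + nrm (y - z).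
Proof. by have := nrmD (x - y) (y - z); rewrite addrA subrK. Qed.

Lemma nrmZ c x : nrm (c *: x) = cabs c * nrm x.
Proof. by rewrite /nrm normrZ cabsE nrmE -rmorphM. Qed.

Lemma gt0_complexE (e : R[i]) : 0 < e -> exists2 r : R, 0 < r & e = r%:C.
Proof. by case: e => a b; rewrite ltcE /= => /andP[/eqP-> a0]; exists a. Qed.

Lemma nrm_ballP (x y : V) (e : R) : ball x (e%:C) y <-> nrm (x - y) < e.
Proof. by rewrite -ball_normE /ball_ /= nrmE ltcR. Qed.

(** Points [x n] are picked whose balls of radius [d n] belong to the filter. Two such balls meet
    because the filter is proper, so [x] is Cauchy, and its limit is a limit of the filter. *)
Lemma seq_complete_complete :
  (forall u : nat -> V, cauchy_for nrm u -> exists l, cvg_for nrm u l) ->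
  forall F : set_system V, ProperFilter F -> cauchy F -> cvg F.
Proof.
move=> seqc F FF /cauchyP cF.
have [d d0 d_lt] := null_seq.
have px n : exists x : V, F (ball x (d n)%:C) by apply: cF; rewrite ltcR.
have [x hx] := choice px.
have xx m n : nrm (x m - x n) < d m + d n.
  have [y [/nrm_ballP xmy /nrm_ballP xny]] :=
    filter_ex (filterI (hx m) (hx n)).
  by have := nrm_tri y (x m) (x n); rewrite (nrm_distC y); lra.
have /seqc[l hl] : cauchy_for nrm x.
  move=> e e0; have [k hk] := d_lt (e / 2) (divr_gt0 e0 (ltr0n _ 2)).
  by exists k => m n /hk hm /hk hn; have := xx m n; lra.
apply/cvg_ex; exists l; apply/cvg_ballP => e /gt0_complexE[r r0 ->].
have [k hk] := d_lt (r / 2) (divr_gt0 r0 (ltr0n _ 2)).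
have [k' hk'] := hl (r / 2) (divr_gt0 r0 (ltr0n _ 2)).
have := hk _ (leq_maxl k k'); have := hk' _ (leq_maxr k k') => h1 h2.
apply: filterS (hx (maxn k k')) => y /nrm_ballP h3; apply/nrm_ballP.
by have := nrm_tri (x (maxn k k')) l y; rewrite (nrm_distC l (x _)); lra.
Qed.

End SequentialCompleteness.

Section Complete.
Variables (V : lmodType R[i]) (d : banach_data V).

Lemma bs_nrmE (x : banach_sub d) : nrm x = bd_norm d (bs_val x).
Proof. by []. Qed.

Lemma bs_complete (F : set_system (banach_sub d)) :
  ProperFilter F -> cauchy F -> cvg F.
Proof.
apply: seq_complete_complete => u cu.
have Du n : bd_set d (bs_val (u n)) by apply/asboolP/bs_valP.
have [l [dl hl]] := bd_complete Du cu.
have lP : l \in bd_pred d by apply/asboolP.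
by exists (BanachSub lP) => e /hl.
Qed.

HB.instance Definition _ := Uniform_isComplete.Build (banach_sub d) bs_complete.
End Complete.
End BanachFromSubspace.

Section NormBasics.
Variable R : realType.
Implicit Types (c : R[i]) (V W : completeNormedModType R[i]).

Lemma cabs_ge0 c : 0 <= cabs c.
Proof. by rewrite -lecR -cabsE normr_ge0. Qed.

Lemma cabs0 : cabs (0 : R[i]) = 0.
Proof. by rewrite /cabs normr0. Qed.

Lemma cabs1 : cabs (1 : R[i]) = 1.
Proof. by rewrite /cabs normr1. Qed.

Lemma cabsM c1 c2 : cabs (c1 * c2) = cabs c1 * cabs c2.
Proof. by rewrite /cabs normrM !cabsE -rmorphM. Qed.

Lemma cabsN c : cabs (- c) = cabs c.
Proof. by rewrite /cabs normrN. Qed.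

Lemma cabsD c1 c2 : cabs (c1 + c2) <= cabs c1 + cabs c2.
Proof. by rewrite -lecR rmorphD /= -!cabsE ler_normD. Qed.

Lemma cabsR (r : R) : cabs r%:C = `|r|.
Proof. by rewrite /cabs normc_def /= expr0n addr0 sqrtr_sqr. Qed.

Lemma cabs_conj c : cabs c^* = cabs c.
Proof. by rewrite /cabs norm_conjC. Qed.

Lemma cabs0_eq0 c : cabs c = 0 -> c = 0.
Proof. by move=> c0; apply/eqP; rewrite -normr_eq0 cabsE c0. Qed.

Lemma Re_le_cabs c : complex.Re c <= cabs c.
Proof.
by case: c => a b; rewrite /cabs normc_def /= (le_trans (ler_norm a)) //
  -sqrtr_sqr ler_wsqrtr // lerDl sqr_ge0.
Qed.

Lemma nrmZr V (r : R) (x : V) : 0 <= r -> nrm (r%:C *: x) = r * nrm x.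
Proof. by move=> r0; rewrite nrmZ cabsR ger0_norm. Qed.

Lemma nrm_eps V (x : V) : (forall e : R, 0 < e -> nrm x <= e) -> x = 0.
Proof.
move=> h; apply: nrm0_eq0; apply/eqP; rewrite eq_le nrm_ge0 andbT.
by apply/ler_addgt0Pr => e e0; rewrite add0r h.
Qed.

Lemma nrm_cauchy_cvg V (u : nat -> V) :
  cauchy_for (@nrm R V) u -> exists l, cvg_for (@nrm R V) u l.
Proof.
move=> cu; have : cvg (u @ \oo).
  apply: cauchy_cvg; apply/cauchyP => e /gt0_complexE[r r0 ->].
  have [k hk] := cu _ r0; exists (u k).
  by exists k => // n /= kn; apply/nrm_ballP; exact: hk.
move=> /cvg_ex[l /cvg_ballP hl]; exists l => e e0.
have /hl[k _ hk] : (0 : R[i]) < e%:C by rewrite ltcR.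
by exists k => n kn; have /nrm_ballP := hk n kn; rewrite nrm_distC.
Qed.

Lemma closure_nrmP V (S : set V) x :
  closure S x <-> forall e : R, 0 < e -> exists2 y, S y & nrm (x - y) < e.
Proof.
split=> [cl e e0|h B].
  have : nbhs x (ball x e%:C) by apply: nbhsx_ballx; rewrite ltcR.
  by move=> /cl [y [Sy /nrm_ballP xy]]; exists y.
move=> /nbhs_ballP[e /= /gt0_complexE[r r0 ->] hB].
have [y Sy xy] := h r r0; exists y; split=> //.
by apply: hB; apply/nrm_ballP.
Qed.

Section Linear.
Variables (V W : lmodType R[i]) (f : V -> W).
Hypothesis flin : is_linear f.

Lemma lin0 : f 0 = 0.
Proof. by have := flin (-1) 0 0; rewrite !scaleN1r oppr0 addr0 addNr. Qed.

Lemma linD x y : f (x + y) = f x + f y.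
Proof. by have := flin 1 x y; rewrite !scale1r. Qed.

Lemma linZ c x : f (c *: x) = c *: f x.
Proof. by have := flin c x 0; rewrite lin0 !addr0. Qed.

Lemma linN x : f (- x) = - f x.
Proof. by rewrite -scaleN1r linZ scaleN1r. Qed.

Lemma linB x y : f (x - y) = f x - f y.
Proof. by rewrite linD linN. Qed.

Lemma lin_sum (I : Type) (r : seq I) (P : pred I) (F : I -> V) :
  f (\sum_(i <- r | P i) F i) = \sum_(i <- r | P i) f (F i).
Proof. by apply: big_morph; [exact: linD | exact: lin0]. Qed.
End Linear.

Lemma is_linear_comp (U V W : lmodType R[i]) (f : V -> W) (g : U -> V) :
  is_linear f -> is_linear g -> is_linear (fun x => f (g x)).
Proof. by move=> lf lg c x y; rewrite lg lf. Qed.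

Definition closed_sub V (D : set V) : Prop :=
  [/\ D 0, forall c x y, D x -> D y -> D (c *: x + y) &
      forall x, (forall e : R, 0 < e -> exists2 y, D y & nrm (x - y) < e) -> D x].

Lemma cspan_min V (S D : set V) : closed_sub D -> S `<=` D -> cspan S `<=` D.
Proof.
move=> [D0 DL Dc] SD x /closure_nrmP h; apply: Dc => e /h[y [n [c [v [Sv ->]]]] xy].
exists (\sum_k c k *: v k) => //.
apply: (big_ind D) => // [a b Da Db|k _]; first by rewrite -(scale1r a); apply: DL.
by rewrite -[_ *: _]addr0; apply: DL => //; apply: SD.
Qed.

Lemma sub_cspan V (S : set V) : S `<=` cspan S.
Proof.
move=> x Sx; apply: subset_closure; exists 1%N, (fun=> 1), (fun=> x).
by split => //; rewrite big_ord1 scale1r.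
Qed.

Lemma cspan_closed V (S : set V) : closed_sub (cspan S).
Proof.
have span0 : cspan S 0.
  apply: subset_closure; exists 0%N, (fun=> 0), (fun=> 0).
  by split => [[]|]; rewrite ?big_ord0.
split=> //.
  move=> c x y /closure_nrmP hx /closure_nrmP hy; apply/closure_nrmP => e e0.
  have c1 : 0 < cabs c + 1 by rewrite ltr_wpDl ?cabs_ge0.
  have e2 : 0 < e / 2 by rewrite divr_gt0.
  have [x' [n1 [c1' [v1 [S1 ->]]]] h1] := hx _ (divr_gt0 e2 c1).
  have [y' [n2 [c2' [v2 [S2 ->]]]] h2] := hy _ e2.
  exists (c *: (\sum_k c1' k *: v1 k) + \sum_k c2' k *: v2 k); last first.
    apply: (le_lt_trans (y := cabs c * (e / 2 / (cabs c + 1)) + e / 2)); last first.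
      have : cabs c * (e / 2 / (cabs c + 1)) < e / 2 => [|h]; last by lra.
      rewrite mulrCA -{2}[e / 2]mulr1 ltr_pM2l // ltr_pdivrMr //; lra.
    rewrite opprD addrACA -scalerBr.
    apply: le_trans (nrmD _ _) _; rewrite nrmZ lerD ?ler_wpM2l ?cabs_ge0 //;
      exact: ltW.
  exists (n1 + n2)%N, (fun k : 'I_(n1 + n2) =>
    match fintype.split k with inl i => c * c1' i | inr j => c2' j end),
    (fun k : 'I_(n1 + n2) => match fintype.split k with inl i => v1 i | inr j => v2 j end).
  split=> [k|]; first by case: (fintype.split k).
  rewrite big_split_ord /= scaler_sumr; congr (_ + _); apply: eq_bigr => i _.
    by rewrite (unsplitK (inl i)) scalerA.
  by rewrite (unsplitK (inr i)).
move=> x hx; apply/closure_nrmP => e e0.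
have e2 : 0 < e / 2 by rewrite divr_gt0.
have [y /closure_nrmP /(_ _ e2)[z Sz yz] xy] := hx _ e2.
by exists z => //; have := nrm_tri y x z; lra.
Qed.

(** Later identities between bounded maps are proved through this: their solution set is a closed
    subspace, so generators suffice. *)
Lemma cspanT_dense V (S D : set V) x :
  cspan S = setT -> closed_sub D -> S `<=` D -> D x.
Proof. by move=> ST cD SD; apply: (cspan_min cD SD); rewrite ST. Qed.

Lemma closed_sub_zero V (W : normedModType R[i]) (f : V -> W) (C : R) :
  (forall c x y, f (c *: x + y) = c *: f x + f y) ->
  (forall x, nrm (f x) <= C * nrm x) -> closed_sub [set x | f x = 0].
Proof.
move=> lf bf; have f0 : f 0 = 0.
  by have := lf (-1) 0 0; rewrite !scaleN1r addr0 oppr0 addNr.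
split=> [|c x y /= fx fy|x hx] //=; first by rewrite lf fx fy scaler0 addr0.
have C1 : 0 < `|C| + 1 by rewrite ltr_wpDl.
apply: nrm0_eq0; apply/eqP; rewrite eq_le nrm_ge0 andbT.
apply/ler_addgt0Pr => e e0; rewrite add0r.
have [y /= fy xy] := hx _ (divr_gt0 e0 C1).
have -> : f x = f (x - y).
  by rewrite addrC -scaleN1r lf fy scaler0 add0r.
apply: le_trans (bf _) _.
apply: le_trans (ler_wpM2r (nrm_ge0 _) (ler_norm C)) _.
apply: le_trans (ler_wpM2l (normr_ge0 C) (ltW xy)) _.
rewrite mulrCA -{2}[e]mulr1 ler_pM2l // ler_pdivrMr //; lra.
Qed.

(** A relation replaces a function on a dense subspace: on vectors written as linear combinations
    the value depends a priori on the expression, and the bound, applied to differences, supplies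
    single-valuedness. *)
Lemma ext_graph V W (G : V -> W -> Prop) (C : R) : 0 <= C ->
  (forall c x y x' y', G x x' -> G y y' -> G (c *: x + y) (c *: x' + y')) ->
  (forall x x', G x x' -> nrm x' <= C * nrm x) ->
  (forall x e, 0 < e -> exists y y', G y y' /\ nrm (x - y) < e) ->
  exists T : V -> W, [/\ is_linear T, forall x x', G x x' -> T x = x' &
    forall x, nrm (T x) <= C * nrm x].
Proof.
move=> C0 GL Gb Gd.
(* [P] is the closure of the graph; it inherits linearity and the bound. *)
pose P x x' := forall e : R, 0 < e -> exists y y',
  [/\ G y y', nrm (x - y) < e & nrm (x' - y') < e].
have C1 : 0 < C + 1 by rewrite ltr_wpDl.
have GP x x' : G x x' -> P x x'.
  by move=> Gx e e0; exists x, x'; rewrite !subrr !nrm0.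
have PL c x y x' y' : P x x' -> P y y' -> P (c *: x + y) (c *: x' + y').
  move=> Px Py e e0.
  have c1 : 0 < cabs c + 1 by rewrite ltr_wpDl ?cabs_ge0.
  have e2 : 0 < e / 2 by rewrite divr_gt0.
  have [a [a' [Ga xa xa']]] := Px _ (divr_gt0 e2 c1).
  have [b [b' [Gb' yb yb']]] := Py _ e2.
  have key (X : completeNormedModType R[i]) (x1 a1 y1 b1 : X) :
      nrm (x1 - a1) < e / 2 / (cabs c + 1) -> nrm (y1 - b1) < e / 2 ->
      nrm (c *: x1 + y1 - (c *: a1 + b1)) < e.
    move=> h1 h2.
    apply: (le_lt_trans (y := cabs c * (e / 2 / (cabs c + 1)) + e / 2)); last first.
      have : cabs c * (e / 2 / (cabs c + 1)) < e / 2 => [|h]; last by lra.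
      rewrite mulrCA -{2}[e / 2]mulr1 ltr_pM2l // ltr_pdivrMr //; lra.
    rewrite opprD addrACA -scalerBr.
    apply: le_trans (nrmD _ _) _; rewrite nrmZ lerD ?ler_wpM2l ?cabs_ge0 //;
      exact: ltW.
  by exists (c *: a + b), (c *: a' + b'); split; [exact: GL| exact: key|exact: key].
have Pb x x' : P x x' -> nrm x' <= C * nrm x.
  move=> Px; apply/ler_addgt0Pr => e e0.
  have [y [y' [Gy xy xy']]] := Px _ (divr_gt0 e0 C1).
  have h1 := nrm_tri y' x' 0; have h2 := nrm_tri x y 0.
  have h3 := Gb _ _ Gy; rewrite !subr0 in h1 h2; rewrite nrm_distC in h2.
  have h4 : C * nrm y <= C * (nrm (x - y) + nrm x) by rewrite ler_wpM2l.
  have h5 : C * nrm (x - y) <= C * (e / (C + 1)) by rewrite ler_wpM2l // ltW.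
  have h6 : (C + 1) * (e / (C + 1)) = e by rewrite mulrC divfK // gt_eqF.
  by rewrite mulrDr in h4; rewrite mulrDl mul1r in h6; lra.
have Pex x : exists x', P x x'.
  have [d d0 d_lt] := null_seq R.
  have [yy hyy] := choice (fun n => Gd x (d n) (d0 n)).
  have [yy' {}hyy] := choice hyy.
  have : cauchy_for (@nrm R W) yy'.
    move=> e e0; have [k hk] := d_lt _ (divr_gt0 (divr_gt0 e0 C1) (ltr0n _ 2)).
    exists k => m n km kn.
    have [Gm xm] := hyy m; have [Gn xn] := hyy n.
    have := GL (-1) _ _ _ _ Gn Gm; rewrite !scaleN1r ![- _ + _]addrC.
    move=> /Gb h; apply: le_lt_trans h _.
    have h1 := nrm_tri x (yy m) (yy n); rewrite (nrm_distC (yy m) x) in h1.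
    have h2 := hk m km; have h3 := hk n kn.
    have h4 : nrm (yy m - yy n) <= e / (C + 1) by lra.
    have h5 : C * nrm (yy m - yy n) <= C * (e / (C + 1)) by rewrite ler_wpM2l.
    have h6 : (C + 1) * (e / (C + 1)) = e by rewrite mulrC divfK // gt_eqF.
    have h7 : 0 < e / (C + 1) by rewrite divr_gt0.
    by rewrite mulrDl mul1r in h6; lra.
  move=> /nrm_cauchy_cvg[l hl]; exists l => e e0.
  have [k hk] := d_lt _ e0; have [k' hk'] := hl _ e0.
  have [Gm xm] := hyy (maxn k k').
  exists (yy (maxn k k')), (yy' (maxn k k')); split => //.
    exact: lt_trans xm (hk _ (leq_maxl _ _)).
  by rewrite nrm_distC hk' // leq_maxr.
have Pu x x' x'' : P x x' -> P x x'' -> x' = x''.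
  move=> P1 P2; apply/eqP; rewrite -subr_eq0; apply/eqP/nrm0_eq0/eqP.
  rewrite eq_le nrm_ge0 andbT; have := PL (-1) _ _ _ _ P2 P1.
  by rewrite !scaleN1r ![- _ + _]addrC subrr => /Pb; rewrite nrm0 mulr0.
have [T hT] := choice Pex; exists T; split.
- by move=> c x y; apply: (Pu (c *: x + y)) => //; apply: PL.
- by move=> x x' /GP Px; exact: (Pu x).
- by move=> x; exact: Pb.
Qed.

End NormBasics.

(** * Norms relative to a weight *)

Section WeightedSupNorm.
Variables (R : realType) (Y : Type) (w : Y -> R) (W : normedModType R[i]).
Hypothesis w0 : forall y, 0 <= w y.
Implicit Types (f g : Y -> W) (C : R).

(** With [w] the norm this gives the operator norm, with [w] the seminorm of a kernel a dual norm,
    with [w] a product of two norms the norm of a sesquilinear form. The least constant [wnorm] is 0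
    for unbounded [f], as an infimum of the empty set, whence the hypotheses
    [exists C, wbound f C]. *)
Definition wbound f C : Prop := 0 <= C /\ forall y, nrm (f y) <= C * w y.

Definition wnorm f : R := inf [set C | wbound f C].

Lemma wnorm_le f y : (exists C, wbound f C) -> nrm (f y) <= wnorm f * w y.
Proof.
move=> [C hC]; have [y0|y0] := eqVneq (w y) 0.
  by rewrite y0 mulr0 -(mulr0 C) -y0 hC.2.
have yp : 0 < w y by rewrite lt_def y0 w0.
rewrite -ler_pdivrMr //; apply: lb_le_inf; first by exists C.
by move=> D [D0 hD]; rewrite ler_pdivrMr.
Qed.

Lemma wnorm_min f C : wbound f C -> wnorm f <= C.
Proof. by move=> hC; apply: ge_inf => //; exists 0 => D []. Qed.

Lemma wnorm_ge0 f : 0 <= wnorm f.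
Proof.
have [[C hC]|nb] := pselect (exists C, wbound f C).
  by apply: lb_le_inf; [exists C | move=> D []].
rewrite /wnorm (_ : [set C | _] = set0) ?inf0 //.
by rewrite predeqE => C; split=> // hC; apply: nb; exists C.
Qed.

Lemma wbound_lin c f g C D : wbound f C -> wbound g D ->
  wbound (fun y => c *: f y + g y) (cabs c * C + D).
Proof.
move=> [C0 hC] [D0 hD]; split=> [|y].
  by rewrite addr_ge0 // mulr_ge0 ?cabs_ge0.
rewrite mulrDl -mulrA; apply: le_trans (nrmD _ _) _; rewrite nrmZ.
by rewrite lerD // ler_wpM2l ?cabs_ge0.
Qed.

Lemma wnormD f g : (exists C, wbound f C) -> (exists C, wbound g C) ->
  wnorm (fun y => f y + g y) <= wnorm f + wnorm g.
Proof.
move=> bf bg; apply: wnorm_min; split; first by rewrite addr_ge0 ?wnorm_ge0.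
by move=> y; rewrite mulrDl (le_trans (nrmD _ _)) // lerD // wnorm_le.
Qed.

Lemma wnormZ c f : (exists C, wbound f C) ->
  wnorm (fun y => c *: f y) = cabs c * wnorm f.
Proof.
move=> bf; apply/eqP; rewrite eq_le; apply/andP; split.
  apply: wnorm_min; split; first by rewrite mulr_ge0 ?cabs_ge0 ?wnorm_ge0.
  by move=> y; rewrite nrmZ -mulrA ler_wpM2l ?cabs_ge0 ?wnorm_le.
have [->|c0] := eqVneq c 0; first by rewrite cabs0 mul0r wnorm_ge0.
have cp : 0 < cabs c.
  by rewrite lt_def cabs_ge0 andbT; apply: contra_neq c0 => /cabs0_eq0.
rewrite mulrC -ler_pdivlMr //; apply: wnorm_min; split.
  by rewrite divr_ge0 ?wnorm_ge0 ?cabs_ge0.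
move=> y; rewrite mulrAC ler_pdivlMr // mulrC -nrmZ.
apply: (wnorm_le (f := fun y => c *: f y)).
have [C hC] := bf; exists (cabs c * C); split.
  by rewrite mulr_ge0 ?cabs_ge0 ?hC.1.
by move=> z; rewrite nrmZ -mulrA ler_wpM2l ?cabs_ge0 ?hC.2.
Qed.

Lemma wnorm_eq0 f y : (exists C, wbound f C) -> wnorm f = 0 -> f y = 0.
Proof.
move=> bf f0; apply: nrm0_eq0; apply/eqP.
by rewrite eq_le nrm_ge0 andbT; have := wnorm_le y bf; rewrite f0 mul0r.
Qed.

Hypothesis W_complete : forall u : nat -> W,
  cauchy_for (@nrm R W) u -> exists l, cvg_for (@nrm R W) u l.

Lemma wnorm_complete (u : nat -> Y -> W) :
  (forall t : R, 0 < t -> exists k, forall m n y, (k <= m)%N -> (k <= n)%N ->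
    nrm (u m y - u n y) <= t * w y) ->
  exists l, forall t : R, 0 < t -> exists k, forall n y, (k <= n)%N ->
    nrm (u n y - l y) <= t * w y.
Proof.
move=> hu; have ex y : exists ly, cvg_for (@nrm R W) (u ^~ y) ly.
  apply: W_complete => t t0.
  have c0 : 0 < w y + 1 by rewrite ltr_wpDl.
  have [k hk] := hu _ (divr_gt0 t0 c0); exists k => m n km kn.
  apply: le_lt_trans (hk m n y km kn) _.
  by rewrite mulrAC ltr_pdivrMr // ltr_pM2l // ltrDl.
have [l hl] := choice ex; exists l => t t0.
have [k hk] := hu t t0; exists k => n y kn.
apply/ler_addgt0Pr => r r0; have [k' hk'] := hl y r r0.
have h1 := hk' _ (leq_maxr k k').
have h2 := hk n _ y kn (leq_maxl k k').
by have := nrm_tri (u (maxn k k') y) (u n y) (l y); lra.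
Qed.

End WeightedSupNorm.

Section ComplexComplete.
Variable R : realType.

Lemma Re_cabs (c : R[i]) : `|complex.Re c| <= cabs c.
Proof.
by case: c => a b; rewrite /cabs normc_def /= -sqrtr_sqr ler_wsqrtr // lerDl sqr_ge0.
Qed.

Lemma Im_cabs (c : R[i]) : `|complex.Im c| <= cabs c.
Proof.
by case: c => a b; rewrite /cabs normc_def /= -sqrtr_sqr ler_wsqrtr // lerDr sqr_ge0.
Qed.

Lemma cabs_ReIm (c : R[i]) : cabs c <= `|complex.Re c| + `|complex.Im c|.
Proof.
case: c => a b; rewrite /cabs normc_def /=.
rewrite -[leRHS]ger0_norm ?addr_ge0 // -sqrtr_sqr ler_wsqrtr //.
rewrite sqrrD !real_normK ?num_real //.
by have := mulr_ge0 (normr_ge0 a) (normr_ge0 b); lra.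
Qed.

Lemma real_seq_complete (u : nat -> R) :
  (forall t : R, 0 < t -> exists k, forall m n, (k <= m)%N -> (k <= n)%N ->
    `|u m - u n| < t) ->
  exists l, forall t : R, 0 < t -> exists k, forall n, (k <= n)%N -> `|u n - l| < t.
Proof.
move=> cu; have : cvg (u @ \oo).
  apply: cauchy_cvg; apply/cauchyP => t t0.
  have [k hk] := cu _ t0; exists (u k).
  by exists k => // n /= kn; rewrite -ball_normE /ball_ /= hk.
move=> /cvg_ex[l /cvgrPdist_lt hl]; exists l => t /hl[k _ hk].
by exists k => n kn; rewrite distrC; exact: hk.
Qed.

Lemma complex_seq_complete (u : nat -> R[i]^o) :
  cauchy_for (@nrm R _) u -> exists l, cvg_for (@nrm R _) u l.
Proof.
move=> cu.
have [a ha] : exists l, forall t : R, 0 < t -> exists k, forall n, (k <= n)%N ->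
    `|complex.Re (u n) - l| < t.
  apply: real_seq_complete => t /cu[k hk]; exists k => m n km kn.
  by rewrite -raddfB; apply: le_lt_trans (Re_cabs _) (hk m n km kn).
have [b hb] : exists l, forall t : R, 0 < t -> exists k, forall n, (k <= n)%N ->
    `|complex.Im (u n) - l| < t.
  apply: real_seq_complete => t /cu[k hk]; exists k => m n km kn.
  by rewrite -raddfB; apply: le_lt_trans (Im_cabs _) (hk m n km kn).
exists (Complex a b) => t t0.
have [k hk] := ha _ (divr_gt0 t0 (ltr0n _ 2)).
have [k' hk'] := hb _ (divr_gt0 t0 (ltr0n _ 2)).
exists (maxn k k') => n; rewrite geq_max => /andP[/hk h1 /hk' h2].
apply: le_lt_trans (cabs_ReIm _) _; rewrite !raddfB /=; lra.
Qed.

End ComplexComplete.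

(** * Square roots and positivity *)

Section CstarBasics.
Variables (R : realType) (A : cstar R).
Implicit Types (x y z : A) (c : R[i]).

Lemma cmulNl x y : cmul (- x) y = - cmul x y.
Proof. by rewrite -scaleN1r cmulZl scaleN1r. Qed.

Lemma cmulNr x y : cmul x (- y) = - cmul x y.
Proof. by rewrite -scaleN1r cmulZr scaleN1r. Qed.

Lemma cmulBl x y z : cmul (x - y) z = cmul x z - cmul y z.
Proof. by rewrite cmulDl cmulNl. Qed.

Lemma cmulBr x y z : cmul x (y - z) = cmul x y - cmul x z.
Proof. by rewrite cmulDr cmulNr. Qed.

Lemma cmul_suml (I : Type) (r : seq I) (P : pred I) (F : I -> A) y :
  cmul (\sum_(i <- r | P i) F i) y = \sum_(i <- r | P i) cmul (F i) y.
Proof.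
by apply: (big_morph (fun x => cmul x y)) => [a b|]; rewrite ?cmulDl ?cmul0l.
Qed.

Lemma cmul_sumr (I : Type) (r : seq I) (P : pred I) (F : I -> A) y :
  cmul y (\sum_(i <- r | P i) F i) = \sum_(i <- r | P i) cmul y (F i).
Proof. by apply: (big_morph (cmul y)) => [a b|]; rewrite ?cmulDr ?cmul0r. Qed.

Lemma cadj0 : cadj (0 : A) = 0.
Proof.
by have := cadj_antilin (-1) (0 : A) 0; rewrite rmorphN1 !scaleN1r oppr0 addr0 addNr.
Qed.

Lemma cadjD x y : cadj (x + y) = cadj x + cadj y.
Proof. by have := cadj_antilin 1 x y; rewrite rmorph1 !scale1r. Qed.

Lemma cadjZ c x : cadj (c *: x) = c^* *: cadj x.
Proof. by have := cadj_antilin c x 0; rewrite cadj0 !addr0. Qed.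

Lemma cadjN x : cadj (- x) = - cadj x.
Proof. by rewrite -scaleN1r cadjZ rmorphN1 scaleN1r. Qed.

Lemma cadjB x y : cadj (x - y) = cadj x - cadj y.
Proof. by rewrite cadjD cadjN. Qed.

Lemma cadj_sum (I : Type) (r : seq I) (P : pred I) (F : I -> A) :
  cadj (\sum_(i <- r | P i) F i) = \sum_(i <- r | P i) cadj (F i).
Proof. by apply: big_morph; [exact: cadjD | exact: cadj0]. Qed.

Lemma cadjZr (r : R) x : cadj (r%:C *: x) = r%:C *: cadj x.
Proof. by rewrite cadjZ conj_Creal // complex_real. Qed.

Lemma nrmM x y : nrm (cmul x y) <= nrm x * nrm y.
Proof. by rewrite -lecR rmorphM /= -!nrmE cnormM. Qed.

Lemma nrm_cstar x : nrm (cmul (cadj x) x) = nrm x ^+ 2.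
Proof. by apply: complexI; rewrite rmorphXn /= -!nrmE cnorm_cstar. Qed.

Lemma nrm_adj x : nrm (cadj x) = nrm x.
Proof.
have le y : nrm y <= nrm (cadj y).
  have [/eqP y0|] := boolP (nrm y == 0); first by rewrite y0 nrm_ge0.
  move=> y0; have ypos : 0 < nrm y by rewrite lt_def y0 nrm_ge0.
  by have := nrmM (cadj y) y; rewrite nrm_cstar expr2 ler_pM2r.
by apply/eqP; rewrite eq_le le andbT -{2}(cadjK x) le.
Qed.

Lemma nrm_cstarV x : nrm (cmul x (cadj x)) = nrm x ^+ 2.
Proof. by rewrite -{1}(cadjK x) nrm_cstar nrm_adj. Qed.

Lemma nrm_sa_sqr x : cadj x = x -> nrm (cmul x x) = nrm x ^+ 2.
Proof. by move=> sx; rewrite -{1}sx nrm_cstar. Qed.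

Lemma cmul_eq0 x : (forall y, cmul x y = 0) -> x = 0.
Proof.
move=> x0; apply: nrm0_eq0; apply/eqP; rewrite -sqrf_eq0.
by rewrite -nrm_cstarV x0 nrm0.
Qed.

Lemma cmul_eq0r x : (forall y, cmul y x = 0) -> x = 0.
Proof.
move=> x0; apply: nrm0_eq0; apply/eqP; rewrite -sqrf_eq0.
by rewrite -nrm_cstar x0 nrm0.
Qed.

Lemma cmul_inj x x' : (forall y, cmul x y = cmul x' y) -> x = x'.
Proof.
move=> xx; apply/eqP; rewrite -subr_eq0; apply/eqP/cmul_eq0 => y.
by rewrite cmulBl xx subrr.
Qed.

Lemma cmul_injr x x' : (forall y, cmul y x = cmul y x') -> x = x'.
Proof.
move=> xx; apply/eqP; rewrite -subr_eq0; apply/eqP/cmul_eq0r => y.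
by rewrite cmulBr xx subrr.
Qed.

End CstarBasics.

(** * Deciding identities in noncommutative algebras *)

Section NonCommutativeNormalization.
Variables (R : realType) (U : cstar R) (e : U).
Hypothesis e1 : forall x, cmul e x = x /\ cmul x e = x.

Inductive nc_expr :=
  | NVar of nat | NZero | NOne | NAdd of nc_expr & nc_expr | NOpp of nc_expr
  | NMul of nc_expr & nc_expr | NScale of R[i] & nc_expr.

Variable env : seq U.

Fixpoint nc_lookup (l : seq U) n : U :=
  match l, n with
  | [::], _ => 0
  | x :: _, 0%N => x
  | _ :: l', n'.+1 => nc_lookup l' n'
  end.

Fixpoint nc_eval (t : nc_expr) : U :=
  match t with
  | NVar n => nc_lookup env n
  | NZero => 0
  | NOne => e
  | NAdd a b => nc_eval a + nc_eval b
  | NOpp a => - nc_eval a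
  | NMul a b => cmul (nc_eval a) (nc_eval b)
  | NScale c a => c *: nc_eval a
  end.

Definition nc_poly := seq (R[i] * seq nat).

Fixpoint nc_mono (m : seq nat) : U :=
  if m is n :: m' then cmul (nc_lookup env n) (nc_mono m') else e.

Fixpoint nc_peval (p : nc_poly) : U :=
  if p is (c, m) :: p' then c *: nc_mono m + nc_peval p' else 0.

(** List operations and comparisons are duplicated so that [nc_compute] unfolds exactly these names
    and leaves coefficients and atoms as they were written. *)
Fixpoint nc_cat (T : Type) (s t : seq T) : seq T :=
  if s is x :: s' then x :: nc_cat s' t else t.

Fixpoint nc_scale (c : R[i]) (p : nc_poly) : nc_poly :=
  if p is (c', m) :: p' then (c * c', m) :: nc_scale c p' else [::].

Fixpoint nc_mul1 (c : R[i]) (m : seq nat) (p : nc_poly) : nc_poly :=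
  if p is (c', m') :: p' then (c * c', nc_cat m m') :: nc_mul1 c m p' else [::].

Fixpoint nc_mul (p q : nc_poly) : nc_poly :=
  if p is (c, m) :: p' then nc_cat (nc_mul1 c m q) (nc_mul p' q) else [::].

Fixpoint nc_nf (t : nc_expr) : nc_poly :=
  match t with
  | NVar n => [:: (1, [:: n])]
  | NZero => [::]
  | NOne => [:: (1, [::])]
  | NAdd a b => nc_cat (nc_nf a) (nc_nf b)
  | NOpp a => nc_scale (-1) (nc_nf a)
  | NMul a b => nc_mul (nc_nf a) (nc_nf b)
  | NScale c a => nc_scale c (nc_nf a)
  end.

Fixpoint nc_eqn (m n : nat) : bool :=
  match m, n with
  | 0%N, 0%N => true | m'.+1, n'.+1 => nc_eqn m' n' | _, _ => false end.

Fixpoint nc_leq (m n : nat) : bool :=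
  match m, n with
  | 0%N, _ => true | m'.+1, n'.+1 => nc_leq m' n' | _, _ => false end.

Fixpoint nc_eqs (s t : seq nat) : bool :=
  match s, t with
  | [::], [::] => true
  | x :: s', y :: t' => if nc_eqn x y then nc_eqs s' t' else false
  | _, _ => false end.

Fixpoint nc_insert (c : R[i]) (m : seq nat) (p : nc_poly) : nc_poly :=
  if p is (c', m') :: p' then
    if nc_eqs m m' then (c + c', m) :: p' else (c', m') :: nc_insert c m p'
  else [:: (c, m)].

Fixpoint nc_collect (p : nc_poly) : nc_poly :=
  if p is (c, m) :: p' then nc_insert c m (nc_collect p') else [::].

Fixpoint nc_ins (n : nat) (m : seq nat) : seq nat :=
  if m is k :: m' then if nc_leq n k then n :: m else k :: nc_ins n m'
  else [:: n].

Fixpoint nc_sort (m : seq nat) : seq nat :=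
  if m is n :: m' then nc_ins n (nc_sort m') else [::].

Fixpoint nc_sortp (p : nc_poly) : nc_poly :=
  if p is (c, m) :: p' then (c, nc_sort m) :: nc_sortp p' else [::].

(** Coefficients are arbitrary scalar terms, so their vanishing is not computed but left as
    equations, to be closed by [ring]. *)
Fixpoint nc_zero (p : nc_poly) : Prop :=
  if p is (c, _) :: p' then c = 0 /\ nc_zero p' else True.

Lemma nc_peval_cat p q : nc_peval (nc_cat p q) = nc_peval p + nc_peval q.
Proof. by elim: p => [|[c m] p IH] /=; rewrite ?add0r // IH addrA. Qed.

Lemma nc_mono_cat m m' : nc_mono (nc_cat m m') = cmul (nc_mono m) (nc_mono m').
Proof.
by elim: m => [|n m IH] /=; [rewrite (e1 _).1 | rewrite IH cmulA].
Qed.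

Lemma nc_peval_scale c p : nc_peval (nc_scale c p) = c *: nc_peval p.
Proof.
by elim: p => [|[c' m] p IH] /=; rewrite ?scaler0 // IH scalerDr scalerA.
Qed.

Lemma nc_peval_mul1 c m p :
  nc_peval (nc_mul1 c m p) = cmul (c *: nc_mono m) (nc_peval p).
Proof.
elim: p => [|[c' m'] p IH] /=; first by rewrite cmul0r.
by rewrite IH nc_mono_cat cmulDr cmulZr !cmulZl scalerA mulrC.
Qed.

Lemma nc_peval_mul p q :
  nc_peval (nc_mul p q) = cmul (nc_peval p) (nc_peval q).
Proof.
elim: p => [|[c m] p IH] /=; first by rewrite cmul0l.
by rewrite nc_peval_cat IH nc_peval_mul1 cmulDl.
Qed.

Lemma nc_nfE t : nc_eval t = nc_peval (nc_nf t).
Proof.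
elim: t => /= [n||| a -> b -> | a -> | a -> b -> | c a ->].
- by rewrite scale1r addr0 (e1 _).2.
- by [].
- by rewrite scale1r addr0.
- by rewrite nc_peval_cat.
- by rewrite nc_peval_scale scaleN1r.
- by rewrite nc_peval_mul.
- by rewrite nc_peval_scale.
Qed.

Lemma nc_eqnP m n : nc_eqn m n -> m = n.
Proof. by elim: m n => [|m IH] [|n] //= /IH ->. Qed.

Lemma nc_eqsP s t : nc_eqs s t -> s = t.
Proof.
elim: s t => [|x s IH] [|y t] //=.
by case: ifP => // /nc_eqnP -> /IH ->.
Qed.

Lemma nc_peval_collect p : nc_peval (nc_collect p) = nc_peval p.
Proof.
have ins c m q : nc_peval (nc_insert c m q) = c *: nc_mono m + nc_peval q.
  elim: q => [|[c' m'] q IH] //=; case: ifP => [/nc_eqsP ->|_] /=.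
    by rewrite scalerDl addrA.
  by rewrite IH addrCA.
by elim: p => [|[c m] p IH] //=; rewrite ins IH.
Qed.

Lemma nc_peval_zero p : nc_zero p -> nc_peval p = 0.
Proof.
by elim: p => [|[c m] p IH] //= [-> /IH ->]; rewrite scale0r addr0.
Qed.

Lemma nc_correct a b :
  nc_zero (nc_collect (nc_nf (NAdd a (NOpp b)))) -> nc_eval a = nc_eval b.
Proof.
move=> /nc_peval_zero; rewrite nc_peval_collect -nc_nfE /=.
by move=> /eqP; rewrite subr_eq0 => /eqP.
Qed.

Fixpoint nc_commuting (l : seq U) : Prop :=
  if l is x :: l' then
    (fix all_comm (k : seq U) : Prop :=
      if k is y :: k' then cmul x y = cmul y x /\ all_comm k' else True) l'
    /\ nc_commuting l'
  else True.

Lemma nc_commutingP : nc_commuting env -> forall m n,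
  cmul (nc_lookup env m) (nc_lookup env n) =
  cmul (nc_lookup env n) (nc_lookup env m).
Proof.
elim: env => [|x l IH] /=; first by move=> _ [|m] [|n] /=; rewrite !cmul0l ?cmul0r.
move=> [hx /IH {}IH].
have hxl n : cmul x (nc_lookup l n) = cmul (nc_lookup l n) x.
  elim: l n hx {IH} => [|y l IHl] [|n] /=; rewrite ?cmul0l ?cmul0r //.
    by case.
  by case=> _ /IHl.
by case=> [|m] [|n] //=.
Qed.

Lemma nc_correct_comm a b : nc_commuting env ->
  nc_zero (nc_collect (nc_sortp (nc_nf (NAdd a (NOpp b))))) ->
  nc_eval a = nc_eval b.
Proof.
move=> /nc_commutingP comm.
have ins n m : nc_mono (nc_ins n m) = cmul (nc_lookup env n) (nc_mono m).
  elim: m => [|k m IH] //=; case: ifP => //= _.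
  by rewrite IH !cmulA comm.
have sorted m : nc_mono (nc_sort m) = nc_mono m.
  by elim: m => [|n m IH] //=; rewrite ins IH.
have sortedp p : nc_peval (nc_sortp p) = nc_peval p.
  by elim: p => [|[c m] p IH] //=; rewrite sorted IH.
move=> /nc_peval_zero; rewrite nc_peval_collect sortedp -nc_nfE /=.
by move=> /eqP; rewrite subr_eq0 => /eqP.
Qed.

End NonCommutativeNormalization.

Ltac nc_index x l k :=
  lazymatch l with
  | x :: _ => k O
  | _ :: ?l' => nc_index x l' ltac:(fun n => k (S n))
  end.

Ltac nc_mem x l yes no :=
  lazymatch l with
  | nil => no tt
  | x :: _ => yes tt
  | _ :: ?l' => nc_mem x l' yes no
  end.

Ltac nc_vars e t l k :=
  lazymatch t with
  | GRing.zero => k l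
  | e => k l
  | GRing.add ?a ?b => nc_vars e a l ltac:(fun l1 => nc_vars e b l1 k)
  | GRing.opp ?a => nc_vars e a l k
  | cmul ?a ?b => nc_vars e a l ltac:(fun l1 => nc_vars e b l1 k)
  | GRing.scale _ ?a => nc_vars e a l k
  | ?x => nc_mem x l ltac:(fun _ => k l) ltac:(fun _ => k constr:(x :: l))
  end.

Ltac nc_reify R e l t k :=
  lazymatch t with
  | GRing.zero => k constr:(@NZero R)
  | e => k constr:(@NOne R)
  | GRing.add ?a ?b =>
      nc_reify R e l a ltac:(fun a' => nc_reify R e l b ltac:(fun b' =>
        k constr:(NAdd a' b')))
  | GRing.opp ?a => nc_reify R e l a ltac:(fun a' => k constr:(NOpp a'))
  | cmul ?a ?b =>
      nc_reify R e l a ltac:(fun a' => nc_reify R e l b ltac:(fun b' =>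
        k constr:(NMul a' b')))
  | GRing.scale ?c ?a =>
      nc_reify R e l a ltac:(fun a' => k constr:(NScale (R:=R) c a'))
  | ?x => nc_index x l ltac:(fun n => k constr:(@NVar R n))
  end.

Ltac nc_compute :=
  cbv [nc_commuting nc_zero nc_collect nc_insert nc_nf nc_cat nc_scale nc_mul1
       nc_mul nc_eqn nc_leq nc_eqs nc_ins nc_sort nc_sortp].

Ltac nc_setup e1 corr :=
  lazymatch type of e1 with
  | forall x : ?T, @cmul ?R ?U ?e x = x /\ _ =>
    lazymatch goal with
    | |- ?a = ?b =>
        nc_vars e a (@nil T) ltac:(fun l1 => nc_vars e b l1 ltac:(fun l =>
          nc_reify R e l a ltac:(fun a' => nc_reify R e l b ltac:(fun b' =>
            change (@nc_eval R U e l a' = @nc_eval R U e l b');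
            apply: (@corr R U e e1 l a' b')))))
    end
  end.

Ltac nc_split := lazymatch goal with
  | |- _ /\ _ => split; [nc_split | nc_split]
  | |- True => exact I
  | _ => idtac
  end.

(* Equalities in the free unital algebra on the maximal non-algebraic
   subterms, resp. in the free commutative one. *)
Ltac nc e1 := nc_setup e1 nc_correct; nc_compute; nc_split.
Ltac ncc e1 := nc_setup e1 nc_correct_comm; nc_compute; nc_split; try done.

Section RealLemmas.
Variable R : realType.

Lemma le_eps (C a b : R) : 0 <= C ->
  (forall t : R, 0 < t -> t <= 1 -> a <= b + C * t) -> a <= b.
Proof.
move=> C0 h; rewrite leNgt; apply/negP => ba.
have C1 : 0 < C + 1 by rewrite ltr_wpDl.
pose t := Num.min 1 ((a - b) / 2 / (C + 1)).
have t0 : 0 < t by rewrite lt_min ltr01 !divr_gt0 // subr_gt0.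
have := h t t0; rewrite ge_min lexx => /(_ isT) h1.
have : C * t <= (C + 1) * ((a - b) / 2 / (C + 1)).
  by rewrite ler_pM ?(ltW t0) // ?lerDl // /t ge_min lexx orbT.
rewrite [X in _ <= X]mulrC divfK ?gt_eqF // => h2; lra.
Qed.

Lemma geom_small (q : R) : 0 <= q -> q < 1 ->
  forall t, 0 < t -> exists k, forall n, (k <= n)%N -> q ^+ n < t.
Proof.
move=> q0 q1 t t0.
have /cvgr0Pnorm_lt /(_ t t0)[k _ hk] : (q ^+ n)%R @[n --> \oo] --> (0 : R).
  by apply: cvg_expr; rewrite ger0_norm.
by exists k => n kn; have := hk n kn; rewrite ger0_norm // exprn_ge0.
Qed.

(** Exponential growth of [r ^+ n] beats a linear bound. The exponents are powers of 2 because
    repeated squaring gives [|x^n| = |x|^n] for self-adjoint [x] precisely at these [n]. *)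
Lemma le1_of_pow2_linear (r c : R) : 0 <= r -> 0 <= c ->
  (forall j, r ^+ (2 ^ j) <= 1 + (2 ^ j)%:R * c) -> r <= 1.
Proof.
move=> r0 c0 h; rewrite leNgt; apply/negP => r1.
have bern n : 1 + n%:R * (r - 1) <= r ^+ n.
  elim: n => [|n IH]; first by rewrite mul0r addr0 expr0.
  rewrite exprS -natr1; apply: le_trans (_ : r * (1 + n%:R * (r - 1)) <= _).
    have : 0 <= n%:R * (r - 1) ^+ 2 by rewrite mulr_ge0 // sqr_ge0.
    by set m : R := n%:R; nra.
  by rewrite ler_wpM2l.
have d0 : 0 < r - 1 by rewrite subr_gt0.
(* With [n = 2 ^ j] and [d = r - 1], squaring Bernoulli's [1 + n d <= r^n] yields
   [(1 + n d)^2 <= 1 + 2 n c], hence [n d^2 < 2 c], which this [j] excludes. *)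
pose j := Num.truncn (2 * c / (r - 1) ^+ 2).
have hj : 2 * c / (r - 1) ^+ 2 < (2 ^ j)%:R.
  by rewrite (lt_le_trans (truncnS_gt _)) // ler_nat ltn_expl.
have := h j.+1; rewrite expnS mul2n -addnn exprD natrD.
have := bern (2 ^ j)%N; move: hj; set n : R := (2 ^ j)%:R => hj h1 h2.
have n0 : 0 < n.
  by apply: le_lt_trans hj; apply: divr_ge0; [exact: mulr_ge0|exact: sqr_ge0].
have h3 : (1 + n * (r - 1)) * (1 + n * (r - 1)) <= 1 + (n + n) * c.
  apply: le_trans h2; rewrite ler_pM //; nra.
rewrite ltr_pdivrMr ?exprn_gt0 // in hj.
by rewrite expr2 in hj; nra.
Qed.

End RealLemmas.

Section FixedPoint.
Variables (R : realType) (V : completeNormedModType R[i]).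

Lemma contraction_fixpoint (D : set V) (F : V -> V) (q : R) (x0 : V) :
  0 <= q -> q < 1 -> D x0 -> (forall x, D x -> D (F x)) ->
  (forall x y, D x -> D y -> nrm (F x - F y) <= q * nrm (x - y)) ->
  (forall x, (forall t : R, 0 < t -> exists2 y, D y & nrm (x - y) < t) -> D x) ->
  exists2 x, D x & F x = x.
Proof.
move=> q0 q1 Dx0 DF Fq Dc.
pose u n := iter n F x0.
have Du n : D (u n) by elim: n => [|n IH] //=; exact: DF.
pose c := nrm (u 1%N - u 0%N).
have c0 : 0 <= c := nrm_ge0 _.
have step n : nrm (u n.+1 - u n) <= q ^+ n * c.
  elim: n => [|n IH]; first by rewrite mul1r.
  rewrite exprS -mulrA; apply: (le_trans (Fq (u n.+1) (u n) (Du _) (Du _))).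
  by rewrite ler_wpM2l.
have q1' : 0 < 1 - q by rewrite subr_gt0.
have tail n k : nrm (u (n + k)%N - u n) <= q ^+ n * c / (1 - q).
  suff : nrm (u (n + k)%N - u n) * (1 - q) <= q ^+ n * c - q ^+ (n + k) * c.
    rewrite -ler_pdivlMr // => /le_trans; apply.
    by rewrite ler_wpM2r ?invr_ge0 ?(ltW q1') // gerBl mulr_ge0 ?exprn_ge0.
  elim: k => [|k IH]; first by rewrite addn0 subrr nrm0 mul0r subrr.
  rewrite addnS exprS; have h1 := nrm_tri (u (n + k)%N) (u (n + k).+1) (u n).
  have h2 := step (n + k)%N; move: IH h1 h2.
  move: (nrm _) (nrm _) (nrm _) => a1 a2 a3; set X := _ ^+ (n + k); nra.
have small t : 0 < t -> exists k, forall n, (k <= n)%N -> q ^+ n * c / (1 - q) < t.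
  move=> t0; have c1 : 0 < c + 1 by rewrite ltr_wpDl.
  have [k hk] := geom_small q0 q1 (divr_gt0 (mulr_gt0 t0 q1') c1).
  exists k => n /hk; rewrite ltr_pdivlMr // ltr_pdivrMr // => h.
  by apply: le_lt_trans h; rewrite ler_wpM2l ?exprn_ge0 // lerDl.
have [l hl] : exists l, cvg_for (@nrm R V) u l.
  apply: nrm_cauchy_cvg => t t0.
  have [k hk] := small _ (divr_gt0 t0 (ltr0n _ 2)).
  exists k => m n km kn.
  have h (i : nat) : (k <= i)%N -> nrm (u i - u k) < t / 2.
    by move=> ki; rewrite -(subnKC ki); apply: le_lt_trans (tail _ _) (hk _ _).
  have := nrm_tri (u k) (u m) (u n); rewrite (nrm_distC (u k) (u n)).
  by have := h m km; have := h n kn; lra.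
have Dl : D l.
  apply: Dc => t t0; have [k hk] := hl t t0.
  by exists (u k) => //; rewrite nrm_distC hk.
exists l => //; apply/eqP; rewrite -subr_eq0; apply/eqP/nrm_eps => t t0.
have [k hk] := hl _ (divr_gt0 t0 (ltr0n _ 2)).
have h1 := hk k (leqnn _); have h2 := hk k.+1 (leqnSn _).
have h3 := nrm_tri (u k.+1) (F l) l; have h4 := Fq _ _ Dl (Du k).
have h5 : q * nrm (l - u k) <= nrm (l - u k) by rewrite ler_piMl ?nrm_ge0 ?ltW.
by rewrite (nrm_distC l) in h4 h5; move: h1 h2 h3 h4 h5 => /=; lra.
Qed.

End FixedPoint.

Section SquareRoot.
Variables (R : realType) (A : cstar R).

(* A quasi-square root: formally [1 - h = (1 - k)^2].  The map
   [k |-> (h + k^2) / 2] is a contraction of the ball of radius [nrm h]. *)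
Lemma quasi_sqrt (h : A) : cadj h = h -> nrm h < 1 -> exists k : A,
  [/\ cadj k = k, nrm k <= nrm h, h = k + k - cmul k k &
      forall x, cmul h x = cmul x h -> cmul k x = cmul x k].
Proof.
move=> sh h1; set q := nrm h; have q0 : 0 <= q := nrm_ge0 _.
pose D := [set k : A | [/\ cadj k = k, nrm k <= q &
  forall x, cmul h x = cmul x h -> cmul k x = cmul x k]].
pose F (k : A) := (2^-1 : R)%:C *: (h + cmul k k).
have half0 : 0 <= (2^-1 : R) by rewrite invr_ge0.
have [k [sk kq ck] Fk] : exists2 k, D k & F k = k.
  apply: (@contraction_fixpoint R A D F q 0) => //.
  - split; rewrite ?cadj0 ?nrm0 // => x _; by rewrite cmul0l cmul0r.
  - move=> k [sk kq ck]; split.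
    + by rewrite /F cadjZr cadjD cadjM sh sk.
    + rewrite /F nrmZr //; have := nrmD h (cmul k k); have := nrmM k k.
      have := nrm_ge0 k; rewrite -/q; nra.
    + move=> x hx; rewrite /F cmulZl cmulZr cmulDl cmulDr hx; congr (_ *: (_ + _)).
      by rewrite -cmulA (ck x) // cmulA (ck x) // -cmulA.
  - move=> x y [sx xq _] [sy yq _]; rewrite /F -scalerBr nrmZr //.
    rewrite opprD addrACA subrr add0r.
    have -> : cmul x x - cmul y y = cmul x (x - y) + cmul (x - y) y.
      by rewrite cmulBr cmulBl addrA subrK.
    have := nrmD (cmul x (x - y)) (cmul (x - y) y).
    have := nrmM x (x - y); have := nrmM (x - y) y.
    have : nrm x * nrm (x - y) <= q * nrm (x - y) by rewrite ler_wpM2r ?nrm_ge0.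
    have : nrm (x - y) * nrm y <= nrm (x - y) * q by rewrite ler_wpM2l ?nrm_ge0.
    lra.
  - move=> x hx; split.
    + apply/eqP; rewrite -subr_eq0; apply/eqP/nrm_eps => t t0.
      have [y [sy _ _] xy] := hx _ (divr_gt0 t0 (ltr0n _ 2)).
      have := nrm_tri y (cadj x) x; rewrite -{1}sy -cadjB nrm_adj.
      by rewrite (nrm_distC y); lra.
    + apply/ler_addgt0Pr => t t0; have [y [_ yq _] xy] := hx _ t0.
      by have := nrm_tri y x 0; rewrite !subr0; lra.
    + move=> w hw; apply/eqP; rewrite -subr_eq0; apply/eqP/nrm_eps => t t0.
      have w1 : 0 < 2 * nrm w + 1 by have := nrm_ge0 w; lra.
      have [y [_ _ cy] xy] := hx _ (divr_gt0 t0 w1).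
      have -> : cmul x w - cmul w x = cmul (x - y) w - cmul w (x - y).
        by rewrite cmulBl cmulBr cy // opprB addrA subrK.
      have := nrmB (cmul (x - y) w) (cmul w (x - y)).
      have := nrmM (x - y) w; have := nrmM w (x - y).
      rewrite ltr_pdivlMr // in xy; have := nrm_ge0 (x - y); nra.
exists k; split => //.
have : F k + F k = k + k by rewrite Fk.
rewrite /F -scalerDl -rmorphD /= -[_ + _]/(2^-1 + 2^-1 : R).
rewrite (_ : 2^-1 + 2^-1 = 1 :> R); last by field.
by rewrite scale1r => <-; rewrite addrK.
Qed.

(** [u = a + i b] satisfies [u^* u = a^2 + b^2] by commutativity, and [2 a = u + u^*]. This stands
    in for the order argument [a^2 <= a^2 + b^2]. *)
Lemma nrm_le_add_sqr (a b : A) : cadj a = a -> cadj b = b ->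
  cmul a b = cmul b a -> nrm a ^+ 2 <= nrm (cmul a a + cmul b b).
Proof.
move=> sa sb ab; pose u := a + 'i *: b.
have su : cadj u = a - 'i *: b by rewrite cadjD cadjZ sa sb conjCi scaleNr.
have -> : cmul a a + cmul b b = cmul (cadj u) u.
  rewrite su cmulBl !cmulDr !cmulZl !cmulZr ab opprD addrA addrK.
  by rewrite scalerA -expr2 sqrCi scaleN1r opprK.
rewrite nrm_cstar ler_sqr ?nnegrE ?nrm_ge0 //.
have : (2%:R : R)%:C *: a = u + cadj u.
  by rewrite su /u addrACA subrr addr0 rmorphMn /= scaler_nat mulr2n.
move=> /(congr1 (@nrm R A)); rewrite nrmZr // => h.
by have := nrmD u (cadj u); rewrite nrm_adj -h; lra.
Qed.

End SquareRoot.

Section Positivity.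
Variables (R : realType) (U : cstar R) (e : U).
Hypothesis e1 : forall x, cmul e x = x /\ cmul x e = x.
Implicit Types (a b h s x y z : U) (r t M : R).

Lemma unit_adj : cadj e = e.
Proof.
have := (e1 (cadj e)).2; rewrite -{1 2}(cadjK e) => h.
by have := congr1 (@cadj R U) (e1 (cadj e)).2; rewrite cadjM cadjK (e1 _).2.
Qed.

Lemma nrm_unit_le1 : nrm e <= 1.
Proof.
have := nrm_cstar e; rewrite unit_adj (e1 e).1 expr2.
by have := nrm_ge0 e; nra.
Qed.

Lemma nrm_scalar t : 0 <= t -> nrm (t%:C *: e) <= t.
Proof. by move=> t0; rewrite nrmZr // ler_piMr // nrm_unit_le1. Qed.

(** Positivity without the spectrum: for self-adjoint [h], [|M - h| <= M] says that the spectrum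
    lies in [[0, 2 M]]. Stability under sums is then the triangle inequality. *)
Definition pos h : Prop :=
  cadj h = h /\ exists2 M : R, 0 <= M & nrm (M%:C *: e - h) <= M.

Lemma sa_scalar t : cadj (t%:C *: e) = t%:C *: e.
Proof. by rewrite cadjZr unit_adj. Qed.

Lemma comm_scalar t x : cmul (t%:C *: e) x = cmul x (t%:C *: e).
Proof. by rewrite cmulZl cmulZr (e1 x).1 (e1 x).2. Qed.

Lemma sqrt_near_unit h : cadj h = h -> nrm h < 1 -> exists z,
  [/\ cadj z = z, cmul z z = e - h, nrm (e - z) < 1 &
      forall x, cmul h x = cmul x h -> cmul z x = cmul x z].
Proof.
move=> sh h1; have [k [sk kh hk ck]] := quasi_sqrt sh h1.
exists (e - k); split.
- by rewrite cadjB unit_adj sk.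
- rewrite [in RHS]hk; nc e1; ring.
- by rewrite opprB addrC subrK; apply: le_lt_trans h1.
- by move=> x /ck kx; rewrite cmulBl cmulBr (e1 x).1 (e1 x).2 kx.
Qed.

(** The shift by [t] makes [(M - h) / (M + t)] have norm strictly below 1, as the contraction behind
    the quasi-square root requires. *)
Lemma pos_sqrt h t : pos h -> 0 < t -> exists z,
  [/\ cmul z z = h + t%:C *: e, pos z &
      forall x, cmul h x = cmul x h -> cmul z x = cmul x z].
Proof.
move=> [sh [M M0 hM]] t0; have Mt : 0 < M + t by rewrite ltr_wpDl.
pose c := (M + t)^-1; have c0 : 0 < c by rewrite invr_gt0.
pose g := c%:C *: (M%:C *: e - h).
have [||z [sz zz z1 cz]] := @sqrt_near_unit g.
- by rewrite cadjZr cadjB sa_scalar sh.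
- rewrite nrmZr ?(ltW c0) // mulrC ltr_pdivrMr // mul1r; lra.
pose q := Num.sqrt (M + t); have q0 : 0 < q by rewrite sqrtr_gt0.
have qq : q * q = M + t by rewrite -expr2 sqr_sqrtr // ltW.
exists (q%:C *: z); split.
- rewrite cmulZl cmulZr scalerA -rmorphM qq zz /g /= scalerBr scalerA -rmorphM.
  by rewrite /c mulfV ?gt_eqF // scale1r; nc e1; rewrite ?rmorphD; ring.
- split; first by rewrite cadjZr sz.
  exists q; first exact: ltW.
  by rewrite -scalerBr nrmZr ?(ltW q0) // ler_piMr ?(ltW q0) // ltW.
- move=> x hx; rewrite cmulZl cmulZr cz //.
  rewrite /g cmulZl cmulZr; congr (_ *: _).
  by rewrite cmulBl cmulBr hx comm_scalar.
Qed.

(** [w^2 = (1 - t) s^2] has norm below 1, so [e - w^2 = z^2] with [z] commuting with [w]; then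
    [z^2 + w^2 = e] bounds [|z|^2] by 1. Let [t] tend to 0. *)
Lemma nrm_unit_sub_sqr s : cadj s = s -> nrm s <= 1 -> nrm (e - cmul s s) <= 1.
Proof.
move=> ss s1; apply: (@le_eps R 1) => // t t0 t1.
have tt0 : 0 <= 1 - t by rewrite subr_ge0.
have ss0 : nrm (cmul s s) <= 1 by rewrite nrm_sa_sqr // expr_le1 ?nrm_ge0.
pose h := (1 - t)%:C *: cmul s s.
have sh : cadj h = h by rewrite cadjZr cadjM ss.
have [|z [sz zz _ cz]] := sqrt_near_unit sh.
  rewrite nrmZr //; have := nrm_ge0 (cmul s s); nra.
pose w := (Num.sqrt (1 - t))%:C *: s.
have ww : cmul w w = h.
  by rewrite /w cmulZl cmulZr scalerA -rmorphM -expr2 sqr_sqrtr.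
have zw : cmul z w = cmul w z.
  rewrite /w cmulZl cmulZr cz // /h cmulZl cmulZr; congr (_ *: _).
  by rewrite cmulA.
have sw : cadj w = w by rewrite cadjZr ss.
have := nrm_le_add_sqr sz sw zw; rewrite ww zz subrK => hz.
have h1 : nrm (e - h) <= 1.
  by rewrite -zz nrm_sa_sqr //; apply: le_trans nrm_unit_le1.
have -> : e - cmul s s = (e - h) - t%:C *: cmul s s.
  by rewrite /h; nc e1; rewrite ?rmorphB ?rmorph1; ring.
have := nrmB (e - h) (t%:C *: cmul s s); rewrite nrmZr ?(ltW t0) //.
have := nrm_ge0 (cmul s s); nra.
Qed.

(** The existential constant of [pos] may be traded for any bound of the norm: [h + t] is a square,
    and scaling by [M + t] reduces to [nrm_unit_sub_sqr]. *)
Lemma pos_bound h M : pos h -> nrm h <= M -> nrm (M%:C *: e - h) <= M.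
Proof.
move=> ph hM; have M0 : 0 <= M by apply: le_trans hM; apply: nrm_ge0.
apply: (@le_eps R 1) => // t t0 t1.
have [z [zz [sz _] _]] := pos_sqrt ph t0.
have Mt : 0 < M + t by rewrite ltr_wpDl.
pose q := Num.sqrt (M + t); have q0 : 0 < q by rewrite sqrtr_gt0.
have qq : q * q = M + t by rewrite -expr2 sqr_sqrtr // ltW.
pose s := (q^-1)%:C *: z.
have qi : 0 <= q^-1 by rewrite invr_ge0 ltW.
have ss : cadj s = s by rewrite cadjZr sz.
have s1 : nrm s <= 1.
  rewrite nrmZr // mulrC ler_pdivrMr // mul1r.
  rewrite -(ler_sqr (nrm_ge0 _) (ltW q0)) -nrm_sa_sqr // zz expr2 qq.
  by have := nrmD h (t%:C *: e); have := nrm_scalar (ltW t0); lra.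
have := nrm_unit_sub_sqr ss s1; rewrite mul1r.
have -> : M%:C *: e - h = (M + t)%:C *: (e - cmul s s).
  rewrite /s cmulZl cmulZr scalerA -rmorphM zz scalerBr scalerA -rmorphM /= -qq.
  rewrite (_ : q * q * (q^-1 * q^-1) = 1); last by field; rewrite gt_eqF.
  by rewrite qq scale1r rmorphD scalerDl opprD addrACA subrr addr0.
by rewrite nrmZr ?(ltW Mt) // => h1; rewrite ler_piMr // ltW.
Qed.

Lemma pos0 : pos 0.
Proof. by split; [exact: cadj0 | exists 0 => //; rewrite scale0r subrr nrm0]. Qed.

Lemma posD a b : pos a -> pos b -> pos (a + b).
Proof.
move=> [sa [M M0 hM]] [sb [N N0 hN]]; split; first by rewrite cadjD sa sb.
exists (M + N); first exact: addr_ge0.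
by rewrite rmorphD scalerDl opprD addrACA (le_trans (nrmD _ _)) // lerD.
Qed.

Lemma posZ r a : 0 <= r -> pos a -> pos (r%:C *: a).
Proof.
move=> r0 [sa [M M0 hM]]; split; first by rewrite cadjZr sa.
exists (r * M); first exact: mulr_ge0.
by rewrite rmorphM -scalerA -scalerBr nrmZr // ler_wpM2l.
Qed.

Lemma pos_sqr s : cadj s = s -> pos (cmul s s).
Proof.
move=> ss; split; first by rewrite cadjM ss.
have c0 : 0 < nrm s + 1 by rewrite ltr_wpDl ?nrm_ge0.
set c := nrm s + 1 in c0.
exists (c * c); first by rewrite mulr_ge0 ?ltW.
have ci : 0 <= c^-1 by rewrite invr_ge0 ltW.
have -> : (c * c)%:C *: e - cmul s s =
    (c * c)%:C *: (e - cmul (c^-1%:C *: s) (c^-1%:C *: s)).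
  rewrite cmulZl cmulZr scalerA scalerBr scalerA -!rmorphM.
  by rewrite (_ : c * c * (c^-1 * c^-1) = 1) ?scale1r //; field; rewrite gt_eqF.
rewrite nrmZr ?mulr_ge0 ?(ltW c0) // ler_piMr ?mulr_ge0 ?(ltW c0) //.
apply: nrm_unit_sub_sqr; first by rewrite cadjZr ss.
by rewrite nrmZr // mulrC ler_pdivrMr // mul1r /c lerDl.
Qed.

Lemma pos_scalar_sub a M : cadj a = a -> nrm a <= M -> pos (M%:C *: e - a).
Proof.
move=> sa aM; have M0 : 0 <= M by apply: le_trans aM; apply: nrm_ge0.
split; first by rewrite cadjB sa_scalar sa.
by exists M => //; rewrite opprB addrC subrK.
Qed.

Lemma pos_lim a : cadj a = a ->
  (forall t : R, 0 < t -> exists2 b, pos b & nrm (a - b) <= t) -> pos a.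
Proof.
move=> sa h; split => //; exists (nrm a + 1); first by rewrite addr_ge0 ?nrm_ge0.
apply: (@le_eps R 1) => // t t0 t1; have [b pb ab] := h t t0.
have bM : nrm b <= nrm a + 1.
  by have := nrm_tri a b 0; rewrite !subr0 (nrm_distC b); lra.
have := nrm_tri b ((nrm a + 1)%:C *: e) a.
by have := pos_bound pb bM; rewrite (nrm_distC b); lra.
Qed.

(** [a + d] and [t e - a + d] are squares of commuting self-adjoint elements with sum [(t + 2 d) e],
    so the norm of the first is at most that of the sum. *)
Lemma pos_le a t : 0 <= t -> pos a -> pos (t%:C *: e - a) -> nrm a <= t.
Proof.
move=> t0 pa pb; apply: (@le_eps R 3) => // d d0 _.
have [r [rr [sr _] cr]] := pos_sqrt pa d0.
have [w [ww [sw _] cw]] := pos_sqrt pb d0.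
have rw : cmul r w = cmul w r.
  apply: cr; apply/esym/cw; rewrite cmulBl cmulBr; congr (_ - _).
  exact: comm_scalar.
have := nrm_le_add_sqr sr sw rw; rewrite -nrm_sa_sqr // rr ww.
have -> : a + d%:C *: e + (t%:C *: e - a + d%:C *: e) = (t + 2 * d)%:C *: e.
  by nc e1; rewrite ?rmorphD ?rmorphM ?rmorphMn ?rmorph1; ring.
have tp : 0 <= t + 2 * d by lra.
have := nrm_scalar tp; have := nrm_scalar (ltW d0).
have := nrm_tri (a + d%:C *: e) a 0; rewrite !subr0 opprD addrA subrr add0r nrmN.
lra.
Qed.

(** With [r^2] close to [z] and [r] commuting with [y], [z y^2] is close to the square of the
    self-adjoint [r y]. *)
Lemma pos_conj_comm z y : pos z -> cadj y = y -> cmul z y = cmul y z ->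
  pos (cmul z (cmul y y)).
Proof.
move=> pz sy zy; have [sz _] := pz.
have yyz : cmul z (cmul y y) = cmul (cmul y y) z.
  by rewrite cmulA zy -cmulA zy cmulA.
apply: pos_lim; first by rewrite !cadjM sz sy.
move=> t t0; have c0 : 0 < nrm (cmul y y) + 1 by rewrite ltr_wpDl ?nrm_ge0.
have td := divr_gt0 t0 c0.
have [r [rr [sr _] cr]] := pos_sqrt pz td.
have ry := cr _ zy.
exists (cmul (cmul r y) (cmul r y)); first by apply: pos_sqr; rewrite cadjM sr sy ry.
have -> : cmul z (cmul y y) - cmul (cmul r y) (cmul r y) =
    - ((t / (nrm (cmul y y) + 1))%:C *: cmul y y).
  have -> : cmul (cmul r y) (cmul r y) = cmul (cmul r r) (cmul y y).
    by ncc e1; ring.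
  by rewrite rr; nc e1; ring.
rewrite nrmN nrmZr ?(ltW td) // mulrAC ler_pdivrMr // ler_pM2l //; lra.
Qed.

(** This is [4 g + (1 - g)^2 = (1 + g)^2], where both summands are squares of commuting self-adjoint
    elements once [g] is replaced by [g + t = r^2]. It turns positivity into a lower bound for a
    norm. *)
Lemma pos_nrm_unitD g : pos g -> 4 * nrm g <= nrm (e + g) ^+ 2.
Proof.
move=> pg; have gN := nrm_ge0 (e + g).
apply: (@le_eps R (2 * nrm (e + g) + 5)) => [|t t0 t1]; first by lra.
have [r [rr [sr _] cr]] := pos_sqrt pg t0.
pose a := (2 : R)%:C *: r; pose b := e - cmul r r.
have sa : cadj a = a by rewrite cadjZr sr.
have sb : cadj b = b by rewrite cadjB unit_adj cadjM sr.
have ab : cmul a b = cmul b a by rewrite /a /b; ncc e1; ring.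
have := nrm_le_add_sqr sa sb ab.
have -> : cmul a a + cmul b b = cmul (e + cmul r r) (e + cmul r r).
  rewrite /a /b; ncc e1; rewrite ?rmorphMn ?rmorph1; ring.
rewrite [nrm (cmul _ _)]nrm_sa_sqr; last by rewrite cadjD unit_adj cadjM sr.
rewrite /a nrmZr // exprMn -[nrm r ^+ 2]nrm_sa_sqr // rr addrA.
have := nrmD (e + g) (t%:C *: e).
have := nrm_tri (g + t%:C *: e) g 0; rewrite !subr0 opprD addrA subrr add0r nrmN.
have := nrm_scalar (ltW t0); move: gN.
have := nrm_ge0 (e + g + t%:C *: e).
set A := nrm (e + g); set B := nrm (e + g + _); set C := nrm (g + _).
set D := nrm g; set E := nrm (_ *: e) => h1 h2 h3 h4 h5 h6.
have : B ^+ 2 <= (A + t) ^+ 2 by rewrite ler_sqr ?nnegrE //; lra.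
rewrite sqrrD [t ^+ 2]expr2; nra.
Qed.

End Positivity.

(** * Positivity of [b^* b] *)

Section Kaplansky.
Variables (R : realType) (U : cstar R) (e : U).
Hypothesis e1 : forall x, cmul e x = x /\ cmul x e = x.
Implicit Types (a b h s x y z d : U) (r t M : R).
Local Notation pos := (pos e).

Definition cpow x n : U := iter n (cmul x) e.

Lemma cpow_sa x n : cadj x = x -> cadj (cpow x n) = cpow x n /\
  cmul (cpow x n) x = cmul x (cpow x n).
Proof.
move=> sx; elim: n => [|n [IH1 IH2]] /=.
  by rewrite (unit_adj e1) (e1 x).1 (e1 x).2.
by rewrite cadjM IH1 sx IH2 -cmulA IH2.
Qed.

Lemma cpowD x m n : cpow x (m + n) = cmul (cpow x m) (cpow x n).
Proof. by elim: m => [|m IH] /=; [rewrite (e1 _).1 | rewrite IH cmulA]. Qed.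

Lemma cpow_le1 x n : nrm x <= 1 -> nrm (cpow x n) <= 1.
Proof.
move=> x1; elim: n => [|n IH] /=; first exact: nrm_unit_le1.
by apply: le_trans (nrmM _ _) _; rewrite mulr_ile1 ?nrm_ge0.
Qed.

Lemma cpow_pow2 x j : cadj x = x -> nrm (cpow x (2 ^ j)) = nrm x ^+ (2 ^ j).
Proof.
move=> sx; elim: j => [|j IH]; first by rewrite /= (e1 x).2 expr1.
rewrite expnS mul2n -addnn cpowD nrm_sa_sqr ?(cpow_sa _ sx).1 // IH.
by rewrite exprD expr2.
Qed.

(** Twice the sum equals [x^2 + y^2] for the self-adjoint [x = d + d^*] and [y = i (d - d^* )]. *)
Lemma pos_adj_sum d : pos (cmul d (cadj d) + cmul (cadj d) d).
Proof.
pose x := d + cadj d; pose y := 'i *: (d - cadj d).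
have sx : cadj x = x by rewrite /x cadjD cadjK addrC.
have sy : cadj y = y.
  by rewrite /y cadjZ cadjB cadjK conjCi scaleNr -scalerN opprB.
have -> : cmul d (cadj d) + cmul (cadj d) d =
    (2^-1 : R)%:C *: (cmul x x + cmul y y).
  have -> : cmul y y = - cmul (d - cadj d) (d - cadj d).
    by rewrite /y cmulZl cmulZr scalerA -expr2 sqrCi scaleN1r.
  set w := _ + _; have -> : w = (2^-1 : R)%:C *: ((2 : R)%:C *: w).
    by rewrite scalerA -rmorphM mulVf ?scale1r // pnatr_eq0.
  congr (_ *: _); rewrite /w /x rmorphMn rmorph1; nc e1; ring.
apply: posZ; first by rewrite invr_ge0.
by apply: posD; apply: pos_sqr.
Qed.

(* If [d* d] were essentially [- g] with [g] positive, [d d*] would be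
   positive; then the powers of [W = 1 - (d* d + k) / M] grow at most linearly,
   up to a factor [(1 + k / M)^n], because [d* p(d d* ) d = d* d p(d* d)].
   This bounds [nrm W], which is impossible unless [g] is as small as [k]. *)
Lemma adj_mul_eq_opp_pos d g y t : 0 <= t -> pos g -> cadj y = y ->
  cmul (cadj d) d = - g + t%:C *: y -> nrm g <= 6 * (t * nrm y).
Proof.
move=> t0 pg sy dd; have [sg _] := pg.
set k := t * nrm y; have k0 : 0 <= k by rewrite mulr_ge0 ?nrm_ge0.
rewrite leNgt; apply/negP => gk.
(* [|d d^*| = |d^* d| <= |g| + k], so [M] bounds the norm of [p = d d^* + k]. *)
pose M := nrm g + 2 * k; have M0 : 0 < M by rewrite /M; lra.
pose c := M^-1; have c0 : 0 < c by rewrite invr_gt0.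
pose p := cmul d (cadj d) + k%:C *: e.
(* [d d^*] is the positive [d d^* + d^* d] minus [d^* d = - g + t y]; the summand [k] absorbs
   [t y]. *)
have pp : pos p.
  have -> : p = (cmul d (cadj d) + cmul (cadj d) d) + g
      + (k%:C *: e - t%:C *: y).
    by rewrite dd /p; nc e1; ring.
  apply: posD; first by apply: posD => //; exact: pos_adj_sum.
  apply: pos_scalar_sub => //; first by rewrite cadjZr sy.
  by rewrite nrmZr.
have ndd : nrm (cmul (cadj d) d) <= nrm g + k.
  by rewrite dd (le_trans (nrmD _ _)) // nrmN lerD2l nrmZr.
have pM : nrm p <= M.
  have := nrmD (cmul d (cadj d)) (k%:C *: e); have := nrm_scalar e1 k0.
  by move: ndd; rewrite nrm_cstar nrm_cstarV /M -/p; lra.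
pose V := e - c%:C *: p.
have V1 : nrm V <= 1.
  have -> : V = c%:C *: (M%:C *: e - p).
    by rewrite scalerBr scalerA -rmorphM mulVf ?gt_eqF // scale1r.
  have := pos_bound e1 pp pM; rewrite nrmZr ?(ltW c0) // => h.
  by rewrite mulrC ler_pdivrMr // mul1r.
pose q := cmul (cadj d) d + k%:C *: e.
pose W := e - c%:C *: q.
have sq : cadj q = q by rewrite cadjD cadjM cadjK (sa_scalar e1).
have sW : cadj W = W by rewrite cadjB cadjZr sq (unit_adj e1).
have VW n : cmul (cpow V n) d = cmul d (cpow W n).
  elim: n => [|n IH] /=; first by rewrite (e1 d).1 (e1 d).2.
  rewrite -cmulA IH !cmulA; congr cmul.
  by rewrite /V /W /p /q; nc e1; ring.
pose th := k * c; have th0 : 0 <= th by rewrite mulr_ge0 // ltW.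
pose C := c * nrm d ^+ 2; have C0 : 0 <= C by rewrite mulr_ge0 ?sqr_ge0 ?ltW.
have Wstep n : nrm (cpow W n.+1) <= nrm (cpow W n) * (1 + th) + C.
  have -> : cpow W n.+1 = cpow W n -
      (c%:C *: cmul (cmul (cadj d) (cpow V n)) d + (th)%:C *: cpow W n).
    rewrite -(cmulA (cadj d)) VW /= {1}/W /th; set w := cpow W n.
    rewrite /q (_ : (k * c)%:C = k%:C * c%:C); last exact: rmorphM.
    by nc e1; ring.
  apply: le_trans (nrmB _ _) _; apply: le_trans (lerD (lexx _) (nrmD _ _)) _.
  rewrite !nrmZr ?(ltW c0) //.
  have h1 : nrm (cmul (cmul (cadj d) (cpow V n)) d) <= nrm d ^+ 2.
    apply: le_trans (nrmM _ _) _; rewrite expr2 ler_wpM2r ?nrm_ge0 //.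
    apply: le_trans (nrmM _ _) _; rewrite nrm_adj ler_piMr ?nrm_ge0 //.
    exact: cpow_le1.
  have h2 : c * nrm (cmul (cmul (cadj d) (cpow V n)) d) <= C.
    by rewrite /C ler_wpM2l // ltW.
  by move: h2; rewrite mulrDr mulr1; lra.
have Wn n : nrm (cpow W n) <= (1 + n%:R * C) * (1 + th) ^+ n.
  elim: n => [|n IH]; first by rewrite mul0r addr0 mulr1 nrm_unit_le1.
  apply: le_trans (Wstep n) _; rewrite exprS -natr1.
  have e1n : 1 <= (1 + th) * (1 + th) ^+ n.
    by rewrite -exprS exprn_ege1 // lerDl.
  have := ler_wpM2r (addr_ge0 ler01 th0) IH.
  have : C * 1 <= C * ((1 + th) * (1 + th) ^+ n) by rewrite ler_wpM2l.
  set m : R := n%:R; set E := _ ^+ n; nra.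
have W1 : nrm W <= 1 + th.
  have th1 : 0 < 1 + th by rewrite ltr_wpDr.
  suff : nrm W / (1 + th) <= 1 by rewrite ler_pdivrMr // mul1r.
  apply: (@le1_of_pow2_linear _ _ C) => // [|j].
    by rewrite divr_ge0 ?nrm_ge0 // ltW.
  rewrite exprMn exprVn ler_pdivrMr ?exprn_gt0 //.
  by rewrite -cpow_pow2 // Wn.
have gW : e + c%:C *: g = W + c%:C *: (t%:C *: y + k%:C *: e).
  by rewrite /W /q dd; nc e1; ring.
have ng : nrm (e + c%:C *: g) <= 1 + 3 * th.
  rewrite gW; apply: le_trans (nrmD _ _) _; rewrite nrmZr ?(ltW c0) //.
  have h1 : nrm (t%:C *: y + k%:C *: e) <= 2 * k.
    apply: le_trans (nrmD _ _) _; rewrite nrmZr // -/k.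
    by have := nrm_scalar e1 k0; lra.
  have : c * nrm (t%:C *: y + k%:C *: e) <= c * (2 * k).
    by rewrite ler_wpM2l // ltW.
  by rewrite /th in W1 *; lra.
(* Here [c |g| = 1 - 2 th], and [|g| > 6 k] gives [M > 8 k], so [th < 1/8]. Then [4 c |g| > 3] while
   [(1 + 3 th)^2 < 2]. *)
have := pos_nrm_unitD e1 (posZ (ltW c0) pg).
have cM : c * M = 1 by rewrite mulVf // gt_eqF.
have : c * nrm g = c * M - 2 * th by rewrite /th /M; ring.
rewrite cM => cg.
have : th < 8^-1.
  by rewrite /th ltr_pdivrMr // /M; lra.
have : nrm (e + c%:C *: g) ^+ 2 <= (1 + 3 * th) ^+ 2.
  by rewrite ler_sqr ?nnegrE ?nrm_ge0 //; lra.
rewrite nrmZr ?(ltW c0) // expr2 [X in _ <= X]expr2; nra.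
Qed.

(** [z] is a perturbed absolute value of [h], so [y = z - h] is near twice the negative part of [h].
    Then [y h y], which is [d^* d] for [d = b y], equals [- z y^2] up to a small term, and the
    preceding lemma forces [z y^2] to be small. Since [y^3 = 2 z y^2 - rr y], [y] is small too, and
    [h] is a limit of the positive elements [z]. *)
Theorem adj_mul_pos b : pos (cmul (cadj b) b).
Proof.
set h := cmul (cadj b) b.
have sh : cadj h = h by rewrite /h cadjM cadjK.
(* The estimates end in [|y|^4 <= 13 r^2 |y|^2], with [13 = 2 * 6 + 1]; for [|y| > t] this
   contradicts [16 r^2 = t^2]. *)
apply: (pos_lim e1) => // t t0; pose r := t / 4; have r0 : 0 < r by rewrite divr_gt0.
pose rr := r ^+ 2; have rr0 : 0 < rr by rewrite exprn_gt0.
have [z [zz pz cz]] := pos_sqrt e1 (pos_sqr e1 sh) rr0.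
have hz : cmul z h = cmul h z by apply: cz; rewrite cmulA.
have [sz _] := pz; pose y := z - h.
have sy : cadj y = y by rewrite cadjB sz sh.
exists z => //; rewrite nrm_distC -/y.
have zy2 : cmul z y + cmul z y = cmul y y + rr%:C *: e.
  apply/eqP; rewrite -subr_eq0; apply/eqP.
  have -> : cmul z y + cmul z y - (cmul y y + rr%:C *: e) =
      cmul z z - cmul h h - rr%:C *: e by rewrite /y; ncc e1; ring.
  by rewrite zz -addrA -opprD subrr.
pose g := cmul z (cmul y y).
have pg : pos g by apply: (pos_conj_comm e1) => //; rewrite /y; ncc e1; ring.
have dd : cmul (cadj (cmul b y)) (cmul b y) = - g + rr%:C *: y.
  rewrite cadjM sy cmulA -(cmulA y) -/h.
  apply/eqP; rewrite -subr_eq0; apply/eqP.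
  have -> : cmul (cmul y h) y - (- g + rr%:C *: y) =
      cmul y (cmul z z - cmul h h - rr%:C *: e) by rewrite /g /y; ncc e1; ring.
  by rewrite zz addrAC addrK subrr cmul0r.
have gk := adj_mul_eq_opp_pos (ltW rr0) pg sy dd.
have y3 : cmul y (cmul y y) = g + g - rr%:C *: y.
  have -> : g + g = cmul (cmul z y + cmul z y) y by rewrite /g /y; ncc e1; ring.
  by rewrite zy2; nc e1; ring.
have ny3 : nrm (cmul y (cmul y y)) <= 13 * (rr * nrm y).
  rewrite y3; have := nrmB (g + g) (rr%:C *: y); have := nrmD g g.
  by rewrite nrmZr ?(ltW rr0) //; lra.
have ny4 : nrm y ^+ 4 <= nrm y * (13 * (rr * nrm y)).
  have -> : nrm y ^+ 4 = nrm (cmul y (cmul y (cmul y y))).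
    rewrite cmulA nrm_sa_sqr ?cadjM ?sy // nrm_sa_sqr // -exprM //.
  by apply: le_trans (nrmM _ _) _; rewrite ler_wpM2l ?nrm_ge0.
rewrite leNgt; apply/negP; move: ny4; have := nrm_ge0 y; set N := nrm y => N0 ny4 tN.
have N1 : 0 < N by apply: lt_trans tN.
have : N ^+ 4 = N * N * N ^+ 2 by rewrite !exprS expr0; ring.
have rrN : 16 * rr < N ^+ 2.
  have -> : 16 * rr = t ^+ 2 by rewrite /rr /r; field.
  by rewrite ltr_sqr ?nnegrE ?ltW.
have NN : 0 < N * N by rewrite mulr_gt0.
nra.
Qed.

End Kaplansky.

(** * Adjointable operators and Hilbert spaces *)

Section AdjointableOperators.
Variable R : realType.

(** A Hilbert module reduced to what its operator algebra uses. Values in [W] cover two cases at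
    once: an algebra over itself with [x^* y], whose adjointable operators are the multipliers, and
    a Hilbert space with scalar values. *)
Record inner (V : completeNormedModType R[i]) (W : normedModType R[i]) := Inner {
  inn : V -> V -> W;
  inn_star : W -> W;
  inn_linr : forall c x y z, inn x (c *: y + z) = c *: inn x y + inn x z;
  inn_sym : forall x y, inn y x = inn_star (inn x y);
  inn_starB : forall v w, inn_star (v - w) = inn_star v - inn_star w;
  inn_starZ : forall c v, inn_star (c *: v) = c^* *: inn_star v;
  inn_CS : forall x y, nrm (inn x y) <= nrm x * nrm y;
  inn_nrm : forall x, nrm (inn x x) = nrm x ^+ 2
}.

Section Operators.
Variables (V : completeNormedModType R[i]) (W : normedModType R[i]).
Variable (I : inner V W).
Local Notation "<< x , y >>" := (inn I x y).

Lemma innBr x y z : <<x, y - z>> = <<x, y>> - <<x, z>>.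
Proof. by rewrite addrC -scaleN1r inn_linr scaleN1r addrC. Qed.

Lemma innBl x y z : <<x - y, z>> = <<x, z>> - <<y, z>>.
Proof. by rewrite inn_sym innBr inn_starB -!inn_sym. Qed.

Lemma inn0r x : <<x, 0>> = 0.
Proof. by rewrite -(subrr (0 : V)) innBr subrr. Qed.

Lemma inn0l x : <<0, x>> = 0.
Proof. by rewrite -(subrr (0 : V)) innBl subrr. Qed.

Lemma innZl c x z : <<c *: x, z>> = c^* *: <<x, z>>.
Proof.
by rewrite inn_sym -[c *: x]addr0 inn_linr inn0r addr0 inn_starZ -inn_sym.
Qed.

Lemma innDl x y z : <<x + y, z>> = <<x, z>> + <<y, z>>.
Proof.
by rewrite -[y in LHS]opprK innBl -[- y]scaleN1r innZl rmorphN1 scaleN1r opprK.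
Qed.

Lemma inn_eq0 x : (forall y, <<y, x>> = 0) -> x = 0.
Proof.
move=> x0; apply: nrm0_eq0; apply/eqP; rewrite -sqrf_eq0 -(inn_nrm I).
by rewrite x0 nrm0.
Qed.

Local Notation op_bound := (@wbound R V (@nrm R V) V).
Local Notation opn := (@wnorm R V (@nrm R V) V).

Definition adjoint_pair (T T' : V -> V) : Prop :=
  forall x y, <<T' x, y>> = <<x, T y>>.

Definition adjointable : set (V -> V) :=
  [set T | (exists C, op_bound T C) /\ exists T', adjoint_pair T T'].

Lemma adjoint_pair_lin T T' : adjoint_pair T T' -> is_linear T.
Proof.
move=> TT c x y; apply/eqP; rewrite -subr_eq0; apply/eqP/inn_eq0 => z.
by rewrite innBr inn_linr -!TT inn_linr subrr.
Qed.

Lemma adjoint_pair_sym T T' : adjoint_pair T T' -> adjoint_pair T' T.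
Proof. by move=> TT x y; rewrite inn_sym -TT -inn_sym. Qed.

Lemma adjoint_pair_uniq T T1 T2 :
  adjoint_pair T T1 -> adjoint_pair T T2 -> T1 = T2.
Proof.
move=> h1 h2; apply/funext => x; apply/eqP; rewrite -subr_eq0.
apply/eqP/inn_eq0 => y; rewrite innBr.
by rewrite -(adjoint_pair_sym h1) -(adjoint_pair_sym h2) subrr.
Qed.

Lemma adjoint_bound T T' C : adjoint_pair T T' -> op_bound T C -> op_bound T' C.
Proof.
move=> TT [C0 hC]; split => // x.
have [x0|x0] := eqVneq (nrm (T' x)) 0; first by rewrite x0 mulr_ge0 ?nrm_ge0.
have xp : 0 < nrm (T' x) by rewrite lt_def x0 nrm_ge0.
rewrite -(ler_pM2r xp) -expr2 -(inn_nrm I) TT.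
apply: le_trans (inn_CS I _ _) _; rewrite mulrAC mulrC.
by rewrite ler_wpM2r ?nrm_ge0.
Qed.

Lemma adjointable_lin c S T S' T' : adjoint_pair S S' -> adjoint_pair T T' ->
  adjoint_pair (c *: S + T) (c^* *: S' + T').
Proof.
move=> hS hT x y.
by rewrite innDl innZl conjCK hS hT inn_linr.
Qed.

Lemma opnD S T : adjointable S -> adjointable T -> opn (S + T) <= opn S + opn T.
Proof. by move=> [bS _] [bT _]; exact: (wnormD (@nrm_ge0 R V)). Qed.

Lemma opnZ c T : adjointable T -> opn (c *: T) = cabs c * opn T.
Proof. by move=> [bT _]; exact: (wnormZ (@nrm_ge0 R V)). Qed.

Lemma opn0 T : adjointable T -> opn T = 0 -> T = 0.
Proof.
by move=> [bT _] T0; apply/funext => x; exact: (wnorm_eq0 (@nrm_ge0 R V)).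
Qed.

(** A bound for an operator bounds its adjoint as well, so the sequence and its adjoints converge
    pointwise at the same rate, and the limits stay adjoint to each other. *)
Lemma opn_complete u : (forall n, adjointable (u n)) -> cauchy_for opn u ->
  exists l, adjointable l /\ cvg_for opn u l.
Proof.
move=> au cu.
have [u' hu'] := choice (fun n => (au n).2).
have auB m n : adjointable (u m - u n) /\
    adjoint_pair (u m - u n) (u' m - u' n).
  have h : adjoint_pair (u m - u n) (u' m - u' n).
    have := adjointable_lin (-1) (hu' n) (hu' m).
    by rewrite rmorphN1 !scaleN1r ![- _ + _]addrC.
  split => //; split; last by exists (u' m - u' n).
  have [[C hC] _] := au n; have [[D hD] _] := au m.
  exists (cabs (-1) * C + D).
  rewrite (_ : u m - u n = fun y => -1 *: u n y + u m y); first exact: wbound_lin.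
  by apply/funext => y; rewrite scaleN1r addrC.
have small t : 0 < t -> exists k, forall m n x, (k <= m)%N -> (k <= n)%N ->
    nrm (u m x - u n x) <= t * nrm x /\ nrm (u' m x - u' n x) <= t * nrm x.
  move=> t0; have [k hk] := cu t t0; exists k => m n x km kn.
  have [am pm] := auB m n; have bm : op_bound (u m - u n) t.
    split; first exact: ltW.
    move=> y; apply: le_trans (wnorm_le (@nrm_ge0 R V) y am.1) _.
    by rewrite ler_wpM2r ?nrm_ge0 // ltW // hk.
  by split; [exact: bm.2 | exact: (adjoint_bound pm bm).2].
have [T hT] := wnorm_complete (@nrm_ge0 R V) (@nrm_cauchy_cvg R V) (fun t t0 => let: ex_intro k hk := small t t0 in
  ex_intro _ k (fun m n x km kn => (hk m n x km kn).1)).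
have [T' hT'] := wnorm_complete (@nrm_ge0 R V) (@nrm_cauchy_cvg R V) (fun t t0 => let: ex_intro k hk := small t t0 in
  ex_intro _ k (fun m n x km kn => (hk m n x km kn).2)).
have TT : adjoint_pair T T'.
  move=> x y; apply/eqP; rewrite -subr_eq0; apply/eqP/nrm0_eq0/eqP.
  rewrite eq_le nrm_ge0 andbT; apply: (@le_eps R (2 * (nrm x * nrm y))).
    by rewrite !mulr_ge0 ?nrm_ge0.
  move=> t t0 _; have [k hk] := hT t t0; have [k' hk'] := hT' t t0.
  set n := maxn k k'; have := hk n y (leq_maxl _ _); have := hk' n x (leq_maxr _ _).
  move=> h1 h2; rewrite add0r.
  have -> : <<T' x, y>> - <<x, T y>> = <<x, u n y - T y>> - <<u' n x - T' x, y>>.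
    by rewrite innBr innBl (hu' n x y) opprB [RHS]addrC subrKA.
  apply: le_trans (nrmB _ _) _; have h3 := inn_CS I x (u n y - T y).
  have h4 := inn_CS I (u' n x - T' x) y.
  have h5 : nrm x * nrm (u n y - T y) <= nrm x * (t * nrm y).
    by rewrite ler_wpM2l ?nrm_ge0.
  have h6 : nrm (u' n x - T' x) * nrm y <= t * nrm x * nrm y.
    by rewrite ler_wpM2r ?nrm_ge0.
  lra.
exists T; split; last first.
  move=> t t0; have [k hk] := hT _ (divr_gt0 t0 (ltr0n _ 2)).
  exists k => n kn; apply: (@le_lt_trans _ _ (t / 2)); last by lra.
  by apply: wnorm_min; split; [rewrite divr_ge0 ?ltW | move=> x; exact: hk].
split; last by exists T'.
have [k hk] := hT 1 ltr01; have [[C [C0 hC]] _] := au k.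
exists (C + 1); split; first exact: addr_ge0.
move=> x; have := hk k x (leqnn _); have := hC x.
by have := nrm_tri (u k x) (T x) 0; rewrite !subr0 (nrm_distC (T x)); lra.
Qed.

Definition op_data : banach_data (V -> V).
Proof.
refine (@BanachData R _ adjointable opn _ _ opnD opnZ opn0 opn_complete).
- split; first by exists 0; split => // x; rewrite nrm0 mul0r.
  by exists 0 => x y; change (<<0, y>> = <<x, 0>>); rewrite inn0l inn0r.
- move=> c S T [[C hC] [S' hS]] [[D hD] [T' hT]]; split.
    by exists (cabs c * C + D); exact: wbound_lin.
  by exists (c^* *: S' + T'); exact: adjointable_lin.
Defined.

Local Notation L := (banach_sub op_data).

Lemma op_adjointable (T : L) : adjointable (bs_val T).
Proof. exact: (elimT (asboolP (bd_set op_data _)) (bs_valP T)). Qed.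

Definition mk_op T (aT : adjointable T) : L :=
  @BanachSub R _ op_data T (introT (asboolP (bd_set op_data _)) aT).

Lemma op_comp_adjointable (S T : L) : adjointable (bs_val S \o bs_val T).
Proof.
have [[C [C0 hC]] [S' hS]] := op_adjointable S.
have [[D [D0 hD]] [T' hT]] := op_adjointable T; split.
  exists (C * D); split => [|x]; first exact: mulr_ge0.
  by apply: le_trans (hC _) _; rewrite -mulrA ler_wpM2l.
by exists (T' \o S') => x y /=; rewrite hT hS.
Qed.

Definition op_mul (S T : L) : L := mk_op (op_comp_adjointable S T).

Lemma op_adj_subproof (T : L) : exists T' : L,
  adjoint_pair (bs_val T) (bs_val T').
Proof.
have [[C hC] [T' hT]] := op_adjointable T.
have aT' : adjointable T'.
  split; first by exists C; exact: adjoint_bound hT hC.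
  by exists (bs_val T); exact: adjoint_pair_sym.
by exists (mk_op aT').
Qed.

Definition op_adj (T : L) : L := projT1 (cid (op_adj_subproof T)).

Lemma op_adjP (T : L) : adjoint_pair (bs_val T) (bs_val (op_adj T)).
Proof. exact: projT2 (cid (op_adj_subproof T)). Qed.

Lemma op_adj_uniq (S T : L) : adjoint_pair (bs_val S) (bs_val T) -> op_adj S = T.
Proof. by move=> h; apply: val_inj; exact: adjoint_pair_uniq (op_adjP S) h. Qed.

Lemma op_lin (T : L) : is_linear (bs_val T).
Proof. exact: adjoint_pair_lin (op_adjP T). Qed.

Lemma op_nrm_le (T : L) x : nrm (bs_val T x) <= nrm T * nrm x.
Proof. by rewrite bs_nrmE; exact: (wnorm_le (@nrm_ge0 R V)) (op_adjointable T).1. Qed.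

Lemma op_nrm_min (T : L) C : op_bound (bs_val T) C -> nrm T <= C.
Proof. by rewrite bs_nrmE; exact: wnorm_min. Qed.

Lemma op_mulA (x y z : L) : op_mul x (op_mul y z) = op_mul (op_mul x y) z.
Proof. exact: val_inj. Qed.

Lemma op_mul_linl c (x y z : L) :
  op_mul (c *: x + y) z = c *: op_mul x z + op_mul y z.
Proof. exact: val_inj. Qed.

Lemma op_mul_linr c (x y z : L) :
  op_mul x (c *: y + z) = c *: op_mul x y + op_mul x z.
Proof. by apply: val_inj; apply/funext => v; exact: (op_lin x). Qed.

Lemma op_normM (x y : L) : `|op_mul x y| <= `|x| * `|y|.
Proof.
rewrite !nrmE -rmorphM lecR; apply: op_nrm_min.
split; first by rewrite mulr_ge0 ?nrm_ge0.
move=> v /=; apply: le_trans (op_nrm_le _ _) _.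
by rewrite -mulrA ler_wpM2l ?nrm_ge0 // op_nrm_le.
Qed.

Lemma op_adj_nrm (x : L) : nrm (op_adj x) <= nrm x.
Proof.
apply: op_nrm_min; apply: adjoint_bound (op_adjP x) _.
by split; [exact: nrm_ge0 | exact: op_nrm_le].
Qed.

Lemma op_norm_cstar (x : L) : `|op_mul (op_adj x) x| = `|x| ^+ 2.
Proof.
rewrite !nrmE -rmorphXn; congr (_ %:C); apply/eqP; rewrite eq_le; apply/andP; split.
  have := op_normM (op_adj x) x; rewrite !nrmE -rmorphM lecR => /le_trans; apply.
  by rewrite expr2 ler_wpM2r ?nrm_ge0 ?op_adj_nrm.
rewrite -[leRHS]sqr_sqrtr ?nrm_ge0 // ler_sqr ?nnegrE ?nrm_ge0 ?sqrtr_ge0 //.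
apply: op_nrm_min; split; first exact: sqrtr_ge0.
move=> v; rewrite -ler_sqr ?nnegrE ?nrm_ge0 ?mulr_ge0 ?sqrtr_ge0 ?nrm_ge0 //.
rewrite exprMn sqr_sqrtr ?nrm_ge0 // -(inn_nrm I).
have -> : <<bs_val x v, bs_val x v>> = <<bs_val (op_mul (op_adj x) x) v, v>>.
  by rewrite /= op_adjP.
apply: le_trans (inn_CS I _ _) _; rewrite expr2 mulrA ler_wpM2r ?nrm_ge0 //.
exact: op_nrm_le.
Qed.

Lemma op_adjK (x : L) : op_adj (op_adj x) = x.
Proof. by apply: op_adj_uniq; apply: adjoint_pair_sym; exact: op_adjP. Qed.

Lemma op_adj_antilin c (x y : L) :
  op_adj (c *: x + y) = c^* *: op_adj x + op_adj y.
Proof. by apply: op_adj_uniq; apply: adjointable_lin; exact: op_adjP. Qed.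

Lemma op_adjM (x y : L) : op_adj (op_mul x y) = op_mul (op_adj y) (op_adj x).
Proof. by apply: op_adj_uniq => v w /=; rewrite !op_adjP. Qed.

Definition op_cstar : cstar R := @CStar R (banach_sub op_data) op_mul op_adj
  op_mulA op_mul_linl op_mul_linr op_adjK op_adj_antilin
  op_adjM op_normM op_norm_cstar.

Lemma op_one_adjointable : adjointable id.
Proof. by split; [exists 1; split => // x; rewrite mul1r | exists id]. Qed.

Definition op_one : op_cstar := mk_op op_one_adjointable.

Lemma op_oneP (x : op_cstar) : cmul op_one x = x /\ cmul x op_one = x.
Proof. by split; apply: val_inj. Qed.

End Operators.
End AdjointableOperators.

Section CauchySchwarz.
Variable R : realType.

Lemma conj_mulE (b : R[i]) : b * b^* = (cabs b ^+ 2)%:C.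
Proof. by rewrite -normCK cabsE -rmorphXn. Qed.

Lemma cauchy_schwarz_real (A C : R) (b : R[i]) : 0 <= A -> 0 <= C ->
  (forall a : R[i], 0 <= A%:C + a^* * b + a * b^* + a * a^* * C%:C) ->
  cabs b ^+ 2 <= A * C.
Proof.
move=> A0 C0 h; set B := cabs b ^+ 2; have B0 : 0 <= B by exact: sqr_ge0.
have key (r : R) : 0 <= A - 2 * r * B + r ^+ 2 * B * C.
  rewrite -lecR; have := h (- (r%:C * b)); congr (_ <= _).
  rewrite rmorphN rmorphM /= conj_Creal ?complex_real // .
  transitivity (A%:C - 2%:R * r%:C * (b * b^*) + r%:C ^+ 2 * (b * b^*) * C%:C).
    by ring.
  by rewrite conj_mulE -/B; ring.
have [C00|C00] := eqVneq C 0; last first.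
  have Cp : 0 < C by rewrite lt_def C00.
  have := key C^-1; rewrite (_ : _ + _ = A - B / C); last by field.
  by rewrite subr_ge0 ler_pdivrMr.
rewrite C00 mulr0 leNgt; apply/negP => Bp.
(* For [C = 0] the form is [A - 2 r B], which this [r] makes equal to -1. *)
have := key ((A + 1) / (2 * B)); rewrite C00 mulr0 addr0.
rewrite (_ : _ * _ * B = A + 1); last by field; rewrite gt_eqF.
lra.
Qed.

End CauchySchwarz.

Section HilbertBasics.
Variables (R : realType) (H : hilbert R).
Implicit Types x y z : H.

Lemma ipDl x y z : ip (x + y) z = ip x z + ip y z.
Proof. by have := ip_linl 1 x y z; rewrite scale1r mul1r. Qed.

Lemma ip0l z : ip (0 : H) z = 0.
Proof. by apply: (addrI (ip 0 z)); rewrite -ipDl !addr0. Qed.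

Lemma ipZl c x z : ip (c *: x) z = c * ip x z.
Proof. by have := ip_linl c x 0 z; rewrite ip0l !addr0. Qed.

Lemma ipNl x z : ip (- x) z = - ip x z.
Proof. by rewrite -scaleN1r ipZl mulN1r. Qed.

Lemma ipBl x y z : ip (x - y) z = ip x z - ip y z.
Proof. by rewrite ipDl ipNl. Qed.

Lemma ipDr x y z : ip z (x + y) = ip z x + ip z y.
Proof. by rewrite ip_sym ipDl rmorphD /= -!ip_sym. Qed.

Lemma ip0r z : ip z (0 : H) = 0.
Proof. by rewrite ip_sym ip0l rmorph0. Qed.

Lemma ipZr c x z : ip z (c *: x) = c^* * ip z x.
Proof. by rewrite ip_sym ipZl rmorphM /= -ip_sym. Qed.

Lemma ipNr x z : ip z (- x) = - ip z x.
Proof. by rewrite -scaleN1r ipZr rmorphN1 mulN1r. Qed.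

Lemma ipBr x y z : ip z (x - y) = ip z x - ip z y.
Proof. by rewrite ipDr ipNr. Qed.

Lemma ip_suml (I : Type) (r : seq I) (P : pred I) (F : I -> H) y :
  ip (\sum_(i <- r | P i) F i) y = \sum_(i <- r | P i) ip (F i) y.
Proof.
by apply: (big_morph (fun x => ip x y)) => [a b|]; rewrite ?ipDl ?ip0l.
Qed.

Lemma ip_sumr (I : Type) (r : seq I) (P : pred I) (F : I -> H) y :
  ip y (\sum_(i <- r | P i) F i) = \sum_(i <- r | P i) ip y (F i).
Proof. by apply: (big_morph (ip y)) => [a b|]; rewrite ?ipDr ?ip0r. Qed.

Lemma ip_nrm x : ip x x = (nrm x ^+ 2)%:C.
Proof. by rewrite -ip_norm nrmE -rmorphXn. Qed.

Lemma ip_CS x y : cabs (ip x y) <= nrm x * nrm y.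
Proof.
rewrite -ler_sqr ?nnegrE ?cabs_ge0 ?mulr_ge0 ?nrm_ge0 // exprMn.
apply: cauchy_schwarz_real; rewrite ?sqr_ge0 // => a.
have -> : (nrm x ^+ 2)%:C + a^* * ip x y + a * (ip x y)^* + a * a^* * (nrm y ^+ 2)%:C
    = ip (x + a *: y) (x + a *: y).
  by rewrite !ipDl !ipDr !ipZl !ipZr -!ip_nrm -ip_sym; ring.
by rewrite ip_nrm lecR sqr_ge0.
Qed.

Lemma ip_eq0 x : (forall y, ip x y = 0) -> x = 0.
Proof.
move=> x0; apply: nrm0_eq0; apply/eqP; rewrite -sqrf_eq0; apply/eqP.
by apply: complexI; rewrite -ip_nrm x0.
Qed.

Lemma ip_inj x x' : (forall y, ip x y = ip x' y) -> x = x'.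
Proof.
move=> h; apply/eqP; rewrite -subr_eq0; apply/eqP/ip_eq0 => y.
by rewrite ipBl h subrr.
Qed.

End HilbertBasics.

(** * Hilbert spaces from positive definite kernels *)

Section DenselyDefinedInnerProduct.
Variables (R : realType) (K : completeNormedModType R[i]) (F : Type).
Variables (kvec : F -> K) (val : K -> F -> R[i]) (kform : F -> F -> R[i]).
Implicit Types (f g h : K) (s t : F).
Local Notation n s := (nrm (kvec s)).
Hypothesis val_lin : forall c f g t, val (c *: f + g) t = c * val f t + val g t.
Hypothesis val_kvec : forall s t, val (kvec s) t = kform s t.
Hypothesis kval_le : forall f s, cabs (val f s) <= nrm f * n s.
Hypothesis kval_sub : forall f s t,
  cabs (val f s - val f t) <= nrm f * nrm (kvec s - kvec t).
Hypothesis kvec_dense : forall f (e : R), 0 < e -> exists t, nrm (f - kvec t) <= e.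
Hypothesis kform_sym : forall s t, kform t s = (kform s t)^*.
Hypothesis kform_self : forall s, kform s s = (n s ^+ 2)%:C.

Lemma kseq_sig : {k : K -> nat -> F | forall g (e : R), 0 < e ->
  exists i, forall m, (i <= m)%N -> nrm (g - kvec (k g m)) <= e}.
Proof.
have [d d0 d_lt] := cid2 (null_seq R).
exists (fun g => projT1 (choice (fun m : nat => kvec_dense g (d0 m)))).
move=> g e e0; case: choice => u hu /=; have [k hk] := d_lt e e0.
by exists k => m /hk hm; apply: le_trans (hu m) (ltW hm).
Qed.

(** Approximants are recorded by their labels in [F], because [val] evaluates at labels; [kip f g]
    is the limit of [val f] along the labels approximating [g]. *)
Definition kseq := sval kseq_sig.

Lemma kseqP g (e : R) : 0 < e -> exists k, forall m, (k <= m)%N ->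
  nrm (g - kvec (kseq g m)) <= e.
Proof. exact: (svalP kseq_sig). Qed.

Lemma kip_subproof f g : exists l : R[i]^o,
  cvg_for (@nrm R _) (fun m => val f (kseq g m) : R[i]^o) l.
Proof.
apply: complex_seq_complete => e e0.
have c0 : 0 < 2 * nrm f + 1 by have := nrm_ge0 f; lra.
have [k hk] := kseqP g (divr_gt0 e0 c0); exists k => i j /hk hi /hk hj.
apply: le_lt_trans (kval_sub f _ _) _.
have := nrm_tri g (kvec (kseq g i)) (kvec (kseq g j)).
rewrite (nrm_distC _ g); move: hi hj; set r := e / _ => hi hj h.
have r0 : 0 < r by exact: divr_gt0.
have -> : e = (2 * nrm f + 1) * r by rewrite mulrC divfK ?gt_eqF.
have hX : nrm (kvec (kseq g i) - kvec (kseq g j)) <= 2 * r by lra.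
have := ler_wpM2l (nrm_ge0 f) hX; lra.
Qed.

Lemma kip_sig : {kip : K -> K -> R[i] | forall f g (e : R), 0 < e ->
  exists k, forall m, (k <= m)%N -> cabs (val f (kseq g m) - kip f g) < e}.
Proof.
exists (fun f g => projT1 (cid (kip_subproof f g))) => f g.
exact: projT2 (cid (kip_subproof f g)).
Qed.

Definition kip := sval kip_sig.

Lemma kip_cvg f g (e : R) : 0 < e -> exists k, forall m, (k <= m)%N ->
  cabs (val f (kseq g m) - kip f g) < e.
Proof. exact: (svalP kip_sig). Qed.

Lemma kip_near f g s t : cabs (kip f g - kform s t) <=
  nrm f * nrm (g - kvec t) + nrm (f - kvec s) * n t.
Proof.
apply: (@le_eps R (nrm f + 1)); first by rewrite addr_ge0 ?nrm_ge0.
move=> e e0 _; have [k hk] := kip_cvg f g e0; have [k' hk'] := kseqP g e0.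
have := hk _ (leq_maxl k k'); have := hk' _ (leq_maxr k k').
set u := kseq g _ => h1 h2.
have -> : kip f g - kform s t = - (val f u - kip f g) +
  (val f u - val f t) + val (f - kvec s) t.
  by rewrite -[- kvec s]scaleN1r (addrC f) val_lin val_kvec; ring.
apply: le_trans (cabsD _ _) _; apply: le_trans (lerD (cabsD _ _) (lexx _)) _.
rewrite cabsN; have h3 := kval_sub f u t; have h4 := kval_le (f - kvec s) t.
have h5 := nrm_tri g (kvec u) (kvec t); rewrite (nrm_distC (kvec u) g) in h5.
have h6 : nrm f * nrm (kvec u - kvec t) <= nrm f * (e + nrm (g - kvec t)).
  by rewrite ler_wpM2l ?nrm_ge0 //; lra.
lra.
Qed.

Lemma kip_close f g e : 0 < e -> exists s t,
  [/\ cabs (kip f g - kform s t) <= e, nrm (f - kvec s) <= e &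
      nrm (g - kvec t) <= e].
Proof.
move=> e0; have c0 : 0 < nrm f + nrm g + 1.
  by have := nrm_ge0 f; have := nrm_ge0 g; lra.
pose r := Num.min 1 (Num.min e (e / (nrm f + nrm g + 1))).
have r0 : 0 < r by rewrite !lt_min ltr01 e0 divr_gt0.
have r1 : r <= 1 by rewrite ge_min lexx.
have re : r <= e by rewrite !ge_min lexx orbT.
have rc : r * (nrm f + nrm g + 1) <= e.
  by rewrite -ler_pdivlMr // !ge_min lexx !orbT.
have [s hs] := kvec_dense f r0; have [t ht] := kvec_dense g r0.
exists s, t; split; [|exact: le_trans hs re|exact: le_trans ht re].
apply: le_trans (kip_near _ _ _ _) _; apply: le_trans rc.
have h1 : n t <= nrm g + 1.
  have := nrm_tri g (kvec t) 0.
  by rewrite !subr0 nrm_distC; lra.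
have h2 : nrm f * nrm (g - kvec t) <= nrm f * r by rewrite ler_wpM2l ?nrm_ge0.
have h3 : nrm (f - kvec s) * n t <= r * (nrm g + 1).
  by apply: ler_pM => //; [exact: nrm_ge0 | exact: nrm_ge0].
lra.
Qed.

Lemma kip_kvec s t : kip (kvec s) (kvec t) = kform s t.
Proof.
apply/eqP; rewrite -subr_eq0; apply/eqP/cabs0_eq0/eqP; rewrite eq_le cabs_ge0 andbT.
by apply: le_trans (kip_near _ _ s t) _; rewrite !subrr !nrm0 mulr0 mul0r addr0.
Qed.

Lemma small_eq (z1 z2 : R[i]) (C : R) : 0 <= C ->
  (forall e : R, 0 < e -> e <= 1 -> cabs (z1 - z2) <= C * e) -> z1 = z2.
Proof.
move=> C0 h; apply/eqP; rewrite -subr_eq0; apply/eqP/cabs0_eq0/eqP.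
rewrite eq_le cabs_ge0 andbT.
by apply: (@le_eps R C) => // e e0 e1; rewrite add0r h.
Qed.

Lemma kip_linl c f g h : kip (c *: f + g) h = c * kip f h + kip g h.
Proof.
apply: (@small_eq _ _ (2 + cabs c)) => [|e e0 _].
  by rewrite addr_ge0 ?cabs_ge0.
have [k1 h1] := kip_cvg (c *: f + g) h e0.
have [k2 h2] := kip_cvg f h e0; have [k3 h3] := kip_cvg g h e0.
have := h1 _ (leq_trans (leq_maxl k1 k2) (leq_maxl _ k3)).
have := h2 _ (leq_trans (leq_maxr k1 k2) (leq_maxl _ k3)).
have := h3 _ (leq_maxr (maxn k1 k2) k3).
set m := maxn _ _.
have -> : val (c *: f + g) (kseq h m) =
  c * val f (kseq h m) + val g (kseq h m) by exact: val_lin.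
move: (val f _) (val g _) => a b hb ha hab.
have -> : kip (c *: f + g) h - (c * kip f h + kip g h) =
    - (c * a + b - kip (c *: f + g) h) + c * (a - kip f h) + (b - kip g h) by ring.
apply: le_trans (cabsD _ _) _; apply: le_trans (lerD (cabsD _ _) (lexx _)) _.
rewrite cabsN cabsM; have := ler_wpM2l (cabs_ge0 c) (ltW ha); lra.
Qed.

Lemma kip_sym f g : kip g f = (kip f g)^*.
Proof.
apply: (@small_eq _ _ (2 * (nrm f + nrm g + 2) + 1)) => [|e e0 e1].
  by have := nrm_ge0 f; have := nrm_ge0 g; lra.
have [s [t [h1 h2 h3]]] := kip_close f g e0.
have := kip_near g f t s.
have -> : kip g f - (kip f g)^* = (kip g f - kform t s) - (kip f g - kform s t)^*.
  by rewrite rmorphB /= -kform_sym; ring.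
move=> h4; have := cabsD (kip g f - kform t s) (- (kip f g - kform s t)^*).
rewrite cabsN cabs_conj => h5; apply: le_trans h5 _.
have h6 : n s <= nrm f + 1.
  have := nrm_tri f (kvec s) 0.
  by rewrite !subr0 nrm_distC; lra.
have h7 : nrm g * nrm (f - kvec s) <= nrm g * e by rewrite ler_wpM2l ?nrm_ge0.
have h8 : nrm (g - kvec t) * n s <= e * (nrm f + 1).
  by apply: ler_pM => //; [exact: nrm_ge0 | exact: nrm_ge0].
by have := mulr_ge0 (nrm_ge0 f) (ltW e0); have := mulr_ge0 (nrm_ge0 g) (ltW e0); lra.
Qed.

Lemma kip_norm f : `|f| ^+ 2 = kip f f.
Proof.
rewrite nrmE -rmorphXn /=.
apply: (@small_eq _ _ (4 * nrm f + 2)); first by have := nrm_ge0 f; lra.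
move=> e e0 e1; have [s hs] := kvec_dense f e0.
have := kip_near f f s s.
have -> : (nrm f ^+ 2)%:C - kip f f = (nrm f ^+ 2 - n s ^+ 2)%:C - (kip f f - kform s s).
  by rewrite kform_self; ring.
move=> h; apply: le_trans (cabsD _ _) _; rewrite cabsN cabsR.
have h1 : `|nrm f - n s| <= e.
  rewrite ler_norml; have h1 := nrm_tri f (kvec s) 0.
  have h2 := nrm_tri (kvec s) f 0.
  rewrite !subr0 in h1 h2; rewrite (nrm_distC _ f) in h1; apply/andP; split; lra.
have f0 := nrm_ge0 f; have s0 := nrm_ge0 (kvec s).
have h2 : n s <= nrm f + e by move: h1; rewrite ler_norml => /andP[]; lra.
have h3 : `|nrm f ^+ 2 - n s ^+ 2| <= e * (2 * nrm f + 1).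
  rewrite subr_sqr normrM; apply: ler_pM => //.
  by rewrite ger0_norm ?addr_ge0 //; lra.
have h4 : nrm f * nrm (f - kvec s) <= nrm f * e by rewrite ler_wpM2l.
have h5 : nrm (f - kvec s) * n s <= e * (nrm f + 1).
  by apply: ler_pM => //; [exact: nrm_ge0 | lra].
lra.
Qed.

Definition completed_hilbert : hilbert R := Hilbert kip_linl kip_sym kip_norm.

Lemma completed_ip s t :
  ip (kvec s : completed_hilbert) (kvec t) = kform s t.
Proof. exact: kip_kvec. Qed.

End DenselyDefinedInnerProduct.

Section Kolmogorov.
Variables (R : realType) (X : Type) (kap : X -> X -> R[i]).
Local Notation F := (seq (R[i] * X)).
Implicit Types (s t : F).

Definition kform s t : R[i] :=
  \sum_(p <- s) \sum_(q <- t) p.1 * q.1^* * kap p.2 q.2.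

Hypothesis kap_sym : forall x y, kap y x = (kap x y)^*.
Hypothesis kap_psd : forall s, 0 <= kform s s.

Definition kscale (c : R[i]) s : F := [seq (c * p.1, p.2) | p <- s].

Lemma kform_catl s s' t : kform (s ++ s') t = kform s t + kform s' t.
Proof. by rewrite /kform big_cat. Qed.

Lemma kform_sym s t : kform t s = (kform s t)^*.
Proof.
rewrite /kform exchange_big /= rmorph_sum; apply: eq_bigr => p _ /=.
rewrite rmorph_sum; apply: eq_bigr => q _ /=.
by rewrite !rmorphM /= conjCK -(kap_sym p.2 q.2); ring.
Qed.

Lemma kform_scalel c s t : kform (kscale c s) t = c * kform s t.
Proof.
rewrite /kform big_map mulr_sumr; apply: eq_bigr => p _ /=.
by rewrite mulr_sumr; apply: eq_bigr => q _; rewrite !mulrA.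
Qed.

Lemma kform_catr s s' t : kform t (s ++ s') = kform t s + kform t s'.
Proof. by rewrite !(kform_sym _ t) kform_catl rmorphD. Qed.

Lemma kform_scaler c s t : kform t (kscale c s) = c^* * kform t s.
Proof. by rewrite !(kform_sym _ t) kform_scalel rmorphM. Qed.

Definition kseminorm s : R := Num.sqrt (complex.Re (kform s s)).
Local Notation n := kseminorm.

Lemma kseminorm_ge0 s : 0 <= n s.
Proof. exact: sqrtr_ge0. Qed.

Lemma kform_self s : kform s s = (n s ^+ 2)%:C.
Proof.
have := kap_psd s; rewrite lecE /= => /andP[/eqP im0 re0].
by rewrite sqr_sqrtr //; case: (kform s s) im0 => a b /= ->.
Qed.

Lemma kform_CS s t : cabs (kform s t) <= n s * n t.
Proof.
rewrite -ler_sqr ?nnegrE ?cabs_ge0 ?mulr_ge0 ?kseminorm_ge0 // exprMn.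
apply: cauchy_schwarz_real; rewrite ?sqr_ge0 // => a.
have := kap_psd (s ++ kscale a t); congr (_ <= _).
rewrite !kform_catl !kform_catr !kform_scalel !kform_scaler !kform_self.
by rewrite (kform_sym s t); ring.
Qed.

(** The completion is realized by functionals on formal combinations: those approximated by some
    [kform t] uniformly relative to the seminorm. Null vectors become the zero functional, so no
    quotient has to be formed. *)
Definition kdom : set (F -> R[i]^o) := [set f | forall e : R, 0 < e ->
  exists t, forall s, cabs (f s - kform t s) <= e * n s].

Local Notation N := (@wnorm R F n R[i]^o).

Lemma kdom_bound f : kdom f -> exists C, wbound n f C.
Proof.
move=> /(_ 1 ltr01)[t ht]; exists (1 + n t).
split=> [|s]; first by rewrite addr_ge0 ?kseminorm_ge0.
have := nrm_tri (kform t s : R[i]^o) (f s) 0; have := ht s; have := kform_CS t s.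
rewrite /nrm !subr0 mulrDl -!/(cabs _); lra.
Qed.

Lemma kdom_linr f : kdom f -> (forall s s', f (s ++ s') = f s + f s') /\
  forall c s, f (kscale c s) = c^* * f s.
Proof.
move=> df; have small (z : R[i]) (C : R) : 0 <= C ->
    (forall e : R, 0 < e -> cabs z <= e * C) -> z = 0.
  move=> C0 h; apply: cabs0_eq0; apply/eqP; rewrite eq_le cabs_ge0 andbT.
  by apply: (@le_eps R C) => // e e0 _; rewrite add0r mulrC h.
split=> [s s'|c s]; apply/eqP; rewrite -subr_eq0; apply/eqP.
  apply: (small _ (n (s ++ s') + n s + n s')); first by rewrite !addr_ge0 ?kseminorm_ge0.
  move=> e e0; have [t ht] := df e e0.
  have -> : f (s ++ s') - (f s + f s') = (f (s ++ s') - kform t (s ++ s')) -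
      (f s - kform t s) - (f s' - kform t s') by rewrite kform_catr; ring.
  have := ht s; have := ht s'; have := ht (s ++ s').
  rewrite !mulrDr; set a := f s - _; set b := f s' - _; set d := f (s ++ s') - _.
  have := cabsD (d - a) (- b); have := cabsD d (- a); rewrite !cabsN; lra.
apply: (small _ (n (kscale c s) + cabs c * n s)).
  by rewrite addr_ge0 ?mulr_ge0 ?cabs_ge0 ?kseminorm_ge0.
move=> e e0; have [t ht] := df e e0.
have -> : f (kscale c s) - c^* * f s = (f (kscale c s) - kform t (kscale c s)) -
    c^* * (f s - kform t s) by rewrite kform_scaler; ring.
have := ht (kscale c s); have h := ht s.
set a := f s - _; set d := f (kscale c s) - _; rewrite (mulrDr e).
have := cabsD d (- (c^* * a)); rewrite cabsN cabsM cabs_conj.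
have : cabs c * cabs a <= cabs c * (e * n s) by rewrite ler_wpM2l ?cabs_ge0.
lra.
Qed.

Lemma kdom0 : kdom 0.
Proof.
move=> e e0; exists [::] => s; rewrite /kform big_nil subrr cabs0.
by apply: mulr_ge0; [exact: ltW | exact: kseminorm_ge0].
Qed.

Lemma kdomL c f g : kdom f -> kdom g -> kdom (c *: f + g).
Proof.
move=> df dg e e0; have c0 : 0 < 2 * cabs c + 2 by have := cabs_ge0 c; lra.
have [t ht] := df _ (divr_gt0 e0 c0).
have [t' ht'] := dg _ (divr_gt0 e0 c0).
exists (kscale c t ++ t') => s.
rewrite kform_catl kform_scalel !fctE.
have -> : c *: f s + g s - (c * kform t s + kform t' s) =
  c * (f s - kform t s) + (g s - kform t' s) by rewrite /GRing.scale /=; ring.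
apply: le_trans (cabsD _ _) _; rewrite cabsM.
have h1 := ler_wpM2l (cabs_ge0 c) (ht s); have h2 := ht' s.
have e_eq : (2 * cabs c + 2) * (e / (2 * cabs c + 2)) = e by rewrite mulrC divfK ?gt_eqF.
move: h1 h2 e_eq; set r := e / _ => h1 h2 e_eq.
have r0 : 0 < r by exact: divr_gt0.
have rs : 0 <= r * n s by apply: mulr_ge0; [exact: ltW | exact: kseminorm_ge0].
have -> : e * n s = 2 * (cabs c * (r * n s)) + 2 * (r * n s).
  by rewrite -{1}e_eq; ring.
have := mulr_ge0 (cabs_ge0 c) rs; lra.
Qed.

Lemma kcomplete u : (forall m, kdom (u m)) -> cauchy_for N u ->
  exists l, kdom l /\ cvg_for N u l.
Proof.
move=> du cu.
have bB k m : exists C, wbound n (u k - u m) C.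
  have h := kdomL (-1) (du m) (du k).
  by have := kdom_bound h; rewrite scaleN1r addrC.
have [|l hl] := wnorm_complete kseminorm_ge0 (@complex_seq_complete R) (u := u).
  move=> t t0; have [k hk] := cu t t0; exists k => i j s ki kj.
  apply: le_trans (wnorm_le kseminorm_ge0 s (bB i j)) _.
  by rewrite ler_wpM2r ?kseminorm_ge0 // ltW // hk.
exists l; split=> e e0; have [k hk] := hl _ (divr_gt0 e0 (ltr0n _ 2)).
  have [t ht] := du k _ (divr_gt0 e0 (ltr0n _ 2)); exists t => s.
  have h1 : cabs (u k s - l s) <= e / 2 * n s := hk k s (leqnn _).
  have := cabsD (- (u k s - l s)) (u k s - kform t s); rewrite cabsN.
  have -> : - (u k s - l s) + (u k s - kform t s) = l s - kform t s by ring.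
  by have := ht s; lra.
exists k => m km; apply: (@le_lt_trans _ _ (e / 2)); last by lra.
by apply: wnorm_min; split; [rewrite divr_ge0 ?ltW | move=> s; exact: hk].
Qed.

Definition kdata : banach_data (F -> R[i]^o) :=
  @BanachData R _ kdom N kdom0 kdomL
    (fun f g df dg => wnormD kseminorm_ge0 (kdom_bound df) (kdom_bound dg))
    (fun c f df => wnormZ kseminorm_ge0 c (kdom_bound df))
    (fun f df f0 => funext (fun s => wnorm_eq0 kseminorm_ge0 s (kdom_bound df) f0))
    kcomplete.

Local Notation K := (banach_sub kdata).
Implicit Types f g h : K.

Lemma kvec_dom t : kdom (kform t : F -> R[i]^o).
Proof.
move=> e e0; exists t => s; rewrite subrr cabs0.
by apply: mulr_ge0; [exact: ltW | exact: kseminorm_ge0].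
Qed.

Definition kvec t : K :=
  @BanachSub R _ kdata _ (introT (asboolP (bd_set kdata _)) (kvec_dom t)).

Lemma kval_dom f : kdom (bs_val f).
Proof. exact: (elimT (asboolP (bd_set kdata _)) (bs_valP f)). Qed.

Lemma kval_le f s : cabs (bs_val f s) <= nrm f * n s.
Proof. exact: (wnorm_le kseminorm_ge0 s (kdom_bound (kval_dom f))). Qed.

Lemma kvec_nrm t : nrm (kvec t) = n t.
Proof.
apply/eqP; rewrite eq_le; apply/andP; split.
  by apply: wnorm_min; split=> [|s]; [exact: kseminorm_ge0 | exact: kform_CS].
have [->|t0] := eqVneq (n t) 0; first exact: nrm_ge0.
have tp : 0 < n t by rewrite lt_def t0 kseminorm_ge0.
have := kval_le (kvec t) t; rewrite /= kform_self cabsR ger0_norm ?sqr_ge0 //.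
by rewrite expr2 ler_pM2r.
Qed.

Lemma kvec_cat s t : kvec (s ++ t) = kvec s + kvec t.
Proof. by apply: val_inj; apply/funext => r; exact: kform_catl. Qed.

Lemma kvec_scale c s : kvec (kscale c s) = c *: kvec s.
Proof. by apply: val_inj; apply/funext => r; exact: kform_scalel. Qed.

Lemma kval_lin c f g t : bs_val (c *: f + g) t = c * bs_val f t + bs_val g t.
Proof. by have -> : bs_val (c *: f + g) = c *: bs_val f + bs_val g by []. Qed.

Lemma kval_kvec s t : bs_val (kvec s) t = kform s t.
Proof. by []. Qed.

Lemma kvec_dense f e : 0 < e -> exists t, nrm (f - kvec t) <= e.
Proof.
move=> e0; have [t ht] := kval_dom f e0; exists t.
by apply: wnorm_min; split; [exact: ltW | exact: ht].
Qed.

Lemma kval_sub f s t : cabs (bs_val f s - bs_val f t) <= nrm f * nrm (kvec s - kvec t).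
Proof.
have [hD hZ] := kdom_linr (kval_dom f).
have -> : bs_val f s - bs_val f t = bs_val f (s ++ kscale (-1) t).
  by rewrite hD hZ rmorphN1 mulN1r.
apply: le_trans (kval_le _ _) _.
by rewrite -kvec_nrm kvec_cat kvec_scale scaleN1r.
Qed.

(** Used with three kernels: [f (n^* m)] for a state [f], a product of two inner products for
    Hilbert tensor products, and inner products of vectors [p' x h] for pulled back
    representations. *)
Lemma kolmogorov : exists (H : hilbert R) (j : X -> H),
  (forall x y, ip (j x) (j y) = kap x y) /\ cspan (range j) = setT.
Proof.
have kself s : kform s s = (nrm (kvec s) ^+ 2)%:C by rewrite kvec_nrm kform_self.
have kle f s : cabs (bs_val f s) <= nrm f * nrm (kvec s).
  by rewrite kvec_nrm; exact: kval_le.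
pose H := @completed_hilbert R K F kvec (fun f => bs_val f) kform
  kval_lin kval_kvec kle kval_sub kvec_dense kform_sym kself.
exists H, (fun x => kvec [:: (1, x)] : H).
split=> [x y|].
  by rewrite [LHS]completed_ip /kform !big_seq1 /= rmorph1 !mul1r.
rewrite predeqE => f; split=> // _.
have [D0 DL Dc] := cspan_closed (range (fun x => kvec [:: (1, x)] : H)).
apply: Dc => e e0; have e2 : 0 < e / 2 by rewrite divr_gt0.
have [t ht] := kvec_dense f e2; exists (kvec t); last by apply: le_lt_trans ht _; lra.
elim: t {ht} => [|[c x] t IH].
  by rewrite (_ : kvec [::] = 0) //; apply: nrm0_eq0; rewrite kvec_nrm /n /kform
     big_nil sqrtr0.
have -> : kvec ((c, x) :: t) = c *: kvec [:: (1, x)] + kvec t.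
  by rewrite -kvec_scale -kvec_cat /= mulr1.
by apply: DL => //; apply: sub_cspan; exists x.
Qed.

End Kolmogorov.

(** * States and the Gelfand-Naimark theorem *)

Section SublinearFunctionals.
Variables (R : realType) (U : lmodType R[i]).
Implicit Types (x y a : U) (p q : U -> R).

Definition sublinear q : Prop := [/\ q 0 = 0,
  forall x y, q (x + y) <= q x + q y &
  forall (r : R) x, 0 < r -> q (r%:C *: x) = r * q x].

Lemma sublinear_opp q x : sublinear q -> - q (- x) <= q x.
Proof. by move=> [q0 qD _]; have := qD x (- x); rewrite subrr q0; lra. Qed.

Lemma minimal_sublinear p : sublinear p -> exists q,
  [/\ sublinear q, forall x, q x <= p x &
      forall q', sublinear q' -> (forall x, q' x <= q x) -> q' = q].
Proof.
move=> sp; pose T := {q : U -> R | sublinear q /\ forall x, q x <= p x}.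
(* The order is reversed: Zorn's lemma yields maximal elements, while a minimal functional is
   wanted. *)
pose rT (s t : T) := `[< forall x, sval t x <= sval s x >].
have [||||t ht] := @Zorn T rT.
- by move=> t; apply/asboolP.
- move=> r s t /asboolP h1 /asboolP h2; apply/asboolP => x.
  exact: le_trans (h2 x) (h1 x).
- move=> [f hf] [g hg] /asboolP /= h1 /asboolP /= h2.
  have fg : f = g by apply/funext => x; apply/eqP; rewrite eq_le h1 h2.
  by subst g; congr exist; exact: Prop_irrelevance.
- move=> A tA; have [[s0 Aa]|nA] := pselect (exists s0 : T, A s0); last first.
    exists (exist _ p (conj sp (fun x => lexx _))) => s As.
    by exfalso; apply: nA; exists s.
  pose V x := [set sval s x | s in A].
  pose q x := inf (V x).
  have lb s x : A s -> q x <= sval s x.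
    move=> As; apply: ge_inf; last by exists s.
    exists (- p (- x)) => _ [s' As' <-].
    have [ss' s'p] := svalP s'.
    by have := sublinear_opp x ss'; have := s'p (- x); lra.
  have glb x (r : R) : (forall s, A s -> r <= sval s x) -> r <= q x.
    move=> h; apply: lb_le_inf; first by exists (sval s0 x), s0.
    by move=> _ [s As <-]; exact: h.
  have sq : sublinear q.
    split.
    - apply/eqP; rewrite eq_le; apply/andP; split.
        by have [[z0 _ _] _] := svalP s0; rewrite -z0 lb.
      by apply: (glb _ _) => s As; have [[z0 _ _] _] := svalP s; rewrite z0.
    - move=> x y; rewrite -lerBlDr; apply: (glb _ _) => s As.
      rewrite lerBlDr -lerBlDl; apply: (glb _ _) => s' As'; rewrite lerBlDl.
      have hs := svalP s; have hs' := svalP s'.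
      have [/asboolP h|/asboolP h] := tA _ _ As As'.
        apply: le_trans (lb _ _ As') _; have [[_ D _] _] := hs'.
        by apply: le_trans (D _ _) _; rewrite lerD.
      apply: le_trans (lb _ _ As) _; have [[_ D _] _] := hs.
      by apply: le_trans (D _ _) _; rewrite lerD.
    - move=> r x r0; apply/eqP; rewrite eq_le; apply/andP; split.
        rewrite mulrC -ler_pdivrMr //; apply: (glb _ _) => s As; rewrite ler_pdivrMr //.
        rewrite mulrC; have [[_ _ Z] _] := svalP s; rewrite -Z //.
        exact: lb.
      apply: (glb _ _) => s As; have [[_ _ Z] _] := svalP s; rewrite Z //.
      by rewrite ler_pM2l // lb.
  have qp x : q x <= p x by apply: le_trans (lb _ _ Aa) _; exact: (svalP s0).2.
  exists (exist _ q (conj sq qp)) => s As; apply/asboolP => x; exact: lb.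
have [st tp] := svalP t.
exists (sval t); split => // q' sq' q't.
have q'p x : q' x <= p x by apply: le_trans (q't x) (tp x).
have := ht (exist _ q' (conj sq' q'p)).
by move=> /(_ (introT (asboolP _) q't)) <-.
Qed.

(* The sublinear functional obtained from [p] by linearizing it along [a]. *)
Definition tilt p a x : R :=
  inf [set p (x + r%:C *: a) - r * p a | r in [set r : R | 0 <= r]].

Section Tilt.
Variables (p : U -> R) (a : U).
Hypothesis sp : sublinear p.

Lemma sublinear_ge0 r x : 0 <= r -> p (r%:C *: x) = r * p x.
Proof.
have [p0 _ pZ] := sp; rewrite le_eqVlt => /predU1P[<-|]; last exact: pZ.
by rewrite scale0r p0 mul0r.
Qed.

Lemma tilt_le x r : 0 <= r -> tilt p a x <= p (x + r%:C *: a) - r * p a.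
Proof.
move=> r0; apply: ge_inf; last by exists r.
exists (- p (- x)) => _ [s /= s0 <-]; have [_ pD _] := sp.
rewrite -sublinear_ge0 //; have := pD (x + s%:C *: a) (- x).
by rewrite addrAC subrr add0r; lra.
Qed.

Lemma tilt_ge x M : (forall r : R, 0 <= r -> M <= p (x + r%:C *: a) - r * p a) ->
  M <= tilt p a x.
Proof.
move=> h; apply: lb_le_inf; last by move=> _ [r r0 <-]; exact: h.
by exists (p (x + 0%:C *: a) - 0 * p a), 0 => //=.
Qed.

Lemma tilt_sublinear : sublinear (tilt p a).
Proof.
have [p0 pD pZ] := sp; split.
- apply/eqP; rewrite eq_le; apply/andP; split.
    have := tilt_le 0 (lexx 0).
    by rewrite (_ : (0 : R)%:C = 0) // scale0r addr0 p0 mul0r subr0.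
  by apply: tilt_ge => r r0; rewrite add0r sublinear_ge0 // subrr.
- move=> x y; rewrite -lerBlDr; apply: tilt_ge => r r0.
  rewrite lerBlDr -lerBlDl; apply: tilt_ge => s s0; rewrite lerBlDl.
  apply: le_trans (tilt_le _ (addr_ge0 r0 s0)) _.
  rewrite (_ : (r + s)%:C = r%:C + s%:C); last exact: rmorphD.
  rewrite scalerDl addrACA mulrDl.
  by have := pD (x + r%:C *: a) (y + s%:C *: a); lra.
- move=> r x r0; apply/eqP; rewrite eq_le; apply/andP; split.
    rewrite mulrC -ler_pdivrMr //; apply: tilt_ge => s s0.
    rewrite ler_pdivrMr // mulrC; apply: le_trans (tilt_le _ (mulr_ge0 (ltW r0) s0)) _.
    rewrite (_ : (r * s)%:C = r%:C * s%:C); last exact: rmorphM.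
    by rewrite -scalerA -scalerDr pZ // mulrBr mulrA.
  apply: tilt_ge => s s0; have sr : 0 <= s / r by rewrite divr_ge0 // ltW.
  have : r * tilt p a x <= r * (p (x + (s / r)%:C *: a) - s / r * p a).
    by rewrite ler_pM2l // tilt_le.
  rewrite mulrBr -(pZ r) // scalerDr scalerA -(rmorphM (real_complex R)).
  have -> : r * (s / r) = s by rewrite mulrC divfK // gt_eqF.
  by rewrite mulrA (_ : r * (s / r) = s) // mulrC divfK // gt_eqF.
Qed.

End Tilt.

(** A minimal sublinear functional is additive, because its tilt along any [y] lies below it and
    hence equals it. Starting from the tilt of [p] along [a] instead of [p] forces
    [f (- a) <= - p a]. *)
Lemma hahn_banach p a : sublinear p -> exists f : U -> R,
  [/\ forall x y, f (x + y) = f x + f y,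
      forall (r : R) x, f (r%:C *: x) = r * f x,
      forall x, f x <= p x & f a = p a].
Proof.
move=> sp; have st := tilt_sublinear a sp.
have [f [sf fp fmin]] := minimal_sublinear st; have [f0 fD fZ] := sf.
have tp x : tilt p a x <= p x.
  have := tilt_le a sp x (lexx 0).
  by rewrite (_ : (0 : R)%:C = 0) // scale0r addr0 mul0r subr0.
have fadd x y : f (x + y) = f x + f y.
  apply/eqP; rewrite eq_le fD /= -lerBrDr.
  rewrite -{1}(fmin _ (tilt_sublinear y sf)).
    have := tilt_le y sf x ler01.
    by rewrite (_ : (1 : R)%:C = 1) // scale1r mul1r.
  move=> z; have := tilt_le y sf z (lexx 0).
  by rewrite (_ : (0 : R)%:C = 0) // scale0r addr0 mul0r subr0.
have fN x : f (- x) = - f x.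
  by apply/eqP; rewrite -addr_eq0 -fadd addNr f0.
exists f; split => // [r x|x|].
- have [r0|r0|->] := ltgtP r 0; last by rewrite scale0r f0 mul0r.
    have -> : r%:C = - (- r)%:C by rewrite [(- r)%:C]rmorphN opprK.
    by rewrite scaleNr fN fZ ?oppr_gt0 // mulNr opprK.
  exact: fZ.
- exact: le_trans (fp x) (tp x).
- apply/eqP; rewrite eq_le (le_trans (fp a)) //=.
  have [p0 _ _] := sp; have := fp (- a); rewrite fN.
  have := tilt_le a sp (- a) ler01.
  by rewrite (_ : (1 : R)%:C = 1) // scale1r mul1r addNr p0; lra.
Qed.

End SublinearFunctionals.

Section States.
Variables (R : realType) (U : cstar R) (e : U).
Hypothesis e1 : forall x, cmul e x = x /\ cmul x e = x.
Hypothesis ne1 : nrm e = 1.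
Local Notation pos := (pos e).
Implicit Types (x y a h : U).

Lemma pos_scalar_ge0 (r : R) : pos (r%:C *: e) -> 0 <= r.
Proof.
move=> [_ [M M0]]; rewrite -scalerBl -rmorphB nrmZ cabsR ne1 mulr1.
by rewrite ler_norml => /andP[]; lra.
Qed.

Definition re_part x : U := (2^-1 : R)%:C *: (x + cadj x).

Lemma re_part_sa x : cadj (re_part x) = re_part x.
Proof. by rewrite cadjZr cadjD cadjK addrC. Qed.

Lemma re_part_of_sa x : cadj x = x -> re_part x = x.
Proof.
move=> sx; rewrite /re_part sx scalerDr -scalerDl -rmorphD.
by rewrite (_ : 2^-1 + 2^-1 = 1 :> R) ?rmorph1 ?scale1r //; field.
Qed.

(** The supremum of the spectrum of the real part. A real functional below it is nonnegative on
    [pos], at most 1 at [e], and zero on skew-adjoint elements, whose real part vanishes. *)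
Definition upper_bound_fun x : R := inf [set t : R | pos (t%:C *: e - re_part x)].
Local Notation p := upper_bound_fun.

Lemma p_le x t : pos (t%:C *: e - re_part x) -> p x <= t.
Proof.
move=> ht; apply: ge_inf => //; exists (- nrm (re_part x)) => s /= hs.
have hN : pos ((nrm (re_part x))%:C *: e + re_part x).
  have := @pos_scalar_sub _ _ _ e1 (- re_part x) (nrm (re_part x)).
  by rewrite opprK; apply; rewrite ?nrmN // cadjN re_part_sa.
have := posD hs hN; rewrite addrCA subrK addrC -scalerDl -rmorphD.
by move=> /pos_scalar_ge0; lra.
Qed.

Lemma p_ge x M : (forall t : R, pos (t%:C *: e - re_part x) -> M <= t) -> M <= p x.
Proof.
move=> h; apply: lb_le_inf => //; exists (nrm (re_part x)) => /=.
by apply: (pos_scalar_sub e1) => //; exact: re_part_sa.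
Qed.

Lemma re_partD x y : re_part (x + y) = re_part x + re_part y.
Proof. by rewrite /re_part cadjD addrACA scalerDr. Qed.

Lemma re_partZ (r : R) x : re_part (r%:C *: x) = r%:C *: re_part x.
Proof. by rewrite /re_part cadjZr -scalerDr !scalerA mulrC. Qed.

Lemma p_sublinear : sublinear p.
Proof.
have half x y t s : pos (t%:C *: e - re_part x) -> pos (s%:C *: e - re_part y) ->
    p (x + y) <= t + s.
  move=> ht hs; apply: p_le; rewrite re_partD rmorphD scalerDl opprD addrACA.
  exact: posD.
have scale x t r : 0 < r -> pos (t%:C *: e - re_part x) -> p (r%:C *: x) <= r * t.
  move=> r0 ht; apply: p_le; rewrite re_partZ rmorphM -scalerA -scalerBr.
  by apply: posZ => //; exact: ltW.
split.
- have r0 : re_part 0 = 0 by rewrite /re_part cadj0 addr0 scaler0.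
  apply/eqP; rewrite eq_le; apply/andP; split.
    by apply: p_le; rewrite r0 subr0 scale0r; exact: pos0.
  by apply: p_ge => t; rewrite r0 subr0; exact: pos_scalar_ge0.
- move=> x y; rewrite -lerBlDr; apply: p_ge => t ht.
  by rewrite lerBlDr -lerBlDl; apply: p_ge => s hs; rewrite lerBlDl; exact: half.
- move=> r x r0; apply/eqP; rewrite eq_le; apply/andP; split.
    rewrite mulrC -ler_pdivrMr //; apply: p_ge => t ht; rewrite ler_pdivrMr //.
    by rewrite mulrC; exact: scale.
  apply: p_ge => t; rewrite re_partZ => ht; rewrite mulrC -ler_pdivlMr //.
  apply: p_le; have ri : 0 <= r^-1 by rewrite invr_ge0 ltW.
  move: (re_part x) ht => y ht.
  have := posZ ri ht; rewrite scalerBr !scalerA -!rmorphM mulVf ?gt_eqF //.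
  by rewrite rmorph1 scale1r mulrC.
Qed.

Lemma state_exists a : pos a -> exists f : U -> R[i],
  [/\ forall c x y, f (c *: x + y) = c * f x + f y,
      forall x, f (cadj x) = (f x)^*,
      forall x, 0 <= f (cmul (cadj x) x),
      f a = (nrm a)%:C & exists2 r : R, r <= 1 & f e = r%:C].
Proof.
move=> pa; have [g [gD gZ gp ga]] := hahn_banach a p_sublinear.
have g0 : g 0 = 0 by apply: (addrI (g 0)); rewrite -gD !addr0.
have gN x : g (- x) = - g x by apply/eqP; rewrite -addr_eq0 -gD addNr g0.
have skew x : cadj x = - x -> g x = 0.
  have le0 y : cadj y = - y -> g y <= 0.
    move=> sy; apply: le_trans (gp y) _; apply: p_le.
    by rewrite /re_part sy subrr scaler0 subr0 scale0r; exact: pos0.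
  move=> sx; apply/eqP; rewrite eq_le le0 //= -oppr_le0 -gN le0 //.
  by rewrite cadjN sx.
have gpos x : pos x -> 0 <= g x.
  move=> px; rewrite -oppr_le0 -gN; apply: le_trans (gp _) _; apply: p_le.
  by rewrite re_part_of_sa ?cadjN ?px.1 // opprK scale0r add0r.
have gadj x : g (cadj x) = g x.
  apply/eqP; rewrite -subr_eq0 -gN -gD; apply/eqP/skew.
  by rewrite cadjB cadjK opprB.
pose f x : R[i] := (g x)%:C - 'i * (g ('i *: x))%:C.
have ii : 'i * 'i = -1 :> R[i] by rewrite -expr2 sqrCi.
have gi_sa x : cadj x = x -> g ('i *: x) = 0.
  by move=> sx; apply: skew; rewrite cadjZ sx conjCi scaleNr.
have fsa x : cadj x = x -> f x = (g x)%:C.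
  by move=> sx; rewrite /f gi_sa // mulr0 subr0.
exists f; split.
- move=> c x y; have cE : c = (complex.Re c)%:C + 'i * (complex.Im c)%:C.
    by rewrite [LHS]complexE complexiE.
  move: cE; set r := complex.Re c; set s := complex.Im c => ->.
  have gc : g ((r%:C + 'i * s%:C) *: x) = r * g x + s * g ('i *: x).
    by rewrite scalerDl gD gZ (mulrC 'i) -scalerA gZ.
  have gic : g ('i *: ((r%:C + 'i * s%:C) *: x)) = r * g ('i *: x) - s * g x.
    rewrite scalerA (_ : _ * _ = r%:C * 'i + (- s)%:C).
      by rewrite scalerDl gD -scalerA !gZ mulNr.
    by rewrite mulrDr mulrA ii mulN1r rmorphN mulrC.
  by rewrite /f scalerDr !gD gc gic; ring: ii.
- move=> x; rewrite /f gadj.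
  have -> : g ('i *: cadj x) = - g ('i *: x).
    by rewrite -gN -(gadj (- _)) cadjN cadjZ conjCi scaleNr opprK.
  rewrite rmorphB rmorphM /= conjCi !conj_Creal ?complex_real // rmorphN.
  by ring.
- move=> x; rewrite fsa ?cadjM ?cadjK // ler0c; apply: gpos.
  exact: adj_mul_pos.
- rewrite fsa ?pa.1 // ga; congr (_ %:C); apply/eqP; rewrite eq_le; apply/andP; split.
    apply: p_le; rewrite re_part_of_sa ?pa.1 //.
    by apply: (pos_scalar_sub e1) => //; exact: pa.1.
  apply: p_ge => t; rewrite re_part_of_sa ?pa.1 // => ht.
  apply: (pos_le e1) => //; apply: pos_scalar_ge0.
  by have := posD ht pa; rewrite subrK.
- exists (g e); last by rewrite fsa // (unit_adj e1).
  apply: le_trans (gp e) _; apply: p_le; rewrite re_part_of_sa ?(unit_adj e1) //.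
  by rewrite scale1r subrr; exact: pos0.
Qed.

End States.

Section Density.
Variable R : realType.
Implicit Types (V : completeNormedModType R[i]).

(** Formal combinations are lists, with [++] and [kscale] as addition and scaling. Maps on a span
    are specified on such lists, and a bound makes them well defined. *)
Definition lincomb (X : Type) (V : lmodType R[i]) (f : X -> V)
    (s : seq (R[i] * X)) : V := \sum_(p <- s) p.1 *: f p.2.

Lemma lincomb_cat (X : Type) (V : lmodType R[i]) (f : X -> V) s t :
  lincomb f (s ++ t) = lincomb f s + lincomb f t.
Proof. by rewrite /lincomb big_cat. Qed.

Lemma lincomb_scale (X : Type) (V : lmodType R[i]) (f : X -> V) c s :
  lincomb f (kscale c s) = c *: lincomb f s.
Proof.
rewrite /lincomb big_map scaler_sumr; apply: eq_bigr => p _ /=.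
by rewrite scalerA.
Qed.

Lemma dense_lincomb V (X : Type) (f : X -> V) : cspan (range f) = setT ->
  forall v (e : R), 0 < e -> exists s, nrm (v - lincomb f s) < e.
Proof.
move=> fT v e e0; have : cspan (range f) v by rewrite fT.
move=> /closure_nrmP /(_ e e0)[y [n [c [w [hw ->]]]] vy].
have [x hx] := choice (fun k => let: ex_intro2 x _ e := hw k in
  ex_intro (fun x => f x = w k) x e).
exists [seq (c k, x k) | k <- enum 'I_n].
rewrite /lincomb big_map big_enum /=; congr (nrm (_ - _) < e): vy.
by apply: eq_bigr => k _; rewrite hx.
Qed.

End Density.

Section HilbertTotal.
Variables (R : realType) (H : hilbert R).

Lemma ip_total (S : set H) (u u' : H) : cspan S = setT ->
  (forall y, S y -> ip u y = ip u' y) -> u = u'.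
Proof.
move=> ST h; apply: ip_inj => y; apply/eqP; rewrite -subr_eq0 -ipBl.
rewrite ip_sym fmorph_eq0; apply/eqP.
pose f y : R[i]^o := ip y (u - u').
have cl : closed_sub [set y | f y = 0].
  apply: (@closed_sub_zero _ _ _ _ (nrm (u - u'))) => [c x z|x].
    by rewrite /f ip_linl.
  by rewrite mulrC; exact: ip_CS.
apply: (cspanT_dense y ST cl) => z Sz /=.
by rewrite /f ip_sym ipBl h // subrr rmorph0.
Qed.

End HilbertTotal.

(** * The contraction principle and representations from kernels *)

Section VectorContraction.
Variables (R : realType) (A : cstar R) (H : hilbert R) (T : A -> H) (v : H).
Hypothesis Tlin : is_linear T.
Hypothesis TT : forall a b, ip (T a) (T b) = ip (T (cmul (cadj b) a)) v.
Hypothesis vT : forall a, ip v (T a) = ip (T (cadj a)) v.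

(* With [1 - a* a = (1 - k)^2], [|v|^2 - |T a|^2 = |v - T k|^2]. *)
Lemma vector_contraction a : nrm (T a) <= nrm a * nrm v.
Proof.
suff key b : nrm b < 1 -> nrm (T b) <= nrm v.
  apply: (@le_eps R (nrm v)) => [|t t0 _]; first exact: nrm_ge0.
  have r0 : 0 < nrm a + t by rewrite ltr_wpDl ?nrm_ge0.
  have := key ((nrm a + t)^-1%:C *: a); rewrite (linZ Tlin) !nrmZr ?invr_ge0 ?(ltW r0) //.
  rewrite mulrC ltr_pdivrMr // mul1r ltrDl => /(_ t0).
  by rewrite mulrC ler_pdivrMr //; lra.
move=> b1; pose h := cmul (cadj b) b.
have sh : cadj h = h by rewrite cadjM cadjK.
have [|k [sk _ hk _]] := quasi_sqrt sh.
  by rewrite nrm_cstar expr_lt1 ?nrm_ge0.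
rewrite -ler_sqr ?nnegrE ?nrm_ge0 // -lecR -!ip_nrm TT -/h -subr_ge0.
have -> : ip v v - ip (T h) v = ip (v - T k) (v - T k).
  rewrite ipBl !ipBr TT sk vT sk hk (linB Tlin) (linD Tlin) ipBl ipDl; ring.
by rewrite ip_nrm ler0c sqr_ge0.
Qed.

End VectorContraction.

Section KernelRepresentation.
Variables (R : realType) (X : Type) (kap : X -> X -> R[i]).
Variables (A : cstar R) (al : A -> X -> X).
Hypothesis al_adj : forall a x y, kap (al a x) y = kap x (al (cadj a) y).
Hypothesis al_mul : forall a b x y, kap (al (cmul a b) x) y = kap (al a (al b x)) y.
Hypothesis al_lin : forall c a b x y,
  kap (al (c *: a + b) x) y = c * kap (al a x) y + kap (al b x) y.
Variables (H : hilbert R) (j : X -> H).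
Hypothesis jP : forall x y, ip (j x) (j y) = kap x y.
Hypothesis jT : cspan (range j) = setT.

(** Boundedness of the action comes from [vector_contraction]. The algebraic laws are asked for
    inside the kernel only, since labels such as [al (cmul a b) x] and [al a (al b x)] may
    differ. *)
Lemma kernel_representation : exists p : A -> H -> H,
  is_representation p /\ forall a x, p a (j x) = j (al a x).
Proof.
have jinj (u u' : H) : (forall y, ip u (j y) = ip u' (j y)) -> u = u'.
  by move=> h; apply: (ip_total jT) => _ [y _ <-].
have jlin c a b x : j (al (c *: a + b) x) = c *: j (al a x) + j (al b x).
  by apply: jinj => y; rewrite ip_linl !jP al_lin.
have jmul a b x : j (al (cmul a b) x) = j (al a (al b x)).
  by apply: jinj => y; rewrite !jP al_mul.
have jadj a x y : ip (j (al a x)) (j y) = ip (j x) (j (al (cadj a) y)).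
  by rewrite !jP al_adj.
(* The vector [s] is fixed and the algebra element varies, as the contraction principle requires. *)
pose T s a := lincomb (fun x => j (al a x)) s.
have Tlin s : is_linear (T s).
  move=> c a b; rewrite /T /lincomb scaler_sumr -big_split; apply: eq_bigr => p _ /=.
  by rewrite jlin scalerDr !scalerA mulrC.
have ipT s t a : ip (T s a) (lincomb j t) = ip (lincomb j s) (T t (cadj a)).
  rewrite /T /lincomb !ip_suml; apply: eq_bigr => p _; rewrite !ip_sumr.
  by apply: eq_bigr => q _; rewrite !ipZl !ipZr jadj.
have ipTT s a b : ip (T s a) (T s b) = ip (T s (cmul (cadj b) a)) (lincomb j s).
  rewrite /T /lincomb !ip_suml; apply: eq_bigr => p _; rewrite !ip_sumr.
  by apply: eq_bigr => q _; rewrite !ipZl !ipZr jmul [in RHS]jadj cadjK.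
have Tb s a : nrm (T s a) <= nrm a * nrm (lincomb j s).
  apply: vector_contraction => [||b]; [exact: Tlin | exact: ipTT |].
  by rewrite ipT cadjK.
have ex a : exists p : H -> H, [/\ is_linear p,
    forall x, p (j x) = j (al a x) & forall x, nrm (p x) <= nrm a * nrm x].
  have [||||p [pl pG pb]] := @ext_graph R H H
      (fun x y => exists s, x = lincomb j s /\ y = T s a) (nrm a).
  - exact: nrm_ge0.
  - move=> c x y x' y' [s [-> ->]] [t [-> ->]]; exists (kscale c s ++ t).
    by rewrite /T !lincomb_cat !lincomb_scale.
  - by move=> x x' [s [-> ->]].
  - by move=> x e e0; have [s hs] := dense_lincomb jT x e0;
      exists (lincomb j s), (T s a); split => //; exists s.
  exists p; split => // x; apply: pG; exists [:: (1, x)].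
  by rewrite /T /lincomb !big_seq1 /= !scale1r.
have [p hp] := choice ex; exists p.
have pl a : is_linear (p a) by case: (hp a).
have pj a x : p a (j x) = j (al a x) by case: (hp a).
have pb a x : nrm (p a x) <= nrm a * nrm x by case: (hp a).
have eq_on (f g : H -> H) (C : R) : is_linear f -> is_linear g ->
    (forall x, nrm (f x) <= C * nrm x) -> (forall x, nrm (g x) <= C * nrm x) ->
    (forall x, f (j x) = g (j x)) -> forall x, f x = g x.
  move=> lf lg bf bg fg x; apply/eqP; rewrite -subr_eq0; apply/eqP.
  pose d y := f y - g y; suff : [set y | d y = 0] x by [].
  apply: (cspanT_dense x jT) => [|_ [y _ <-] /=]; last by rewrite /d fg subrr.
  apply: (@closed_sub_zero _ _ _ _ (C + C)) => [c y z|y].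
    by rewrite /d lf lg scalerBr opprD addrACA.
  by rewrite mulrDl (le_trans (nrmB _ _)) // lerD.
split=> //; split => //.
- move=> c a b x.
  apply: (@eq_on (fun x => p (c *: a + b) x) (fun x => c *: p a x + p b x)
    (nrm (c *: a + b) + (cabs c * nrm a + nrm b))) => //.
  + by move=> d y z; rewrite !pl !scalerDr !scalerA (mulrC c) addrACA.
  + move=> y; apply: le_trans (pb _ _) _; rewrite ler_wpM2r ?nrm_ge0 // lerDl.
    by rewrite addr_ge0 ?mulr_ge0 ?cabs_ge0 ?nrm_ge0.
  + move=> y; apply: le_trans (nrmD _ _) _; rewrite nrmZ !mulrDl.
    have := ler_wpM2l (cabs_ge0 c) (pb a y); have := pb b y.
    have := mulr_ge0 (nrm_ge0 (c *: a + b)) (nrm_ge0 y); lra.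
  + by move=> y; rewrite !pj jlin.
- move=> a b; apply: (@eq_on _ (fun x => p a (p b x))
    (nrm (cmul a b) + nrm a * nrm b)) => //.
  + by apply: is_linear_comp.
  + move=> y; apply: le_trans (pb _ _) _; rewrite ler_wpM2r ?nrm_ge0 // lerDl.
    by rewrite mulr_ge0 ?nrm_ge0.
  + move=> y; apply: le_trans (pb _ _) _; rewrite mulrDl -mulrA.
    have := ler_wpM2l (nrm_ge0 a) (pb b y).
    have := mulr_ge0 (nrm_ge0 (cmul a b)) (nrm_ge0 y); lra.
  + by move=> y; rewrite !pj jmul.
- move=> a x y; apply/eqP; rewrite -subr_eq0; apply/eqP.
  pose f x : R[i]^o := ip (p a x) y - ip x (p (cadj a) y).
  have fl c u v : f (c *: u + v) = c *: f u + f v.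
    rewrite /f pl !ip_linl -[RHS]/(c * (ip (p a u) y - ip u (p (cadj a) y)) +
      (ip (p a v) y - ip v (p (cadj a) y))); ring.
  suff : [set x | f x = 0] x by [].
  have bnd (q : H -> H) (C : R) (z : H) : (forall x, nrm (q x) <= C * nrm x) ->
      forall x, cabs (ip (q x) z) <= C * nrm z * nrm x.
    move=> qb x'; apply: le_trans (ip_CS _ _) _.
    by rewrite mulrAC ler_wpM2r ?nrm_ge0.
  apply: (cspanT_dense x jT).
    apply: (@closed_sub_zero _ _ _ _ (nrm a * nrm y + nrm (p (cadj a) y))) => // u.
    rewrite mulrDl /f; apply: le_trans (cabsD _ _) _; rewrite cabsN lerD //.
      exact: bnd.
    by rewrite mulrC; exact: ip_CS.
  move=> _ [z _ <-] /=; rewrite /f.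
  apply/eqP; rewrite subr_eq0; apply/eqP.
  rewrite (ip_sym y) (ip_sym (p (cadj a) y)); congr (_ ^*).
  apply/eqP; rewrite -subr_eq0; apply/eqP.
  pose g x : R[i]^o := ip x (p a (j z)) - ip (p (cadj a) x) (j z).
  suff : [set x | g x = 0] y by [].
  apply: (cspanT_dense y jT).
    apply: (@closed_sub_zero _ _ _ _
      (nrm (p a (j z)) + nrm (cadj a) * nrm (j z))) => [c u w|u].
      rewrite /g pl !ip_linl -[RHS]/(c * (ip u (p a (j z)) - ip (p (cadj a) u) (j z)) +
        (ip w (p a (j z)) - ip (p (cadj a) w) (j z))); ring.
    rewrite mulrDl /g; apply: le_trans (cabsD _ _) _; rewrite cabsN lerD //.
      by rewrite mulrC; exact: ip_CS.
    exact: bnd.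
  move=> _ [w _ <-] /=; rewrite /g !pj jadj cadjK subrr //.
Qed.

End KernelRepresentation.

(** * Multiplier algebras *)

Section MultiplierAlgebra.
Variable R : realType.
Implicit Types A B D : cstar R.

Section One.
Variable A : cstar R.
Implicit Types (m n : multiplier A) (x y z : A).

Lemma multiplier_ext m n : (forall x, lact m x = lact n x) -> m = n.
Proof.
move=> h; have hl : lact m = lact n by apply/funext.
have hr : ract m = ract n.
  by apply/funext => x; apply: cmul_inj => y; rewrite -!lractP h.
case: m n {h} hl hr => [l r p] [l' r' p'] /= hl hr; subst l' r'.
by congr Multiplier; exact: Prop_irrelevance.
Qed.

Lemma lact_lin m : is_linear (lact m).
Proof.
move=> c x y; apply: cmul_injr => z.
by rewrite lractP cmul_linr cmul_linr !lractP.
Qed.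

Lemma lactM m x y : lact m (cmul x y) = cmul (lact m x) y.
Proof.
by apply: cmul_injr => z; rewrite lractP [RHS]cmulA lractP -cmulA.
Qed.

Lemma lact_adjE m x y : cmul (cadj x) (lact m y) = cmul (cadj (lact (mult_adj m) x)) y.
Proof. by rewrite lractP /= cadjK. Qed.

Lemma mult_adjK m : mult_adj (mult_adj m) = m.
Proof. by apply: multiplier_ext => x /=; rewrite !cadjK. Qed.

Definition cs_inner : inner A A.
Proof.
refine (@Inner R A A (fun x y => cmul (cadj x) y) (@cadj R A) _ _ _ _ _ _).
- by move=> c x y z; rewrite cmul_linr.
- by move=> x y; rewrite cadjM cadjK.
- by move=> x y; rewrite cadjB.
- by move=> c x; rewrite cadjZ.
- by move=> x y; apply: le_trans (nrmM _ _) _; rewrite nrm_adj.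
- by move=> x; rewrite nrm_cstar.
Defined.

(* The multiplier algebra as a C^*-algebra: the adjointable operators of [A], a
   Hilbert module over itself; [mul_of] identifies them with the bounded
   multipliers. *)
Definition Mcs : cstar R := op_cstar cs_inner.

Definition Mact (T : Mcs) : A -> A := bs_val T.

Lemma mul_of_subproof (T : Mcs) x y :
  cmul x (Mact T y) = cmul (cadj (Mact (cadj T) (cadj x))) y.
Proof. by have := op_adjP T (cadj x) y; rewrite /= cadjK => ->. Qed.

Definition mul_of (T : Mcs) : multiplier A := Multiplier (mul_of_subproof T).

Definition bounded_mult m : Prop :=
  exists C, wbound (@nrm R A) (lact m) C.

Lemma mul_of_inj : injective mul_of.
Proof.
move=> S T h; apply: val_inj; apply/funext => x.
exact: (congr1 (fun m => lact m x) h).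
Qed.

Lemma bounded_mult_adjointable m : bounded_mult m -> adjointable cs_inner (lact m).
Proof.
move=> bm; split => //; exists (fun x => cadj (ract m (cadj x))) => x y /=.
by rewrite cadjK lractP.
Qed.

Lemma mul_of_surj m : bounded_mult m -> exists T, mul_of T = m.
Proof.
by move=> /bounded_mult_adjointable bm; exists (mk_op bm); exact: multiplier_ext.
Qed.

Lemma mul_of_lin c S T :
  mul_of (c *: S + T) = multD (multZ c (mul_of S)) (mul_of T).
Proof. exact: multiplier_ext. Qed.

Lemma mul_ofM S T : mul_of (cmul S T) = multM (mul_of S) (mul_of T).
Proof. exact: multiplier_ext. Qed.

Lemma mul_ofJ T : mul_of (cadj T) = mult_adj (mul_of T).
Proof. by apply: multiplier_ext => x /=; rewrite !cadjK. Qed.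

Lemma mul_of1 : mul_of (op_one cs_inner) = mult1.
Proof. exact: multiplier_ext. Qed.

Lemma embed_bounded x : bounded_mult (mult_embed A x).
Proof. by exists (nrm x); split; [exact: nrm_ge0 | move=> y; exact: nrmM]. Qed.

Definition embM x : Mcs := mk_op (bounded_mult_adjointable (embed_bounded x)).

Lemma mul_of_embM x : mul_of (embM x) = mult_embed A x.
Proof. exact: multiplier_ext. Qed.

Lemma embM_hom : is_hom embM.
Proof.
split=> [c x y|x y|x]; apply: mul_of_inj; apply: multiplier_ext => z.
- by rewrite mul_of_lin !mul_of_embM /= cmul_linl.
- by rewrite mul_ofM !mul_of_embM /= cmulA.
- by rewrite mul_ofJ !mul_of_embM /= cadjM cadjK.
Qed.

Lemma embM_nrm x : nrm (embM x) = nrm x.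
Proof.
apply/eqP; rewrite eq_le; apply/andP; split.
  by apply: op_nrm_min; split; [exact: nrm_ge0 | move=> y; exact: nrmM].
have [/eqP x0|x0] := boolP (nrm x == 0); first by rewrite x0 nrm_ge0.
have xp : 0 < nrm x by rewrite lt_def x0 nrm_ge0.
have := op_nrm_le (embM x) (cadj x).
have -> : bs_val (embM x) (cadj x) = cmul x (cadj x) by [].
by rewrite nrm_cstarV nrm_adj expr2 ler_pM2r.
Qed.

End One.

Section Representations.
Variables (A : cstar R) (H : hilbert R) (p : A -> H -> H).
Hypothesis hp : is_representation p.

Lemma rep_linl v : is_linear (fun a => p a v).
Proof. by case: hp => _ h _ _ c a b; exact: h. Qed.

Lemma rep_contraction a v : nrm (p a v) <= nrm a * nrm v.
Proof.
have [_ _ pM pJ] := hp; apply: (vector_contraction (rep_linl v)) => [a' b|b].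
  by rewrite pM [RHS]pJ cadjK.
by rewrite [RHS]pJ cadjK.
Qed.

End Representations.

(** The Gelfand-Naimark-Segal construction is carried out on the multiplier algebra, whose unit
    gives the vector [j e], with [A] acting through [embM]. For a state attaining the norm of
    [a^* a], the vector [p a (j e)] has norm [|a|]. *)
Lemma gelfand_naimark A (a : A) (C : R) : 0 <= C ->
  (forall (H : hilbert R) (p : A -> H -> H) v, is_representation p ->
    nrm (p a v) <= C * nrm v) -> nrm a <= C.
Proof.
(* A nonzero [a] makes the unit of the multiplier algebra nonzero, hence of norm 1. *)
move=> C0 hC; have [a0|a0] := pselect (a = 0); first by rewrite a0 nrm0.
pose U := Mcs A; pose e : U := op_one (cs_inner A).
have e1 (x : U) : cmul e x = x /\ cmul x e = x := op_oneP x.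
have [eD eM eJ] := @embM_hom A.
have ne1 : nrm e = 1.
  have e0 : nrm e <> 0.
    move=> /nrm0_eq0 e0; apply: a0; apply: nrm0_eq0.
    by rewrite -embM_nrm -(e1 (embM a)).1 e0 cmul0l nrm0.
  have := nrm_cstar e; rewrite (unit_adj e1) (e1 e).1 expr2.
  by rewrite -{1}[nrm e]mulr1 => /mulfI -> //; apply/eqP.
have [f [fL fJ fP fa [r r1 fe]]] := state_exists e1 ne1 (adj_mul_pos e1 (embM a)).
pose kap (m n : U) := f (cmul (cadj n) m).
have kap_sym m n : kap n m = (kap m n)^* by rewrite /kap -fJ cadjM cadjK.
have f0 : f 0 = 0.
  by have := fL (-1) 0 0; rewrite !scaleN1r addr0 oppr0 mulN1r addNr.
have fZ c x : f (c *: x) = c * f x by have := fL c x 0; rewrite f0 !addr0.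
have fD x y : f (x + y) = f x + f y by have := fL 1 x y; rewrite scale1r mul1r.
have kap_psd s : 0 <= kform kap s s.
  have := fP (lincomb id s); congr (_ <= _).
  rewrite /lincomb cadj_sum cmul_sumr (big_morph f fD f0) /kform.
  apply: eq_bigr => p _; rewrite cmul_suml (big_morph f fD f0).
  apply: eq_bigr => q _; rewrite cadjZ cmulZl cmulZr !fZ /kap mulrA.
  by rewrite (mulrC q.1^*).
have [H [j [jP jT]]] := kolmogorov kap_sym kap_psd.
have [|||p [hp pj]] := @kernel_representation R U kap A
  (fun b m => cmul (embM b) m) _ _ _ H j jP jT.
- by move=> b x y; rewrite /kap eJ cadjM cadjK cmulA.
- by move=> b c x y; rewrite /kap eM -!cmulA.
- by move=> c b b' x y; rewrite /kap eD cmul_linl cmul_linr fL.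
have := hC H p (j e) hp.
have nj m : nrm (j m) ^+ 2 = complex.Re (f (cmul (cadj m) m)).
  by apply: complexI; rewrite -ip_nrm jP RRe_real // ger0_real // fP.
rewrite pj (e1 _).2.
have -> : nrm (j (embM a)) = nrm a.
  apply/eqP; rewrite -(@eqrXn2 _ 2) ?nrm_ge0 // nj fa.
  by rewrite -[complex.Re _]/(nrm _) nrm_cstar embM_nrm.
move=> /le_trans; apply; rewrite ler_piMr //.
rewrite -(@ler_pXn2r _ 2) ?nnegrE ?nrm_ge0 //.
by rewrite nj (unit_adj e1) (e1 e).1 fe expr1n.
Qed.

(** For each representation [p] and vector [v], the map [a |-> p (T a) v] meets the hypotheses of
    [vector_contraction], and representations recover the norm of [B]. With [T] built from a fixed
    formal combination, this bounds operators that are so far defined only on generators. *)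
Lemma cstar_contraction A B (T : A -> B) (y : B) : is_linear T ->
  (forall a b, cmul (cadj (T b)) (T a) = cmul (cadj y) (T (cmul (cadj b) a))) ->
  (forall a, cmul (cadj (T a)) y = cmul (cadj y) (T (cadj a))) ->
  forall a, nrm (T a) <= nrm a * nrm y.
Proof.
move=> Tl TT Ty a; apply: gelfand_naimark => [|H p v hp].
  by rewrite mulr_ge0 ?nrm_ge0.
have [pl plin pM pJ] := hp.
apply: le_trans (_ : nrm a * nrm (p y v) <= _); last first.
  by rewrite -mulrA ler_wpM2l ?nrm_ge0 // rep_contraction.
apply: (@vector_contraction R A H (fun a => p (T a) v) (p y v)) => [c b b'|b b'|b].
- by rewrite Tl plin.
- have swap z w u u' : ip (p z u) (p w u') = ip (p (cmul (cadj w) z) u) u'.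
    by rewrite pM [RHS]pJ cadjK.
  by rewrite !swap TT.
- have swap z w u u' : ip (p z u) (p w u') = ip (p (cmul (cadj w) z) u) u'.
    by rewrite pM [RHS]pJ cadjK.
  by rewrite !swap Ty.
Qed.

Section MultiplierHoms.
Variables (A B : cstar R) (f : A -> multiplier B).
Hypothesis hf : is_mhom f.

Lemma mhom_lin y : is_linear (fun a => lact (f a) y).
Proof. by case: hf => h _ _ c a b; rewrite h. Qed.

Lemma mhom_contraction a y : nrm (lact (f a) y) <= nrm a * nrm y.
Proof.
have [_ fM fJ] := hf.
apply: (cstar_contraction (T := fun a => lact (f a) y) (mhom_lin y)) => [b c|b].
  rewrite fM fJ.
  by rewrite [RHS](lact_adjE (mult_adj (f c)) y (lact (f b) y)) mult_adjK.
by rewrite fJ lact_adjE mult_adjK.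
Qed.

Lemma mhom_bounded a : bounded_mult (f a).
Proof.
by exists (nrm a); split; [exact: nrm_ge0 | move=> y; exact: mhom_contraction].
Qed.

(** The values are bounded multipliers, so the map can be studied as a homomorphism into the algebra
    [Mcs B], where norms and adjoints are available. *)
Lemma mhom_lift : exists2 F : A -> Mcs B, is_hom F & forall a, mul_of (F a) = f a.
Proof.
have [F hF] := choice (fun a => mul_of_surj (mhom_bounded a)).
have [fl fM fJ] := hf; exists F => //; split=> [c x y|x y|x]; apply: mul_of_inj.
- by rewrite hF fl mul_of_lin !hF.
- by rewrite hF fM mul_ofM !hF.
- by rewrite hF fJ mul_ofJ !hF.
Qed.

End MultiplierHoms.

Lemma hom_mhom A B (F : A -> Mcs B) : is_hom F -> is_mhom (fun a => mul_of (F a)).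
Proof.
move=> [Fl FM FJ]; split=> [c x y|x y|x].
- by rewrite Fl mul_of_lin.
- by rewrite FM mul_ofM.
- by rewrite FJ mul_ofJ.
Qed.

Lemma embed_mhom A : is_mhom (mult_embed A).
Proof.
have := hom_mhom (@embM_hom A).
by rewrite (_ : (fun a => _) = mult_embed A) //; apply/funext => a; exact: mul_of_embM.
Qed.

Lemma mhom_comp_hom A B D (f : B -> multiplier D) (g : A -> B) :
  is_mhom f -> is_hom g -> is_mhom (fun a => f (g a)).
Proof.
by move=> [fl fM fJ] [gl gM gJ]; split => *; rewrite ?gl ?gM ?gJ ?fl ?fM ?fJ.
Qed.

Lemma hom_comp A B D (f : B -> D) (g : A -> B) :
  is_hom f -> is_hom g -> is_hom (fun a => f (g a)).
Proof.
move=> [fl fM fJ] [gl gM gJ]; split=> [c x y|x y|x].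
- by rewrite gl fl.
- by rewrite gM fM.
- by rewrite gJ fJ.
Qed.

Lemma hom_contraction A B (f : A -> B) : is_hom f -> forall a, nrm (f a) <= nrm a.
Proof.
(* Evaluating at [cadj (f a)] turns the bound into [|f a|^2 <= |a| |f a|]. *)
move=> hf a; have := mhom_contraction (mhom_comp_hom (@embed_mhom B) hf) a (cadj (f a)).
rewrite /= nrm_cstarV nrm_adj expr2.
have [->|f0] := eqVneq (nrm (f a)) 0; first by rewrite nrm_ge0.
by rewrite ler_pM2r // lt_def f0 nrm_ge0.
Qed.

End MultiplierAlgebra.

(** * Tensor products *)

Section OperatorsOnHilbert.
Variables (R : realType) (H : hilbert R).

(** The arguments are exchanged: [inner] is linear in its second variable, [ip] in its first. *)
Definition hb_inner : inner H (R[i]^o).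
Proof.
refine (@Inner R H R[i]^o (fun x y => ip y x) (fun c => c^*) _ _ _ _ _ _).
- by move=> c x y z; exact: ip_linl.
- by move=> x y; exact: ip_sym.
- by move=> v w; exact: rmorphB.
- by move=> c v; exact: rmorphM.
- by move=> x y; rewrite mulrC; exact: ip_CS.
- by move=> x; rewrite ip_nrm /nrm -/(cabs _) cabsR ger0_norm ?sqr_ge0.
Defined.

Definition BH : cstar R := op_cstar hb_inner.

Definition Hact (T : BH) : H -> H := bs_val T.

Lemma Hact_lin T : is_linear (Hact T).
Proof. exact: op_lin. Qed.

Lemma Hact_le T x : nrm (Hact T x) <= nrm T * nrm x.
Proof. exact: op_nrm_le. Qed.

Lemma Hact_min T C : 0 <= C -> (forall x, nrm (Hact T x) <= C * nrm x) -> nrm T <= C.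
Proof. by move=> C0 h; apply: op_nrm_min. Qed.

Lemma Hact_ext (T T' : BH) : (forall x, Hact T x = Hact T' x) -> T = T'.
Proof. by move=> h; apply: val_inj; apply/funext. Qed.

Lemma Hact_linl x : is_linear (fun T => Hact T x).
Proof. by []. Qed.

Lemma HactL c S T x : Hact (c *: S + T) x = c *: Hact S x + Hact T x.
Proof. by []. Qed.

Lemma HactM S T x : Hact (cmul S T) x = Hact S (Hact T x).
Proof. by []. Qed.

Lemma Hact_adj T x y : ip (Hact T x) y = ip x (Hact (cadj T) y).
Proof. by have := op_adjP T y x => /= ->. Qed.

Lemma rep_op (A : cstar R) (p : A -> H -> H) : is_representation p ->
  exists2 F : A -> BH, is_hom F & forall a x, Hact (F a) x = p a x.
Proof.
move=> hp; have [pl plin pM pJ] := hp.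
have ad a : adjointable hb_inner (p a).
  split; first by exists (nrm a); split=> [|x]; [exact: nrm_ge0|exact: rep_contraction].
  by exists (p (cadj a)) => x y /=; rewrite -pJ.
pose F a : BH := mk_op (ad a).
exists F => //; split=> [c x y|x y|x].
- by apply: Hact_ext => v; exact: plin.
- by apply: Hact_ext => v; exact: pM.
- by apply/esym/op_adj_uniq => v w /=; rewrite pJ.
Qed.

Lemma op_rep (A : cstar R) (F : A -> BH) : is_hom F ->
  is_representation (fun a => Hact (F a)).
Proof.
move=> [Fl FM FJ]; split=> [a|c a b x|a b x|a x y].
- exact: Hact_lin.
- by rewrite Fl.
- by rewrite FM.
- by rewrite FJ Hact_adj.
Qed.

End OperatorsOnHilbert.

Section GramSchmidt.
Variables (R : realType) (H : hilbert R).

(** Serves twice: positivity of the tensor product kernel becomes a sum of squares, and vectors of a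
    Hilbert tensor product become columns with entries in the second factor. *)
Lemma gram_schmidt (s : seq H) : exists n (v : 'I_n -> H),
  (forall i j, ip (v i) (v j) = (i == j)%:R) /\
  forall h, h \in s -> h = \sum_k ip h (v k) *: v k.
Proof.
elim: s => [|h s [n [v [von vs]]]]; first by exists 0%N, (fun=> 0); split => // -[].
pose w := h - \sum_k ip h (v k) *: v k.
have wv j : ip w (v j) = 0.
  rewrite /w ipBl ip_suml (bigD1 j) //= ipZl von eqxx mulr1 big1 ?addr0 ?subrr //.
  by move=> i ij; rewrite ipZl von (negbTE ij) mulr0.
have [w0|w0] := eqVneq (nrm w) 0.
  exists n, v; split => // g; rewrite in_cons => /predU1P[->|/vs //].
  by apply/eqP; rewrite -subr_eq0 -/w (nrm0_eq0 w0).
have wp : 0 < nrm w by rewrite lt_def w0 nrm_ge0.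
pose u := (nrm w)^-1%:C *: w.
have uu : ip u u = 1.
  rewrite ipZl ipZr conj_Creal ?complex_real // ip_nrm -!rmorphM.
  by rewrite (_ : _ * _ = 1) ?rmorph1 //; field.
have uv j : ip u (v j) = 0 by rewrite ipZl wv mulr0.
have vu j : ip (v j) u = 0 by rewrite ip_sym uv rmorph0.
pose v' (k : 'I_n.+1) := if unlift ord_max k is Some j then v j else u.
have v'l j : v' (widen_ord (leqnSn n) j) = v j.
  have -> : widen_ord (leqnSn n) j = lift ord_max j by apply: val_inj; exact/esym/lift_max.
  by rewrite /v' liftK.
have v'm : v' ord_max = u by rewrite /v' unlift_none.
have sum_v' g : \sum_k ip g (v' k) *: v' k = \sum_k ip g (v k) *: v k + ip g u *: u.
  rewrite big_ord_recr /= v'm; congr (_ + _); apply: eq_bigr => k _.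
  by rewrite v'l.
exists n.+1, v'; split.
  move=> i j; rewrite /v'; case: unliftP => [i' ->|->]; case: unliftP => [j' ->|->].
  - by rewrite von (inj_eq lift_inj).
  - by rewrite vu eq_sym (negbTE (neq_lift _ _)).
  - by rewrite uv (negbTE (neq_lift _ _)).
  - by rewrite uu eqxx.
move=> g; rewrite in_cons sum_v' => /predU1P[->|gs].
  have hw : h = w + \sum_k ip h (v k) *: v k by rewrite /w subrK.
  have hu : ip h u = (nrm w)%:C.
    rewrite {1}hw ipDl ip_suml [X in _ + X]big1 => [|k _]; last first.
      by rewrite ipZl vu mulr0.
    rewrite addr0 ipZr conj_Creal ?complex_real // ip_nrm -rmorphM.
    by congr (_ %:C); field.
  rewrite hu scalerA -rmorphM mulfV // rmorph1 scale1r.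
  by rewrite {1}hw addrC.
have -> : ip g u = 0.
  by rewrite (vs _ gs) ip_suml big1 // => k _; rewrite ipZl vu mulr0.
by rewrite scale0r addr0; exact: vs.
Qed.

End GramSchmidt.

Section HilbertTensor.
Variables (R : realType) (H K : hilbert R).

Definition htens_kernel (x y : H * K) : R[i] := ip x.1 y.1 * ip x.2 y.2.

Lemma htens_kernel_sym x y : htens_kernel y x = (htens_kernel x y)^*.
Proof. by rewrite /htens_kernel rmorphM /= -!ip_sym. Qed.

Lemma htens_kernel_psd s : 0 <= kform htens_kernel s s.
Proof.
have [n [v [von vs]]] := gram_schmidt [seq p.2.1 | p <- s].
(* With the first legs expanded in the orthonormal family, the form is the sum of the [|w j|^2]. *)
pose w j := \sum_(p <- s) (p.1 * ip p.2.1 (v j)) *: p.2.2.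
have -> : kform htens_kernel s s = \sum_j ip (w j) (w j).
  transitivity (\sum_(p <- s) \sum_(q <- s) \sum_j
    (p.1 * ip p.2.1 (v j)) * ((q.1 * ip q.2.1 (v j))^* * ip p.2.2 q.2.2)).
    rewrite /kform; apply: eq_big_seq => p ps; apply: eq_big_seq => q qs.
    have pv := vs _ (map_f (fun p => p.2.1) ps).
    rewrite /htens_kernel {1}pv ip_suml mulr_suml mulr_sumr.
    apply: eq_bigr => j _; rewrite ipZl (ip_sym q.2.1 (v j)) rmorphM /=; ring.
  under eq_bigr do rewrite exchange_big /=.
  rewrite exchange_big /=; apply: eq_bigr => j _; rewrite /w ip_suml.
  apply: eq_bigr => p _; rewrite ipZl ip_sumr mulr_sumr; apply: eq_bigr => q _.
  by rewrite ipZr.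
by apply: sumr_ge0 => j _; rewrite ip_nrm ler0c sqr_ge0.
Qed.

Lemma htens_sig : {T : hilbert R & {t : H * K -> T |
  (forall x y, ip (t x) (t y) = htens_kernel x y) /\ cspan (range t) = setT}}.
Proof.
have [T hT] := cid (kolmogorov htens_kernel_sym htens_kernel_psd).
by exists T; exact: cid hT.
Qed.

Definition htens : hilbert R := projT1 htens_sig.
Definition htv (h : H) (k : K) : htens := sval (projT2 htens_sig) (h, k).

Lemma htv_ip h k h' k' : ip (htv h k) (htv h' k') = ip h h' * ip k k'.
Proof. exact: (svalP (projT2 htens_sig)).1. Qed.

Lemma htv_total : cspan (range (fun x : H * K => htv x.1 x.2)) = setT.
Proof.
have -> : (fun x : H * K => htv x.1 x.2) = sval (projT2 htens_sig).
  by apply/funext => -[].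
exact: (svalP (projT2 htens_sig)).2.
Qed.

Lemma htv_inj (u u' : htens) :
  (forall h k, ip u (htv h k) = ip u' (htv h k)) -> u = u'.
Proof. by move=> hu; apply: (ip_total htv_total) => _ [[h k] _ <-]; exact: hu. Qed.

Lemma htv_linl k : is_linear (htv ^~ k).
Proof.
by move=> c x y; apply: htv_inj => h' k'; rewrite ip_linl !htv_ip ip_linl; ring.
Qed.

Lemma htv_linr h : is_linear (htv h).
Proof.
by move=> c x y; apply: htv_inj => h' k'; rewrite ip_linl !htv_ip ip_linl; ring.
Qed.

Lemma htv_norm h k : nrm (htv h k) = nrm h * nrm k.
Proof.
apply/eqP; rewrite -(@eqrXn2 _ 2) ?mulr_ge0 ?nrm_ge0 //; apply/eqP.
by apply: complexI; rewrite -ip_nrm htv_ip !ip_nrm -rmorphM exprMn.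
Qed.

Lemma hilbert_tensor_normE (I : finType) (h : I -> H) (k : I -> K) :
  hilbert_tensor_norm h k = nrm (\sum_s htv (h s) (k s)).
Proof.
rewrite /hilbert_tensor_norm.
have -> : \sum_s \sum_t ip (h s) (h t) * ip (k s) (k t) =
    ip (\sum_s htv (h s) (k s)) (\sum_s htv (h s) (k s)).
  rewrite ip_suml; apply: eq_bigr => s _; rewrite ip_sumr; apply: eq_bigr => t _.
  by rewrite htv_ip.
by rewrite ip_nrm /= sqrtr_sqr ger0_norm ?nrm_ge0.
Qed.

Lemma htens_bound (T : BH htens) (C : R) : 0 <= C ->
  (forall s, nrm (Hact T (lincomb (fun x => htv x.1 x.2) s)) <=
    C * nrm (lincomb (fun x => htv x.1 x.2) s)) -> nrm T <= C.
Proof.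
move=> C0 h; apply: Hact_min => // x; apply: (@le_eps R (nrm T + C)).
  by rewrite addr_ge0 ?nrm_ge0.
move=> t t0 _; have [s xs] := dense_lincomb htv_total x t0.
set y := lincomb _ s in xs; have hy := h s; rewrite -/y in hy.
have := Hact_le T (x - y); rewrite (linB (Hact_lin T)).
have := nrm_tri (Hact T y) (Hact T x) 0; rewrite !subr0.
have := nrm_tri x y 0; rewrite !subr0 (nrm_distC y).
have := ler_wpM2l (nrm_ge0 T) (ltW xs).
move=> h1 h2 h3 h4.
have : C * nrm y <= C * (nrm x + t) by rewrite ler_wpM2l //; lra.
lra.
Qed.

End HilbertTensor.

Section TensorRepresentations.
Variables (R : realType) (A B : cstar R) (H K : hilbert R).
Variables (p : A -> H -> H) (q : B -> K -> K).
Hypotheses (hp : is_representation p) (hq : is_representation q).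

Lemma htens_rep_left : exists2 F : A -> BH (htens H K), is_hom F &
  forall a h k, Hact (F a) (htv h k) = htv (p a h) k.
Proof.
have [_ plin pM pJ] := hp.
have [||||P [hP Pj]] := @kernel_representation R (H * K) (@htens_kernel R H K) A
  (fun a x => (p a x.1, x.2)) _ _ _ (htens H K) (fun x => htv x.1 x.2) _ (htv_total H K).
- by move=> a x y; rewrite /htens_kernel /= pJ.
- by move=> a b x y; rewrite /htens_kernel /= pM.
- by move=> c a b x y; rewrite /htens_kernel /= plin ip_linl; ring.
- by move=> x y; exact: htv_ip.
have [F hF FP] := rep_op hP; exists F => // a h k.
by rewrite FP (Pj a (h, k)).
Qed.

Lemma htens_rep_right : exists2 F : B -> BH (htens H K), is_hom F &
  forall b h k, Hact (F b) (htv h k) = htv h (q b k).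
Proof.
have [_ qlin qM qJ] := hq.
have [||||P [hP Pj]] := @kernel_representation R (H * K) (@htens_kernel R H K) B
  (fun a x => (x.1, q a x.2)) _ _ _ (htens H K) (fun x => htv x.1 x.2) _ (htv_total H K).
- by move=> a x y; rewrite /htens_kernel /= qJ.
- by move=> a b x y; rewrite /htens_kernel /= qM.
- by move=> c a b x y; rewrite /htens_kernel /= qlin ip_linl; ring.
- by move=> x y; exact: htv_ip.
have [F hF FP] := rep_op hP; exists F => // a h k.
by rewrite FP (Pj a (h, k)).
Qed.

Lemma top_elt_ex : exists t : A * B -> BH (htens H K),
  (forall x h k, Hact (t x) (htv h k) = htv (p x.1 h) (q x.2 k)) /\
  forall x, nrm (t x) <= nrm x.1 * nrm x.2.
Proof.
have [F hF Fp] := htens_rep_left; have [F' hF' Fq] := htens_rep_right.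
exists (fun x => cmul (F x.1) (F' x.2)); split=> [x h k|x].
  by rewrite HactM Fq Fp.
apply: le_trans (nrmM _ _) _.
by apply: ler_pM; rewrite ?nrm_ge0 ?hom_contraction.
Qed.

End TensorRepresentations.

Definition top_elt R A B H K p q (hp : is_representation p)
  (hq : is_representation q) := projT1 (cid (@top_elt_ex R A B H K p q hp hq)).

Section MinimalTensorNorm.
Variables (R : realType) (A B : cstar R) (M : min_tensor A B).

Definition algt (s : seq (R[i] * (A * B))) : M :=
  lincomb (fun x => tensor_elt M x.1 x.2) s.

Section Reps.
Variables (H K : hilbert R) (p : A -> H -> H) (q : B -> K -> K).
Hypotheses (hp : is_representation p) (hq : is_representation q).
Local Notation t := (top_elt hp hq).

Lemma top_eltE x h k : Hact (t x) (htv h k) = htv (p x.1 h) (q x.2 k).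
Proof. exact: (projT2 (cid (top_elt_ex hp hq))).1. Qed.

Lemma top_elt_le x : nrm (t x) <= nrm x.1 * nrm x.2.
Proof. exact: (projT2 (cid (top_elt_ex hp hq))).2. Qed.

Lemma top_htensE (n m : nat) (a : 'I_n -> A) (b : 'I_n -> B)
    (h : 'I_m -> H) (k : 'I_m -> K) :
  hilbert_tensor_norm
    (fun s : ('I_n * 'I_m)%type => p (a (fst s)) (h (snd s)))
    (fun s : ('I_n * 'I_m)%type => q (b (fst s)) (k (snd s))) =
  nrm (Hact (\sum_i t (a i, b i)) (\sum_j htv (h j) (k j))).
Proof.
rewrite hilbert_tensor_normE -(pair_bigA _ (fun i j => htv (p (a i) (h j)) (q (b i) (k j)))).
congr nrm; rewrite (lin_sum (Hact_linl _)); apply: eq_bigr => i _.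
rewrite (lin_sum (Hact_lin _)); apply: eq_bigr => j _.
by rewrite top_eltE.
Qed.

End Reps.

Lemma spatial_norms_ub n (a : 'I_n -> A) (b : 'I_n -> B) :
  ubound (spatial_norms a b) (\sum_i nrm (a i) * nrm (b i)).
Proof.
move=> r [H [K [p [q [hp hq [m [h [k [h1 ->]]]]]]]]].
rewrite (top_htensE hp hq); apply: le_trans (Hact_le _ _) _.
rewrite hilbert_tensor_normE in h1.
apply: le_trans (_ : (\sum_i nrm (a i) * nrm (b i)) * 1 <= _); last by rewrite mulr1.
apply: ler_pM; rewrite ?nrm_ge0 //.
elim/big_rec2: _ => [|i x y _ xy]; first by rewrite nrm0.
apply: le_trans (nrmD _ _) _; apply: lerD => //.
exact: (top_elt_le hp hq (a i, b i)).
Qed.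

Definition top H K p q (hp : @is_representation R A H p)
  (hq : @is_representation R B K q) (s : seq (R[i] * (A * B))) := lincomb (top_elt hp hq) s.

Lemma top_elt_linl H K p q (hp : @is_representation R A H p)
    (hq : @is_representation R B K q) b : is_linear (fun a => top_elt hp hq (a, b)).
Proof.
have [_ plin _ _] := hp.
move=> c x y; apply: Hact_ext => z.
suff : [set z | Hact (top_elt hp hq (c *: x + y, b)) z -
  Hact (c *: top_elt hp hq (x, b) + top_elt hp hq (y, b)) z = 0] z.
  by move=> /eqP; rewrite subr_eq0 => /eqP.
apply: (cspanT_dense z (htv_total H K)) => [|_ [[h k] _ <-] /=].
  apply: (@closed_sub_zero _ _ _ _ (nrm (top_elt hp hq (c *: x + y, b)) +
    nrm (c *: top_elt hp hq (x, b) + top_elt hp hq (y, b)))) => [d u v|u].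
    by rewrite !Hact_lin scalerBr opprD addrACA.
  by rewrite mulrDl (le_trans (nrmB _ _)) // lerD // Hact_le.
rewrite -[X in _ - X]/(c *: Hact (top_elt hp hq (x, b)) (htv h k) +
  Hact (top_elt hp hq (y, b)) (htv h k)).
by rewrite !top_eltE /= plin htv_linl subrr.
Qed.

(** [spatial_norms] takes families indexed by ordinals and without coefficients, so the coefficients
    are absorbed into the first leg. *)
Lemma tensor_normE s : exists n (a : 'I_n -> A) (b : 'I_n -> B),
  [/\ algt s = \sum_i tensor_elt M (a i) (b i),
      nrm (algt s) = sup (spatial_norms a b) &
      forall H K p q (hp : @is_representation R A H p)
        (hq : @is_representation R B K q),
      top hp hq s = \sum_i top_elt hp hq (a i, b i)].
Proof.
pose f i := tnth (in_tuple s) i.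
exists (size s), (fun i => (f i).1 *: (f i).2.1), (fun i => (f i).2.2).
have e1 : algt s = \sum_i tensor_elt M ((f i).1 *: (f i).2.1) (f i).2.2.
  rewrite /algt /lincomb big_tnth; apply: eq_bigr => i _.
  by rewrite (linZ (tensor_linl M _)).
split => //; first by rewrite e1; exact: tensor_norm.
move=> H K p q hp hq; rewrite /top /lincomb big_tnth; apply: eq_bigr => i _.
rewrite (linZ (top_elt_linl hp hq _)) /f.
by case: (tnth _ _) => c [a b].
Qed.

Lemma spatial_norms_le_sup n (a : 'I_n -> A) (b : 'I_n -> B) r :
  spatial_norms a b r -> r <= sup (spatial_norms a b).
Proof.
move=> hr; apply: ub_le_sup => //; exists (\sum_i nrm (a i) * nrm (b i)).
exact: spatial_norms_ub.
Qed.

(** The spatial norm only sees algebraic vectors of norm at most 1, so a formal vector is divided by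
    its norm; [htens_bound] passes to the completion. *)
Lemma top_le H K p q (hp : @is_representation R A H p)
  (hq : @is_representation R B K q) s : nrm (top hp hq s) <= nrm (algt s).
Proof.
have [n [a [b [_ nE ->]]]] := tensor_normE s.
apply: htens_bound => [|t]; first exact: nrm_ge0.
set z := lincomb _ t; have [z0|z0] := eqVneq (nrm z) 0.
  by rewrite (nrm0_eq0 z0) (lin0 (Hact_lin _)) !nrm0 mulr0.
have zp : 0 < nrm z by rewrite lt_def z0 nrm_ge0.
rewrite -ler_pdivrMr //; set T := \sum_i _.
pose z1 := (nrm z)^-1%:C *: z.
have -> : nrm (Hact T z) / nrm z = nrm (Hact T z1).
  by rewrite (linZ (Hact_lin T)) nrmZr ?invr_ge0 ?nrm_ge0 // mulrC.
rewrite nE; apply: spatial_norms_le_sup; exists H, K, p, q; split => //.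
pose f i := tnth (in_tuple t) i.
pose h0 i := ((nrm z)^-1%:C * (f i).1) *: (f i).2.1; pose k0 i := (f i).2.2.
exists (size t), h0, k0; have z1E : \sum_j htv (h0 j) (k0 j) = z1.
  rewrite /z1 /h0 /k0; move: ((nrm z)^-1%:C) => r.
  rewrite /z /lincomb [in RHS]big_tnth scaler_sumr; apply: eq_bigr => i _.
  by rewrite (linZ (htv_linl _)) scalerA.
split; last by rewrite (top_htensE hp hq) z1E.
rewrite hilbert_tensor_normE z1E nrmZr ?invr_ge0 ?nrm_ge0 //.
by rewrite mulVf.
Qed.

Lemma algt_nrm_min s (C : R) : 0 <= C ->
  (forall H K p q (hp : @is_representation R A H p)
    (hq : @is_representation R B K q), nrm (top hp hq s) <= C) ->
  nrm (algt s) <= C.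
Proof.
move=> C0 h; have [n [a [b [_ -> topE]]]] := tensor_normE s.
(* Without [has_sup] the value of [sup] is 0 by convention. *)
have [hs|hs] := pselect (has_sup (spatial_norms a b)); last by rewrite sup_out.
apply: sup_le_ub; first by case: hs.
move=> r [H [K [p [q [hp hq [m [hh [k [h1 ->]]]]]]]]].
rewrite (top_htensE hp hq) -topE; apply: le_trans (Hact_le _ _) _.
rewrite hilbert_tensor_normE in h1.
by rewrite -[C]mulr1; apply: ler_pM; rewrite ?nrm_ge0 ?h.
Qed.

End MinimalTensorNorm.

Section LincombPairs.
Variable R : realType.

Definition lpair (X Y : Type) (s : seq (R[i] * X)) (t : seq (R[i] * Y)) :
  seq (R[i] * (X * Y)) := [seq (p.1 * q.1, (p.2, q.2)) | p <- s, q <- t].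

Lemma lincomb_pair (X Y : Type) (V : lmodType R[i]) (f : X * Y -> V) s t :
  lincomb f (lpair s t) = lincomb (fun x => lincomb (fun y => f (x, y)) t) s.
Proof.
rewrite /lincomb big_allpairs_dep /=; apply: eq_bigr => p _.
by rewrite scaler_sumr; apply: eq_bigr => q _; rewrite scalerA.
Qed.

Lemma lincomb_map (X Y : Type) (V : lmodType R[i]) (f : Y -> V) (h : X -> Y) s :
  lincomb f [seq (p.1, h p.2) | p <- s] = lincomb (fun x => f (h x)) s.
Proof. by rewrite /lincomb big_map. Qed.

Lemma lincomb_lin (X : Type) (V W : lmodType R[i]) (T : V -> W) (f : X -> V) s :
  is_linear T -> T (lincomb f s) = lincomb (fun x => T (f x)) s.
Proof.
move=> Tl; rewrite /lincomb (lin_sum Tl); apply: eq_bigr => p _.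
by rewrite (linZ Tl).
Qed.

Lemma eq_lincomb (X : Type) (V : lmodType R[i]) (f g : X -> V) s :
  (forall x, f x = g x) -> lincomb f s = lincomb g s.
Proof. by move=> fg; apply: eq_bigr => p _; rewrite fg. Qed.

Lemma ip_lincomb (X Y : Type) (H : hilbert R) (f : X -> H) (g : Y -> H) s t :
  ip (lincomb f s) (lincomb g t) =
  \sum_(p <- s) \sum_(q <- t) p.1 * q.1^* * ip (f p.2) (g q.2).
Proof.
rewrite /lincomb ip_suml; apply: eq_bigr => p _; rewrite ip_sumr.
by apply: eq_bigr => q _; rewrite ipZl ipZr mulrA.
Qed.

(** Comparing Gram matrices replaces the construction of isometries between the Hilbert spaces
    involved. *)
Lemma nrm_lincomb_gram (X : Type) (H K : hilbert R) (f : X -> H) (g : X -> K) s :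
  (forall x y, ip (f x) (f y) = ip (g x) (g y)) ->
  nrm (lincomb f s) = nrm (lincomb g s).
Proof.
move=> fg; apply/eqP; rewrite -(@eqrXn2 _ 2) ?nrm_ge0 //; apply/eqP.
apply: complexI; rewrite -!ip_nrm !ip_lincomb.
by apply: eq_bigr => p _; apply: eq_bigr => q _; rewrite fg.
Qed.

Lemma gram_psd (X : Type) (H : hilbert R) (f : X -> H) s :
  0 <= kform (fun x y => ip (f x) (f y)) s s.
Proof.
by have := ip_lincomb f f s s; rewrite ip_nrm /kform => <-; rewrite ler0c sqr_ge0.
Qed.

End LincombPairs.

Section MactBasics.
Variables (R : realType) (A : cstar R).
Implicit Types (S T : Mcs A) (x y : A).

Lemma Mact_lin T : is_linear (Mact T).
Proof. exact: op_lin. Qed.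

Lemma MactL c S T x : Mact (c *: S + T) x = c *: Mact S x + Mact T x.
Proof. by []. Qed.

Lemma MactC S T x : Mact (cmul S T) x = Mact S (Mact T x).
Proof. by []. Qed.

Lemma Mact_le T x : nrm (Mact T x) <= nrm T * nrm x.
Proof. exact: op_nrm_le. Qed.

Lemma Mact_adj T x y : cmul (cadj x) (Mact T y) = cmul (cadj (Mact (cadj T) x)) y.
Proof. by have := op_adjP T x y. Qed.

Lemma MactM T x y : Mact T (cmul x y) = cmul (Mact T x) y.
Proof. exact: (lactM (mul_of T)). Qed.

Lemma Mact_ext S T : (forall x, Mact S x = Mact T x) -> S = T.
Proof. by move=> h; apply: val_inj; apply/funext. Qed.

Lemma Mact_embM x y : Mact (embM x) y = cmul x y.
Proof. by []. Qed.

Lemma lact_mul_of T : lact (mul_of T) = Mact T.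
Proof. by []. Qed.

End MactBasics.

Section ClosedEq.
Variable R : realType.

Lemma closed_eq (V W : completeNormedModType R[i]) (f g : V -> W) (C : R) :
  is_linear f -> is_linear g -> (forall x, nrm (f x) <= C * nrm x) ->
  (forall x, nrm (g x) <= C * nrm x) -> closed_sub [set x | f x = g x].
Proof.
move=> lf lg bf bg.
have -> : [set x | f x = g x] = [set x | f x - g x = 0].
  rewrite predeqE => x; split=> /= [->|/eqP]; first by rewrite subrr.
  by rewrite subr_eq0 => /eqP.
apply: (@closed_sub_zero _ _ _ _ (C + C)) => [c x y|x].
  by rewrite lf lg scalerBr opprD addrACA.
by rewrite mulrDl (le_trans (nrmB _ _)) // lerD.
Qed.

End ClosedEq.

Section HomOfGenerators.
Variables (R : realType) (X : Type) (M D : cstar R) (g : X -> M) (L : X -> D).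
Variables (mX : X -> X -> X) (jX : X -> X).
Hypothesis g_dense : cspan (range g) = setT.

Lemma generated_ind (P : set M) : closed_sub P -> (forall x, P (g x)) -> forall z, P z.
Proof.
by move=> cP Pg z; apply: (cspanT_dense z g_dense cP) => _ [x _ <-]; exact: Pg.
Qed.

Lemma generated_eq (W : completeNormedModType R[i]) (f h : M -> W) (C : R) :
  is_linear f -> is_linear h -> (forall x, nrm (f x) <= C * nrm x) ->
  (forall x, nrm (h x) <= C * nrm x) -> (forall x, f (g x) = h (g x)) ->
  forall z, f z = h z.
Proof.
move=> lf lh bf bh fh z; apply: (cspanT_dense z g_dense (closed_eq lf lh bf bh)).
by move=> _ [x _ <-]; exact: fh.
Qed.

Lemma generated_Mcs_ext (S T : Mcs M) :
  (forall x, Mact S (g x) = Mact T (g x)) -> S = T.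
Proof.
move=> h; apply: Mact_ext; apply: (generated_eq (C := nrm S + nrm T)) h.
- exact: Mact_lin.
- exact: Mact_lin.
- by move=> x; apply: le_trans (Mact_le _ _) _; rewrite ler_wpM2r ?nrm_ge0 // lerDl nrm_ge0.
- by move=> x; apply: le_trans (Mact_le _ _) _; rewrite ler_wpM2r ?nrm_ge0 // lerDr nrm_ge0.
Qed.

Lemma generated_adj_ext (W W' : Mcs M) :
  (forall x y, cmul (cadj (Mact W' (g x))) (g y) = cmul (cadj (g x)) (Mact W (g y))) -> W' = cadj W.
Proof.
move=> h; apply: generated_Mcs_ext => x.
apply: (can_inj (@cadjK R M)); apply: cmul_inj => z; rewrite -Mact_adj.
move: z; apply: (generated_eq (C := nrm (Mact W' (g x)) + nrm (g x) * nrm W)).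
- by move=> c u v; rewrite cmul_linr.
- by move=> c u v; rewrite (Mact_lin W) cmul_linr.
- move=> u; apply: le_trans (nrmM _ _) _; rewrite nrm_adj mulrDl lerDl.
  by rewrite !mulr_ge0 ?nrm_ge0.
- move=> u; apply: le_trans (nrmM _ _) _; rewrite nrm_adj mulrDl -mulrA.
  have := ler_wpM2l (nrm_ge0 (g x)) (Mact_le W u).
  by have := mulr_ge0 (nrm_ge0 (Mact W' (g x))) (nrm_ge0 u); lra.
by move=> y; exact: h.
Qed.

(** [f] and its prospective adjoint [f'] are both extended by density, and the adjoint relation is
    then verified one variable at a time. *)
Lemma generated_operator (f f' : X -> M) (C : R) : 0 <= C ->
  (forall s, nrm (lincomb f s) <= C * nrm (lincomb g s)) ->
  (forall s, nrm (lincomb f' s) <= C * nrm (lincomb g s)) ->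
  (forall x y, cmul (cadj (f' x)) (g y) = cmul (cadj (g x)) (f y)) ->
  exists T : Mcs M, forall x, Mact T (g x) = f x.
Proof.
have ext (h : X -> M) : 0 <= C ->
    (forall s, nrm (lincomb h s) <= C * nrm (lincomb g s)) ->
    exists T : M -> M, [/\ is_linear T, forall x, T (g x) = h x &
      forall x, nrm (T x) <= C * nrm x].
  move=> C0 hh; have [||||T [Tl TG Tb]] := @ext_graph R M M
    (fun x y => exists s, x = lincomb g s /\ y = lincomb h s) C.
  - exact: C0.
  - move=> c x y x' y' [s [-> ->]] [t [-> ->]]; exists (kscale c s ++ t).
    by rewrite !lincomb_cat !lincomb_scale.
  - by move=> x x' [s [-> ->]].
  - by move=> x e e0; have [s hs] := dense_lincomb g_dense x e0;
      exists (lincomb g s), (lincomb h s); split => //; exists s.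
  exists T; split => // x; apply: TG; exists [:: (1, x)].
  by rewrite /lincomb !big_seq1 /= !scale1r.
move=> C0 hf hf' ff'; have [T [Tl Te Tb]] := ext f C0 hf.
have [T' [Tl' Te' Tb']] := ext f' C0 hf'.
have adj : adjoint_pair (cs_inner M) T T'.
  move=> x y /=.
  have lx : is_linear (fun x => cmul (cadj y) (T' x)).
    by move=> c u v; rewrite Tl' cmul_linr.
  suff : [set x | cmul (cadj y) (T' x) = cmul (cadj (T y)) x] x.
    by move=> /(congr1 (@cadj R M)); rewrite !cadjM !cadjK.
  move: x; apply: generated_ind.
    apply: (closed_eq (C := nrm y * C + nrm (T y))) => // [c u v|u|u].
    - by rewrite cmul_linr.
    - apply: le_trans (nrmM _ _) _; rewrite nrm_adj mulrDl.
      have := ler_wpM2l (nrm_ge0 y) (Tb' u).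
      by have := mulr_ge0 (nrm_ge0 (T y)) (nrm_ge0 u); lra.
    - apply: le_trans (nrmM _ _) _; rewrite nrm_adj mulrDl lerDr.
      by rewrite !mulr_ge0 ?nrm_ge0.
  move=> a /=; rewrite Te'.
  suff : [set y | cmul (cadj (f' a)) y = cmul (cadj (g a)) (T y)] y.
    by move=> /(congr1 (@cadj R M)); rewrite !cadjM !cadjK.
  move: y lx => y _; move: y; apply: generated_ind.
    apply: (closed_eq (C := nrm (f' a) + nrm (g a) * C)) => [c u v|c u v|u|u].
    - by rewrite cmul_linr.
    - by rewrite Tl cmul_linr.
    - apply: le_trans (nrmM _ _) _; rewrite nrm_adj mulrDl lerDl.
      by rewrite !mulr_ge0 ?nrm_ge0.
    - apply: le_trans (nrmM _ _) _; rewrite nrm_adj mulrDl.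
      have := ler_wpM2l (nrm_ge0 (g a)) (Tb u).
      by have := mulr_ge0 (nrm_ge0 (f' a)) (nrm_ge0 u); lra.
  by move=> b /=; rewrite Te ff'.
have aT : adjointable (cs_inner M) T by split; [exists C | exists T'].
by exists (mk_op aT).
Qed.

Lemma hom_of_generators :
  (forall x y, cmul (g x) (g y) = g (mX x y)) -> (forall x, cadj (g x) = g (jX x)) ->
  (forall x y, cmul (L x) (L y) = L (mX x y)) -> (forall x, cadj (L x) = L (jX x)) ->
  (forall s, nrm (lincomb L s) <= nrm (lincomb g s)) ->
  exists2 F : M -> D, is_hom F & forall x, F (g x) = L x.
Proof.
move=> gM gJ LM LJ Lb.
have [||||F [Fl FG Fb]] := @ext_graph R M D
  (fun x y => exists s, x = lincomb g s /\ y = lincomb L s) 1.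
- exact: ler01.
- move=> c x y x' y' [s [-> ->]] [t [-> ->]]; exists (kscale c s ++ t).
  by rewrite !lincomb_cat !lincomb_scale.
- by move=> x x' [s [-> ->]]; rewrite mul1r; exact: Lb.
- by move=> x e e0; have [s hs] := dense_lincomb g_dense x e0;
    exists (lincomb g s), (lincomb L s); split => //; exists s.
have FE x : F (g x) = L x.
  by apply: FG; exists [:: (1, x)]; rewrite /lincomb !big_seq1 /= !scale1r.
exists F => //; split => //.
- move=> x y; move: x; apply: (generated_eq (C := nrm y)).
  + by move=> c u v; rewrite cmul_linl Fl.
  + by move=> c u v; rewrite Fl cmul_linl.
  + move=> u; apply: le_trans (Fb _) _; rewrite mul1r mulrC; exact: nrmM.
  + move=> u; apply: le_trans (nrmM _ _) _; rewrite mulrC.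
    by apply: ler_pM; rewrite ?nrm_ge0 //; have := Fb u; have := Fb y; rewrite !mul1r.
  move=> a; move: y; apply: (generated_eq (C := nrm (g a))).
  + by move=> c u v; rewrite cmul_linr Fl.
  + by move=> c u v; rewrite Fl cmul_linr.
  + move=> u; apply: le_trans (Fb _) _; rewrite mul1r; exact: nrmM.
  + move=> u; apply: le_trans (nrmM _ _) _.
    by apply: ler_pM; rewrite ?nrm_ge0 //; have := Fb u; have := Fb (g a); rewrite !mul1r.
  by move=> b; rewrite gM !FE LM.
- suff h x : cadj (F (cadj x)) = F x by move=> x; rewrite -h cadjK.
  move: x; apply: (generated_eq (C := 1)) => //.
  + by move=> c u v; rewrite cadj_antilin Fl cadj_antilin conjCK.
  + by move=> u; rewrite nrm_adj; have := Fb (cadj u); rewrite nrm_adj.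
  by move=> x; rewrite gJ !FE -LJ cadjK.
Qed.

End HomOfGenerators.

Section TensorBasics.
Variables (R : realType) (A B : cstar R) (M : min_tensor A B).
Local Notation "a ⊗ b" := (tensor_elt M a b) (at level 35).

Lemma tensor_range_dense : cspan (range (fun x : A * B => x.1 ⊗ x.2)) = setT.
Proof.
rewrite -(tensor_dense M); congr cspan; rewrite predeqE => z; split.
  by move=> [[a b] _ <-]; exists a, b.
by move=> [a [b ->]]; exists (a, b).
Qed.

Lemma tensor_ind (D : set M) : closed_sub D -> (forall a b, D (a ⊗ b)) ->
  forall z, D z.
Proof.
move=> cD Dab z; apply: (cspanT_dense z tensor_range_dense cD).
by move=> _ [[a b] _ <-]; exact: Dab.
Qed.

Lemma tensor_eq (W : completeNormedModType R[i]) (f g : M -> W) (C : R) :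
  is_linear f -> is_linear g -> (forall x, nrm (f x) <= C * nrm x) ->
  (forall x, nrm (g x) <= C * nrm x) -> (forall a b, f (a ⊗ b) = g (a ⊗ b)) ->
  forall z, f z = g z.
Proof. by move=> lf lg bf bg fg z; exact: (tensor_ind (closed_eq lf lg bf bg) fg). Qed.

Lemma Mcs_tensor_ext (S T : Mcs M) :
  (forall a b, Mact S (a ⊗ b) = Mact T (a ⊗ b)) -> S = T.
Proof. by move=> h; apply: (generated_Mcs_ext tensor_range_dense) => -[a b]; exact: h. Qed.

Lemma Mcs_adj_ext (W W' : Mcs M) :
  (forall x y, cmul (cadj (Mact W' (x.1 ⊗ x.2))) (y.1 ⊗ y.2) =
               cmul (cadj (x.1 ⊗ x.2)) (Mact W (y.1 ⊗ y.2))) -> W' = cadj W.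
Proof. exact: (generated_adj_ext tensor_range_dense). Qed.

Lemma tensor_operator (f f' : A * B -> M) (C : R) : 0 <= C ->
  (forall s, nrm (lincomb f s) <= C * nrm (algt M s)) ->
  (forall s, nrm (lincomb f' s) <= C * nrm (algt M s)) ->
  (forall x y, cmul (cadj (f' x)) (y.1 ⊗ y.2) = cmul (cadj (x.1 ⊗ x.2)) (f y)) ->
  exists T : Mcs M, forall a b, Mact T (a ⊗ b) = f (a, b).
Proof.
move=> C0 hf hf' ff'.
have [T hT] := generated_operator tensor_range_dense C0 hf hf' ff'.
by exists T => a b; rewrite (hT (a, b)).
Qed.

Lemma tensor_mult_left : exists L : Mcs A -> Mcs M, forall T a b,
  Mact (L T) (a ⊗ b) = Mact T a ⊗ b.
Proof.
suff ex T : exists L : Mcs M, forall a b, Mact L (a ⊗ b) = Mact T a ⊗ b.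
  by have [L hL] := choice ex; exists L.
(* For fixed [s] the left side is linear in [S], and [S] moves across products of elementary tensors
   as an adjoint, so this is an instance of [cstar_contraction]. *)
have bd (S : Mcs A) s : nrm (lincomb (fun x => Mact S x.1 ⊗ x.2) s) <=
    nrm S * nrm (algt M s).
  apply: (cstar_contraction (T := fun S => lincomb (fun x => Mact S x.1 ⊗ x.2) s)).
  - move=> c S1 S2; rewrite /lincomb scaler_sumr -big_split.
    apply: eq_bigr => p _; cbv beta; rewrite MactL.
    by rewrite (tensor_linl M _ c) scalerDr !scalerA (mulrC c).
  - move=> S1 S2; rewrite /algt /lincomb !cadj_sum !cmul_suml.
    apply: eq_bigr => p _; rewrite !cmul_sumr; apply: eq_bigr => q _.
    rewrite !cadjZ !cmulZl !cmulZr !tensor_adj !tensor_mul; congr (_ *: (_ *: (_ ⊗ _))).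
    by rewrite MactC [RHS]Mact_adj cadjK.
  - move=> S1; rewrite /algt /lincomb !cadj_sum !cmul_suml.
    apply: eq_bigr => p _; rewrite !cmul_sumr; apply: eq_bigr => q _.
    rewrite !cadjZ !cmulZl !cmulZr !tensor_adj !tensor_mul; congr (_ *: (_ *: (_ ⊗ _))).
    by rewrite [RHS]Mact_adj cadjK.
apply: (@tensor_operator (fun x => Mact T x.1 ⊗ x.2)
  (fun x => Mact (cadj T) x.1 ⊗ x.2) (nrm T)) => //.
- exact: nrm_ge0.
- by move=> s; have := bd (cadj T) s; rewrite nrm_adj.
- by move=> x y; rewrite !tensor_adj !tensor_mul Mact_adj.
Qed.

Lemma tensor_mult_right : exists L : Mcs B -> Mcs M, forall T a b,
  Mact (L T) (a ⊗ b) = a ⊗ Mact T b.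
Proof.
suff ex T : exists L : Mcs M, forall a b, Mact L (a ⊗ b) = a ⊗ Mact T b.
  by have [L hL] := choice ex; exists L.
have bd (S : Mcs B) s : nrm (lincomb (fun x => x.1 ⊗ Mact S x.2) s) <=
    nrm S * nrm (algt M s).
  apply: (cstar_contraction (T := fun S => lincomb (fun x => x.1 ⊗ Mact S x.2) s)).
  - move=> c S1 S2; rewrite /lincomb scaler_sumr -big_split.
    apply: eq_bigr => p _; cbv beta; rewrite MactL.
    by rewrite (tensor_linr M _ c) scalerDr !scalerA (mulrC c).
  - move=> S1 S2; rewrite /algt /lincomb !cadj_sum !cmul_suml.
    apply: eq_bigr => p _; rewrite !cmul_sumr; apply: eq_bigr => q _.
    rewrite !cadjZ !cmulZl !cmulZr !tensor_adj !tensor_mul; congr (_ *: (_ *: (_ ⊗ _))).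
    by rewrite MactC [RHS]Mact_adj cadjK.
  - move=> S1; rewrite /algt /lincomb !cadj_sum !cmul_suml.
    apply: eq_bigr => p _; rewrite !cmul_sumr; apply: eq_bigr => q _.
    rewrite !cadjZ !cmulZl !cmulZr !tensor_adj !tensor_mul; congr (_ *: (_ *: (_ ⊗ _))).
    by rewrite [RHS]Mact_adj cadjK.
apply: (@tensor_operator (fun x => x.1 ⊗ Mact T x.2)
  (fun x => x.1 ⊗ Mact (cadj T) x.2) (nrm T)) => //.
- exact: nrm_ge0.
- by move=> s; have := bd (cadj T) s; rewrite nrm_adj.
- by move=> x y; rewrite !tensor_adj !tensor_mul Mact_adj.
Qed.

Lemma tensor_mult : exists L : Mcs A -> Mcs B -> Mcs M, forall S T a b,
  Mact (L S T) (a ⊗ b) = Mact S a ⊗ Mact T b.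
Proof.
have [L hL] := tensor_mult_left; have [L' hL'] := tensor_mult_right.
by exists (fun S T => cmul (L S) (L' T)) => S T a b; rewrite MactC hL' hL.
Qed.

Lemma hom_of_elementary (D : cstar R) (L : A * B -> D) :
  (forall x y, cmul (L x) (L y) = L (cmul x.1 y.1, cmul x.2 y.2)) ->
  (forall x, cadj (L x) = L (cadj x.1, cadj x.2)) ->
  (forall s, nrm (lincomb L s) <= nrm (algt M s)) ->
  exists2 F : M -> D, is_hom F & forall a b, F (a ⊗ b) = L (a, b).
Proof.
move=> LM LJ Lb; have [||F hF FE] := @hom_of_generators R (A * B)%type M D
  (fun x => x.1 ⊗ x.2) L (fun x y => (cmul x.1 y.1, cmul x.2 y.2))
  (fun x => (cadj x.1, cadj x.2)) tensor_range_dense _ _ LM LJ Lb.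
- by move=> x y; rewrite tensor_mul.
- by move=> x; rewrite tensor_adj.
by exists F => // a b; rewrite (FE (a, b)).
Qed.

End TensorBasics.

Section PulledBackRepresentation.
Variables (R : realType) (A A' : cstar R) (f : A -> Mcs A').
Hypothesis hf : is_hom f.
Variables (H' : hilbert R) (p' : A' -> H' -> H').
Hypothesis hp' : is_representation p'.

(** Formally [j x h] is the vector [p' x h] and [p] is [p'] composed with [f]. On vectors of this
    shape a multiplier acts through [x], which bypasses the extension of [p'] to multipliers. *)
Lemma pulled_back_representation : exists (H : hilbert R) (p : A -> H -> H)
    (j : A' -> H' -> H), [/\ is_representation p,
  forall x h y k, ip (j x h) (j y k) = ip (p' x h) (p' y k) &
  forall a x h, p a (j x h) = j (Mact (f a) x) h].
Proof.
have [fl fM fJ] := hf; have [pl plin pM pJ] := hp'.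
pose kap (x y : A' * H') := ip (p' x.1 x.2) (p' y.1 y.2).
have ks x y : kap y x = (kap x y)^* by rewrite /kap -ip_sym.
have kp s : 0 <= kform kap s s := gram_psd (fun x => p' x.1 x.2) s.
have [H [j [jP jT]]] := kolmogorov ks kp.
have swap z w u u' : ip (p' z u) (p' w u') = ip (p' (cmul (cadj w) z) u) u'.
  by rewrite pM [RHS]pJ cadjK.
have [|||p [hp pj]] := @kernel_representation R (A' * H') kap A
  (fun a x => (Mact (f a) x.1, x.2)) _ _ _ H j jP jT.
- by move=> a x y; rewrite /kap /= !swap fJ Mact_adj.
- by move=> a b x y; rewrite /kap /= fM.
- by move=> c a b x y; rewrite /kap /= fl MactL plin ip_linl.
by exists H, p, (fun x h => j (x, h)).
Qed.

End PulledBackRepresentation.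

Section TensorOfHoms.
Variables (R : realType) (A B A' B' : cstar R).
Variables (M : min_tensor A B) (M' : min_tensor A' B').
Variables (f : A -> Mcs A') (g : B -> Mcs B').
Hypotheses (hf : is_hom f) (hg : is_hom g).
Local Notation "a ⊗ b" := (tensor_elt M a b) (at level 35).
Local Notation "a ⊗' b" := (tensor_elt M' a b) (at level 35).

(** [W] is tested on algebraic tensors in product representations of [A'] and [B']. The vectors [V1]
    met there have the same Gram matrix as the vectors [V2] in the tensor product of the pulled back
    representations, where [top_le] bounds the operator by the norm of [s]; [V3] and [V4] lead
    back. *)
Lemma tensor_of_homs_bound (L : A * B -> Mcs M') :
  (forall a b x y, Mact (L (a, b)) (x ⊗' y) = Mact (f a) x ⊗' Mact (g b) y) ->
  forall s, nrm (lincomb L s) <= nrm (algt M s).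
Proof.
move=> hL s; set W := lincomb L s.
have alg t : nrm (Mact W (algt M' t)) <= nrm (algt M s) * nrm (algt M' t).
  pose fg (x : A * B * (A' * B')) := (Mact (f x.1.1) x.2.1, Mact (g x.1.2) x.2.2).
  pose u := [seq (r.1, fg r.2) | r <- lpair s t].
  have -> : Mact W (algt M' t) = algt M' u.
    rewrite /algt (lincomb_lin _ _ (Mact_lin W)) /u lincomb_map lincomb_pair.
    rewrite /W.
    have -> : lincomb (fun x => Mact (lincomb L s) (x.1 ⊗' x.2)) t =
        lincomb (fun y => lincomb (fun x => Mact (L x) (y.1 ⊗' y.2)) s) t.
      apply: eq_lincomb => x.
      by apply: (lincomb_lin (T := fun S => Mact S (x.1 ⊗' x.2))).
    rewrite /lincomb; under eq_bigr do rewrite scaler_sumr.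
    rewrite exchange_big; apply: eq_bigr => p _; rewrite scaler_sumr.
    apply: eq_bigr => q _; rewrite !scalerA mulrC; congr (_ *: _).
    by case: p q => [c [a b]] [d [x y]]; rewrite hL.
  apply: algt_nrm_min => [|H' K' p' q' hp' hq'].
    by rewrite mulr_ge0 ?nrm_ge0.
  apply: htens_bound => [|z]; first by rewrite mulr_ge0 ?nrm_ge0.
  have [H [p [j [hp jP pj]]]] := pulled_back_representation hf hp'.
  have [K [q [k [hq kP qk]]]] := pulled_back_representation hg hq'.
  pose V1 (r : (A * B * (A' * B')) * (H' * K')) :=
    htv (p' (Mact (f r.1.1.1) r.1.2.1) r.2.1) (q' (Mact (g r.1.1.2) r.1.2.2) r.2.2).
  pose V2 (r : (A * B * (A' * B')) * (H' * K')) :=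
    htv (j (Mact (f r.1.1.1) r.1.2.1) r.2.1) (k (Mact (g r.1.1.2) r.1.2.2) r.2.2).
  pose V3 (r : (A' * B') * (H' * K')) := htv (j r.1.1 r.2.1) (k r.1.2 r.2.2).
  pose V4 (r : (A' * B') * (H' * K')) := htv (p' r.1.1 r.2.1) (q' r.1.2 r.2.2).
  have topE (X : Type) (P : X -> A' * B') (r : seq (R[i] * X)) :
      Hact (top hp' hq' [seq (x.1, P x.2) | x <- r])
        (lincomb (fun x : H' * K' => htv x.1 x.2) z) =
      lincomb (fun x => htv (p' (P x.1).1 x.2.1) (q' (P x.1).2 x.2.2)) (lpair r z).
    rewrite /top lincomb_map lincomb_pair.
    rewrite (lincomb_lin (T := fun S => Hact S _)) //; apply: eq_lincomb => x.
    rewrite (lincomb_lin _ _ (Hact_lin _)); apply: eq_lincomb => y.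
    by rewrite top_eltE.
  rewrite (topE _ fg).
  rewrite (@nrm_lincomb_gram _ _ _ _ V1 V2); last first.
    by move=> x y; rewrite /V1 /V2 !htv_ip jP kP.
  have -> : lincomb V2 (lpair (lpair s t) z) =
      Hact (top hp hq s) (lincomb V3 (lpair t z)).
    rewrite /top (lincomb_lin (T := fun S => Hact S _)) // lincomb_pair lincomb_pair.
    apply: eq_lincomb => x; rewrite lincomb_pair.
    rewrite (lincomb_lin _ _ (Hact_lin _)); apply: eq_lincomb => y.
    rewrite (lincomb_lin _ _ (Hact_lin _)); apply: eq_lincomb => w.
    by rewrite /V2 /V3 top_eltE pj qk.
  apply: le_trans (Hact_le _ _) _; rewrite -mulrA; apply: ler_pM; rewrite ?nrm_ge0 //.
    exact: top_le.
  rewrite (@nrm_lincomb_gram _ _ _ _ V3 V4); last first.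
    by move=> x y; rewrite /V3 /V4 !htv_ip jP kP.
  have := topE _ id t; rewrite (_ : [seq (x.1, id x.2) | x <- t] = t); last first.
    by rewrite -[RHS]map_id; apply: eq_map => -[].
  move=> <-; apply: le_trans (Hact_le _ _) _.
  by rewrite ler_wpM2r ?nrm_ge0 // top_le.
apply: op_nrm_min; split; first exact: nrm_ge0.
move=> x; apply: (@le_eps R (nrm W + nrm (algt M s))).
  by rewrite addr_ge0 ?nrm_ge0.
move=> t t0 _; have [r xr] := dense_lincomb (tensor_range_dense M') x t0.
set y := lincomb _ r in xr; have hy := alg r; rewrite -/y in hy.
have := Mact_le W (x - y); rewrite (linB (Mact_lin W)).
have := nrm_tri (Mact W y) (Mact W x) 0; rewrite !subr0.
have := nrm_tri x y 0; rewrite !subr0 (nrm_distC y).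
have := ler_wpM2l (nrm_ge0 W) (ltW xr).
move=> h1 h2 h3 h4.
have : nrm (algt M s) * nrm y <= nrm (algt M s) * (nrm x + t).
  by rewrite ler_wpM2l ?nrm_ge0 //; lra.
rewrite -[bs_val W x]/(Mact W x) => h5; lra.
Qed.

Lemma tensor_of_homs : exists2 F : M -> Mcs M', is_hom F &
  forall a b x y, Mact (F (a ⊗ b)) (x ⊗' y) = Mact (f a) x ⊗' Mact (g b) y.
Proof.
have [L0 hL0] := tensor_mult M'.
pose L (x : A * B) := L0 (f x.1) (g x.2).
have hL a b x y : Mact (L (a, b)) (x ⊗' y) = Mact (f a) x ⊗' Mact (g b) y.
  exact: hL0.
have [fl fM fJ] := hf; have [gl gM gJ] := hg.
have [|||F hF FE] := @hom_of_elementary R A B M (Mcs M') L.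
- move=> [a b] [a' b']; apply: Mcs_tensor_ext => x y.
  by rewrite MactC !hL fM gM !MactC.
- move=> [a b]; apply/esym/Mcs_adj_ext => -[x y] [x' y'].
  by rewrite !hL !tensor_adj !tensor_mul fJ gJ !Mact_adj ?cadjK.
- exact: tensor_of_homs_bound.
by exists F => // a b x y; rewrite FE hL.
Qed.

End TensorOfHoms.

Section TotalVectors.
Variable R : realType.

Lemma bh_bound_total (H : hilbert R) (X : Type) (f : X -> H) (T : BH H) (C : R) :
  cspan (range f) = setT -> 0 <= C ->
  (forall s, nrm (Hact T (lincomb f s)) <= C * nrm (lincomb f s)) -> nrm T <= C.
Proof.
move=> fT C0 h; apply: Hact_min => // x; apply: (@le_eps R (nrm T + C)).
  by rewrite addr_ge0 ?nrm_ge0.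
move=> t t0 _; have [s xs] := dense_lincomb fT x t0.
set y := lincomb _ s in xs; have hy := h s; rewrite -/y in hy.
have := Hact_le T (x - y); rewrite (linB (Hact_lin T)).
have := nrm_tri (Hact T y) (Hact T x) 0; rewrite !subr0.
have := nrm_tri x y 0; rewrite !subr0 (nrm_distC y).
have := ler_wpM2l (nrm_ge0 T) (ltW xs).
move=> h1 h2 h3 h4.
have : C * nrm y <= C * (nrm x + t) by rewrite ler_wpM2l //; lra.
lra.
Qed.

Lemma closed_preim (V W : completeNormedModType R[i]) (f : V -> W) (D : set W)
    (C : R) : is_linear f -> (forall x, nrm (f x) <= C * nrm x) ->
  closed_sub D -> closed_sub [set x | D (f x)].
Proof.
move=> lf bf [D0 DL Dc]; split=> [|c x y /= fx fy|x hx] /=.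
- by rewrite lin0.
- by rewrite lf; exact: DL.
apply: Dc => e e0; have C1 : 0 < `|C| + 1 by rewrite ltr_wpDl.
have [y /= fy xy] := hx _ (divr_gt0 e0 C1); exists (f y) => //.
rewrite -linB //; apply: le_lt_trans (bf _) _.
apply: le_lt_trans (ler_wpM2r (nrm_ge0 _) (ler_norm C)) _.
rewrite ltr_pdivlMr // in xy; have := nrm_ge0 (x - y); have := normr_ge0 C; nra.
Qed.

Lemma htv_total3 (H K L : hilbert R) :
  cspan (range (fun x : H * (K * L) => htv x.1 (htv x.2.1 x.2.2))) = setT.
Proof.
rewrite predeqE => z; split => // _.
set S := range (fun x : H * (K * L) => htv x.1 (htv x.2.1 x.2.2)).
have cS := cspan_closed S.
apply: (cspanT_dense z (htv_total H (htens K L)) cS) => _ [[h w] _ <-] /=.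
have hc : closed_sub [set w | cspan S (htv h w)].
  apply: (closed_preim (C := nrm h)) => //; first exact: htv_linr.
  by move=> x; rewrite htv_norm.
apply: (cspanT_dense w (htv_total K L) hc) => _ [[k l] _ <-] /=.
by apply: sub_cspan; exists (h, (k, l)).
Qed.

End TotalVectors.

Section RepresentationOfTensor.
Variables (R : realType) (A B : cstar R) (M : min_tensor A B).
Variables (H K : hilbert R) (p : A -> H -> H) (q : B -> K -> K).
Hypotheses (hp : is_representation p) (hq : is_representation q).

Lemma BH_htv_ext (S T : BH (htens H K)) :
  (forall h k, Hact S (htv h k) = Hact T (htv h k)) -> S = T.
Proof.
move=> h; apply/eqP; rewrite -subr_eq0; apply/eqP/nrm0_eq0/eqP.
rewrite eq_le nrm_ge0 andbT.
apply: (bh_bound_total (htv_total H K)) => // s.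
rewrite (lincomb_lin _ _ (Hact_lin _)) mul0r /lincomb big1 ?nrm0 // => x _.
rewrite -[Hact _ _]/(Hact S (htv x.2.1 x.2.2) - Hact T (htv x.2.1 x.2.2)).
by rewrite h subrr scaler0.
Qed.

Lemma tensor_representation : exists2 F : M -> BH (htens H K), is_hom F &
  forall a b h k, Hact (F (tensor_elt M a b)) (htv h k) = htv (p a h) (q b k).
Proof.
have [_ _ pM pJ] := hp; have [_ _ qM qJ] := hq.
have [|||F hF FE] := @hom_of_elementary R A B M _ (top_elt hp hq).
- by move=> x y; apply: BH_htv_ext => h k; rewrite HactM !top_eltE /= pM qM.
- move=> x; apply: BH_htv_ext => h k; apply: htv_inj => h' k'.
  by rewrite Hact_adj cadjK !top_eltE !htv_ip /= pJ qJ !cadjK.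
- by move=> s; exact: (top_le M hp hq s).
by exists F => // a b h k; rewrite FE top_eltE.
Qed.

End RepresentationOfTensor.

(** * Matrices over an algebra with a norming class of representations *)

Section MatrixAlgebra.
Variables (R : realType) (E : cstar R) (n : nat).
Variable Rep : forall H : hilbert R, (E -> BH H) -> Prop.
Hypothesis Rep_hom : forall H (F : E -> BH H), Rep F -> is_hom F.
Hypothesis Rep_norming : forall x (C : R), 0 <= C ->
  (forall H (F : E -> BH H), Rep F -> nrm (F x) <= C) -> nrm x <= C.
Variables (H0 : hilbert R) (v : 'I_n -> H0).
Hypothesis v_on : forall i j, ip (v i) (v j) = (i == j)%:R.

Local Notation mat := ('I_n -> 'I_n -> E).
Implicit Types (m : mat).

(** The direct sum of [n] copies of [H], placed inside a tensor product by an orthonormal family; by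
    [hcol_ip] the choice of the family does not affect inner products. *)
Definition hcol (H : hilbert R) (k : 'I_n -> H) : htens H0 H := \sum_i htv (v i) (k i).

Lemma hcol_ip (H : hilbert R) (k k' : 'I_n -> H) :
  ip (hcol k) (hcol k') = \sum_i ip (k i) (k' i).
Proof.
rewrite /hcol ip_suml; apply: eq_bigr => i _; rewrite ip_sumr (bigD1 i) //=.
rewrite htv_ip v_on eqxx mul1r big1 ?addr0 // => j ij.
by rewrite htv_ip v_on eq_sym (negbTE ij) mul0r.
Qed.

Lemma hcol_lin (H : hilbert R) c (k k' : 'I_n -> H) :
  hcol (fun i => c *: k i + k' i) = c *: hcol k + hcol k'.
Proof.
rewrite /hcol scaler_sumr -big_split; apply: eq_bigr => i _.
exact: htv_linr.
Qed.

Lemma hcol_entry (H : hilbert R) (k : 'I_n -> H) i : nrm (k i) <= nrm (hcol k).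
Proof.
rewrite -ler_sqr ?nnegrE ?nrm_ge0 // -lecR -!ip_nrm hcol_ip (bigD1 i) //= lerDl.
by apply: sumr_ge0 => j _; rewrite ip_nrm ler0c sqr_ge0.
Qed.

Lemma hcol_le (H : hilbert R) (k : 'I_n -> H) : nrm (hcol k) <= \sum_i nrm (k i).
Proof.
rewrite /hcol; elim/big_rec2: _ => [|i x y _ xy]; first by rewrite nrm0.
apply: le_trans (nrmD _ _) _; apply: lerD => //.
have : nrm (v i) ^+ 2 = 1 by apply: complexI; rewrite -ip_nrm v_on eqxx.
move=> /eqP; rewrite htv_norm sqrf_eq1 => /orP[/eqP->|/eqP vi]; first by rewrite mul1r.
by have := nrm_ge0 (v i); rewrite vi; lra.
Qed.

Definition macts (H : hilbert R) (F : E -> BH H) m (k : 'I_n -> H) : 'I_n -> H :=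
  fun j => \sum_i Hact (F (m j i)) (k i).

Lemma macts_linl (H : hilbert R) (F : E -> BH H) (hF : is_hom F) c m m' k j :
  macts F (fun i j => c *: m i j + m' i j) k j = c *: macts F m k j + macts F m' k j.
Proof.
have [Fl _ _] := hF; rewrite /macts scaler_sumr -big_split; apply: eq_bigr => i _.
by rewrite Fl HactL.
Qed.

Definition mmul m m' : mat := fun i k => \sum_j cmul (m i j) (m' j k).
Definition madj m : mat := fun i j => cadj (m j i).

Lemma mactsM (H : hilbert R) (F : E -> BH H) (hF : is_hom F) m m' k j :
  macts F (mmul m m') k j = macts F m (macts F m' k) j.
Proof.
have [Fl FM _] := hF; rewrite /macts /mmul.
under [RHS]eq_bigr do rewrite (lin_sum (Hact_lin _)).
rewrite exchange_big; apply: eq_bigr => i _.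
rewrite (lin_sum Fl) (lin_sum (Hact_linl _)); apply: eq_bigr => l _.
by rewrite FM HactM.
Qed.

Lemma macts_adj (H : hilbert R) (F : E -> BH H) (hF : is_hom F) m k k' :
  ip (hcol (macts F m k)) (hcol k') = ip (hcol k) (hcol (macts F (madj m) k')).
Proof.
have [_ _ FJ] := hF; rewrite !hcol_ip /macts.
under eq_bigr do rewrite ip_suml; under [RHS]eq_bigr do rewrite ip_sumr.
rewrite exchange_big; apply: eq_bigr => i _; apply: eq_bigr => j _.
by rewrite Hact_adj /madj FJ.
Qed.

(** A test is a representation in [Rep] with two columns. The matrix norm bounds all matrix
    coefficients relative to the norms of the columns, which makes it an instance of [wnorm]. *)
Definition mat_test := {H : hilbert R & {F : E -> BH H & Rep F * (('I_n -> H) * ('I_n -> H))}%type}.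

Definition mat_val m (y : mat_test) : R[i]^o :=
  let: existT H (existT F (_, (k, k'))) := y in ip (hcol (macts F m k)) (hcol k').

Definition mat_weight (y : mat_test) : R :=
  let: existT H (existT F (_, (k, k'))) := y in nrm (hcol k) * nrm (hcol k').

Lemma mat_weight_ge0 y : 0 <= mat_weight y.
Proof. by case: y => H [F [_ [k k']]] /=; rewrite mulr_ge0 ?nrm_ge0. Qed.

Local Notation N m := (wnorm mat_weight (mat_val m)).

Lemma macts_bound (H : hilbert R) (F : E -> BH H) (hF : is_hom F) m k :
  nrm (hcol (macts F m k)) <= (\sum_i \sum_j nrm (m i j)) * nrm (hcol k).
Proof.
apply: le_trans (hcol_le _) _; rewrite mulr_suml; apply: ler_sum => i _.
rewrite mulr_suml /macts; elim/big_rec2: _ => [|j x y _ xy]; first by rewrite nrm0.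
apply: le_trans (nrmD _ _) _; apply: lerD => //.
apply: le_trans (Hact_le _ _) _; apply: ler_pM; rewrite ?nrm_ge0 //.
  exact: hom_contraction.
exact: hcol_entry.
Qed.

Lemma mat_bounded m : wbound mat_weight (mat_val m) (\sum_i \sum_j nrm (m i j)).
Proof.
split; first by apply: sumr_ge0 => i _; apply: sumr_ge0 => j _; exact: nrm_ge0.
case=> H [F [hR [k k']]] /=; apply: le_trans (ip_CS _ _) _; rewrite mulrA.
by rewrite ler_wpM2r ?nrm_ge0 //; apply: macts_bound; exact: Rep_hom.
Qed.

Lemma mat_bounded_ex m : exists C, wbound mat_weight (mat_val m) C.
Proof. by exists (\sum_i \sum_j nrm (m i j)); exact: mat_bounded. Qed.

Lemma mat_norm_act m (H : hilbert R) (F : E -> BH H) k : Rep F ->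
  nrm (hcol (macts F m k)) <= N m * nrm (hcol k).
Proof.
move=> hR; set x := hcol _; have [x0|x0] := eqVneq (nrm x) 0.
  by rewrite x0 mulr_ge0 ?nrm_ge0 ?wnorm_ge0.
have xp : 0 < nrm x by rewrite lt_def x0 nrm_ge0.
have : cabs (ip x x) <= N m * (nrm (hcol k) * nrm x) :=
  wnorm_le mat_weight_ge0 (existT _ H (existT _ F (hR, (k, macts F m k))))
  (mat_bounded_ex m).
by rewrite ip_nrm cabsR ger0_norm ?sqr_ge0 // expr2 mulrA ler_pM2r.
Qed.

Lemma mat_norm_min m C : 0 <= C -> (forall (H : hilbert R) (F : E -> BH H) k, Rep F ->
  nrm (hcol (macts F m k)) <= C * nrm (hcol k)) -> N m <= C.
Proof.
move=> C0 h; apply: wnorm_min; split=> // -[H [F [hR [k k']]]] /=.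
apply: le_trans (ip_CS _ _) _; rewrite mulrA ler_wpM2r ?nrm_ge0 //.
exact: h.
Qed.

(** Columns supported at [j] single out an entry, and [Rep] is norming. Definiteness and
    completeness of the matrix norm rest on this. *)
Lemma mat_entry_le m i j : nrm (m i j) <= N m.
Proof.
apply: Rep_norming => [|H F hR]; first exact: wnorm_ge0.
apply: Hact_min => [|x]; first exact: wnorm_ge0.
pose k l : H := if l == j then x else 0.
have kx : nrm (hcol k) <= nrm x.
  rewrite -ler_sqr ?nnegrE ?nrm_ge0 // -lecR -!ip_nrm hcol_ip (bigD1 j) //=.
  by rewrite /k eqxx big1 ?addr0 // => l lj; rewrite (negbTE lj) ip0l.
have -> : Hact (F (m i j)) x = macts F m k i.
  rewrite /macts (bigD1 j) //= /k eqxx big1 ?addr0 // => l lj.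
  by rewrite (negbTE lj) (lin0 (Hact_lin _)).
apply: le_trans (hcol_entry _ _) _; apply: le_trans (mat_norm_act _ _ hR) _.
by rewrite ler_wpM2l // wnorm_ge0.
Qed.

Lemma mat_norm_le_sum m : N m <= \sum_i \sum_j nrm (m i j).
Proof. exact: wnorm_min (mat_bounded m). Qed.

Lemma mat_val_lin c m m' y :
  mat_val (fun i j => c *: m i j + m' i j) y = c *: mat_val m y + mat_val m' y.
Proof.
case: y => H [F [hR [k k']]] /=.
rewrite -[RHS]/(c * ip (hcol (macts F m k)) (hcol k') + ip (hcol (macts F m' k)) (hcol k')).
rewrite -ip_linl -hcol_lin; congr (ip (hcol _) _).
by apply/funext => j; apply: macts_linl; exact: Rep_hom.
Qed.

Lemma mat_normD m m' : N (fun i j => m i j + m' i j) <= N m + N m'.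
Proof.
have := wnormD mat_weight_ge0 (mat_bounded_ex m) (mat_bounded_ex m').
congr (wnorm _ _ <= _); apply/funext => y.
have := mat_val_lin 1 m m' y; rewrite scale1r => <-; congr mat_val.
by apply/funext => i; apply/funext => j; rewrite scale1r.
Qed.

Lemma mat_normZ c m : N (fun i j => c *: m i j) = cabs c * N m.
Proof.
rewrite -(wnormZ mat_weight_ge0 c (mat_bounded_ex m)); congr wnorm.
apply/funext => y; have m0 : mat_val (fun _ _ => 0) y = 0.
  have := mat_val_lin (-1) m m y.
  rewrite scaleN1r addNr => <-; congr mat_val.
  by apply/funext => i; apply/funext => j; rewrite scaleN1r addNr.
have := mat_val_lin c m (fun _ _ => 0) y; rewrite m0 addr0 => <-; congr mat_val.
by apply/funext => i; apply/funext => j; rewrite addr0.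
Qed.

Lemma mat_complete (u : nat -> mat) : (forall k, [set: mat] (u k)) ->
  cauchy_for (fun m => N m) u ->
  exists l, [set: mat] l /\ cvg_for (fun m => N m) u l.
Proof.
move=> _ cu.
have ex i j : exists l, cvg_for (@nrm R E) (fun k => u k i j) l.
  apply: nrm_cauchy_cvg => t /cu[k hk]; exists k => a b ka kb.
  exact: le_lt_trans (mat_entry_le (u a - u b) i j) (hk a b ka kb).
have [l hl] := choice (fun i => let: existT f hf := choice (ex i) in
  ex_intro (fun f => forall j, cvg_for (@nrm R E) (fun k => u k i j) (f j)) f hf).
exists l; split => // t t0.
have c0 : 0 < (n * n)%:R + 1 :> R by rewrite ltr_wpDl.
have small i j := hl i j _ (divr_gt0 t0 c0).
have [k hk] := choice (fun i => let: existT f hf := choice (small i) in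
  ex_intro (fun f => forall j a, (f j <= a)%N -> nrm (u a i j - l i j) < t / ((n * n)%:R + 1)) f hf).
exists (\max_i \max_j k i j) => m km.
apply: le_lt_trans (mat_norm_le_sum _) _.
apply: (@le_lt_trans _ _ ((n * n)%:R * (t / ((n * n)%:R + 1)))); last first.
  by rewrite mulrCA gtr_pMr // ltr_pdivrMr // mul1r ltrDl.
set r := t / _ in hk *.
have -> : (n * n)%:R * r = \sum_(i < n) \sum_(j < n) r.
  by rewrite !sumr_const card_ord -mulrnA mulr_natl.
apply: ler_sum => i _; apply: ler_sum => j _.
apply/ltW/hk; apply: leq_trans km.
by apply: leq_trans (leq_bigmax i); exact: (leq_bigmax j).
Qed.

Definition mat_data : banach_data mat.
Proof.
refine (@BanachData R _ [set: mat] (fun m => N m) I (fun c x y _ _ => I)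
  (fun x y _ _ => mat_normD x y) (fun c x _ => mat_normZ c x) _ mat_complete).
move=> m _ m0; apply/funext => i; apply/funext => j.
apply: nrm0_eq0; apply/eqP; rewrite eq_le nrm_ge0 andbT -m0.
exact: mat_entry_le.
Defined.

Local Notation MT := (banach_sub mat_data).

Definition mk_mat m : MT := @BanachSub R _ mat_data m (introT (asboolP _) I).

Lemma mat_nrmE (x : MT) : nrm x = N (bs_val x).
Proof. by []. Qed.

Definition mat_mul (x y : MT) : MT := mk_mat (mmul (bs_val x) (bs_val y)).
Definition mat_adj (x : MT) : MT := mk_mat (madj (bs_val x)).

Lemma mat_mulA x y z : mat_mul x (mat_mul y z) = mat_mul (mat_mul x y) z.
Proof.
apply: val_inj; apply/funext => i; apply/funext => j; rewrite /= /mmul.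
under eq_bigr do rewrite cmul_sumr; under [RHS]eq_bigr do rewrite cmul_suml.
rewrite exchange_big; apply: eq_bigr => k _; apply: eq_bigr => l _.
exact: cmulA.
Qed.

Lemma mat_mul_linl c x y z :
  mat_mul (c *: x + y) z = c *: mat_mul x z + mat_mul y z.
Proof.
apply: val_inj; apply/funext => i; apply/funext => j.
transitivity (c *: mmul (bs_val x) (bs_val z) i j + mmul (bs_val y) (bs_val z) i j) => //.
rewrite /= /mmul scaler_sumr -big_split; apply: eq_bigr => k _.
exact: cmul_linl.
Qed.

Lemma mat_mul_linr c x y z :
  mat_mul x (c *: y + z) = c *: mat_mul x y + mat_mul x z.
Proof.
apply: val_inj; apply/funext => i; apply/funext => j.
transitivity (c *: mmul (bs_val x) (bs_val y) i j + mmul (bs_val x) (bs_val z) i j) => //.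
rewrite /= /mmul scaler_sumr -big_split; apply: eq_bigr => k _.
exact: cmul_linr.
Qed.

Lemma mat_adjK x : mat_adj (mat_adj x) = x.
Proof. by apply: val_inj; apply/funext => i; apply/funext => j; exact: cadjK. Qed.

Lemma mat_adj_antilin c x y :
  mat_adj (c *: x + y) = c^* *: mat_adj x + mat_adj y.
Proof.
apply: val_inj; apply/funext => i; apply/funext => j.
transitivity (cadj (c *: bs_val x j i + bs_val y j i)); first by [].
by rewrite cadj_antilin.
Qed.

Lemma mat_adjM x y : mat_adj (mat_mul x y) = mat_mul (mat_adj y) (mat_adj x).
Proof.
apply: val_inj; apply/funext => i; apply/funext => j; rewrite /= /madj /mmul.
by rewrite cadj_sum; apply: eq_bigr => k _; rewrite cadjM.
Qed.

Lemma mat_nrmM x y : nrm (mat_mul x y) <= nrm x * nrm y.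
Proof.
rewrite !mat_nrmE; apply: mat_norm_min.
  by rewrite mulr_ge0 ?wnorm_ge0.
move=> H F k hR; have hF := Rep_hom hR.
have -> : macts F (bs_val (mat_mul x y)) k = macts F (bs_val x) (macts F (bs_val y) k).
  by apply/funext => j; exact: mactsM.
apply: le_trans (mat_norm_act _ _ hR) _; rewrite -mulrA.
by rewrite ler_wpM2l ?wnorm_ge0 // mat_norm_act.
Qed.

Lemma mat_nrm_sqr_le x : nrm x ^+ 2 <= nrm (mat_mul (mat_adj x) x).
Proof.
set C := nrm (mat_mul _ _); have C0 : 0 <= C := nrm_ge0 _.
rewrite -[leRHS](sqr_sqrtr C0) ler_sqr ?nnegrE ?nrm_ge0 ?sqrtr_ge0 //.
rewrite mat_nrmE; apply: mat_norm_min => [|H F k hR]; first exact: sqrtr_ge0.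
have hF := Rep_hom hR.
rewrite -ler_sqr ?nnegrE ?nrm_ge0 ?mulr_ge0 ?sqrtr_ge0 ?nrm_ge0 //.
rewrite exprMn sqr_sqrtr // -lecR -ip_nrm macts_adj //.
have -> : macts F (madj (bs_val x)) (macts F (bs_val x) k) =
    macts F (bs_val (mat_mul (mat_adj x) x)) k.
  by apply/funext => j; rewrite mactsM.
set w := hcol _; set z := hcol _.
have -> : ip w z = (complex.Re (ip w z))%:C.
  rewrite RRe_real // ger0_real // /w /z.
  have -> : macts F (bs_val (mat_mul (mat_adj x) x)) k =
    macts F (madj (bs_val x)) (macts F (bs_val x) k) by apply/funext => j; rewrite mactsM.
  by rewrite -macts_adj // ip_nrm ler0c sqr_ge0.
rewrite lecR; apply: le_trans (Re_le_cabs _) _; apply: le_trans (ip_CS _ _) _.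
rewrite mulrC expr2 mulrA ler_wpM2r ?nrm_ge0 //.
by apply: mat_norm_act.
Qed.

Lemma mat_nrm_adj x : nrm (mat_adj x) <= nrm x.
Proof.
have := mat_nrm_sqr_le (mat_adj x); rewrite mat_adjK => h.
have := le_trans h (mat_nrmM _ _); rewrite expr2.
have [->|x0] := eqVneq (nrm (mat_adj x)) 0; first by rewrite nrm_ge0.
by rewrite ler_pM2r // lt_def x0 nrm_ge0.
Qed.

Lemma mat_normM x y : `|mat_mul x y| <= `|x| * `|y|.
Proof. by rewrite !nrmE -rmorphM lecR mat_nrmM. Qed.

Lemma mat_norm_cstar x : `|mat_mul (mat_adj x) x| = `|x| ^+ 2.
Proof.
rewrite !nrmE -rmorphXn; congr (_ %:C); apply/eqP; rewrite eq_le mat_nrm_sqr_le andbT.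
apply: le_trans (mat_nrmM _ _) _; rewrite expr2.
by rewrite ler_wpM2r ?nrm_ge0 // mat_nrm_adj.
Qed.

Definition mat_cstar : cstar R := @CStar R (banach_sub mat_data) mat_mul mat_adj
  mat_mulA mat_mul_linl mat_mul_linr mat_adjK mat_adj_antilin mat_adjM
  mat_normM mat_norm_cstar.

(* Any representation of [E] is dominated by the norming ones on matrices. *)
Lemma macts_contraction (L : hilbert R) (Q : E -> BH L) (hQ : is_hom Q) m
    (l : 'I_n -> L) (C : R) : 0 <= C ->
  (forall (H : hilbert R) (F : E -> BH H) k, Rep F ->
    nrm (hcol (macts F m k)) <= C * nrm (hcol k)) ->
  nrm (hcol (macts Q m l)) <= C * nrm (hcol l).
Proof.
move=> C0 h; pose T (x : mat_cstar) := hcol (macts Q (bs_val x) l).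
have Tl : is_linear T.
  move=> c x y; rewrite /T -hcol_lin; congr hcol; apply/funext => j.
  exact: (macts_linl hQ c (bs_val x) (bs_val y)).
have -> : hcol (macts Q m l) = T (mk_mat m) by [].
apply: le_trans (_ : nrm (mk_mat m : mat_cstar) * nrm (hcol l) <= _); last first.
  by rewrite ler_wpM2r ?nrm_ge0 // mat_nrmE; exact: mat_norm_min.
apply: (vector_contraction Tl) => [x y|x].
  have -> : T (cmul (cadj y) x) = hcol (macts Q (madj (bs_val y)) (macts Q (bs_val x) l)).
    by congr hcol; apply/funext => j; rewrite -mactsM.
  by rewrite [RHS]ip_sym -macts_adj // -ip_sym.
by rewrite ip_sym macts_adj // -ip_sym.
Qed.

End MatrixAlgebra.

(** * Associativity of the minimal tensor product *)

Section Associativity.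
Variables (R : realType) (A B D : cstar R).
Variables (M1 : min_tensor A B) (M12 : min_tensor M1 D).
Variables (N1 : min_tensor B D) (N12 : min_tensor A N1).

(** These representations compute the norm of [N1], and rebracketing is harmless for them; the norm
    of [N12], however, involves every representation of [N1]. *)
Inductive product_rep : forall H : hilbert R, (N1 -> BH H) -> Prop :=
  ProductRep : forall (K L : hilbert R) (q : B -> K -> K) (r : D -> L -> L)
    (F : N1 -> BH (htens K L)), is_representation q -> is_representation r ->
    is_hom F -> (forall b d k l,
      Hact (F (tensor_elt N1 b d)) (htv k l) = htv (q b k) (r d l)) ->
    product_rep F.

Lemma product_rep_hom H (F : N1 -> BH H) : product_rep F -> is_hom F.
Proof. by case. Qed.

Lemma product_rep_norming (x : N1) (C : R) : 0 <= C ->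
  (forall H (F : N1 -> BH H), product_rep F -> nrm (F x) <= C) -> nrm x <= C.
Proof.
move=> C0 h; apply: (@le_eps R 2) => // t t0 _.
have [s xs] := dense_lincomb (tensor_range_dense N1) x t0.
have hs : nrm (algt N1 s) <= C + t.
  apply: algt_nrm_min => [|K L q r hq hr]; first by rewrite addr_ge0 // ltW.
  have [F hF Fe] := tensor_representation N1 hq hr; have [Fl _ _] := hF.
  have -> : top hq hr s = F (algt N1 s).
    rewrite /algt (lincomb_lin _ _ Fl) /top; apply: eq_lincomb => y.
    by apply: BH_htv_ext => k l; rewrite top_eltE Fe.
  have hx := h _ F (ProductRep hq hr hF Fe).
  have := hom_contraction hF (x - algt N1 s); rewrite (linB Fl).
  have := nrm_tri (F x) (F (algt N1 s)) 0; rewrite !subr0 (nrm_distC (F (algt N1 s))).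
  rewrite -/(algt N1 s) in xs; lra.
have := nrm_tri (algt N1 s) x 0; rewrite !subr0 -/(algt N1 s) in xs *.
lra.
Qed.

Variable s : seq (R[i] * (A * (B * D))).
Let s1 : seq (R[i] * (A * N1)) :=
  [seq (x.1, (x.2.1, tensor_elt N1 x.2.2.1 x.2.2.2)) | x <- s].
Let s2 : seq (R[i] * (M1 * D)) :=
  [seq (x.1, (tensor_elt M1 x.2.1 x.2.2.1, x.2.2.2)) | x <- s].
Let C := nrm (algt M12 s2).

Section FixedRepresentation.
Variables (H : hilbert R) (p : A -> H -> H).
Hypothesis hp : is_representation p.

(** Rebracketing elementary tensors of vectors preserves inner products, so the operators of [s1]
    and [s2] have the same norms on corresponding vectors. *)
Lemma product_rep_bound (L : hilbert R) (F : N1 -> BH L) (hF : is_hom F) :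
  product_rep F -> nrm (top hp (op_rep hF) s1) <= C.
Proof.
move=> pF; case: pF hF => K {}L q r {}F hq hr _ Fe hF.
have [P hP Pe] := tensor_representation M1 hp hq.
apply: (bh_bound_total (htv_total3 H K L)) => [|t]; first exact: nrm_ge0.
pose V1 (x : (A * (B * D)) * (H * (K * L))) :=
  htv (p x.1.1 x.2.1) (htv (q x.1.2.1 x.2.2.1) (r x.1.2.2 x.2.2.2)).
pose V2 (x : (A * (B * D)) * (H * (K * L))) :=
  htv (htv (p x.1.1 x.2.1) (q x.1.2.1 x.2.2.1)) (r x.1.2.2 x.2.2.2).
pose W2 (x : H * (K * L)) := htv (htv x.1 x.2.1) x.2.2.
have -> : Hact (top hp (op_rep hF) s1)
    (lincomb (fun x => htv x.1 (htv x.2.1 x.2.2)) t) = lincomb V1 (lpair s t).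
  rewrite /top /s1 (lincomb_map _ (fun x => (x.1, tensor_elt N1 x.2.1 x.2.2))).
  rewrite lincomb_pair.
  rewrite (lincomb_lin (T := fun S => Hact S _)) //; apply: eq_lincomb => x.
  rewrite (lincomb_lin _ _ (Hact_lin _)); apply: eq_lincomb => y.
  by rewrite top_eltE /= Fe.
rewrite (@nrm_lincomb_gram _ _ _ _ V1 V2); last first.
  by move=> x y; rewrite /V1 /V2 !htv_ip mulrA.
rewrite (@nrm_lincomb_gram _ _ _ _ (fun x => htv x.1 (htv x.2.1 x.2.2)) W2); last first.
  by move=> x y; rewrite /W2 !htv_ip mulrA.
have -> : lincomb V2 (lpair s t) = Hact (top (op_rep hP) hr s2) (lincomb W2 t).
  rewrite /top /s2 (lincomb_map _ (fun x => (tensor_elt M1 x.1 x.2.1, x.2.2))).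
  rewrite lincomb_pair.
  rewrite [RHS](lincomb_lin (T := fun S => Hact S _)) //; apply: eq_lincomb => x.
  rewrite (lincomb_lin _ _ (Hact_lin _)); apply: eq_lincomb => y.
  by rewrite /V2 /W2 top_eltE /= Pe.
apply: le_trans (Hact_le _ _) _; rewrite ler_wpM2r ?nrm_ge0 //.
exact: top_le.
Qed.

Variables (n : nat) (v : 'I_n -> H).
Hypothesis v_on : forall i j, ip (v i) (v j) = (i == j)%:R.

(** The matrix of [T^* T] along [v], where [T] is the operator of [s1]. Inner products in [H] are
    scalars, so the entries lie in [N1] and do not depend on the representation of [N1]. *)
Let m (i' i : 'I_n) : N1 := \sum_(x <- s) \sum_(y <- s)
  (x.1 * y.1^* * ip (p x.2.1 (v i)) (p y.2.1 (v i'))) *: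
  cmul (cadj (tensor_elt N1 y.2.2.1 y.2.2.2)) (tensor_elt N1 x.2.2.1 x.2.2.2).

Lemma gram_matrix (L : hilbert R) (F : N1 -> BH L) (hF : is_hom F) (k k' : 'I_n -> L) :
  ip (hcol v (macts F m k)) (hcol v k') =
  ip (Hact (top hp (op_rep hF) s1) (hcol v k)) (Hact (top hp (op_rep hF) s1) (hcol v k')).
Proof.
have [Fl FM FJ] := hF.
pose e (x : A * (B * D)) := tensor_elt N1 x.2.1 x.2.2.
have topE w : Hact (top hp (op_rep hF) s1) (hcol v w) =
    \sum_i lincomb (fun x => htv (p x.1 (v i)) (Hact (F (e x)) (w i))) s.
  rewrite /hcol (lin_sum (Hact_lin _)); apply: eq_bigr => i _.
  rewrite /top /s1 (lincomb_map _ (fun x => (x.1, tensor_elt N1 x.2.1 x.2.2))).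
  rewrite (lincomb_lin (T := fun S => Hact S _)) //; apply: eq_lincomb => x.
  by rewrite top_eltE.
rewrite (hcol_ip v_on) !topE [RHS]ip_suml /macts.
under eq_bigr do rewrite ip_suml; rewrite exchange_big; apply: eq_bigr => i _ /=.
rewrite ip_sumr; apply: eq_bigr => i' _.
rewrite ip_lincomb /m (lin_sum Fl) (lin_sum (Hact_linl _)) ip_suml.
apply: eq_bigr => x _; rewrite (lin_sum Fl) (lin_sum (Hact_linl _)) ip_suml.
apply: eq_bigr => y _; rewrite (linZ Fl) (linZ (Hact_linl _)) ipZl htv_ip FM HactM FJ.
by rewrite Hact_adj cadjK mulrA.
Qed.

(** [T] need not preserve columns over [v], but [T^* T] compressed to them is the matrix [m].
    Product representations bound [m] by [C ^+ 2], contractivity on matrices carries this to an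
    arbitrary [F], and [|T x|^2 = <T^* T x, x>] concludes. *)
Lemma assoc_matrix_bound (L : hilbert R) (F : N1 -> BH L) (hF : is_hom F)
    (l : 'I_n -> L) :
  nrm (Hact (top hp (op_rep hF) s1) (hcol v l)) <= C * nrm (hcol v l).
Proof.
have C0 : 0 <= C by exact: nrm_ge0.
have key : nrm (hcol v (macts F m l)) <= C ^+ 2 * nrm (hcol v l).
  apply: (macts_contraction product_rep_hom product_rep_norming v_on hF).
    exact: sqr_ge0.
  move=> H' F' k hR; have hF' := product_rep_hom hR.
  set w := hcol v (macts F' m k).
  have [w0|w0] := eqVneq (nrm w) 0; first by rewrite w0 mulr_ge0 ?sqr_ge0 ?nrm_ge0.
  have wp : 0 < nrm w by rewrite lt_def w0 nrm_ge0.
  rewrite -(ler_pM2r wp) -expr2.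
  have -> : nrm w ^+ 2 = cabs (ip w w) by rewrite ip_nrm cabsR ger0_norm ?sqr_ge0.
  rewrite {1}/w gram_matrix; apply: le_trans (ip_CS _ _) _.
  have hO := product_rep_bound hF' hR.
  have h1 (x : htens H H') : nrm (Hact (top hp (op_rep hF') s1) x) <= C * nrm x.
    by apply: le_trans (Hact_le _ _) _; rewrite ler_wpM2r ?nrm_ge0.
  have -> : C ^+ 2 * nrm (hcol v k) * nrm w = (C * nrm (hcol v k)) * (C * nrm w) by ring.
  apply: ler_pM; rewrite ?nrm_ge0 //; exact: h1.
rewrite -ler_sqr ?nnegrE ?nrm_ge0 ?mulr_ge0 ?nrm_ge0 //.
rewrite -[nrm (Hact _ _) ^+ 2]ger0_norm ?sqr_ge0 // -cabsR -ip_nrm -gram_matrix.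
apply: le_trans (ip_CS _ _) _; rewrite exprMn [X in _ <= _ * X]expr2 mulrA.
by rewrite ler_wpM2r ?nrm_ge0.
Qed.

End FixedRepresentation.

Lemma assoc_bound :
  nrm (lincomb (fun x => tensor_elt N12 x.1 (tensor_elt N1 x.2.1 x.2.2)) s) <=
  nrm (lincomb (fun x => tensor_elt M12 (tensor_elt M1 x.1 x.2.1) x.2.2) s).
Proof.
have -> : lincomb (fun x => tensor_elt N12 x.1 (tensor_elt N1 x.2.1 x.2.2)) s =
    algt N12 s1.
  by rewrite /algt /s1 (lincomb_map _ (fun x => (x.1, tensor_elt N1 x.2.1 x.2.2))).
have -> : lincomb (fun x => tensor_elt M12 (tensor_elt M1 x.1 x.2.1) x.2.2) s =
    algt M12 s2.
  by rewrite /algt /s2 (lincomb_map _ (fun x => (tensor_elt M1 x.1 x.2.1, x.2.2))).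
rewrite -/C; apply: algt_nrm_min => [|H L p Q hp hQ]; first exact: nrm_ge0.
apply: htens_bound => [|t]; first exact: nrm_ge0.
(* Over an orthonormal family spanning its first legs, the vector becomes a column with entries
   [l i] in [L]. *)
have [n [v [von vs]]] := gram_schmidt [seq x.2.1 | x <- t].
have [F hF FQ] := rep_op hQ.
pose l i := \sum_(x <- t) (x.1 * ip x.2.1 (v i)) *: x.2.2.
have -> : lincomb (fun x => htv x.1 x.2) t = hcol v l.
  rewrite /hcol /l; under eq_bigr do rewrite (lin_sum (htv_linr _)).
  rewrite exchange_big /lincomb; apply: eq_big_seq => x xt /=.
  rewrite {1}(vs _ (map_f (fun x => x.2.1) xt)).
  rewrite (lin_sum (htv_linl _)) scaler_sumr; apply: eq_bigr => i _.
  by rewrite (linZ (htv_linl _)) (linZ (htv_linr _)) scalerA.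
have -> : top hp hQ s1 = top hp (op_rep hF) s1.
  apply: eq_lincomb => x; apply: BH_htv_ext => h k.
  by rewrite !top_eltE FQ.
exact: assoc_matrix_bound.
Qed.

End Associativity.

Lemma tensor_elt_nrm (R : realType) (A B : cstar R) (M : min_tensor A B) a b :
  nrm (tensor_elt M a b) <= nrm a * nrm b.
Proof.
have -> : tensor_elt M a b = algt M [:: (1, (a, b))].
  by rewrite /algt /lincomb big_seq1 scale1r.
apply: algt_nrm_min => [|H K p q hp hq]; first by rewrite mulr_ge0 ?nrm_ge0.
by rewrite /top /lincomb big_seq1 scale1r; exact: (top_elt_le hp hq (a, b)).
Qed.

Section AssociativityHom.
Variables (R : realType) (A B D : cstar R).
Variables (M1 : min_tensor A B) (M12 : min_tensor M1 D).
Variables (N1 : min_tensor B D) (N12 : min_tensor A N1).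

Lemma tensor_total3 : cspan (range (fun x : A * (B * D) =>
  tensor_elt M12 (tensor_elt M1 x.1 x.2.1) x.2.2)) = setT.
Proof.
rewrite predeqE => z; split => // _.
set S := range (fun x : A * (B * D) => tensor_elt M12 (tensor_elt M1 x.1 x.2.1) x.2.2).
have cS := cspan_closed S; move: z; apply: (tensor_ind cS) => w d.
move: w; apply: (tensor_ind (M := M1)
    (closed_preim (C := nrm d) (tensor_linl M12 d) _ cS)) => [x|a b] /=.
  by rewrite mulrC tensor_elt_nrm.
by apply: sub_cspan; exists (a, (b, d)).
Qed.

Lemma tensor_assoc_hom : exists2 F : M12 -> N12, is_hom F & forall a b d,
  F (tensor_elt M12 (tensor_elt M1 a b) d) = tensor_elt N12 a (tensor_elt N1 b d).
Proof.
have [|||||F hF FE] := @hom_of_generators R (A * (B * D))%type M12 N12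
  (fun x => tensor_elt M12 (tensor_elt M1 x.1 x.2.1) x.2.2)
  (fun x => tensor_elt N12 x.1 (tensor_elt N1 x.2.1 x.2.2))
  (fun x y => (cmul x.1 y.1, (cmul x.2.1 y.2.1, cmul x.2.2 y.2.2)))
  (fun x => (cadj x.1, (cadj x.2.1, cadj x.2.2))) tensor_total3.
- by move=> x y; rewrite !tensor_mul.
- by move=> x; rewrite !tensor_adj.
- by move=> x y; rewrite !tensor_mul.
- by move=> x; rewrite !tensor_adj.
- exact: assoc_bound.
by exists F => // a b d; rewrite (FE (a, (b, d))).
Qed.

End AssociativityHom.

(** * Approximate units and quotients *)

Section ApproximateUnit.
Variables (R : realType) (E : cstar R).
Implicit Types (s x y j : E).

Lemma nrm_sub_mul_sqr s x : cadj s = s -> nrm s <= 1 ->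
  nrm (x - cmul (cmul x s) s) <= nrm x.
Proof.
move=> ss s1; have [El EM EJ] := embM_hom E.
pose e := op_one (cs_inner E).
have h : nrm (e - cmul (embM s) (embM s)) <= 1.
  by apply: (nrm_unit_sub_sqr (@op_oneP _ _ _ (cs_inner E))); rewrite ?embM_nrm // -EJ ss.
rewrite -embM_nrm; have -> : embM (x - cmul (cmul x s) s) =
    cmul (embM x) (e - cmul (embM s) (embM s)).
  rewrite (linB El) !EM cmulBr -!cmulA; congr (_ - _).
  by rewrite (@op_oneP _ _ _ (cs_inner E) _).2.
by apply: le_trans (nrmM _ _) _; rewrite embM_nrm ler_piMr ?nrm_ge0.
Qed.

Section Averages.
Variable s : E.
Hypotheses (ss : cadj s = s) (s1 : nrm s <= 1).
Let t x := x - cmul (cmul x s) s.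

(** The iterates are [x (1 - s^2)^n], expanded without a unit; the factor [s w] is what remains in
    an ideal. *)
Lemma iter_sub_mul_sqr n : exists w, forall x, iter n t x = x - cmul x (cmul s w).
Proof.
elim: n => [|n [w hw]]; first by exists 0 => x; rewrite !cmul0r subr0.
exists (w + s - cmul (cmul w s) s) => x; rewrite iterS hw /t.
by by rewrite !cmulBr !cmulDr !cmulBl !cmulA !opprD !opprK !addrA.
Qed.

Lemma iter_sub_mul_sqr_nrm n x : nrm (iter n t x) <= nrm x.
Proof.
elim: n => [//|n IH]; rewrite iterS; apply: le_trans IH.
exact: nrm_sub_mul_sqr.
Qed.

(** [s^3 = s - t s], and the iterates of [t] are linear, so the sum telescopes. *)
Lemma sum_iter_sub_mul_sqr n :
  \sum_(m < n) iter m t (cmul (cmul s s) s) = s - iter n t s.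
Proof.
have tC m : iter m t (cmul (cmul s s) s) = cmul (cmul (iter m t s) s) s.
  elim: m => [//|m IH]; rewrite !iterS IH /t.
  by rewrite !cmulBl.
elim: n => [|n IH]; first by rewrite big_ord0 subrr.
rewrite big_ord_recr /= IH tC; move: (iter n t s) => y.
by rewrite /t opprB -addrA (addrC (- y)).
Qed.

(** The mean of the first [n] iterates has the form [x - x s w] and is contractive. On [s^3] the
    telescoped sum has norm at most 2, so the mean is at most [2 / n]. *)
Lemma average_approx (e : R) : 0 < e -> exists w,
  (forall x, nrm (x - cmul x (cmul s w)) <= nrm x) /\
  nrm (cmul (cmul s s) s - cmul (cmul (cmul s s) s) (cmul s w)) <= e.
Proof.
move=> e0; have [w hw] := choice iter_sub_mul_sqr.
have [n n0 ne] : exists2 n, (0 < n)%N & 2 <= n%:R * e.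
  exists (Num.truncn (2 / e)).+1 => //; rewrite -ler_pdivrMr //.
  by apply: ltW; exact: truncnS_gt.
have np : 0 < n%:R :> R by rewrite ltr0n.
have nn : n%:R != 0 :> R[i] by rewrite pnatr_eq0 -lt0n.
exists ((n%:R^-1 : R)%:C *: \sum_(m < n) w m).
have hx x : x - cmul x (cmul s ((n%:R^-1 : R)%:C *: \sum_(m < n) w m)) =
    (n%:R^-1 : R)%:C *: \sum_(m < n) iter m t x.
  under [in RHS]eq_bigr do rewrite hw.
  rewrite sumrB sumr_const card_ord scalerBr !cmulZr !cmul_sumr; congr (_ - _).
  rewrite -(scaler_nat n x) scalerA (_ : _ * _ = 1) ?scale1r //.
  by rewrite fmorphV rmorph_nat mulVf.
have ni0 : 0 <= (n%:R^-1 : R) by rewrite invr_ge0 ltW.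
split=> [x|]; rewrite hx ?sum_iter_sub_mul_sqr nrmZr // mulrC ler_pdivrMr //.
  apply: (@le_trans _ _ (\sum_(m < n) nrm x)); last first.
    by rewrite sumr_const card_ord mulr_natr.
  elim/big_rec2: _ => [|m y1 y2 _ h]; first by rewrite nrm0.
  by apply: le_trans (nrmD _ _) _; rewrite lerD // iter_sub_mul_sqr_nrm.
have := nrmB s (iter n t s); have := iter_sub_mul_sqr_nrm n s.
have := s1; move: (n%:R * e) ne (mulrC e n%:R) => z ne ->; lra.
Qed.

End Averages.

(* The defect [x - x u] is a right-module map in [x], which yields
   [|x - x u|^2 <= |x^* x - x^* x u|]; hence it suffices to treat high powers
   of [j^* j]. *)
Lemma defect_sqr u : (forall x, nrm (x - cmul x u) <= nrm x) ->
  forall x, nrm (x - cmul x u) ^+ 2 <= nrm (cmul (cadj x) x - cmul (cmul (cadj x) x) u).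
Proof.
move=> hu x; set y := x - cmul x u.
have yM z : cmul z y = cmul z x - cmul (cmul z x) u by rewrite /y cmulBr cmulA.
rewrite -nrm_cstar yM; apply: le_trans (hu _) _.
by rewrite -nrm_adj cadjM cadjK -yM.
Qed.

(** The element [u = j^* j w] lies in every ideal containing [j], as the quotient norm requires. The
    mean is small on [s^4], and [defect_sqr] descends from there to [s^2], [s] and [j] at the price
    of a square root each time. *)
Lemma approximate_unit j (e : R) : 0 < e -> exists w,
  (forall x, nrm (x - cmul x (cmul (cmul (cadj j) j) w)) <= nrm x) /\
  nrm (j - cmul j (cmul (cmul (cadj j) j) w)) <= e.
Proof.
move=> e0; set b := cmul (cadj j) j; set M := nrm b + 1.
have M0 : 0 < M by rewrite ltr_wpDl ?nrm_ge0.
pose s := M^-1%:C *: b.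
have ss : cadj s = s by rewrite cadjZr /b cadjM cadjK.
have s1 : nrm s <= 1.
  by rewrite nrmZr ?invr_ge0 ?(ltW M0) // mulrC ler_pdivrMr // mul1r lerDl.
have bs : b = M%:C *: s by rewrite scalerA -rmorphM divff ?gt_eqF // scale1r.
(* Two square roots take this tolerance on [s^4] to [e^2 / M] on [s]; since [j^* j = M s], the third
   one leaves [e] on [j]. *)
have d0 : 0 < (e ^+ 2 / M) ^+ 2 ^+ 2 by rewrite !exprn_gt0 // divr_gt0 // exprn_gt0.
have [w [hw1 hw2]] := average_approx ss s1 d0.
exists (M^-1%:C *: w); have -> : cmul b (M^-1%:C *: w) = cmul s w.
  by rewrite cmulZr /s cmulZl.
split=> //; set u := cmul s w in hw1 hw2 *.
have hj := defect_sqr hw1 j; have hs := defect_sqr hw1 s.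
have hss := defect_sqr hw1 (cmul s s).
rewrite ss in hs; rewrite cadjM !ss in hss.
have : nrm (cmul (cmul s s) (cmul s s) - cmul (cmul (cmul s s) (cmul s s)) u) <=
    (e ^+ 2 / M) ^+ 2 ^+ 2.
  have -> : cmul (cmul s s) (cmul s s) = cmul s (cmul (cmul s s) s) by rewrite !cmulA.
  rewrite -(cmulA s _ u) -cmulBr; apply: le_trans hw2.
  by apply: le_trans (nrmM _ _) _; rewrite ler_piMl ?nrm_ge0.
move=> /(le_trans hss); rewrite ler_sqr ?nnegrE ?nrm_ge0 ?exprn_ge0 ?divr_ge0 ?(ltW M0) ?sqr_ge0 //.
move=> /(le_trans hs); rewrite ler_sqr ?nnegrE ?nrm_ge0 ?exprn_ge0 ?divr_ge0 ?(ltW M0) ?sqr_ge0 //.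
rewrite ler_pdivlMr // mulrC => h.
rewrite -ler_sqr ?nnegrE ?nrm_ge0 ?(ltW e0) //; apply: le_trans hj _.
by rewrite -/b bs cmulZl -scalerBr nrmZr ?(ltW M0).
Qed.

Lemma cspan_cmul : cspan [set x : E | exists a b, x = cmul a b] = setT.
Proof.
rewrite predeqE => x; split=> // _; set S := [set x : E | _].
apply/closure_nrmP => e e0; have [w [_ hw]] := approximate_unit x (divr_gt0 e0 (ltr0n _ 2)).
exists (cmul x (cmul (cmul (cadj x) x) w)).
  exists 1%N, (fun=> 1), (fun=> cmul x (cmul (cmul (cadj x) x) w)).
  by rewrite big_ord1 scale1r; split=> // k; exists x, (cmul (cmul (cadj x) x) w).
by apply: le_lt_trans hw _; rewrite ltr_pdivrMr //; lra.
Qed.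

End ApproximateUnit.

(** * Quotients by closed ideals *)

Section QuotientModule.
Variables (R : realType) (V : lmodType R[i]).

Record submodule := Submodule {
  sm_set :> V -> Prop;
  sm0 : sm_set 0;
  smL : forall c x y, sm_set x -> sm_set y -> sm_set (c *: x + y)
}.

Section Quotient.
Variable I : submodule.

Lemma smN x : I x -> I (- x).
Proof. by move=> Ix; rewrite -scaleN1r -[_ *: _]addr0; apply: smL => //; exact: sm0. Qed.

Lemma smD x y : I x -> I y -> I (x + y).
Proof. by move=> Ix Iy; rewrite -[x]scale1r; exact: smL. Qed.

Lemma smZ c x : I x -> I (c *: x).
Proof. by move=> Ix; rewrite -[_ *: _]addr0; apply: smL => //; exact: sm0. Qed.

(** [xget] depends only on the set it chooses from, so congruent vectors receive the same
    representative. *)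
Definition coset_repr (x : V) : V := xget 0 [set y | I (x - y)].

Lemma coset_reprP x : I (x - coset_repr x).
Proof.
by apply: (@xgetPex _ 0 [set y | I (x - y)]); exists x => /=; rewrite subrr; exact: sm0.
Qed.

Lemma coset_repr_eq x y : coset_repr x = coset_repr y <-> I (x - y).
Proof.
split=> [e|Ixy].
  have -> : x - y = (x - coset_repr x) - (y - coset_repr y).
    by rewrite e opprB addrA subrK.
  by apply: smD; [|apply: smN]; exact: coset_reprP.
rewrite /coset_repr; congr xget; rewrite predeqE => z /=; split=> h.
  by have := smD (smN Ixy) h; rewrite opprB addrA subrK.
by have := smD Ixy h; rewrite addrA subrK.
Qed.

(* Cosets are encoded by their chosen representatives. *)
Record quot := Quot { quot_repr : V; quot_reprP : coset_repr quot_repr == quot_repr }.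

HB.instance Definition _ := [isSub for quot_repr].
HB.instance Definition _ := [Choice of quot by <:].

Lemma quot_pi_subproof x : coset_repr (coset_repr x) == coset_repr x.
Proof. by apply/eqP/coset_repr_eq; rewrite -opprB; apply/smN/coset_reprP. Qed.
Definition quot_pi x : quot := Quot (quot_pi_subproof x).

Lemma quot_pi_eq x y : quot_pi x = quot_pi y <-> I (x - y).
Proof.
split=> [/(congr1 quot_repr)/coset_repr_eq //|/coset_repr_eq h].
exact: val_inj.
Qed.

Lemma quot_reprK p : quot_pi (quot_repr p) = p.
Proof. by apply: val_inj => /=; apply/eqP/quot_reprP. Qed.

Lemma quot_repr_pi x : I (x - quot_repr (quot_pi x)).
Proof. exact: coset_reprP. Qed.

Let add p q := quot_pi (quot_repr p + quot_repr q).
Let opp p := quot_pi (- quot_repr p).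
Let scale c p := quot_pi (c *: quot_repr p).

Let addE x y : add (quot_pi x) (quot_pi y) = quot_pi (x + y).
Proof.
apply/quot_pi_eq; rewrite -opprB; apply: smN.
by rewrite opprD addrACA; apply: smD; exact: quot_repr_pi.
Qed.

Let oppE x : opp (quot_pi x) = quot_pi (- x).
Proof. by apply/quot_pi_eq; rewrite opprK addrC; exact: quot_repr_pi. Qed.

Let scaleE c x : scale c (quot_pi x) = quot_pi (c *: x).
Proof.
apply/quot_pi_eq; rewrite -opprB; apply: smN.
by rewrite -scalerBr; apply: smZ; exact: quot_repr_pi.
Qed.

Let addA : associative add.
Proof.
move=> p q r; rewrite -(quot_reprK p) -(quot_reprK q) -(quot_reprK r).
by rewrite !addE addrA.
Qed.

Let addC : commutative add.
Proof. by move=> p q; rewrite /add addrC. Qed.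

Let add0 : left_id (quot_pi 0) add.
Proof. by move=> p; rewrite -(quot_reprK p) addE add0r. Qed.

Let addN : left_inverse (quot_pi 0) opp add.
Proof. by move=> p; rewrite -(quot_reprK p) oppE addE addNr. Qed.

HB.instance Definition _ := GRing.isZmodule.Build quot addA addC add0 addN.

Let quot_piD x y : quot_pi x + quot_pi y = quot_pi (x + y).
Proof. exact: addE. Qed.

Let scaleA a b p : scale a (scale b p) = scale (a * b) p.
Proof. by rewrite -(quot_reprK p) !scaleE scalerA. Qed.

Let scale1 : left_id 1 scale.
Proof. by move=> p; rewrite -(quot_reprK p) scaleE scale1r. Qed.

Let scaleDr : right_distributive scale +%R.
Proof.
move=> c p q; rewrite -(quot_reprK p) -(quot_reprK q) quot_piD !scaleE quot_piD.
by rewrite scalerDr.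
Qed.

Let scaleDl p : {morph scale^~ p : a b / a + b}.
Proof.
move=> a b; rewrite -(quot_reprK p) !scaleE.
by rewrite quot_piD scalerDl.
Qed.

HB.instance Definition _ :=
  GRing.Zmodule_isLmodule.Build R[i] quot scaleA scale1 scaleDr scaleDl.

Lemma quot_pi_lin : is_linear quot_pi.
Proof.
move=> c x y; have -> : c *: quot_pi x = quot_pi (c *: x) by exact: scaleE.
by rewrite quot_piD.
Qed.

Lemma quot_pi0 x : quot_pi x = 0 <-> I x.
Proof. by rewrite -[0]/(quot_pi 0) quot_pi_eq subr0. Qed.

End Quotient.
End QuotientModule.

Section QuotientNorm.
Variables (R : realType) (V : completeNormedModType R[i]) (I : submodule V).
Hypothesis I_closed : closed_sub (sm_set I).
Local Notation q := (quot_pi I).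

Definition quot_norm (p : quot I) : R := inf [set r | exists2 x, q x = p & r = nrm x].

Lemma quot_norm_le x : quot_norm (q x) <= nrm x.
Proof.
by apply: ge_inf; [exists 0 => _ [y _ ->]; exact: nrm_ge0 | exists x].
Qed.

Lemma quot_norm_lift p (e : R) : 0 < e -> exists2 x, q x = p & nrm x < quot_norm p + e.
Proof.
move=> e0; have [||_ [x qx ->] xe] := @inf_adherent _ [set r | exists2 x, q x = p & r = nrm x] e.
- exact: e0.
- split; first by exists (nrm (quot_repr p)), (quot_repr p); rewrite ?quot_reprK.
  by exists 0 => _ [y _ ->]; exact: nrm_ge0.
by exists x.
Qed.

Lemma quot_norm_glb p (C : R) : (forall x, q x = p -> C <= nrm x) -> C <= quot_norm p.
Proof.
move=> h; apply: lb_le_inf; last by move=> _ [x qx ->]; exact: h.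
by exists (nrm (quot_repr p)), (quot_repr p); rewrite ?quot_reprK.
Qed.

Lemma quot_norm_ge0 p : 0 <= quot_norm p.
Proof. by apply: quot_norm_glb => x _; exact: nrm_ge0. Qed.

Lemma quot_normD p p' : quot_norm (p + p') <= quot_norm p + quot_norm p'.
Proof.
apply: (@le_eps R 1) => // t t0 _; have t2 : 0 < t / 2 by rewrite divr_gt0.
have [x <- hx] := quot_norm_lift p t2; have [y <- hy] := quot_norm_lift p' t2.
rewrite -(linD (quot_pi_lin I)); apply: le_trans (quot_norm_le _) _.
have := nrmD x y; lra.
Qed.

Lemma quot_normZ_le c p : quot_norm (c *: p) <= cabs c * quot_norm p.
Proof.
have [->|c0] := eqVneq c 0.
  rewrite scale0r cabs0 mul0r; have := quot_norm_le 0.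
  by rewrite (lin0 (quot_pi_lin I)) nrm0.
have cp : 0 < cabs c.
  by rewrite lt_def cabs_ge0 andbT; apply/eqP => /cabs0_eq0 /eqP; exact/negP.
rewrite mulrC -ler_pdivrMr //; apply: quot_norm_glb => x <-.
rewrite ler_pdivrMr // mulrC -nrmZ -(linZ (quot_pi_lin I)); exact: quot_norm_le.
Qed.

Lemma quot_normZ c p : quot_norm (c *: p) = cabs c * quot_norm p.
Proof.
apply/eqP; rewrite eq_le quot_normZ_le /=.
have [->|c0] := eqVneq c 0; first by rewrite cabs0 mul0r quot_norm_ge0.
have := quot_normZ_le c^-1 (c *: p); rewrite scalerA mulVf // scale1r => h.
apply: le_trans (ler_wpM2l (cabs_ge0 c) h) _.
by rewrite mulrA -cabsM mulfV // cabs1 mul1r.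
Qed.

Lemma quot_norm_eq0 p : quot_norm p = 0 -> p = 0.
Proof.
move=> p0; rewrite -(quot_reprK p); apply/quot_pi0.
have [_ _ Ic] := I_closed; apply: Ic => e e0.
have [x qx xe] := quot_norm_lift p e0; exists (quot_repr p - x).
  by apply/quot_pi_eq; rewrite quot_reprK qx.
by rewrite opprB addrC subrK; rewrite p0 add0r in xe.
Qed.

Lemma half_power_small (e : R) : 0 < e -> exists k, 2^-1 ^+ k * 2 < e.
Proof.
move=> e0; exists (Num.truncn (2 / e)); set k := Num.truncn _.
have : (2 / e) < 2 ^+ k.
  apply: lt_le_trans (truncnS_gt _) _; rewrite -natrX ler_nat; exact: ltn_expl.
by rewrite ltr_pdivrMr // exprVn [X in _ -> X < _]mulrC ltr_pdivrMr ?exprn_gt0 // mulrC.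
Qed.

Lemma geometric_cvg (x : nat -> V) :
  (forall k, nrm (x k.+1 - x k) <= 2^-1 ^+ k) ->
  exists l, forall k, nrm (x k - l) <= 2^-1 ^+ k * 3.
Proof.
move=> hx; have h0 k : 0 < (2^-1 : R) ^+ k by rewrite exprn_gt0.
have hk j k : nrm (x (k + j)%N - x k) <= 2^-1 ^+ k * 2 - 2^-1 ^+ (k + j) * 2.
  elim: j => [|j IH]; first by rewrite addn0 !subrr nrm0.
  have := nrm_tri (x (k + j)%N) (x (k + j.+1)%N) (x k).
  have := hx (k + j)%N; rewrite addnS exprSr; move: (2^-1 ^+ (k + j)) (2^-1 ^+ k) IH => a b IH; lra.
have [e e0|l hl] := @nrm_cauchy_cvg R V x.
  have [k ke] := half_power_small (divr_gt0 e0 (ltr0n _ 2)); exists k => m n km kn.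
  have := hk (m - k)%N k; have := hk (n - k)%N k; rewrite !subnKC //.
  have := nrm_tri (x k) (x m) (x n); rewrite (nrm_distC (x k)).
  have := h0 m; have := h0 n; lra.
exists l => k; have [k' hk'] := hl _ (h0 k).
have := hk' _ (leq_maxr k k'); have := hk (maxn k k' - k)%N k.
rewrite subnKC ?leq_maxl //; have := h0 (maxn k k').
have := nrm_tri (x (maxn k k')) (x k) l.
rewrite (nrm_distC (x k) (x (maxn k k'))); lra.
Qed.

(** Successive differences along a fast subsequence lift to vectors of norm at most [2^-k], whose
    partial sums converge in [V]. *)
Lemma quot_norm_complete (u : nat -> quot I) : cauchy_for quot_norm u ->
  exists l, cvg_for quot_norm u l.
Proof.
move=> cu; have h0 k : 0 < (2^-1 : R) ^+ k by rewrite exprn_gt0.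
have [K hK] := choice (fun k => cu _ (h0 k)).
pose m := fix m k := if k is k'.+1 then maxn (K k) (m k') else K 0%N.
have Km k : (K k <= m k)%N by case: k => [|k] //=; exact: leq_maxl.
have step k : exists x, q x = u (m k.+1) - u (m k) /\ nrm x <= 2^-1 ^+ k.
  have lt : quot_norm (u (m k.+1) - u (m k)) < 2^-1 ^+ k.
    by apply: hK => //; apply: leq_trans (Km k) _; exact: leq_maxr.
  rewrite -subr_gt0 in lt; have [x qx hx] := quot_norm_lift (u (m k.+1) - u (m k)) lt.
  by exists x; split=> //; rewrite addrC subrK in hx; exact: ltW.
have [y hy] := choice step.
pose x := fix x k := if k is k'.+1 then x k' + y k' else quot_repr (u (m 0%N)).
have qx k : q (x k) = u (m k).
  elim: k => [|k IH] /=; first exact: quot_reprK.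
  by rewrite (linD (quot_pi_lin I)) IH (hy k).1 addrC subrK.
have [k|l hl] := @geometric_cvg x.
  by rewrite /= addrC addKr; exact: (hy k).2.
exists (q l) => e e0; have [k ke] : exists k, 2^-1 ^+ k * 4 < e.
  have [k ke] := half_power_small (divr_gt0 e0 (ltr0n _ 2)); exists k; lra.
exists (K k) => n kn; have h1 : quot_norm (u n - u (m k)) < 2^-1 ^+ k by exact: hK.
have h2 : quot_norm (u (m k) - q l) <= 2^-1 ^+ k * 3.
  rewrite -qx -(linB (quot_pi_lin I)); apply: le_trans (quot_norm_le _) _; exact: hl.
have := quot_normD (u n - u (m k)) (u (m k) - q l); rewrite addrA subrK; lra.
Qed.

End QuotientNorm.

Section QuotientCstar.
Variables (R : realType) (E : cstar R).

Record cideal := Cideal {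
  ci_sub :> submodule E;
  ci_closed : closed_sub (sm_set ci_sub);
  ci_l : forall x y, ci_sub y -> ci_sub (cmul x y);
  ci_adj : forall x, ci_sub x -> ci_sub (cadj x)
}.

Variable I : cideal.
Local Notation q := (quot_pi I).

Lemma ci_r x y : I x -> I (cmul x y).
Proof. by move=> Ix; rewrite -[x]cadjK -[y]cadjK -cadjM; apply/ci_adj/ci_l/ci_adj. Qed.

Let mul (p p' : quot I) := q (cmul (quot_repr p) (quot_repr p')).
Let adj (p : quot I) := q (cadj (quot_repr p)).

Let mulE x y : mul (q x) (q y) = q (cmul x y).
Proof.
apply/quot_pi_eq; rewrite -opprB; apply: smN.
have -> : cmul x y - cmul (quot_repr (q x)) (quot_repr (q y)) =
    cmul (x - quot_repr (q x)) y + cmul (quot_repr (q x)) (y - quot_repr (q y)).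
  by rewrite cmulBl cmulBr addrA subrK.
by apply: smD; [apply: ci_r | apply: ci_l]; exact: quot_repr_pi.
Qed.

Let adjE x : adj (q x) = q (cadj x).
Proof.
apply/quot_pi_eq; rewrite -opprB -cadjB; apply/smN/ci_adj.
exact: quot_repr_pi.
Qed.

Definition quot_data : banach_data (quot I).
Proof.
refine (@BanachData R (quot I) setT (@quot_norm R E I) _ _ _ _ _ _) => //.
- by move=> x y _ _; exact: quot_normD.
- by move=> c x _; exact: quot_normZ.
- by move=> x _; apply: quot_norm_eq0; exact: ci_closed.
- by move=> u _ /quot_norm_complete[l hl]; exists l.
Defined.

Local Notation Q := (banach_sub quot_data).

Lemma quot_in (p : quot I) : p \in bd_pred quot_data.
Proof. exact/asboolP. Qed.

Definition cquot_pi (x : E) : Q := BanachSub (quot_in (q x)).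

Lemma cquot_piP (p : Q) : exists x, cquot_pi x = p.
Proof. by exists (quot_repr (bs_val p)); apply: val_inj; rewrite /= quot_reprK. Qed.

Lemma cquot_pi_nrm x : nrm (cquot_pi x) = quot_norm (q x).
Proof. by []. Qed.

Lemma cquot_pi_lin : is_linear cquot_pi.
Proof. by move=> c x y; apply: val_inj; rewrite /= quot_pi_lin. Qed.

Let cmulQ (p p' : Q) : Q := BanachSub (quot_in (mul (bs_val p) (bs_val p'))).
Let cadjQ (p : Q) : Q := BanachSub (quot_in (adj (bs_val p))).

Let cmulQE x y : cmulQ (cquot_pi x) (cquot_pi y) = cquot_pi (cmul x y).
Proof. by apply: val_inj; rewrite /= mulE. Qed.

Let cadjQE x : cadjQ (cquot_pi x) = cquot_pi (cadj x).
Proof. by apply: val_inj; rewrite /= adjE. Qed.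

Let cmulQA x y z : cmulQ x (cmulQ y z) = cmulQ (cmulQ x y) z.
Proof.
have [[a <-] [b <-] [c <-]] := And3 (cquot_piP x) (cquot_piP y) (cquot_piP z).
by rewrite !cmulQE cmulA.
Qed.

Let cmulQl c x y z : cmulQ (c *: x + y) z = c *: cmulQ x z + cmulQ y z.
Proof.
have [[a <-] [b <-] [d <-]] := And3 (cquot_piP x) (cquot_piP y) (cquot_piP z).
by rewrite -cquot_pi_lin !cmulQE cmul_linl cquot_pi_lin.
Qed.

Let cmulQr c x y z : cmulQ x (c *: y + z) = c *: cmulQ x y + cmulQ x z.
Proof.
have [[a <-] [b <-] [d <-]] := And3 (cquot_piP x) (cquot_piP y) (cquot_piP z).
by rewrite -cquot_pi_lin !cmulQE cmul_linr cquot_pi_lin.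
Qed.

Let cadjQK x : cadjQ (cadjQ x) = x.
Proof. by have [a <-] := cquot_piP x; rewrite !cadjQE cadjK. Qed.

Let cadjQl c x y : cadjQ (c *: x + y) = c^* *: cadjQ x + cadjQ y.
Proof.
have [[a <-] [b <-]] := conj (cquot_piP x) (cquot_piP y).
by rewrite -cquot_pi_lin !cadjQE cadj_antilin cquot_pi_lin.
Qed.

Let cadjQM x y : cadjQ (cmulQ x y) = cmulQ (cadjQ y) (cadjQ x).
Proof.
have [[a <-] [b <-]] := conj (cquot_piP x) (cquot_piP y).
by rewrite (cmulQE a) (cadjQE (cmul a b)) cadjM (cadjQE a) (cadjQE b) (cmulQE (cadj b)).
Qed.

Let nrmQM x y : nrm (cmulQ x y) <= nrm x * nrm y.
Proof.
suff h (e : R) : 0 < e -> nrm (cmulQ x y) <= (nrm x + e) * (nrm y + e).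
  move: (nrm (cmulQ x y)) (nrm x) (nrm y) (nrm_ge0 x) (nrm_ge0 y) h => Z X Y X0 Y0 h.
  apply: (@le_eps R 1) => // t t0 t1; have s0 : 0 < X + Y + 1 by rewrite ltr_wpDl ?addr_ge0.
  have e0 : 0 < t / (X + Y + 1) by rewrite divr_gt0.
  apply: le_trans (h _ e0) _; set e := t / _ in e0 *.
  have te : t = e * (X + Y + 1) by rewrite /e divfK // gt_eqF.
  have e1 : e <= 1 by rewrite /e ler_pdivrMr // mul1r; lra.
  by rewrite te; nra.
move=> e0; have [a qa ha] := quot_norm_lift (bs_val x) e0.
have [b qb hb] := quot_norm_lift (bs_val y) e0.
have -> : x = cquot_pi a by apply: val_inj.
have -> : y = cquot_pi b by apply: val_inj.
rewrite (cmulQE a b) !cquot_pi_nrm qa qb.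
apply: le_trans (quot_norm_le _ _) _; apply: le_trans (nrmM _ _) _.
by apply: ler_pM; rewrite ?nrm_ge0 // ltW.
Qed.

Let nrmQ_adj x : nrm (cadjQ x) <= nrm x.
Proof.
apply: quot_norm_glb => a qa; have -> : x = cquot_pi a by apply: val_inj.
by rewrite (cadjQE a) cquot_pi_nrm -(nrm_adj a); exact: quot_norm_le.
Qed.

(** For [z] congruent to [a^* a], take [u] in [I] approximating a unit for [j = z - a^* a]. Then [|a
    - a u|^2 <= |a^* a - a^* a u| <= |z - z u| + |j - j u| <= |z| + e], while [a - a u] is congruent
    to [a]. *)
Let nrmQ_cstar_le x : nrm x ^+ 2 <= nrm (cmulQ (cadjQ x) x).
Proof.
have [a <-] := cquot_piP x; rewrite (cadjQE a) (cmulQE (cadj a)).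
apply: quot_norm_glb => z qz; pose j := z - cmul (cadj a) a.
have Ij : I j by apply/quot_pi_eq.
apply: (@le_eps R 1) => // e e0 _; have [w [w1 w2]] := approximate_unit j e0.
set u := cmul _ w in w1 w2; have Iu : I u by rewrite /u; apply/ci_r/ci_l.
have -> : cquot_pi a = cquot_pi (a - cmul a u).
  apply: val_inj; apply/quot_pi_eq; rewrite opprB addrC subrK; exact: ci_l.
apply: (@le_trans _ _ (nrm (a - cmul a u) ^+ 2)).
  by rewrite ler_sqr ?nnegrE ?nrm_ge0 //; exact: quot_norm_le.
apply: le_trans (defect_sqr w1 a) _.
have -> : cmul (cadj a) a - cmul (cmul (cadj a) a) u =
    (z - cmul z u) - (j - cmul j u).
  have zE : z = cmul (cadj a) a + j by rewrite addrC subrK.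
  by rewrite {1 2}zE cmulDl opprD addrACA addrK.
have := w1 z; have := nrmB (z - cmul z u) (j - cmul j u); lra.
Qed.

Let cnormQM x y : `|cmulQ x y| <= `|x| * `|y|.
Proof. by rewrite !nrmE -rmorphM lecR. Qed.

Let cnormQ_cstar x : `|cmulQ (cadjQ x) x| = `|x| ^+ 2.
Proof.
rewrite !nrmE -rmorphXn; congr (_ %:C); apply/eqP; rewrite eq_le nrmQ_cstar_le andbT.
by apply: le_trans (nrmQM _ _) _; rewrite expr2 ler_wpM2r ?nrm_ge0.
Qed.

Definition quot_cstar : cstar R := @CStar R Q cmulQ cadjQ cmulQA cmulQl cmulQr
  cadjQK cadjQl cadjQM cnormQM cnormQ_cstar.

Lemma quotient_cstar : exists (D : cstar R) (f : E -> D),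
  [/\ is_hom f, forall d, exists x, f x = d & forall x, f x = 0 <-> I x].
Proof.
exists quot_cstar, cquot_pi; split; last 2 first.
- exact: cquot_piP.
- move=> x; rewrite -quot_pi0; split=> [/(congr1 (@bs_val _ _ _)) //|h].
  exact: val_inj.
by split=> [|x y|x]; [exact: cquot_pi_lin | rewrite -cmulQE | rewrite -cadjQE].
Qed.

End QuotientCstar.

(** * Extension of nondegenerate homomorphisms *)

Section NondegenerateHoms.
Variable R : realType.
Implicit Types X Y Z : cstar R.

Definition dense_range (T : Type) (V : completeNormedModType R[i]) (f : T -> V) : Prop :=
  cspan (range f) = setT.

Definition nondegM X Y (f : X -> Mcs Y) : Prop :=
  dense_range (fun x : X * Y => Mact (f x.1) x.2).

Lemma cspan_image X (V : completeNormedModType R[i]) (f : X -> V) (S : set X) (D : set V) :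
  is_linear f -> (exists C, forall x, nrm (f x) <= C * nrm x) -> closed_sub D ->
  cspan S = setT -> (forall x, S x -> D (f x)) -> forall x, D (f x).
Proof.
move=> lf [C bf] cD ST SD x.
apply: (cspanT_dense x ST (closed_preim lf bf cD)) => y Sy; exact: SD.
Qed.

Lemma hom_bounded X Y (f : X -> Y) : is_hom f -> exists C, forall x, nrm (f x) <= C * nrm x.
Proof. by move=> hf; exists 1 => x; rewrite mul1r; exact: hom_contraction. Qed.

(** The value at [T] is prescribed on vectors [f x y] as [f (T x) y]. For a fixed combination of
    such vectors this is linear in [T], and [cstar_contraction] bounds it by [nrm T]. *)
Lemma hom_ext X Y (f : X -> Mcs Y) : is_hom f -> nondegM f ->
  exists2 F : Mcs X -> Mcs Y, is_hom F & forall T x, cmul (F T) (f x) = f (Mact T x).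
Proof.
move=> hf nf; have [fl fM fJ] := hf.
pose g (x : X * Y) := Mact (f x.1) x.2.
have swap x x' y y' : cmul (cadj (Mact (f x) y)) (Mact (f x') y') =
    cmul (cadj y) (Mact (f (cmul (cadj x) x')) y').
  by rewrite fM fJ MactC [RHS]Mact_adj cadjK.
have bd (T : Mcs X) s : nrm (lincomb (fun x => Mact (f (Mact T x.1)) x.2) s) <=
    nrm T * nrm (lincomb g s).
  apply: (cstar_contraction (T := fun T => lincomb (fun x => Mact (f (Mact T x.1)) x.2) s)).
  - move=> c S1 S2; rewrite /lincomb scaler_sumr -big_split.
    apply: eq_bigr => p _; cbv beta; rewrite MactL fl MactL.
    by rewrite scalerDr !scalerA (mulrC c).
  - move=> S1 S2; rewrite /lincomb !cadj_sum !cmul_suml.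
    apply: eq_bigr => p _; rewrite !cmul_sumr; apply: eq_bigr => r _.
    rewrite !cadjZ !cmulZl !cmulZr /g !swap; congr (_ *: (_ *: (cmul _ (Mact (f _) _)))).
    by rewrite MactC [RHS]Mact_adj cadjK.
  - move=> S1; rewrite /lincomb !cadj_sum !cmul_suml.
    apply: eq_bigr => p _; rewrite !cmul_sumr; apply: eq_bigr => r _.
    rewrite !cadjZ !cmulZl !cmulZr /g !swap; congr (_ *: (_ *: (cmul _ (Mact (f _) _)))).
    by rewrite [RHS]Mact_adj cadjK.
have ex (T : Mcs X) : exists W : Mcs Y, forall x,
    Mact W (g x) = Mact (f (Mact T x.1)) x.2.
  apply: (@generated_operator _ _ _ g nf _
    (fun x => Mact (f (Mact (cadj T) x.1)) x.2) (nrm T)) => //.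
  - exact: nrm_ge0.
  - by move=> s; have := bd (cadj T) s; rewrite nrm_adj.
  - by move=> x y; rewrite /g !swap; congr (cmul _ (Mact (f _) _)); rewrite Mact_adj.
have [F hF] := choice ex.
have Fe T x y : Mact (F T) (Mact (f x) y) = Mact (f (Mact T x)) y by exact: (hF T (x, y)).
exists F => [|T x]; last by apply: Mact_ext => y; rewrite MactC Fe.
split=> [c S T|S T|T].
- by apply: (generated_Mcs_ext nf) => p; rewrite MactL !hF MactL fl MactL.
- apply: (generated_Mcs_ext nf) => -[x y]; rewrite MactC !hF MactC.
  exact/esym/Fe.
- apply: (generated_adj_ext nf) => -[x y] [x' y'] /=.
  by rewrite !Fe !swap; congr (cmul _ (Mact (f _) _)); rewrite Mact_adj.
Qed.

Definition hext X Y (f : X -> Mcs Y) : Mcs X -> Mcs Y :=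
  the (fun=> 0) (fun F => is_hom F /\ forall T x, cmul (F T) (f x) = f (Mact T x)).

(** Descriptions are opened by exhibiting one solution; that the chosen one is the intended object
    then follows from density of generators. *)
Lemma the_spec (T : Type) (d : T) (P : T -> Prop) : (exists x, P x) -> P (the d P).
Proof. by move=> e; rewrite /the; case: pselect => // e'; exact: (projT2 (cid e')). Qed.

(** Multipliers come without a bound, so density is not applied to [lact n] itself. After passing to
    [ract], the maps compared are multiplications by fixed elements, which are bounded. *)
Lemma dense_lact_eq (T : Type) Y (g : T -> Y) (n n' : multiplier Y) : dense_range g ->
  (forall x, lact n (g x) = lact n' (g x)) -> n = n'.
Proof.
move=> dg nn'; apply: multiplier_ext => y; apply: cmul_injr => z.
rewrite !lractP; congr (cmul _ y); apply: cmul_inj.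
apply: (generated_eq dg (C := nrm (ract n z) + nrm (ract n' z))) => [c u v|c u v|w|w|x].
- by rewrite cmul_linr.
- by rewrite cmul_linr.
- by apply: le_trans (nrmM _ _) _; rewrite ler_wpM2r ?nrm_ge0 // lerDl nrm_ge0.
- by apply: le_trans (nrmM _ _) _; rewrite ler_wpM2r ?nrm_ge0 // lerDr nrm_ge0.
by rewrite -!lractP nn'.
Qed.

Section Extension.
Variables (X Y : cstar R) (f : X -> Mcs Y).
Lemma nondeg_homE : nondeg_hom (fun x => mul_of (f x)) <-> nondegM f.
Proof.
rewrite /nondeg_hom /nondegM /dense_range.
suff -> : [set y | exists a b, y = lact (mul_of (f a)) b] =
    range (fun x : X * Y => Mact (f x.1) x.2) by [].
by rewrite predeqE => z; split=> [[a [b ->]]|[[a b] _ <-]]; [exists (a, b) | exists a, b].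
Qed.

Hypotheses (hf : is_hom f) (nf : nondegM f).

Lemma hext_spec : is_hom (hext f) /\ forall T x, cmul (hext f T) (f x) = f (Mact T x).
Proof.
have [F hF Fe] := hom_ext hf nf.
exact: (the_spec (P := fun F => is_hom F /\ forall T x, cmul (F T) (f x) = f (Mact T x))
  _ (ex_intro _ F (conj hF Fe))).
Qed.

Lemma hext_hom : is_hom (hext f).
Proof. exact: hext_spec.1. Qed.

Lemma hextE T x y : Mact (hext f T) (Mact (f x) y) = Mact (f (Mact T x)) y.
Proof. by rewrite -MactC hext_spec.2. Qed.

Lemma hext_uniq T W : (forall x y, Mact W (Mact (f x) y) = Mact (f (Mact T x)) y) ->
  W = hext f T.
Proof.
by move=> h; apply: (generated_Mcs_ext nf) => -[x y] /=; rewrite h hextE.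
Qed.

Lemma mult_extE T : mult_ext (fun x => mul_of (f x)) (mul_of T) = mul_of (hext f T).
Proof.
have : exists n : multiplier Y, forall a,
    multM n (mul_of (f a)) = mul_of (f (lact (mul_of T) a)).
  by exists (mul_of (hext f T)) => a; rewrite -mul_ofM hext_spec.2.
move=> /(@the_spec _ mult1) hn; apply: (dense_lact_eq nf) => -[x y] /=.
rewrite -[Mact (f x) y]/(lact (mul_of (f x)) y).
by rewrite -[LHS]/(lact (multM _ (mul_of (f x))) y) hn /= hextE.
Qed.

End Extension.
Section Intertwining.
Variables (X Y X' Y' : cstar R) (f : X -> Mcs Y) (f' : X' -> Mcs Y').
Variables (al : X -> X') (be : Y -> Y').
Hypotheses (hf : is_hom f) (hf' : is_hom f') (hbe : is_hom be) (dbe : dense_range be).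
Hypothesis nf : nondegM f.
Hypothesis ff' : forall x y, be (Mact (f x) y) = Mact (f' (al x)) (be y).

Lemma intertwined_nondegenerate : nondegM f'.
Proof.
rewrite /nondegM /dense_range predeqE => z; split=> // _.
have [bel _ _] := hbe; have [C bb] := hom_bounded hbe.
have cS := cspan_closed (range (fun x : X' * Y' => Mact (f' x.1) x.2)).
apply: (generated_ind dbe cS) => y; move: y.
apply: (generated_ind nf (closed_preim bel bb cS)) => -[x y] /=.
by rewrite ff'; apply: sub_cspan; exists (al x, be y).
Qed.

(** Naturality of the extension along a homomorphism of dense range. Identities between composites
    of extended homomorphisms are carried to slices and quotients by this, after a check on
    generators. *)
Lemma intertwined_hext (T : Mcs X) (T' : Mcs X') :
  (forall x, Mact T' (al x) = al (Mact T x)) ->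
  forall y, Mact (hext f' T') (be y) = be (Mact (hext f T) y).
Proof.
move=> TT'; have nf' := intertwined_nondegenerate; have [bel _ _] := hbe.
have bb := hom_contraction hbe.
apply: (generated_eq nf (C := nrm (hext f' T') + nrm (hext f T))) => [c u v|c u v|y|y|[x y] /=].
- by rewrite bel Mact_lin.
- by rewrite (Mact_lin (hext f T)) bel.
- apply: le_trans (Mact_le _ _) _; rewrite mulrDl ler_wpDr ?mulr_ge0 ?nrm_ge0 //.
  by rewrite ler_wpM2l ?nrm_ge0.
- apply: le_trans (bb _) _; apply: le_trans (Mact_le _ _) _.
  by rewrite ler_wpM2r ?nrm_ge0 // lerDr nrm_ge0.
by rewrite ff' !hextE // TT' ff'.
Qed.

End Intertwining.
Lemma intertwine_generated (T1 T2 : Type) X Y X' Y' (g1 : T1 -> X) (g2 : T2 -> Y)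
    (f : X -> Mcs Y) (f' : X' -> Mcs Y') (al : X -> X') (be : Y -> Y') :
  dense_range g1 -> dense_range g2 ->
  is_hom f -> is_hom f' -> is_hom al -> is_hom be ->
  (forall s t, be (Mact (f (g1 s)) (g2 t)) = Mact (f' (al (g1 s))) (be (g2 t))) ->
  forall x y, be (Mact (f x) y) = Mact (f' (al x)) (be y).
Proof.
move=> d1 d2 hf hf' hal hbe h x y.
have [[fl _ _] [fl' _ _] [al_l _ _] [be_l _ _]] := And4 hf hf' hal hbe.
have [bf bf' bal bbe] := And4 (hom_contraction hf) (hom_contraction hf')
  (hom_contraction hal) (hom_contraction hbe).
have b1 u v : nrm (be (Mact (f u) v)) <= nrm u * nrm v.
  apply: le_trans (bbe _) _; apply: le_trans (Mact_le _ _) _.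
  by rewrite ler_wpM2r ?nrm_ge0.
have b2 u v : nrm (Mact (f' (al u)) (be v)) <= nrm u * nrm v.
  apply: le_trans (Mact_le _ _) _; apply: ler_pM; rewrite ?nrm_ge0 ?bbe //.
  exact: le_trans (bf' _) _.
move: y; apply: (generated_eq d2 (C := nrm x)) => [c u v|c u v|u|u|t] //.
- by rewrite Mact_lin be_l.
- by rewrite be_l Mact_lin.
move: x; apply: (generated_eq d1 (C := nrm (g2 t))) => [c u v|c u v|u|u|s] //.
- by rewrite fl MactL be_l.
- by rewrite al_l fl' MactL.
- by rewrite mulrC.
- by rewrite mulrC.
Qed.

End NondegenerateHoms.

Section DenseHoms.
Variable R : realType.

Lemma dense_hom_eq (T : Type) (X Y : cstar R) (g : T -> X) (f f' : X -> Y) :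
  dense_range g -> is_hom f -> is_hom f' -> (forall t, f (g t) = f' (g t)) ->
  forall x, f x = f' x.
Proof.
move=> dg hf hf' ff'; have [fl _ _] := hf; have [fl' _ _] := hf'.
by apply: (generated_eq dg (C := 1)) => // x; rewrite mul1r hom_contraction.
Qed.

Lemma embM_nondegenerate (X : cstar R) : nondegM (@embM R X).
Proof.
rewrite /nondegM /dense_range -(cspan_cmul X); congr cspan; rewrite predeqE => z.
by split=> [[[a b] _ <-]|[a [b ->]]]; [exists a, b | exists (a, b)].
Qed.

Lemma comp_nondegenerate (X Y Z : cstar R) (h : X -> Y) (f : Y -> Mcs Z) :
  is_hom h -> dense_range h -> is_hom f -> nondegM f ->
  nondegM (fun x => f (h x)).
Proof.
move=> hh dh hf nf; rewrite /nondegM /dense_range predeqE => z; split=> // _.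
have cS := cspan_closed (range (fun x : X * Z => Mact (f (h x.1)) x.2)).
apply: (generated_ind nf cS) => -[y w] /=.
have lf : is_linear (fun y => Mact (f y) w).
  by case: hf => fl _ _ c u v; rewrite fl MactL.
move: y; apply: (generated_ind dh (closed_preim (C := nrm w) lf _ cS)) => [y|x] /=.
  apply: le_trans (Mact_le _ _) _; rewrite mulrC.
  by rewrite ler_wpM2l ?nrm_ge0 // hom_contraction.
by apply: sub_cspan; exists (x, w).
Qed.

Lemma surjective_dense (X Y : cstar R) (h : X -> Y) :
  (forall y, exists x, h x = y) -> dense_range h.
Proof.
move=> sh; rewrite /dense_range predeqE => y; split=> // _.
by apply: sub_cspan; have [x <-] := sh y; exists x.
Qed.

Lemma iotaE (X : cstar R) : mult_embed X = fun x => mul_of (embM x).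
Proof. by apply/funext => x; rewrite mul_of_embM. Qed.

Lemma ract_mul_of (X : cstar R) (T : Mcs X) x :
  ract (mul_of T) x = cadj (Mact (cadj T) (cadj x)).
Proof. by []. Qed.

Lemma iota_inj (X : cstar R) : injective (@mult_embed R X).
Proof.
move=> x y h; apply: cmul_inj => z; exact: (congr1 (fun m => lact m z) h).
Qed.

Lemma hext_embM (X : cstar R) (T : Mcs X) : hext (@embM R X) T = T.
Proof.
apply/esym/hext_uniq; first exact: embM_hom.
  exact: embM_nondegenerate.
by move=> x y; rewrite !Mact_embM MactM.
Qed.

Section Push.
Variables (X Y : cstar R) (h : X -> Y).
Hypotheses (hh : is_hom h) (dh : dense_range h).

(** A homomorphism with dense range is nondegenerate as a map into multipliers, so it induces
    [M(X) -> M(Y)]. *)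
Definition push : Mcs X -> Mcs Y := hext (fun x => embM (h x)).

Lemma push_hom : is_hom push.
Proof.
apply: hext_hom; first exact: hom_comp (@embM_hom _ _) hh.
exact: comp_nondegenerate hh dh (@embM_hom _ _) (@embM_nondegenerate _).
Qed.

Lemma pushE T x : Mact (push T) (h x) = h (Mact T x).
Proof.
rewrite (intertwined_hext (al := id) (@embM_hom R X) (hom_comp (@embM_hom _ _) hh)
  hh dh (@embM_nondegenerate _) _ (T := T)) ?hext_embM //.
by move=> u v; rewrite !Mact_embM; case: hh.
Qed.

End Push.
End DenseHoms.

(** * Tensor products in the chosen setting *)

Section TensorSetting.
Variables (R : realType) (G : topGroupType) (S : setting R G).
Local Notation calg := (cstar R).
Local Notation "A '⊠' B" := (tensor_car (tens S A B))
  (at level 35, right associativity).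
Local Notation "a '⊗' b" := (tensor_elt (tens S _ _) a b)
  (at level 35, right associativity).
Local Notation iota := (mult_embed _).

(** The description also constrains the right action; for [W] this part is read off from its
    adjoint, which is the tensor product of the adjoints. *)
Lemma mult_tensorE (A B : calg) (V : Mcs A) (T : Mcs B) (W : Mcs (A ⊠ B)) :
  (forall a b, Mact W (a ⊗ b) = Mact V a ⊗ Mact T b) ->
  mult_tensor S (mul_of V) (mul_of T) = mul_of W.
Proof.
move=> hW; have [L hL] := tensor_mult (tens S A B).
have WL : L (cadj V) (cadj T) = cadj W.
  by apply: Mcs_adj_ext => x y; rewrite hL hW !tensor_adj !tensor_mul -!Mact_adj.
have : exists p : multiplier (A ⊠ B), forall a b,
    lact p (a ⊗ b) = lact (mul_of V) a ⊗ lact (mul_of T) b /\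
    ract p (a ⊗ b) = ract (mul_of V) a ⊗ ract (mul_of T) b.
  exists (mul_of W) => a b; split; first by rewrite !lact_mul_of.
  by rewrite !ract_mul_of tensor_adj -WL hL tensor_adj.
move=> /(@the_spec _ mult1) hp; apply: (dense_lact_eq (tensor_range_dense _)) => -[a b] /=.
by rewrite (hp a b).1 -hW.
Qed.

Section TensorOfMultipliers.
Variables (A B : calg).

Definition tmul : Mcs A -> Mcs B -> Mcs (A ⊠ B) :=
  projT1 (cid (tensor_mult (tens S A B))).

Lemma tmulE V T a b : Mact (tmul V T) (a ⊗ b) = Mact V a ⊗ Mact T b.
Proof. exact: (projT2 (cid (tensor_mult (tens S A B)))). Qed.

Lemma mult_tensor_tmul V T : mult_tensor S (mul_of V) (mul_of T) = mul_of (tmul V T).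
Proof. exact/mult_tensorE/tmulE. Qed.

End TensorOfMultipliers.

Section TensorOfHoms.
Variables (A B A' B' : calg) (f : A -> Mcs A') (g : B -> Mcs B').
Hypotheses (hf : is_hom f) (hg : is_hom g).

Definition mtens : A ⊠ B -> Mcs (A' ⊠ B') := the (fun=> 0) (fun F =>
  is_hom F /\ forall a b x y, Mact (F (a ⊗ b)) (x ⊗ y) = Mact (f a) x ⊗ Mact (g b) y).

Lemma mtens_spec : is_hom mtens /\
  forall a b x y, Mact (mtens (a ⊗ b)) (x ⊗ y) = Mact (f a) x ⊗ Mact (g b) y.
Proof.
have [F hF Fe] := tensor_of_homs (tens S A B) (tens S A' B') hf hg.
exact: (the_spec (P := fun F => is_hom F /\ forall a b x y,
  Mact (F (a ⊗ b)) (x ⊗ y) = Mact (f a) x ⊗ Mact (g b) y) _ (ex_intro _ F (conj hF Fe))).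
Qed.

Lemma mtens_hom : is_hom mtens. Proof. exact: mtens_spec.1. Qed.

Lemma mtensE a b x y : Mact (mtens (a ⊗ b)) (x ⊗ y) = Mact (f a) x ⊗ Mact (g b) y.
Proof. exact: mtens_spec.2. Qed.

Lemma hom_tensorE : @hom_tensor R G S A B A' B' (fun a => mul_of (f a)) (fun b => mul_of (g b)) =
  fun z => mul_of (mtens z).
Proof.
have mE a b : mult_tensor S (mul_of (f a)) (mul_of (g b)) = mul_of (mtens (a ⊗ b)).
  by apply: mult_tensorE => x y; exact: mtensE.
have : exists F : A ⊠ B -> multiplier (A' ⊠ B'), is_mhom F /\
    forall a b, F (a ⊗ b) = mult_tensor S (mul_of (f a)) (mul_of (g b)).
  by exists (fun z => mul_of (mtens z)); split=> [|a b]; [exact/hom_mhom/mtens_hom | rewrite mE].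
move=> /(@the_spec _ (fun=> mult1)); rewrite -/(@hom_tensor _ _ _ _ _ _ _ _ _).
move: (@hom_tensor _ _ _ _ _ _ _ _ _) => F [mF Fe]; have [F1 hF1 FF1] := mhom_lift mF.
apply/funext => z; rewrite -FF1; congr mul_of.
move: z; apply: (dense_hom_eq (tensor_range_dense _) hF1 mtens_hom) => -[a b] /=.
by apply: mul_of_inj; rewrite FF1 Fe mE.
Qed.

Lemma mtens_nondegenerate : nondegM f -> nondegM g -> nondegM mtens.
Proof.
move=> nf ng; rewrite /nondegM /dense_range predeqE => z; split=> // _.
have cS := cspan_closed (range (fun x : A ⊠ B * A' ⊠ B' => Mact (mtens x.1) x.2)).
apply: (tensor_ind cS) => x y; move: x.
apply: (generated_ind nf (closed_preim (C := nrm y) (tensor_linl (tens S A' B') y) _ cS)).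
  by move=> x; rewrite mulrC tensor_elt_nrm.
move=> [a x] /=; move: y.
apply: (generated_ind ng (closed_preim (C := nrm (Mact (f a) x)) (tensor_linr (tens S A' B') _) _ cS)).
  by move=> y; rewrite tensor_elt_nrm.
by move=> [b y] /=; rewrite -mtensE; apply: sub_cspan; exists (a ⊗ b, x ⊗ y).
Qed.

End TensorOfHoms.

Section TensorMap.
Variables (A B A' B' : calg) (f : A -> A') (g : B -> B').
Hypotheses (hf : is_hom f) (hg : is_hom g).

Definition tmap : A ⊠ B -> A' ⊠ B' := the (fun=> 0) (fun F =>
  is_hom F /\ forall a b, F (a ⊗ b) = f a ⊗ g b).

Lemma mtens_embM a b : mtens (fun a => embM (f a)) (fun b => embM (g b)) (a ⊗ b) =
  embM (f a ⊗ g b).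
Proof.
apply: Mcs_tensor_ext => x y.
rewrite mtensE; [|exact: (hom_comp (@embM_hom _ _) hf)|exact: (hom_comp (@embM_hom _ _) hg)].
by rewrite !Mact_embM tensor_mul.
Qed.

Lemma tmap_spec : is_hom tmap /\ forall a b, tmap (a ⊗ b) = f a ⊗ g b.
Proof.
have hF := mtens_hom (hom_comp (@embM_hom _ _) hf) (hom_comp (@embM_hom _ _) hg).
have [|||F hF' Fe] := @hom_of_elementary R A B (tens S A B) _ (fun x => f x.1 ⊗ g x.2).
- by move=> x y; case: hf hg => _ fM _ [_ gM _]; rewrite tensor_mul fM gM.
- by move=> x; case: hf hg => _ _ fJ [_ _ gJ]; rewrite tensor_adj fJ gJ.
(* The bound is inherited from the homomorphism into multipliers, [embM] being isometric. *)
- move=> s; have [El _ _] := @embM_hom R (A' ⊠ B').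
  rewrite -embM_nrm (lincomb_lin _ _ El).
  have -> : lincomb (fun x => embM (f x.1 ⊗ g x.2)) s =
      mtens (fun a => embM (f a)) (fun b => embM (g b)) (algt _ s).
    have [Fl _ _] := hF; rewrite /algt (lincomb_lin _ _ Fl).
    by apply: eq_lincomb => -[a b]; rewrite mtens_embM.
  exact: hom_contraction.
exact: (the_spec (P := fun F => is_hom F /\ forall a b, F (a ⊗ b) = f a ⊗ g b) _
  (ex_intro _ F (conj hF' Fe))).
Qed.

Lemma tmap_hom : is_hom tmap. Proof. exact: tmap_spec.1. Qed.
Lemma tmapE a b : tmap (a ⊗ b) = f a ⊗ g b. Proof. exact: tmap_spec.2. Qed.

Lemma tmap_dense : dense_range f -> dense_range g -> dense_range tmap.
Proof.
move=> df dg; rewrite /dense_range predeqE => z; split=> // _.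
have cS := cspan_closed (range tmap); apply: (tensor_ind cS) => x y; move: x.
apply: (generated_ind df (closed_preim (C := nrm y) (tensor_linl (tens S A' B') y) _ cS)).
  by move=> x; rewrite mulrC tensor_elt_nrm.
move=> a /=; move: y.
apply: (generated_ind dg (closed_preim (C := nrm (f a)) (tensor_linr (tens S A' B') _) _ cS)).
  by move=> y; rewrite tensor_elt_nrm.
by move=> b /=; rewrite -tmapE; apply: sub_cspan; exists (a ⊗ b).
Qed.

Lemma hom_tensor_tmap : @hom_tensor R G S A B A' B' (fun a => iota (f a)) (fun b => iota (g b)) =
  fun z => iota (tmap z).
Proof.
have h1 := hom_comp (@embM_hom _ _) hf; have h2 := hom_comp (@embM_hom _ _) hg.
have -> : @hom_tensor R G S A B A' B' (fun a => iota (f a)) (fun b => iota (g b)) =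
    @hom_tensor R G S A B A' B' (fun a => mul_of (embM (f a))) (fun b => mul_of (embM (g b))).
  by rewrite !iotaE.
rewrite (hom_tensorE h1 h2) iotaE; apply/funext => z; congr mul_of; move: z.
apply: (dense_hom_eq (tensor_range_dense _) (mtens_hom h1 h2) (hom_comp (@embM_hom _ _) tmap_hom)).
by move=> [a b] /=; rewrite mtens_embM tmapE.
Qed.

End TensorMap.

Section Associator.
Variables (A B D : calg).

Definition tassoc : (A ⊠ B) ⊠ D -> A ⊠ (B ⊠ D) := the (fun=> 0) (fun F =>
  is_hom F /\ forall a b d, F ((a ⊗ b) ⊗ d) = a ⊗ (b ⊗ d)).

Lemma tassoc_spec : is_hom tassoc /\ forall a b d, tassoc ((a ⊗ b) ⊗ d) = a ⊗ (b ⊗ d).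
Proof.
have [F hF Fe] := tensor_assoc_hom (tens S (A ⊠ B) D) (tens S A (B ⊠ D)).
exact: (the_spec (P := fun F => is_hom F /\ forall a b d, F ((a ⊗ b) ⊗ d) = a ⊗ (b ⊗ d)) _
  (ex_intro _ F (conj hF Fe))).
Qed.

Lemma tassoc_hom : is_hom tassoc. Proof. exact: tassoc_spec.1. Qed.
Lemma tassocE a b d : tassoc ((a ⊗ b) ⊗ d) = a ⊗ (b ⊗ d). Proof. exact: tassoc_spec.2. Qed.

Lemma tassoc_dense : dense_range tassoc.
Proof.
rewrite /dense_range predeqE => z; split=> // _.
have cS := cspan_closed (range tassoc); apply: (tensor_ind cS) => a.
apply: (tensor_ind (closed_preim (C := nrm a) (tensor_linr (tens S A (B ⊠ D)) a) _ cS)).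
  by move=> y; rewrite tensor_elt_nrm.
by move=> b d /=; rewrite -tassocE; apply: sub_cspan; exists ((a ⊗ b) ⊗ d).
Qed.

Lemma tensor_assocE : @tensor_assoc R G S A B D = fun z => iota (tassoc z).
Proof.
have tot := tensor_total3 (M1 := tens S A B) (tens S (A ⊠ B) D).
have : exists F : (A ⊠ B) ⊠ D -> multiplier (A ⊠ (B ⊠ D)), is_mhom F /\
    forall a b d, F ((a ⊗ b) ⊗ d) = iota (a ⊗ (b ⊗ d)).
  exists (fun z => iota (tassoc z)); split=> [|a b d]; last by rewrite tassocE.
  exact: mhom_comp_hom (@embed_mhom _ _) tassoc_hom.
move=> /(@the_spec _ (fun=> mult1)); rewrite -/(@tensor_assoc _ _ _ _ _ _).
move: (@tensor_assoc _ _ _ _ _ _) => F [mF Fe]; have [F1 hF1 FF1] := mhom_lift mF.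
apply/funext => z; rewrite -FF1 iotaE; congr mul_of; move: z.
apply: (dense_hom_eq tot hF1 (hom_comp (@embM_hom _ _) tassoc_hom)) => -[a [b d]] /=.
by apply: mul_of_inj; rewrite FF1 Fe tassocE mul_of_embM.
Qed.

End Associator.
End TensorSetting.

(** * Comultiplication and counit *)

Section StrictContinuity.
Variables (R : realType) (G : topGroupType).

Definition ctn (V : completeNormedModType R[i]) (f : G -> V) : Prop :=
  forall s0 (e : R), 0 < e -> \forall s \near s0, nrm (f s - f s0) < e.

Lemma ctnP (V : completeNormedModType R[i]) (f : G -> V) : continuous f <-> ctn f.
Proof.
split=> [cf s0 e e0|cf s0].
  have /cvg_ballP/(_ e%:C) := cf s0; rewrite ltcR => /(_ e0); apply: filterS => s.
  by move=> /nrm_ballP; rewrite nrm_distC.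
apply/cvg_ballP => e /gt0_complexE[r r0 ->]; apply: filterS (cf s0 r r0) => s.
by rewrite nrm_distC => h; apply/nrm_ballP.
Qed.

Lemma ctn_lin (V : completeNormedModType R[i]) c (f g : G -> V) :
  ctn f -> ctn g -> ctn (fun s => c *: f s + g s).
Proof.
move=> cf cg s0 e e0; have c1 : 0 < cabs c + 1 by rewrite ltr_wpDl ?cabs_ge0.
have e2 : 0 < e / 2 by rewrite divr_gt0.
apply: filterS2 (cf s0 _ (divr_gt0 e2 c1)) (cg s0 _ e2) => s h1 h2.
rewrite opprD addrACA -scalerBr; apply: le_lt_trans (nrmD _ _) _; rewrite nrmZ.
move: h1; rewrite ltr_pdivlMr // => h1.
have := nrm_ge0 (f s - f s0); have := cabs_ge0 c; nra.
Qed.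

Lemma ctn_lim (V : completeNormedModType R[i]) (f : G -> V) :
  (forall e : R, 0 < e -> exists2 g : G -> V, ctn g & forall s, nrm (f s - g s) < e) ->
  ctn f.
Proof.
move=> h s0 e e0; have e3 : 0 < e / 3 by rewrite divr_gt0.
have [g cg fg] := h _ e3; apply: filterS (cg s0 _ e3) => s hs.
have := nrm_tri (g s) (f s) (f s0); have := nrm_tri (g s0) (g s) (f s0).
have := fg s; have := fg s0; rewrite (nrm_distC (f s0)); lra.
Qed.

(** The uniform bound on [V] makes the vectors with continuous orbit a closed subspace. *)
Lemma ctn_generated (T : Type) (X : cstar R) (g : T -> X) (V : G -> Mcs X) :
  dense_range g -> (forall s, nrm (V s) <= 1) ->
  (forall t, ctn (fun s => Mact (V s) (g t))) -> forall x, ctn (fun s => Mact (V s) x).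
Proof.
move=> dg V1; apply: (generated_ind dg); split=> [|c x y cx cy|x hx].
- move=> s0 e e0; apply: filterE => s.
  by rewrite !(lin0 (Mact_lin _)) subrr nrm0.
- by move=> s0 e e0; have := ctn_lin c cx cy s0 e0; apply: filterS => s; rewrite !Mact_lin.
apply: ctn_lim => e e0; have [y cy xy] := hx e e0; exists (fun s => Mact (V s) y) => // s.
rewrite -(linB (Mact_lin _)); apply: le_lt_trans (Mact_le _ _) _.
apply: le_lt_trans xy; rewrite ler_piMl ?nrm_ge0 //.
Qed.

Lemma ctn_tensor (A B : cstar R) (M : min_tensor A B) (f : G -> A) (g : G -> B) :
  ctn f -> ctn g -> ctn (fun s => tensor_elt M (f s) (g s)).
Proof.
move=> cf cg s0 e e0.
pose a := nrm (f s0) + 1; pose b := nrm (g s0) + 1.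
have a0 : 0 < a by rewrite ltr_wpDl ?nrm_ge0.
have b0 : 0 < b by rewrite ltr_wpDl ?nrm_ge0.
have e2 : 0 < e / 2 by rewrite divr_gt0.
apply: filterS3 (cf s0 _ (divr_gt0 e2 b0)) (cg s0 _ (divr_gt0 e2 a0)) (cg s0 _ ltr01) => s.
rewrite !ltr_pdivlMr // => h1 h2 h3.
have -> : tensor_elt M (f s) (g s) - tensor_elt M (f s0) (g s0) =
   tensor_elt M (f s - f s0) (g s) + tensor_elt M (f s0) (g s - g s0).
  by rewrite (linB (tensor_linl M _)) (linB (tensor_linr M _)) addrA subrK.
apply: le_lt_trans (nrmD _ _) _.
have := tensor_elt_nrm M (f s - f s0) (g s); have := tensor_elt_nrm M (f s0) (g s - g s0).
have : nrm (g s) <= b.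
  by have := nrm_tri (g s0) (g s) 0; rewrite !subr0 /b; lra.
rewrite /a in h2; move: (nrm_ge0 (f s - f s0)) (nrm_ge0 (g s - g s0)) (nrm_ge0 (f s0)) h1 h2.
move: (nrm (f s - f s0)) (nrm (g s - g s0)) (nrm (f s0)) (nrm (g s)) => x y z w; nra.
Qed.

Lemma unitary_nrm (X : cstar R) (u : multiplier X) : unitary_mult u ->
  forall x, nrm (lact u x) = nrm x.
Proof.
move=> [uu _] x; apply/eqP; rewrite -(eqrXn2 (n := 2)) ?nrm_ge0 //; apply/eqP.
rewrite -!nrm_cstar lact_adjE (_ : lact (mult_adj u) (lact u x) = x) //.
exact: (congr1 (fun m => lact m x) uu).
Qed.

Lemma unitary_lift (X : cstar R) (u : G -> multiplier X) : is_unitary_hom u ->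
  exists2 U : G -> Mcs X, (forall s, mul_of (U s) = u s) & forall s, nrm (U s) <= 1.
Proof.
move=> [uU uM uC].
have ex s : exists T : Mcs X, mul_of T = u s.
  apply: mul_of_surj; exists 1; split=> [|x]; first exact: ler01.
  by rewrite unitary_nrm // mul1r.
have [U hU] := choice ex; exists U => // s; apply: op_nrm_min; split=> [|x]; first exact: ler01.
by rewrite -[bs_val _ x]/(lact (mul_of (U s)) x) hU unitary_nrm // mul1r.
Qed.

End StrictContinuity.

Section Comultiplication.
Variables (R : realType) (G : topGroupType) (S : setting R G).
Local Notation calg := (cstar R).
Local Notation "A '⊠' B" := (tensor_car (tens S A B))
  (at level 35, right associativity).
Local Notation "a '⊗' b" := (tensor_elt (tens S _ _) a b)
  (at level 35, right associativity).
Local Notation CG := (group_algebra_car (CsG S)).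
Local Notation iota := (mult_embed _).
Local Notation "m ⊗m n" := (mult_tensor S m n)
  (at level 35, right associativity).

Section TensorUnitary.
Variables (A B : calg) (u : G -> multiplier A) (v : G -> multiplier B).
Hypotheses (hu : is_unitary_hom u) (hv : is_unitary_hom v).

(** With [u] and [v] the canonical map of [G], the universal property of the group algebra turns
    this into a solution of the description of the comultiplication. *)
Lemma tensor_unitary_hom : is_unitary_hom (fun s => u s ⊗m v s).
Proof.
have [U UE U1] := unitary_lift hu; have [V VE V1] := unitary_lift hv.
have [uU uM uC] := hu; have [vU vM vC] := hv.
have [L hL] := tensor_mult (tens S A B).
have LE s : u s ⊗m v s = mul_of (L (U s) (V s)) by rewrite -UE -VE; exact: mult_tensorE.
have LJ T W : L (cadj T) (cadj W) = cadj (L T W).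
  by apply: Mcs_adj_ext => x y; rewrite !hL !tensor_adj !tensor_mul -!Mact_adj.
have LM T W T' W' : cmul (L T W) (L T' W') = L (cmul T T') (cmul W W').
  by apply: Mcs_tensor_ext => a b; rewrite MactC !hL !MactC.
have L1 : L (op_one (cs_inner A)) (op_one (cs_inner B)) = op_one (cs_inner (A ⊠ B)).
  by apply: Mcs_tensor_ext => a b; rewrite hL.
have unit1 (X : calg) (W : Mcs X) (w : multiplier X) : mul_of W = w -> unitary_mult w ->
    cmul (cadj W) W = op_one (cs_inner X) /\ cmul W (cadj W) = op_one (cs_inner X).
  by move=> <- [h1 h2]; split; apply: mul_of_inj; rewrite mul_ofM mul_ofJ mul_of1.
have nW s : nrm (L (U s) (V s)) <= 1.
  have [ul _] := unit1 _ _ _ (UE s) (uU s); have [vl _] := unit1 _ _ _ (VE s) (vU s).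
  rewrite -(@ler_pXn2r _ 2) ?nnegrE ?nrm_ge0 // -nrm_cstar -LJ LM ul vl L1 expr1n.
  exact: (nrm_unit_le1 (@op_oneP _ _ _ (cs_inner (A ⊠ B)))).
have ract_ctn (X : calg) (w : G -> multiplier X) (W : G -> Mcs X) :
    (forall s, mul_of (W s) = w s) -> strictly_continuous w ->
    forall x, ctn (fun s => Mact (cadj (W s)) x).
  move=> WE wC x s0 e e0; have [_ /ctnP/(_ s0 e e0)] := wC (cadj x).
  by apply: filterS => s; rewrite -!WE !ract_mul_of cadjK -cadjB nrm_adj.
split.
- move=> s; have [ul ur] := unit1 _ _ _ (UE s) (uU s).
  have [vl vr] := unit1 _ _ _ (VE s) (vU s).
  by split; rewrite LE -mul_ofJ -mul_ofM -LJ LM ?ul ?vl ?ur ?vr L1 mul_of1.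
- move=> s t; rewrite !LE -mul_ofM LM; congr (mul_of (L _ _)); apply: mul_of_inj.
    by rewrite mul_ofM !UE uM.
  by rewrite mul_ofM !VE vM.
move=> b; split; apply/ctnP => s0 e e0.
  have h := ctn_generated (V := fun s => L (U s) (V s)) (tensor_range_dense (tens S A B)) nW.
  have {}h := h _ b s0 e e0; apply: filterS (h _) => [s|[x y]]; first by rewrite !LE.
  move=> s1 d d0; have := @ctn_tensor R G A B (tens S A B)
    (fun s => lact (u s) x) (fun s => lact (v s) y).
  move=> /(_ _ _ s1 d d0) H; apply: filterS (H _ _) => [s||].
  + by rewrite !hL -!UE -!VE.
  + by apply/ctnP; case: (uC x).
  + by apply/ctnP; case: (vC y).
have h := ctn_generated (V := fun s => cadj (L (U s) (V s))) (tensor_range_dense (tens S A B)).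
have {}h := h _ _ (cadj b) s0 e e0; apply: filterS (h _ _) => [s|s|[x y]].
- by rewrite !LE !ract_mul_of -cadjB nrm_adj.
- by rewrite nrm_adj.
move=> s1 d d0.
have := ctn_tensor (tens S A B) (ract_ctn _ _ _ UE uC x) (ract_ctn _ _ _ VE vC y).
by move=> /(_ s1 d d0); apply: filterS => s; rewrite -!LJ !hL.
Qed.

End TensorUnitary.

Lemma comult_spec : [/\ is_mhom (@comult R G S), nondeg_hom (@comult R G S) &
  forall s, mult_ext (@comult R G S) (gelt (CsG S) s) = gelt (CsG S) s ⊗m gelt (CsG S) s].
Proof.
have h := tensor_unitary_hom (gelt_unitary (CsG S)) (gelt_unitary (CsG S)).
have [p [hp _]] := @group_algebra_univ R G (CsG S) _ _ h.
exact: (the_spec (P := fun p => [/\ is_mhom p, nondeg_hom p & forall s,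
  mult_ext p (gelt (CsG S) s) = gelt (CsG S) s ⊗m gelt (CsG S) s]) _ (ex_intro _ p hp)).
Qed.

End Comultiplication.

(** * The counit and slice maps *)

Section ComplexNumbers.
Variable R : realType.

Definition complex_data : banach_data R[i]^o.
Proof.
refine (@BanachData R R[i]^o setT (@cabs R) _ _ _ _ _ _) => //.
- by move=> x y _ _; exact: cabsD.
- by move=> c x _; exact: cabsM.
- by move=> x _; exact: cabs0_eq0.
- by move=> u _ cu; have [l hl] := complex_seq_complete cu; exists l.
Defined.

Local Notation C := (banach_sub complex_data).

Lemma complex_in (z : R[i]^o) : z \in bd_pred complex_data.
Proof. exact/asboolP. Qed.

Definition toC (z : R[i]) : C := BanachSub (complex_in z).
Definition ofC (z : C) : R[i] := bs_val z.

Lemma nrmC (z : C) : nrm z = cabs (ofC z). Proof. by []. Qed.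

Lemma ofC_lin c (x y : C) : ofC (c *: x + y) = c * ofC x + ofC y.
Proof. by []. Qed.

Let mulC (x y : C) : C := toC (ofC x * ofC y).
Let adjC (x : C) : C := toC (ofC x)^*.

Let ofCM x y : ofC (mulC x y) = ofC x * ofC y. Proof. by []. Qed.
Let ofCJ x : ofC (adjC x) = (ofC x)^*. Proof. by []. Qed.

Lemma ofC_inj : injective ofC. Proof. exact: val_inj. Qed.

Definition complex_cstar : cstar R.
Proof.
refine (@CStar R C mulC adjC _ _ _ _ _ _ _ _).
- by move=> x y z; apply: ofC_inj; rewrite !ofCM mulrA.
- by move=> c x y z; apply: ofC_inj; rewrite !(ofCM, ofC_lin) mulrDl mulrA.
- by move=> c x y z; apply: ofC_inj; rewrite !(ofCM, ofC_lin) mulrDr mulrCA.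
- by move=> x; apply: ofC_inj; rewrite !ofCJ conjCK.
- by move=> c x y; apply: ofC_inj; rewrite !(ofCJ, ofC_lin) rmorphD rmorphM.
- by move=> x y; apply: ofC_inj; rewrite !(ofCJ, ofCM) rmorphM mulrC.
- by move=> x y; rewrite !nrmE -rmorphM lecR !nrmC ofCM cabsM.
- by move=> x; rewrite !nrmE -rmorphXn !nrmC ofCM ofCJ cabsM cabs_conj.
Defined.

Definition complex_hilbert : hilbert R.
Proof.
refine (@Hilbert R C (fun x y => ofC x * (ofC y)^*) _ _ _).
- by move=> c x y z; rewrite ofC_lin mulrDl mulrA.
- by move=> x y; rewrite rmorphM /= conjCK mulrC.
- by move=> x; rewrite -[`|x|]cabsE -normCK.
Defined.

End ComplexNumbers.

Section Counit.
Variables (R : realType) (G : topGroupType) (S : setting R G).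
Local Notation calg := (cstar R).
Local Notation "A '⊠' B" := (tensor_car (tens S A B))
  (at level 35, right associativity).
Local Notation "a '⊗' b" := (tensor_elt (tens S _ _) a b)
  (at level 35, right associativity).
Local Notation CG := (group_algebra_car (CsG S)).
Local Notation iota := (mult_embed _).
Local Notation CC := (complex_cstar R).
Local Notation one := (toC 1 : CC).

Lemma trivial_unitary_hom (B : calg) : is_unitary_hom (fun _ : G => @mult1 R B).
Proof.
split=> [s|s t|b]; first by split; apply: multiplier_ext => x /=; rewrite ?cadjK.
  exact: multiplier_ext.
by split; exact: cst_continuous.
Qed.

(** The trivial homomorphism integrates to a map into multipliers of the scalars, which are scalars
    again. Nondegeneracy makes it nonzero, and the last clause expresses that group elements are
    sent to 1. *)
Lemma counit_exists : exists ev : CG -> R[i],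
  [/\ forall c x y, ev (c *: x + y) = c * ev x + ev y,
      forall x y, ev (cmul x y) = ev x * ev y,
      forall x, ev (cadj x) = (ev x)^*,
      exists x, ev x = 1 &
      forall s x, ev (lact (gelt (CsG S) s) x) = ev x].
Proof.
have [p [[mp np pg] _]] := @group_algebra_univ R G (CsG S) _ _ (trivial_unitary_hom CC).
have [P hP PE] := mhom_lift mp; have [Pl PM PJ] := hP.
have pE : p = fun x => mul_of (P x) by apply/funext => x; rewrite PE.
rewrite pE in np pg; have nP := (nondeg_homE P).1 np.
have [U UE U1] := unitary_lift (gelt_unitary (CsG S)).
pose ev (x : CG) := ofC (Mact (P x) one).
have evE x z : Mact (P x) z = ev x *: z.
  have -> : z = cmul one z by apply: ofC_inj; rewrite /= mul1r.
  rewrite MactM; apply: ofC_inj.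
  by rewrite -[LHS]/(ev x * ofC z) -[RHS]/(ev x * (1 * ofC z)) mul1r.
have evL c x y : ev (c *: x + y) = c * ev x + ev y by rewrite /ev Pl MactL.
have ev0 : ev 0 = 0 by have := evL (- 1) 0 0; rewrite scaler0 addr0 mulN1r addNr.
exists ev; split=> //.
- move=> x y; rewrite {1}/ev PM MactC !evE.
  by rewrite -[LHS]/(ev x * (ev y * 1)) mulr1.
- move=> x; have := Mact_adj (P x) one one; rewrite -PJ !evE => /(congr1 (@ofC R)) h.
  have {h} : 1^* * (ev x * 1) = (ev (cadj x) * 1)^* * 1 := h.
  by rewrite !mulr1 rmorph1 mul1r => ->; rewrite conjCK.
- have [[x x0]|h] := pselect (exists x, ev x != 0).
    exists ((ev x)^-1 *: x); have := evL (ev x)^-1 x 0.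
    by rewrite addr0 ev0 addr0 mulVf.
  (* If [ev] vanished, nondegeneracy would make the zero subspace dense in the scalars. *)
  have : one = 0.
    apply: (@cspanT_dense R CC _ [set z | z = 0] one nP) => [|_ [[x z] _ <-]] /=.
      split=> [|c x y -> ->|x h'] //=; first by rewrite scaler0 addr0.
      by apply: nrm_eps => e /h'[y /= -> ]; rewrite subr0 => /ltW.
    rewrite evE; have [->|/negP x0] := eqVneq (ev x) 0; first by rewrite scale0r.
    by case: h; exists x; apply/negP.
  by move=> /(congr1 (@ofC R)) /eqP; rewrite oner_eq0.
move=> s x; have := pg s; rewrite -UE mult_extE // -mul_of1 => /mul_of_inj h.
have := hextE hP nP (U s) x one; rewrite h.
by move=> /(congr1 (@ofC R)) /esym.
Qed.

Definition counit : CG -> R[i] := projT1 (cid counit_exists).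

Let counit_spec := projT2 (cid counit_exists).

Lemma counit_lin c x y : counit (c *: x + y) = c * counit x + counit y.
Proof. by have [h _ _ _ _] := counit_spec; exact: h. Qed.

Lemma counitM x y : counit (cmul x y) = counit x * counit y.
Proof. by have [_ h _ _ _] := counit_spec; exact: h. Qed.

Lemma counitJ x : counit (cadj x) = (counit x)^*.
Proof. by have [_ _ h _ _] := counit_spec; exact: h. Qed.

Lemma counit1 : exists x, counit x = 1.
Proof. by have [_ _ _ h _] := counit_spec; exact: h. Qed.

Lemma counit_gelt s x : counit (lact (gelt (CsG S) s) x) = counit x.
Proof. by have [_ _ _ _ h] := counit_spec; exact: h. Qed.

Lemma counit_representation :
  is_representation (fun (c : CG) (z : complex_hilbert R) => counit c *: z).
Proof.
split=> [a c x y|c a b x|a b x|a x y].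
- by rewrite scalerDr !scalerA mulrC.
- by rewrite counit_lin scalerDl scalerA.
- by rewrite counitM scalerA.
by rewrite counitJ ipZl ipZr conjCK.
Qed.

Section Slice.
Variable A : calg.

(** The map is compared with the tensor product of a representation of [A] and the one-dimensional
    representation given by the counit, acting on vectors [v (x) 1]. *)
Lemma slice_exists : exists2 F : A ⊠ CG -> A, is_hom F &
  forall a c, F (a ⊗ c) = counit c *: a.
Proof.
apply: (@hom_of_elementary R A CG (tens S A CG) A (fun x => counit x.2 *: x.1)).
- by move=> x y /=; rewrite cmulZl cmulZr scalerA counitM.
- by move=> x /=; rewrite cadjZ counitJ.
move=> s; apply: gelfand_naimark => [|H p v hp]; first exact: nrm_ge0.
have [pl plin _ _] := hp; pose o : complex_hilbert R := toC 1.
have no : nrm o = 1 by rewrite nrmC cabs1.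
have hq := counit_representation.
rewrite -[nrm (p _ v)]mulr1 -[nrm v]mulr1 -no -!htv_norm.
have -> : htv (p (lincomb (fun x => counit x.2 *: x.1) s) v) o =
    Hact (top hp hq s) (htv v o).
  rewrite /top (lincomb_lin (T := fun W => Hact W _)) //.
  have pv : is_linear (fun a => p a v) by move=> c a b; exact: plin.
  rewrite (lincomb_lin (T := fun a => p a v)) // (lincomb_lin (T := fun w => htv w o)); last first.
    exact: htv_linl.
  apply: eq_lincomb => x; rewrite top_eltE (linZ pv).
  by rewrite (linZ (htv_linl _)) (linZ (htv_linr _)).
by apply: le_trans (Hact_le _ _) _; rewrite ler_wpM2r ?nrm_ge0 // top_le.
Qed.

Definition slice : A ⊠ CG -> A := the (fun=> 0) (fun F =>
  is_hom F /\ forall a c, F (a ⊗ c) = counit c *: a).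

Lemma slice_spec : is_hom slice /\ forall a c, slice (a ⊗ c) = counit c *: a.
Proof.
have [F hF Fe] := slice_exists.
exact: (the_spec (P := fun F => is_hom F /\ forall a c, F (a ⊗ c) = counit c *: a) _
  (ex_intro _ F (conj hF Fe))).
Qed.

Lemma slice_hom : is_hom slice. Proof. exact: slice_spec.1. Qed.
Lemma sliceE a c : slice (a ⊗ c) = counit c *: a. Proof. exact: slice_spec.2. Qed.

Lemma slice_dense : dense_range slice.
Proof.
have [c c1] := counit1; apply: surjective_dense => a.
by exists (a ⊗ c); rewrite sliceE c1 scale1r.
Qed.

End Slice.
End Counit.

Section CounitIdentity.
Variables (R : realType) (G : topGroupType) (S : setting R G).
Local Notation calg := (cstar R).
Local Notation "A '⊠' B" := (tensor_car (tens S A B))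
  (at level 35, right associativity).
Local Notation "a '⊗' b" := (tensor_elt (tens S _ _) a b)
  (at level 35, right associativity).
Local Notation CG := (group_algebra_car (CsG S)).
Local Notation iota := (mult_embed _).

Lemma comult_lift_exists : exists D : CG -> Mcs (CG ⊠ CG),
  [/\ is_hom D, nondegM D & forall c, mul_of (D c) = comult c].
Proof.
have [mc nc _] := comult_spec S; have [D hD DE] := mhom_lift mc.
exists D; split=> //; apply/nondeg_homE; move: nc; congr nondeg_hom.
by apply/funext => c; rewrite DE.
Qed.

Definition comultM : CG -> Mcs (CG ⊠ CG) := projT1 (cid comult_lift_exists).

Lemma comultM_hom : is_hom comultM.
Proof. by have [h _ _] := projT2 (cid comult_lift_exists). Qed.

Lemma comultM_nondeg : nondegM comultM.
Proof. by have [_ h _] := projT2 (cid comult_lift_exists). Qed.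

Lemma comultE : @comult R G S = fun c => mul_of (comultM c).
Proof.
by apply/funext => c; have [_ _ h] := projT2 (cid comult_lift_exists); rewrite h.
Qed.

(** The slice of the comultiplication and the canonical embedding both integrate [s |-> s], since
    slicing sends [s (x) s] to [s]; uniqueness in the universal property identifies them. *)
Lemma slice_comult c w : slice (Mact (comultM c) w) = cmul c (slice w).
Proof.
have [U UE U1] := unitary_lift (gelt_unitary (CsG S)).
have hs := slice_hom S CG; have ds := slice_dense S CG.
pose p c := push (@slice R G S CG) (comultM c).
have pE x w' : Mact (p x) (slice w') = slice (Mact (comultM x) w') by exact: pushE.
have hp : is_hom p by exact: hom_comp (push_hom hs ds) comultM_hom.
have pint x y : slice (Mact (comultM x) y) = Mact (p x) (slice y) by rewrite pE.
have np : nondegM p.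
  exact: (intertwined_nondegenerate (al := id) hs ds comultM_nondeg pint).
have pu s : mult_ext (fun x => mul_of (p x)) (gelt (CsG S) s) = gelt (CsG S) s.
  rewrite -UE mult_extE //; congr mul_of; apply: (generated_Mcs_ext ds) => y.
  have [_ _ cg] := comult_spec S.
  rewrite (intertwined_hext (al := id) comultM_hom hp hs ds comultM_nondeg pint (T := U s)) //.
  have : mul_of (hext comultM (U s)) = mult_tensor S (mul_of (U s)) (mul_of (U s)).
    by rewrite -mult_extE ?UE -?comultE ?cg //; [exact: comultM_hom | exact: comultM_nondeg].
  have [L hL] := tensor_mult (tens S CG CG).
  rewrite (mult_tensorE (W := L (U s) (U s))) // => /mul_of_inj ->.
  move: y; apply: (tensor_eq (C := nrm (L (U s) (U s)) + nrm (U s))) => [a u v|a u v|u|u|a b].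
  - by case: hs => sl _ _; rewrite Mact_lin sl.
  - by case: hs => sl _ _; rewrite sl Mact_lin.
  - apply: le_trans (hom_contraction hs _) _; apply: le_trans (Mact_le _ _) _.
    by rewrite ler_wpM2r ?nrm_ge0 // lerDl nrm_ge0.
  - apply: le_trans (Mact_le _ _) _; rewrite mulrDl ler_wpDl ?mulr_ge0 ?nrm_ge0 //.
    by rewrite ler_wpM2l ?nrm_ge0 // hom_contraction.
  by rewrite hL !sliceE (linZ (Mact_lin _)) -lact_mul_of UE counit_gelt -UE.
have [p0 [_ p0u]] := @group_algebra_univ R G (CsG S) _ _ (gelt_unitary (CsG S)).
have e1 : p0 = fun x => mul_of (p x).
  by apply: p0u; split=> //; [exact: hom_mhom | exact/nondeg_homE].
have e2 : p0 = fun x => iota x.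
  apply: p0u; split=> [||s]; first exact: embed_mhom.
    by rewrite iotaE; apply/nondeg_homE/embM_nondegenerate.
  rewrite iotaE -UE mult_extE ?hext_embM //; [exact: embM_hom | exact: embM_nondegenerate].
have pc : p c = embM c.
  by apply: mul_of_inj; rewrite mul_of_embM; exact: (congr1 (fun f => f c) (etrans (esym e1) e2)).
by rewrite -pE pc Mact_embM.
Qed.

Section CoactionLift.
Variable A : coaction S.

Lemma coact_lift_exists : exists D : A -> Mcs (A ⊠ CG),
  is_hom D /\ forall a, mul_of (D a) = coact a.
Proof. by have [D hD DE] := mhom_lift (coact_hom A); exists D. Qed.

Definition coactM : A -> Mcs (A ⊠ CG) := projT1 (cid coact_lift_exists).

Lemma coactM_hom : is_hom coactM.
Proof. exact: (projT2 (cid coact_lift_exists)).1. Qed.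

Lemma mul_of_coactM a : mul_of (coactM a) = coact a.
Proof. exact: (projT2 (cid coact_lift_exists)).2. Qed.

Lemma coactE : @coact R G S A = fun a => mul_of (coactM a).
Proof. by apply/funext => a; rewrite mul_of_coactM. Qed.

Lemma coactM_nondeg : nondegM coactM.
Proof. by apply/nondeg_homE; rewrite -coactE; exact: coact_nondeg. Qed.

Lemma coactM_inj : injective coactM.
Proof. by move=> a b h; apply: (@coact_inj _ _ _ A); rewrite -!mul_of_coactM h. Qed.

Lemma mtens_coactM_nondeg : nondegM (@mtens R G S _ _ _ _ coactM (@embM R CG)).
Proof.
exact: mtens_nondegenerate coactM_hom (@embM_hom _ _) coactM_nondeg
  (@embM_nondegenerate _ _).
Qed.

Lemma mtens_comultM_nondeg (X : calg) : nondegM (@mtens R G S _ _ _ _ (@embM R X) comultM).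
Proof.
exact: mtens_nondegenerate (@embM_hom _ _) comultM_hom (@embM_nondegenerate _ _)
  comultM_nondeg.
Qed.

Lemma tassoc_nondeg (X Y Z : calg) :
  nondegM (fun z : (X ⊠ Y) ⊠ Z => embM (tassoc z)).
Proof.
exact: comp_nondegenerate (tassoc_hom _ _ _ _) (tassoc_dense _ _ _ _)
  (@embM_hom _ _) (@embM_nondegenerate _ _).
Qed.

End CoactionLift.

Lemma coassocE (A : calg) (D : A -> Mcs (A ⊠ CG)) (c : A -> multiplier (A ⊠ CG)) a :
  is_hom D -> nondegM D -> (forall a, mul_of (D a) = c a) ->
  mult_ext (@tensor_assoc R G S A CG CG)
      (mult_ext (hom_tensor c (fun c : CG => iota c)) (c a)) =
    mult_ext (hom_tensor (fun a : A => iota a) (@comult R G S)) (c a) <->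
  hext (fun z => embM (tassoc z)) (hext (@mtens R G S _ _ _ _ D (@embM R CG)) (D a)) =
  hext (@mtens R G S _ _ _ _ (@embM R A) comultM) (D a).
Proof.
move=> hD nD DE; have cE : c = fun a => mul_of (D a) by apply/funext => x; rewrite DE.
rewrite cE !iotaE comultE !hom_tensorE ?tensor_assocE ?iotaE; last 4 first.
- exact: embM_hom.
- exact: comultM_hom.
- exact: hD.
- exact: embM_hom.
rewrite !mult_extE; last 6 first.
- by apply: mtens_hom; [exact: embM_hom | exact: comultM_hom].
- exact: mtens_comultM_nondeg.
- exact: hom_comp (@embM_hom _ _) (tassoc_hom _ _ _ _).
- exact: tassoc_nondeg.
- by apply: mtens_hom; [exact: hD | exact: embM_hom].
- exact: mtens_nondegenerate hD (@embM_hom _ _) nD (@embM_nondegenerate _ _).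
by split=> [/mul_of_inj|->].
Qed.

Section SliceCoaction.
Variable A : coaction S.
Local Notation dl := (@coactM A).

(** [e] is the multiplier obtained by slicing [dl a]. Slicing the last leg of coassociativity shows
    that the extension of [dl] takes [e] to [dl a]; then [e u] and [a u] have the same image under
    [dl], and injectivity gives [e u = a u]. *)
Lemma slice_coact a x : slice (Mact (dl a) x) = cmul a (slice x).
Proof.
have hs := slice_hom S A; have ds := slice_dense S A.
have hs2 := slice_hom S (A ⊠ CG); have ds2 := slice_dense S (A ⊠ CG).
have hd := coactM_hom A; have he := @embM_hom R CG.
pose e := push (@slice R G S A) (dl a).
pose ga : A ⊠ (CG ⊠ CG) -> A ⊠ CG := @tmap R G S _ _ _ _ (fun a => a) (@slice R G S CG).
have hid (X : calg) : is_hom (fun x : X => x) by split.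
have hga : is_hom ga by apply: tmap_hom; [exact: hid | exact: slice_hom].
have dga : dense_range ga.
  apply: tmap_dense; [exact: hid | exact: slice_hom | | exact: slice_dense].
  by apply: surjective_dense => y; exists y.
have tot := tensor_total3 (M1 := tens S A CG) (tens S (A ⊠ CG) CG).
have gassoc z : ga (tassoc z) = slice z.
  move: z; apply: (dense_hom_eq tot (hom_comp hga (tassoc_hom _ _ _ _)) hs2) => -[b [c d]] /=.
  rewrite tassocE /ga tmapE; [|exact: hid|exact: slice_hom].
  by rewrite !sliceE (linZ (tensor_linr _ _)).
pose f1 := @mtens R G S _ _ _ _ dl (@embM R CG).
have hf1 : is_hom f1 by exact: mtens_hom.
(* The [delta (x) id] side of coassociativity slices to the extension of [delta] at [e]. *)
have s1 y : Mact (hext dl e) (slice y) = slice (Mact (hext f1 (dl a)) y).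
  apply: (intertwined_hext (al := @slice R G S A) hf1 hd hs2 ds2
    (mtens_coactM_nondeg A)) => [u v|u]; last exact: pushE.
  move: u v; apply: (intertwine_generated (tensor_range_dense _) (tensor_range_dense _)) => //.
  move=> [b c] [u d] /=.
  rewrite mtensE // !sliceE Mact_embM counitM.
  by case: hd => dll _ _; rewrite (linZ dll) (linZ (Mact_lin _))
    [Mact (_ *: _) _]/(_ *: _) scalerA mulrC.
(* The [id (x) delta_G] side slices back to [delta(a)], by the counit identity for the
   comultiplication. *)
have s2 y : Mact (dl a) (ga y) =
    ga (Mact (hext (@mtens R G S _ _ _ _ (@embM R A) comultM) (dl a)) y).
  rewrite -{1}[dl a]hext_embM.
  have hm : is_hom (@mtens R G S _ _ _ _ (@embM R A) comultM).
    by apply: mtens_hom; [exact: embM_hom | exact: comultM_hom].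
  apply: (intertwined_hext (al := id) hm (@embM_hom _ _) hga dga (mtens_comultM_nondeg A)) => // u v.
  move: u v; apply: (intertwine_generated (al := id) (tensor_range_dense _)
    (tensor_range_dense _)) => //.
    exact: embM_hom.
  move=> [b c] [u v] /=.
  rewrite mtensE; [|exact: embM_hom|exact: comultM_hom].
  by rewrite /ga !tmapE ?slice_comult ?Mact_embM ?tensor_mul //; exact: slice_hom.
have ea : hext dl e = dl a.
  apply: (generated_Mcs_ext ds2) => y; rewrite s1 -!gassoc s2.
  rewrite -((coassocE a hd (coactM_nondeg A) (@mul_of_coactM A)).1 (coact_coassoc a)).
  by rewrite -/(push _ _) pushE //; [exact: tassoc_hom | exact: tassoc_dense].
have [_ dM _] := hd.
have ex u : Mact e u = cmul a u.
  apply: (@coactM_inj A); rewrite dM -ea.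
  by rewrite (hext_spec hd (coactM_nondeg A)).2.
by rewrite -ex pushE.
Qed.


End SliceCoaction.
End CounitIdentity.

(** * Quotient coactions *)

Section EquivariantHoms.
Variables (R : realType) (G : topGroupType) (S : setting R G).
Local Notation calg := (cstar R).
Local Notation "A '⊠' B" := (tensor_car (tens S A B))
  (at level 35, right associativity).
Local Notation "a '⊗' b" := (tensor_elt (tens S _ _) a b)
  (at level 35, right associativity).
Local Notation CG := (group_algebra_car (CsG S)).
Local Notation iota := (mult_embed _).
Local Notation "m ⊗m n" := (mult_tensor S m n)
  (at level 35, right associativity).

Definition oneT (X : calg) (c : CG) : Mcs (X ⊠ CG) := tmul S (op_one (cs_inner X)) (embM c).

Lemma oneTE X c x y : Mact (oneT X c) (x ⊗ y) = x ⊗ cmul c y.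
Proof. by rewrite /oneT tmulE Mact_embM. Qed.

Lemma mult1_tensorE X c : @mult1 R X ⊗m iota c = mul_of (oneT X c).
Proof. by rewrite -mult_tensor_tmul mul_of1 mul_of_embM. Qed.

Lemma oneT_dense X : dense_range (fun p : CG * (X ⊠ CG) => Mact (oneT X p.1) p.2).
Proof.
rewrite /dense_range predeqE => z; split=> // _.
have cS := cspan_closed (range (fun p : CG * (X ⊠ CG) => Mact (oneT X p.1) p.2)).
apply: (tensor_ind cS) => x y; move: y.
apply: (generated_ind (@embM_nondegenerate R CG)
  (closed_preim (C := nrm x) (tensor_linr (tens S X CG) x) _ cS)) => [y|[c d]] /=.
  by rewrite tensor_elt_nrm.
suff : cspan (range (fun p : CG * (X ⊠ CG) => Mact (oneT X p.1) p.2)) (x ⊗ cmul c d) by [].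
by rewrite -oneTE; apply: sub_cspan; exists (c, x ⊗ d).
Qed.

Lemma embM_eqP (X : calg) (T : Mcs X) m x : mul_of T = m ->
  (m = iota x <-> T = embM x).
Proof. by rewrite -mul_of_embM => <-; split=> [/mul_of_inj|->]. Qed.

Definition mtildeM X (T : Mcs (X ⊠ CG)) : Prop := forall c,
  (exists x, cmul T (oneT X c) = embM x) /\ (exists x, cmul (oneT X c) T = embM x).

Lemma mtildeE X (T : Mcs (X ⊠ CG)) : mtilde (mul_of T) <-> mtildeM T.
Proof.
have e1 c := etrans (mul_ofM T (oneT X c)) (congr1 (multM _) (esym (mult1_tensorE X c))).
have e2 c := etrans (mul_ofM (oneT X c) T) (congr1 (fun m => multM m _) (esym (mult1_tensorE X c))).
by split=> h c; have [[x hx] [y hy]] := h c; split; [exists x | exists y | exists x | exists y];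
  [apply/(embM_eqP _ (e1 c)) | apply/(embM_eqP _ (e2 c)) |
   apply/(embM_eqP _ (e1 c)) | apply/(embM_eqP _ (e2 c))].
Qed.

Lemma mtilde_scale X (k : R[i]) (n : multiplier (X ⊠ CG)) : mtilde n -> mtilde (multZ k n).
Proof.
move=> hn c; have [[x hx] [y hy]] := hn c; split.
  exists (k *: x); apply: multiplier_ext => z /=.
  by rewrite -[lact n _]/(lact (multM n _) z) hx /= cmulZl.
exists (k *: y); apply: multiplier_ext => z /=.
by rewrite (linZ (lact_lin _)) -[lact _ (lact n z)]/(lact (multM _ n) z) hy /= cmulZl.
Qed.

Lemma coact_oneT (A : coaction S) (a : A) c :
  coact a ** (mult1 ⊗m iota c) = mul_of (cmul (coactM a) (oneT A c)).
Proof. by rewrite mult1_tensorE mul_ofM mul_of_coactM. Qed.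

Section Equivariance.
Variables (A B : coaction S) (f : A -> B).
Hypothesis hf : is_hom f.

Definition tensor_id : A ⊠ CG -> B ⊠ CG := @tmap R G S A CG B CG f (fun c => c).

Lemma id_hom (X : calg) : is_hom (fun x : X => x). Proof. by split. Qed.

Lemma tensor_id_hom : is_hom tensor_id.
Proof. by apply: tmap_hom; [exact: hf | exact: id_hom]. Qed.

Lemma tensor_idE a c : tensor_id (a ⊗ c) = f a ⊗ c.
Proof. by apply: tmapE; [exact: hf | exact: id_hom]. Qed.

(** Equivariance tested against [1 (x) c], so that the products lie in the tensor products
    themselves and the description [mtilde_ext] is avoided. *)
Definition equivariant : Prop := forall a c x,
  cmul (coactM a) (oneT A c) = embM x -> cmul (coactM (f a)) (oneT B c) = embM (tensor_id x).

Let solves (m : multiplier (A ⊠ CG)) (n : multiplier (B ⊠ CG)) := mtilde n /\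
  forall c x, m ** (mult1 ⊗m iota c) = iota x ->
    n ** (mult1 ⊗m iota c) = hom_tensor (fun a => iota (f a)) (fun c : CG => iota c) x.

Let solvesE m n : solves m n <-> mtilde n /\
  forall c x, m ** (mult1 ⊗m iota c) = iota x ->
    n ** (mult1 ⊗m iota c) = iota (tensor_id x).
Proof. by rewrite /solves (hom_tensor_tmap S hf (@id_hom CG)). Qed.

Let coact_solves : equivariant -> forall a, solves (coact a) (coact (f a)).
Proof.
move=> ef a; apply/solvesE; split=> [|c x]; first exact: coact_mtilde.
rewrite !coact_oneT => /(embM_eqP _ (erefl _)) h.
by apply/(embM_eqP _ (erefl _)); exact: ef.
Qed.

Lemma equivariant_coact : equivariant -> forall a, coact (f a) = mtilde_ext f (coact a).
Proof.
move=> ef a; have h1 := coact_solves ef a.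
have h2 : solves (coact a) (mtilde_ext f (coact a)).
  exact: (the_spec (P := solves (coact a)) _ (ex_intro _ _ h1)).
move/solvesE: h1 => [_ h1]; move/solvesE: h2 => [_ h2].
apply: (dense_lact_eq (oneT_dense B)) => -[c y].
have [[x hx] _] := coact_mtilde a c.
have := etrans (h1 c x hx) (esym (h2 c x hx)); rewrite mult1_tensorE.
by move=> /(congr1 (fun m => lact m y)).
Qed.

(* If the description defining [mtilde_ext f (coact a)] had no solution, it
   would have none at [2a] either, so [coact (f a)] and its double would both
   be [1] and the target would be zero. *)
Lemma coact_equivariant : (forall a, coact (f a) = mtilde_ext f (coact a)) -> equivariant.
Proof.
move=> cf a c x h; have hx : coact a ** (mult1 ⊗m iota c) = iota x.
  by rewrite coact_oneT; apply/(embM_eqP _ (erefl _)).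
have [ex|nex] := pselect (exists n, solves (coact a) n).
  have /solvesE[_ hs] : solves (coact a) (coact (f a)).
    by rewrite cf; exact: (the_spec (P := solves (coact a)) _ ex).
  by apply/(embM_eqP _ (erefl _)); rewrite -coact_oneT; exact: hs.
have the_none m : ~ (exists n, solves m n) -> mtilde_ext f m = mult1.
  by move=> nm; rewrite /mtilde_ext /the; case: pselect => // e; case: nm; exact: e.
have nex2 : ~ exists n, solves (coact (2 *: a)) n.
  move=> [n /solvesE[mn hn]]; apply: nex; exists (multZ 2^-1 n); apply/solvesE.
  split=> [|d y hy]; first exact: mtilde_scale.
  have [tl _ _] := tensor_id_hom; have [dl _ _] := coactM_hom A.
  have := hn d (2 *: y); rewrite !coact_oneT (linZ dl) cmulZl in hy *.
  move/(embM_eqP _ (erefl _)): hy => ->; have [El _ _] := @embM_hom R (A ⊠ CG).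
  rewrite -(linZ El) mul_of_embM (linZ tl) => /(_ erefl) hd.
  apply: multiplier_ext => z /=; rewrite -[lact n _]/(lact (n ** _) z) hd /=.
  by rewrite cmulZl scalerA mulVf ?scale1r // pnatr_eq0.
have e1 : coactM (f a) = op_one (cs_inner (B ⊠ CG)).
  by apply: mul_of_inj; rewrite mul_of_coactM cf the_none // mul_of1.
have e2 : coactM (f (2 *: a)) = op_one (cs_inner (B ⊠ CG)).
  by apply: mul_of_inj; rewrite mul_of_coactM cf the_none // mul_of1.
have o0 : op_one (cs_inner (B ⊠ CG)) = 0.
  have [fl _ _] := hf; have [dl _ _] := coactM_hom B.
  move: e2; rewrite (linZ fl) (linZ dl) e1 scaler_nat mulr2n => oo.
  by apply: (addrI (op_one (cs_inner (B ⊠ CG)))); rewrite addr0.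
have o1 := @op_oneP _ _ _ (cs_inner (B ⊠ CG)).
by rewrite -[LHS](o1 _).1 -[RHS](o1 _).1 o0 !cmul0l.
Qed.

End Equivariance.
End EquivariantHoms.

Section QuotientCoaction.
Variables (R : realType) (G : topGroupType) (S : setting R G).
Local Notation calg := (cstar R).
Local Notation "A '⊠' B" := (tensor_car (tens S A B))
  (at level 35, right associativity).
Local Notation "a '⊗' b" := (tensor_elt (tens S _ _) a b)
  (at level 35, right associativity).
Local Notation CG := (group_algebra_car (CsG S)).
Local Notation iota := (mult_embed _).

Variables (A : coaction S) (Q : calg) (q : A -> Q).
Hypotheses (hq : is_hom q) (sq : forall p, exists a, q a = p).
Local Notation th := (@tmap R G S A CG Q CG q (fun c => c)).
Hypothesis q_invariant : forall a, q a = 0 -> forall y, th (Mact (coactM a) y) = 0.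

Let dq : dense_range q. Proof. exact: surjective_dense. Qed.
Let did (X : calg) : dense_range (fun x : X => x).
Proof. by apply: surjective_dense => x; exists x. Qed.
Let hth : is_hom th. Proof. by apply: tmap_hom; [exact: hq | exact: id_hom]. Qed.
Let thE a c : th (a ⊗ c) = q a ⊗ c.
Proof. by apply: tmapE; [exact: hq | exact: id_hom]. Qed.
Let dth : dense_range th.
Proof. by apply: tmap_dense; [exact: hq | exact: id_hom | exact: dq | exact: did]. Qed.

Let lft (p : Q) : A := projT1 (cid (sq p)).
Let lftK p : q (lft p) = p. Proof. exact: (projT2 (cid (sq p))). Qed.

(** Defined through chosen lifts; [q_invariant] makes the result independent of them. *)
Definition quot_coact (p : Q) : Mcs (Q ⊠ CG) := push th (coactM (lft p)).

Lemma quot_coactE a : quot_coact (q a) = push th (coactM a).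
Proof.
have [ql _ _] := hq; have [dl _ _] := coactM_hom A.
apply: (generated_Mcs_ext dth) => y; rewrite /quot_coact !pushE //.
have [tl _ _] := hth; apply/eqP; rewrite -subr_eq0 -(linB tl).
have := @q_invariant (lft (q a) - a); rewrite (linB ql) lftK subrr => /(_ erefl y).
by rewrite (linB dl) => <-; apply/eqP.
Qed.

Lemma quot_coact_th a y : Mact (quot_coact (q a)) (th y) = th (Mact (coactM a) y).
Proof. by rewrite quot_coactE pushE. Qed.

Lemma quot_coact_hom : is_hom quot_coact.
Proof.
have [ql qM qJ] := hq; have [pl pM pJ] := hom_comp (push_hom hth dth) (coactM_hom A).
split=> [c x y|x y|x].
- rewrite -[x]lftK -[y]lftK -ql !quot_coactE; exact: pl.
- rewrite -[x]lftK -[y]lftK -qM !quot_coactE; exact: pM.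
- rewrite -[x]lftK -qJ !quot_coactE; exact: pJ.
Qed.

Lemma quot_coact_int x y : th (Mact (coactM x) y) = Mact (quot_coact (q x)) (th y).
Proof. by rewrite quot_coact_th. Qed.

Lemma quot_coact_nondeg : nondegM quot_coact.
Proof. exact: (intertwined_nondegenerate hth dth (coactM_nondeg A) quot_coact_int). Qed.

Lemma slice_quot z : slice (th z) = q (slice z).
Proof.
have [ql _ _] := hq; move: z.
apply: (dense_hom_eq (tensor_range_dense _) (hom_comp (slice_hom S Q) hth)
  (hom_comp hq (slice_hom S A))) => -[a c] /=.
by rewrite thE !sliceE (linZ ql).
Qed.

(** Slicing the value at [q a] recovers left multiplication by [q a], because every element of [Q]
    is the image of a slice. *)
Lemma quot_coact_inj : injective quot_coact.
Proof.
have [_ qM _] := hq.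
have key a y : slice (Mact (quot_coact (q a)) (th y)) = cmul (q a) (q (slice y)).
  by rewrite quot_coact_th slice_quot slice_coact qM.
move=> p p'; have [a <-] := sq p; have [a' <-] := sq p' => h.
apply: cmul_inj => z.
have [c c1] := counit1 S; have [b <-] := sq z.
have -> : b = slice (b ⊗ c) by rewrite sliceE c1 scale1r.
by rewrite -!key h.
Qed.

Lemma oneT_th c y : Mact (oneT Q c) (th y) = th (Mact (oneT A c) y).
Proof.
have [tl _ _] := hth; have tb := hom_contraction hth.
move: y; apply: (tensor_eq (C := nrm (oneT Q c) + nrm (oneT A c))) => [a u v|a u v|u|u|a d].
- by rewrite tl Mact_lin.
- by rewrite Mact_lin tl.
- apply: le_trans (Mact_le _ _) _; rewrite mulrDl ler_wpDr ?mulr_ge0 ?nrm_ge0 //.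
  by rewrite ler_wpM2l ?nrm_ge0.
- apply: le_trans (tb _) _; apply: le_trans (Mact_le _ _) _.
  by rewrite ler_wpM2r ?nrm_ge0 // lerDr nrm_ge0.
by rewrite thE !oneTE thE.
Qed.

Lemma quot_coact_oneT a c x : cmul (coactM a) (oneT A c) = embM x ->
  cmul (quot_coact (q a)) (oneT Q c) = embM (th x).
Proof.
move=> h; apply: (generated_Mcs_ext dth) => y; have [_ tM _] := hth.
by rewrite MactC oneT_th quot_coact_th -MactC h !Mact_embM tM.
Qed.

Lemma quot_oneT_coact a c x : cmul (oneT A c) (coactM a) = embM x ->
  cmul (oneT Q c) (quot_coact (q a)) = embM (th x).
Proof.
move=> h; apply: (generated_Mcs_ext dth) => y; have [_ tM _] := hth.
by rewrite MactC quot_coact_th oneT_th -MactC h !Mact_embM tM.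
Qed.

Lemma quot_coact_mtilde p : mtilde (mul_of (quot_coact p)).
Proof.
have [a <-] := sq p; apply/mtildeE => c.
have /mtildeE/(_ c)[[x hx] [y hy]] : mtilde (mul_of (coactM a))
  by rewrite mul_of_coactM; exact: coact_mtilde.
by split; [exists (th x); exact: quot_coact_oneT | exists (th y); exact: quot_oneT_coact].
Qed.

Lemma quot_coact_span : cspan [set x : Q ⊠ CG |
  exists p c, iota x = mul_of (quot_coact p) ** mult_tensor S mult1 (iota c)] = setT.
Proof.
rewrite predeqE => z; split=> // _; set W := [set x : Q ⊠ CG | _].
have [tl _ _] := hth.
apply: (generated_ind dth (cspan_closed W)) => x; move: x.
apply: (cspan_image tl (hom_bounded hth) (cspan_closed W) (coact_span A)) => x [a [c h]].
apply: sub_cspan; exists (q a), c; rewrite mult1_tensorE -mul_ofM.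
apply/esym/(embM_eqP _ (erefl _)); apply: quot_coact_oneT.
by apply/(embM_eqP _ (erefl _)); rewrite -coact_oneT.
Qed.

Local Notation dli := (@mtens R G S _ _ _ _ (@coactM R G S A) (@embM R CG)).
Local Notation qci := (@mtens R G S _ _ _ _ quot_coact (@embM R CG)).
Local Notation icm X := (@mtens R G S _ _ _ _ (@embM R X) (@comultM R G S)).
Local Notation th2 := (@tmap R G S (A ⊠ CG) CG (Q ⊠ CG) CG th (fun c => c)).
Local Notation th3 := (@tmap R G S A (CG ⊠ CG) Q (CG ⊠ CG) q (fun c => c)).

(** [th3], which is [q (x) id], intertwines the two composites for [A] with those for [Q], as [e2]
    and [e3] state; its range is dense. *)
Lemma quot_coact_coassoc p :
  hext (fun z => embM (tassoc z)) (hext qci (quot_coact p)) = hext (icm Q) (quot_coact p).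
Proof.
have [a <-] := sq p.
have hd := coactM_hom A; have hqc := quot_coact_hom; have hc := comultM_hom S.
have he (X : calg) := @embM_hom R X; have hi := id_hom.
have hdli : is_hom dli by exact: mtens_hom.
have hqci : is_hom qci by exact: mtens_hom.
have hicm (X : calg) : is_hom (icm X) by exact: mtens_hom.
have hth2 : is_hom th2 by exact: tmap_hom.
have hth3 : is_hom th3 by exact: tmap_hom.
have dth2 : dense_range th2 by exact: tmap_dense.
have dth3 : dense_range th3 by exact: tmap_dense.
have hA := tassoc_hom S.
have td (X Y : calg) := tensor_range_dense (tens S X Y).
have i1 u v : th2 (Mact (dli u) v) = Mact (qci (th u)) (th2 v).
  move: u v; apply: (intertwine_generated (td _ _) (td _ _)) => // -[u c] [v d] /=.
  by rewrite mtensE // !tmapE // mtensE // quot_coact_th.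
have i2 u v : th3 (Mact (embM (tassoc u)) v) = Mact (embM (tassoc (th2 u))) (th3 v).
  rewrite !Mact_embM; have [_ t3M _] := hth3; rewrite t3M; congr cmul; move: u.
  apply: (dense_hom_eq (tensor_total3 (M1 := tens S A CG) (tens S (A ⊠ CG) CG))
    (hom_comp hth3 (hA _ _ _)) (hom_comp (hA _ _ _) hth2)) => -[u [c d]] /=.
  by rewrite tassocE !tmapE // tassocE.
have i3 u v : th3 (Mact (icm A u) v) = Mact (icm Q (th u)) (th3 v).
  have [_ qM _] := hq.
  move: u v; apply: (intertwine_generated (td _ _) (td _ _)) => // -[u c] [v d] /=.
  by rewrite mtensE // !tmapE // mtensE // !Mact_embM qM.
have e1 := intertwined_hext hdli hqci hth2 dth2 (mtens_coactM_nondeg A) i1 (quot_coact_th a).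
have e2 := intertwined_hext (hom_comp (he _) (hA _ _ _)) (hom_comp (he _) (hA _ _ _))
  hth3 dth3 (@tassoc_nondeg _ _ _ _ _ _) i2 e1.
have e3 := intertwined_hext (hicm A) (hicm Q) hth3 dth3 (mtens_comultM_nondeg S A) i3
  (quot_coact_th a).
apply: (generated_Mcs_ext dth3) => y; rewrite e2 e3.
by rewrite ((coassocE a hd (coactM_nondeg A) (@mul_of_coactM R G S A)).1 (coact_coassoc a)).
Qed.

Definition quotient_coaction : coaction S.
Proof.
refine (@Coaction R G S Q (fun p => mul_of (quot_coact p)) _ _ _ _ _ _).
- exact/hom_mhom/quot_coact_hom.
- by move=> p p' /mul_of_inj/quot_coact_inj.
- exact/nondeg_homE/quot_coact_nondeg.
- exact: quot_coact_mtilde.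
- move=> p; apply/(coassocE p quot_coact_hom quot_coact_nondeg (fun _ => erefl)).
  exact: quot_coact_coassoc.
- exact: quot_coact_span.
Defined.

Lemma coactM_quotient p : @coactM R G S quotient_coaction p = quot_coact p.
Proof. by apply: mul_of_inj; rewrite mul_of_coactM. Qed.

End QuotientCoaction.

(** * The greatest lower bound *)

Section GreatestLowerBound.
Variables (R : realType) (G : topGroupType) (S : setting R G).
Variables (Mx : maximalization S) (Nx : normalization S).
Variable T : coaction_functor Mx Nx -> Prop.
Local Notation CG := (group_algebra_car (CsG S)).

Lemma cf_ker_closed (tau : coaction_functor Mx Nx) A : closed_sub (cf_ker tau A).
Proof.
have hf := coact_mor_hom (cf_q tau A); have [fl _ _] := hf.
apply: (@closed_sub_zero R _ _ _ 1) => //.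
by move=> x; rewrite mul1r; exact: hom_contraction.
Qed.

Definition ker_span (A : coaction S) : set (Mx A) :=
  cspan [set a : Mx A | exists tau, T tau /\ cf_ker tau A a].

Arguments ker_span A : clear implicits.

Lemma ker_span_closed A : closed_sub (ker_span A).
Proof. exact: cspan_closed. Qed.

Definition ker_submodule A : submodule (Mx A) :=
  @Submodule R (Mx A) (ker_span A)
    (let: And3 h0 _ _ := ker_span_closed A in h0)
    (let: And3 _ hL _ := ker_span_closed A in hL).

Lemma ker_span_min A (D : set (Mx A)) : closed_sub D ->
  (forall tau, T tau -> cf_ker tau A `<=` D) -> ker_span A `<=` D.
Proof. by move=> cD h; apply: cspan_min => // a [tau [Tt ka]]; exact: h ka. Qed.

Lemma sub_ker_span A tau a : T tau -> cf_ker tau A a -> ker_span A a.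
Proof. by move=> Tt ka; apply: sub_cspan; exists tau. Qed.

Definition ker_ideal A : cideal (Mx A).
Proof.
refine (@Cideal R (Mx A) (ker_submodule A) _ _ _); rewrite /=.
- exact: ker_span_closed.
- move=> x; apply: ker_span_min => [|tau Tt a ka].
    apply: (closed_preim (C := nrm x)) (ker_span_closed A) => [c u v|u].
      exact: cmul_linr.
    exact: nrmM.
  apply: (sub_ker_span Tt); rewrite /cf_ker /=.
  by have [_ fM _] := coact_mor_hom (cf_q tau A); rewrite fM ka cmul0r.
- apply: ker_span_min => [|tau Tt a ka].
    have [h0 hL hc] := ker_span_closed A; split=> [|c u v /= hu hv|u hu] /=.
    + by rewrite cadj0.
    + by rewrite cadj_antilin; exact: hL.
    + apply: hc => e /hu[v /= hv uv]; exists (cadj v) => //.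
      by rewrite -cadjB nrm_adj.
  apply: (sub_ker_span Tt); rewrite /cf_ker /=.
  by have [_ _ fJ] := coact_mor_hom (cf_q tau A); rewrite fJ ka cadj0.
Defined.

Lemma glb_alg_exists A : exists (D : cstar R) (f : Mx A -> D),
  [/\ is_hom f, forall d, exists a, f a = d & forall a, f a = 0 <-> ker_span A a].
Proof. exact: (quotient_cstar (ker_ideal A)). Qed.

Definition glb_alg A : cstar R := projT1 (cid (glb_alg_exists A)).
Definition glb_q A : Mx A -> glb_alg A := projT1 (cid (projT2 (cid (glb_alg_exists A)))).

Lemma glb_q_spec A : [/\ is_hom (@glb_q A), forall d, exists a : Mx A, glb_q a = d &
  forall a : Mx A, glb_q a = 0 <-> ker_span A a].
Proof. exact: (projT2 (cid (projT2 (cid (glb_alg_exists A))))). Qed.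

Lemma glb_q_hom A : is_hom (@glb_q A). Proof. by have [] := glb_q_spec A. Qed.
Lemma glb_q_surj A d : exists a : Mx A, glb_q a = d. Proof. by have [_ h _] := glb_q_spec A. Qed.
Lemma glb_q_ker A (a : Mx A) : glb_q a = 0 <-> ker_span A a.
Proof. by have [_ _ h] := glb_q_spec A. Qed.

Local Notation th A :=
  (@tmap R G S (Mx A) CG (glb_alg A) CG (@glb_q A) (fun c => c)).

(* Factor [glb_q] through the [tau]-quotient of the maximalization, on which
   elements of [cf_ker tau A] have trivial coaction. *)
Lemma glb_q_invariant A (a : Mx A) : glb_q a = 0 -> forall y, th A (Mact (coactM a) y) = 0.
Proof.
have hth : is_hom (th A) by apply: tmap_hom; [exact: glb_q_hom | exact: id_hom].
have [tl tM _] := hth; have tb := hom_contraction hth; have [dl _ _] := coactM_hom (Mx A).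
move=> /glb_q_ker ka y; move: a ka; apply: ker_span_min => [|tau Tt a ka] /=.
  apply: (closed_sub_zero (C := nrm y) (f := fun a => th A (Mact (coactM a) y))) => [c u v|u].
    by rewrite dl MactL tl.
  apply: le_trans (tb _) _; apply: le_trans (Mact_le _ _) _.
  by rewrite mulrC ler_wpM2l ?nrm_ge0 //; exact: hom_contraction (coactM_hom _) u.
have hf := coact_mor_hom (cf_q tau A); have [fl fM fJ] := hf.
pose f : Mx A -> cf_functor tau A := cf_q tau A.
have [r rP] := choice (@cf_q_surj R G S Mx Nx tau A).
have [ql qM qJ] := glb_q_hom A.
have rE x : glb_q (r (f x)) = glb_q x.
  apply/eqP; rewrite -subr_eq0 -(linB ql); apply/eqP/glb_q_ker; apply: (sub_ker_span Tt).
  by rewrite /cf_ker /= (linB fl) rP subrr.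
have hr : is_hom (fun x => glb_q (r x)).
  split=> [c u v|u v|u].
  - by rewrite -{1}(rP u) -{1}(rP v) -fl rE ql.
  - by rewrite -{1}(rP u) -{1}(rP v) -fM rE qM.
  - by rewrite -{1}(rP u) -fJ rE qJ.
have thr z : @tmap R G S _ CG _ CG (fun x => glb_q (r x)) (fun c => c)
    (@tensor_id R G S (Mx A) (cf_functor tau A) f z) = th A z.
  have hi := id_hom CG; move: z.
  apply: (dense_hom_eq (tensor_range_dense _)
    (hom_comp (tmap_hom S hr hi) (tensor_id_hom hf)) hth) => -[u c] /=.
  by rewrite tensor_idE // !tmapE ?rE //; exact: glb_q_hom.
move: y; apply: (generated_eq (@oneT_dense R G S (Mx A)) (C := nrm (coactM a)))
    => [c u v|c u v|u|u|[c y] /=].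
- by rewrite Mact_lin tl.
- by rewrite scaler0 addr0.
- by apply: le_trans (tb _) _; exact: Mact_le.
- by rewrite nrm0 mulr_ge0 ?nrm_ge0.
have /mtildeE/(_ c)[[x hx] _] : mtilde (mul_of (coactM a))
  by rewrite mul_of_coactM; exact: coact_mtilde.
have := coact_equivariant hf (coact_mor_equiv (cf_q tau A)) hx.
have [dl' _ _] := coactM_hom (cf_functor tau A).
rewrite [cf_q tau A a]ka (lin0 dl') cmul0l => /esym h0.
have [El _ _] := @embM_hom R (tensor_car (tens S (cf_functor tau A) CG)).
have {}h0 : @tensor_id R G S (Mx A) (cf_functor tau A) f x = 0.
  by apply: nrm0_eq0; rewrite -embM_nrm h0 nrm0.
rewrite -MactC hx Mact_embM tM -thr h0.
have [tl' _ _] := tmap_hom S hr (id_hom CG).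
by rewrite (lin0 tl') cmul0l.
Qed.

Definition glb_obj A : coaction S :=
  quotient_coaction (glb_q_hom A) (@glb_q_surj A) (@glb_q_invariant A).

Lemma glb_q_equivariant A : @equivariant R G S (Mx A) (glb_obj A) (@glb_q A).
Proof.
move=> a c x h; rewrite coactM_quotient.
exact: (quot_coact_oneT (glb_q_hom A) (@glb_q_surj A) (@glb_q_invariant A) h).
Qed.

Definition glb_quot A : coact_mor (Mx A) (glb_obj A) :=
  @CoactMor R G S (Mx A) (glb_obj A) (@glb_q A) (glb_q_hom A)
    (@equivariant_coact R G S (Mx A) (glb_obj A) (@glb_q A) (glb_q_hom A)
      (@glb_q_equivariant A)).

Section Functoriality.
Variables (A B : coaction S) (f : coact_mor A B).
Local Notation fm := (Defs.fmap Mx f).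

(** Naturality of each [cf_q tau] sends kernel into kernel, and a bounded linear map respects closed
    spans. *)
Lemma ker_span_fmap (a : Mx A) : ker_span A a -> ker_span B (fm a).
Proof.
have hf := coact_mor_hom fm; have [fl _ _] := hf; have [C bf] := hom_bounded hf.
move: a; apply: ker_span_min => [|tau Tt a ka].
  exact: closed_preim fl bf (ker_span_closed B).
apply: (sub_ker_span Tt); have [hl _ _] := coact_mor_hom (Defs.fmap (cf_functor tau) f).
by rewrite /cf_ker /= -cf_q_nat [cf_q tau A a]ka (lin0 hl).
Qed.

Definition glb_fmap_fun (p : glb_alg A) : glb_alg B :=
  glb_q (fm (projT1 (cid (glb_q_surj p)))).

Lemma glb_fmapE (a : Mx A) : glb_fmap_fun (glb_q a) = glb_q (fm a).
Proof.
have [fl _ _] := coact_mor_hom fm.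
have [ql _ _] := glb_q_hom A; have [ql' _ _] := glb_q_hom B.
rewrite /glb_fmap_fun; case: cid => b /= hb; apply/eqP.
rewrite -subr_eq0 -(linB ql') -(linB fl); apply/eqP/glb_q_ker/ker_span_fmap/glb_q_ker.
by rewrite (linB ql) hb subrr.
Qed.

Lemma glb_fmap_hom : is_hom glb_fmap_fun.
Proof.
have [fl fM fJ] := coact_mor_hom fm.
have [ql qM qJ] := glb_q_hom A; have [ql' qM' qJ'] := glb_q_hom B.
split=> [c x y|x y|x].
- have [a <-] := glb_q_surj x; have [b <-] := glb_q_surj y.
  by rewrite -ql !glb_fmapE fl ql'.
- have [a <-] := glb_q_surj x; have [b <-] := glb_q_surj y.
  by rewrite -qM !glb_fmapE fM qM'.
have [a <-] := glb_q_surj x.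
by rewrite -qJ !glb_fmapE fJ qJ'.
Qed.

Lemma glb_fmap_equivariant : @equivariant R G S (glb_obj A) (glb_obj B) glb_fmap_fun.
Proof.
have hF := glb_fmap_hom; have hf := coact_mor_hom fm; have hi := id_hom CG.
have hqA := glb_q_hom A; have hqB := glb_q_hom B.
move=> p c x'; have [a <-] := glb_q_surj p => hx'.
have /mtildeE/(_ c)[[x hx] _] : mtilde (mul_of (coactM a))
  by rewrite mul_of_coactM; exact: coact_mtilde.
have := glb_q_equivariant hx; rewrite hx' => ex.
(* [x'] is known only through the multiplier it embeds to; injectivity of the embedding identifies
   it with the image of [x]. *)
have {}ex : x' = @tensor_id R G S (Mx A) (glb_obj A) (@glb_q A) x.
  by apply: iota_inj; rewrite -!mul_of_embM ex.
rewrite ex glb_fmapE (glb_q_equivariant (coact_equivariant hf (coact_mor_equiv fm) hx)).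
congr embM; move: {hx ex} x.
apply: (dense_hom_eq (tensor_range_dense (tens S (Mx A) CG))
  (hom_comp (tensor_id_hom (A := Mx B) (B := glb_obj B) hqB) (tensor_id_hom hf))
  (hom_comp (tensor_id_hom (A := glb_obj A) (B := glb_obj B) hF)
    (tensor_id_hom (A := Mx A) (B := glb_obj A) hqA))) => -[u d] /=.
rewrite (tensor_idE hf) (tensor_idE (A := Mx B) (B := glb_obj B) hqB).
rewrite (tensor_idE (A := Mx A) (B := glb_obj A) hqA).
by rewrite (tensor_idE (A := glb_obj A) (B := glb_obj B) hF) glb_fmapE.
Qed.

Definition glb_fmap : coact_mor (glb_obj A) (glb_obj B) :=
  @CoactMor R G S (glb_obj A) (glb_obj B) glb_fmap_fun glb_fmap_hom
    (@equivariant_coact R G S (glb_obj A) (glb_obj B) glb_fmap_fun glb_fmap_hom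
      glb_fmap_equivariant).

End Functoriality.

Definition glb_functor : coact_functor S.
Proof.
refine (@CoactFunctor R G S glb_obj glb_fmap _ _) => [A f hf x|A B D f g h hh x].
- have [a <-] := glb_q_surj x.
  by rewrite -[LHS]/(glb_fmap_fun f (glb_q a)) glb_fmapE (Defs.fmap_id hf).
- have [a <-] := glb_q_surj x.
  rewrite -[LHS]/(glb_fmap_fun h (glb_q a)).
  rewrite -[RHS]/(glb_fmap_fun g (glb_fmap_fun f (glb_q a))).
  by rewrite !glb_fmapE (Defs.fmap_comp hh).
Defined.

Definition glb : coaction_functor Mx Nx.
Proof.
refine (@CoactionFunctor R G S Mx Nx glb_functor glb_quot _ _ _).
- by move=> A B f a; exact: glb_fmapE.
- by move=> A b; exact: glb_q_surj.
(* The kernel of the normalization map is a closed subspace containing each [cf_ker tau A], hence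
   also their closed span. *)
move=> A a /glb_q_ker; move: a; apply: ker_span_min => [|tau Tt a ka] /=.
  have hq := coact_mor_hom (qnor Nx (Mx A)); have [ql _ _] := hq.
  have [C bC] := hom_bounded hq; exact: closed_sub_zero ql bC.
exact: cf_q_ker ka.
Defined.

Lemma cf_ker_glb A : cf_ker glb A = ker_span A.
Proof. by rewrite predeqE => a; exact: glb_q_ker. Qed.

Lemma ker_span_is_glb (sigma : coaction_functor Mx Nx) :
  (forall A, cf_ker sigma A = ker_span A) -> cf_is_glb T sigma.
Proof.
move=> hs; split=> [tau Tt A a ka|rho hr A]; first by rewrite hs; exact: sub_ker_span ka.
by rewrite hs; apply: ker_span_min => [|tau Tt]; [exact: cf_ker_closed | exact: hr].
Qed.

(** Two greatest lower bounds lie below each other, and the order compares kernels by inclusion, so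
    [sigma] has the same kernels as [glb]. *)
Lemma is_glb_ker_span (sigma : coaction_functor Mx Nx) :
  cf_is_glb T sigma -> forall A, cf_ker sigma A = ker_span A.
Proof.
have [g1 g2] := ker_span_is_glb cf_ker_glb => -[s1 s2] A.
by rewrite -cf_ker_glb; apply/seteqP; split; [exact: (s2 _ g1) | exact: (g2 _ s1)].
Qed.

End GreatestLowerBound.

Theorem theorem4p9 (R : realType) (G : topGroupType)
    (hausdorffG : hausdorff_space G) (lcG : locally_compact [set: G])
    (S : setting R G) (Mx : maximalization S) (Nx : normalization S)
    (T : coaction_functor Mx Nx -> Prop) (T_nonempty : exists tau, T tau) :
  (exists sigma : coaction_functor Mx Nx, cf_is_glb T sigma) /\
  (forall sigma : coaction_functor Mx Nx,
     cf_is_glb T sigma <->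
     forall A : coaction S,
       cf_ker sigma A = cspan [set a : Mx A | exists tau, T tau /\ cf_ker tau A a]).
Proof.
split; first by exists (glb T); apply: ker_span_is_glb; exact: cf_ker_glb.
by move=> sigma; split; [exact: is_glb_ker_span | exact: ker_span_is_glb].
Qed.
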